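(* Let $X$ be a compact metric space, and let $A$ be a pure $C^*$-algebra. Assume that $A$ has no quotient whose Cuntz semigroup contains a nonzero, compact, properly infinite Cuntz class. Then $C(X,A)$ is pure.
   Context: Cuntz semigroup: for a $C^*$-algebra $B$ and $a,b\in B_+$, $a\precsim b$ means there is a sequence $(v_n)$ in $B$ with $v_n b v_n^*\to a$; $a\sim b$ means $a\precsim b$ and $b\precsim a$. With $\mathcal{K}$ the compact operators on a separable infinite-dimensional Hilbert space, $\mathrm{Cu}(B)=(B\otimes\mathcal{K})_+/\!\sim$, with classes $[a]$, order $[a]\le[b]$ iff $a\precsim b$, and addition $[a]+[b]=[a\oplus b]$. For $a\in B_+$ and $\varepsilon>0$, $(a-\varepsilon)_+$ is the functional calculus of $a$ with $\lambda\mapsto\max\{\lambda-\varepsilon,0\}$. For $x,y\in\mathrm{Cu}(B)$, $x\ll y$ means $x=[a]$, $y=[b]$ and $a\precsim(b-\varepsilon)_+$ for some $\varepsilon>0$. An element $x\in\mathrm{Cu}(B)$ is compact if $x\ll x$, and properly infinite if $2x\le x$. Pureness: $B$ is pure if $\mathrm{Cu}(B)$ is both (a) almost unperforated: whenever $x,y\in\mathrm{Cu}(B)$ satisfy $(k+1)x\le ky$ for some $k\in\mathbb{N}$, then $x\le y$; and (b) almost divisible: for every $x'\ll x$ in $\mathrm{Cu}(B)$ and every $N\in\mathbb{N}$ there is $y\in\mathrm{Cu}(B)$ with $Ny\le x$ and $x'\le(N+1)y$. Quotients are quotients by closed two-sided ideals. $C(X,A)$ is the $C^*$-algebra of continuous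 functions $X\to A$. *)

(* Defs.v *)
From HB Require Import structures.
From mathcomp Require Import all_boot all_order all_algebra.
From mathcomp Require Import complex.
From mathcomp Require Import all_classical all_reals all_analysis.

Set Implicit Arguments.
Unset Strict Implicit.
Unset Printing Implicit Defensive.

Import Order.TTheory GRing.Theory Num.Theory.
Import numFieldNormedType.Exports.

Local Open Scope classical_set_scope.
Local Open Scope ring_scope.

(* C*-algebras are complex and not assumed unital, so the product cannot come
   from the ring hierarchy and is part of the mixin.  The norm of the underlying
   Banach space takes values in the nonnegative reals inside R[i]. *)
HB.mixin Record isCStarAlgebra (R : realType) A
    & CompleteNormedModule R[i] A := {
  cmul : A -> A -> A ;
  cstar : A -> A ;
  cmulA : associative cmul ;
  cmulDl : left_distributive cmul +%R ;
  cmulDr : right_distributive cmul +%R ;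
  cmulZl : forall (k : R[i]) x y, cmul (k *: x) y = k *: cmul x y ;
  cmulZr : forall (k : R[i]) x y, cmul x (k *: y) = k *: cmul x y ;
  cstarK : involutive cstar ;
  cstarD : {morph cstar : x y / x + y} ;
  cstarZ : forall (k : R[i]) x, cstar (k *: x) = conjc k *: cstar x ;
  cstarM : forall x y, cstar (cmul x y) = cmul (cstar y) (cstar x) ;
  normr_cmul : forall x y, `|cmul x y| <= `|x| * `|y| ;
  normr_cstar_cmul : forall x, `|cmul (cstar x) x| = `|x| ^+ 2
}.

#[short(type="cstarAlgType")]
HB.structure Definition CStarAlgebra (R : realType) :=
  {A of CompleteNormedModule R[i] A & isCStarAlgebra R A}.

Definition rnorm (R : realType) (A : cstarAlgType R) (x : A) : R :=
  complex.Re `|x|.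

Section RealComplex.
Context (R : realType).
Implicit Types (a b : R) (k : R[i]).
Local Notation toC := (real_complex R).

Lemma toCD a b : toC (a + b) = toC a + toC b.
Proof. exact: rmorphD. Qed.
Lemma toCM a b : toC (a * b) = toC a * toC b.
Proof. exact: rmorphM. Qed.
Lemma toCV a : toC a^-1 = (toC a)^-1.
Proof. exact: fmorphV. Qed.
Lemma normCReK k : toC (complex.Re `|k|) = `|k|.
Proof. exact/RRe_real/ger0_real. Qed.
Lemma normCRe_ge0 k : 0 <= complex.Re `|k|.
Proof. by rewrite -ler0c normCReK. Qed.

Lemma split3 k : k = k / 3 + (k / 3 + k / 3).
Proof.
rewrite -!mulrDl (_ : k + (k + k) = k * 3%:R) ?mulfK ?pnatr_eq0//.
by rewrite mulr_natr.
Qed.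

End RealComplex.

Section CStarTheory.
Context (R : realType) (A : cstarAlgType R).
Implicit Types x y : A.

Lemma rnormE x : real_complex R (rnorm x) = `|x|.
Proof. by rewrite /rnorm RRe_real// ger0_real. Qed.

Lemma rnorm_ge0 x : 0 <= rnorm x.
Proof. by rewrite -ler0c rnormE. Qed.

Lemma rnorm_cmul x y : rnorm (cmul x y) <= rnorm x * rnorm y.
Proof. by rewrite -lecR rmorphM/= !rnormE normr_cmul. Qed.

Lemma rnorm_cstar_cmul x : rnorm (cmul (cstar x) x) = rnorm x ^+ 2.
Proof. by apply: complexI; rewrite rmorphXn/= !rnormE normr_cstar_cmul. Qed.

Lemma ler_rnormD x y : rnorm (x + y) <= rnorm x + rnorm y.
Proof. by rewrite -lecR rmorphD/= !rnormE ler_normD. Qed.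

Lemma cmulBl x y z : cmul (x - y) z = cmul x z - cmul y z.
Proof. by rewrite cmulDl -scaleN1r cmulZl scaleN1r. Qed.

Lemma cmulBr x y z : cmul x (y - z) = cmul x y - cmul x z.
Proof. by rewrite cmulDr -scaleN1r cmulZr scaleN1r. Qed.

Lemma cstar0 : cstar (0 : A) = 0.
Proof. by have := cstarZ 0 (0 : A); rewrite scale0r conjc0 scale0r. Qed.

Lemma cstarB x y : cstar (x - y) = cstar x - cstar y.
Proof. by rewrite cstarD -scaleN1r cstarZ rmorphN rmorph1 scaleN1r. Qed.

Lemma normr_cstar x : `|cstar x| = `|x|.
Proof.
suff le (z : A) : `|z| <= `|cstar z|.
  by apply/eqP; rewrite eq_le le andbT -{2}(cstarK x) le.
have [->|z0] := eqVneq z 0; first by rewrite cstar0.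
rewrite -(ler_pM2r (_ : 0 < `|z|)) ?normr_gt0//.
by rewrite -expr2 -normr_cstar_cmul normr_cmul.
Qed.

Lemma continuous_cstar : continuous (@cstar R A).
Proof.
move=> x; apply/cvgrPdist_lt => e e0; near=> y.
rewrite -cstarB normr_cstar; near: y.
exact: (cvgr_dist_lt id x cvg_id).
Unshelve. all: by end_near. Qed.

Lemma continuous_cmul (X : topologicalType) (f g : X -> A) :
  continuous f -> continuous g -> continuous (fun t : X => cmul (f t) (g t)).
Proof.
move=> cf cg x; apply/cvgrPdist_lt => _/posnumP[e].
pose M : R[i] := `|f x| + `|g x| + 1.
have M0 : 0 < M by rewrite ltr_wpDl// addr_ge0.
have fM : `|f x| <= M by rewrite /M -addrA lerDl addr_ge0.
near=> y.
rewrite (_ : _ - _ = cmul (f x) (g x - g y) + cmul (f x - f y) (g y)); last first.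
  by rewrite cmulBr cmulBl addrA subrK.
rewrite (le_lt_trans (ler_normD _ _))// (splitr e%:num) ltrD//.
  rewrite (le_lt_trans (normr_cmul _ _))//.
  rewrite (@le_lt_trans _ _ (M * `|g x - g y|)) ?ler_wpM2r// -ltr_pdivlMl//.
  near: y; apply: (cvgr_dist_lt g _ (cg x)); rewrite mulr_gt0 ?invr_gt0//.
rewrite (le_lt_trans (normr_cmul _ _))//.
have gM : `|g y| <= M.
  rewrite -[g y](subrK (g x)) (le_trans (ler_normD _ _))//.
  rewrite /M [leRHS]addrC addrA lerD2r (@le_trans _ _ 1)// ?lerDl//.
  rewrite distrC ltW//; near: y; exact: (cvgr_dist_lt g _ (cg x)).
rewrite (@le_lt_trans _ _ (`|f x - f y| * M)) ?ler_wpM2l// -ltr_pdivlMr//.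
near: y; apply: (cvgr_dist_lt f _ (cf x)); rewrite mulr_gt0 ?invr_gt0//.
Unshelve. all: by end_near. Qed.

End CStarTheory.

(* The algebra of continuous functions on a compact space; the norm is finite
   because of the compactness proof carried by the type. *)
Definition contfun (X : topologicalType) (cptX : compact [set: X])
  (R : realType) (A : cstarAlgType R) : Type := continuousType X A.

Section ContFun.
Context (X : topologicalType) (cptX : compact [set: X]).
Context (R : realType) (A : cstarAlgType R).
Local Notation CXA := (contfun cptX A).

HB.instance Definition _ := Choice.copy CXA (continuousType X A).

Implicit Types f g : CXA.
Definition cfeval f : X -> A := f : continuousType X A.
Definition mkcf (f : X -> A) (cf : continuous f) : CXA := mkcts cf.

Lemma cfP f g : (forall x, cfeval f x = cfeval g x) -> f = g.
Proof. by move=> fg; apply/continuousEP. Qed.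

Lemma ev_continuous f : continuous (cfeval f).
Proof. exact: (@cts_fun X A f). Qed.


Definition cf_zero : CXA := mkcf (@cst_continuous X A 0).
Definition cf_opp f : CXA :=
  mkcf (fun x => cvgN (@ev_continuous f x)).
Definition cf_add f g : CXA :=
  mkcf (fun x => cvgD (@ev_continuous f x) (@ev_continuous g x)).
Definition cf_scale (k : R[i]) f : CXA :=
  mkcf (fun x => cvgZr (k := k) (@ev_continuous f x)).
Definition cf_mul f g : CXA :=
  mkcf (continuous_cmul (@ev_continuous f) (@ev_continuous g)).
Definition cf_star f : CXA :=
  mkcf (fun x => continuous_comp (@ev_continuous f x)
                   (@continuous_cstar R A (cfeval f x))).

Lemma cf_addA : associative cf_add.
Proof. by move=> f g h; apply: cfP => x /=; exact: addrA. Qed.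
Lemma cf_addC : commutative cf_add.
Proof. by move=> f g; apply: cfP => x /=; exact: addrC. Qed.
Lemma cf_add0 : left_id cf_zero cf_add.
Proof. by move=> f; apply: cfP => x /=; exact: add0r. Qed.
Lemma cf_addN : left_inverse cf_zero cf_opp cf_add.
Proof. by move=> f; apply: cfP => x /=; exact: addNr. Qed.

HB.instance Definition _ :=
  GRing.isZmodule.Build CXA cf_addA cf_addC cf_add0 cf_addN.

Lemma cf_scaleA (k l : R[i]) f :
  cf_scale k (cf_scale l f) = cf_scale (k * l) f.
Proof. by apply: cfP => x /=; exact: scalerA. Qed.
Lemma cf_scale1 : left_id 1 cf_scale.
Proof. by move=> f; apply: cfP => x /=; exact: scale1r. Qed.
Lemma cf_scaleDr : right_distributive cf_scale +%R.
Proof. by move=> k f g; apply: cfP => x /=; exact: scalerDr. Qed.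
Lemma cf_scaleDl f : {morph cf_scale^~ f : k l / k + l}.
Proof. by move=> k l; apply: cfP => x /=; exact: scalerDl. Qed.

HB.instance Definition _ := GRing.Zmodule_isLmodule.Build R[i] CXA
  cf_scaleA cf_scale1 cf_scaleDr cf_scaleDl.

Definition cf_norm f : R := sup [set rnorm (cfeval f x) | x in [set: X]].

Lemma rnorm_continuous : continuous (@rnorm R A).
Proof.
move=> a; apply/cvgrPdist_lt => e e0; near=> b.
have : `|a - b| < real_complex R e.
  by near: b; apply: (cvgr_dist_lt id a cvg_id); rewrite ltcR.
rewrite -rnormE ltcR; apply: le_lt_trans.
rewrite ler_norml; apply/andP; split.
  rewrite lerBrDl lerBlDr -{1}(subrK a b).
  by rewrite (le_trans (ler_rnormD _ _))// addrC lerD2l -lecR !rnormE distrC.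
by rewrite lerBlDr -{1}(subrK b a) ler_rnormD.
Unshelve. all: by end_near. Qed.

Lemma cf_norm_ubound f : has_ubound [set rnorm (cfeval f x) | x in [set: X]].
Proof.
have : compact [set rnorm (cfeval f x) | x in [set: X]].
  apply: continuous_compact => //; apply: continuous_subspaceT => x.
  by apply: continuous_comp; [exact: ev_continuous|exact: rnorm_continuous].
move=> /compact_bounded[M [_ /(_ (M + 1))]].
rewrite ltrDl => /(_ ltr01) bM; exists (M + 1) => y /bM /=.
exact: le_trans (ler_norm _).
Qed.

Lemma ler_cf_norm f x : rnorm (cfeval f x) <= cf_norm f.
Proof. by apply: ub_le_sup; [exact: cf_norm_ubound|exists x]. Qed.

Lemma cf_norm_ler f c : 0 <= c -> (forall x, rnorm (cfeval f x) <= c) ->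
  cf_norm f <= c.
Proof.
move=> c0 fc; have [[y Ey]|/nonemptyPn E0] :=
  pselect ([set rnorm (cfeval f x) | x in [set: X]] !=set0).
  by apply: ge_sup; [exists y|move=> _ [x _ <-]].
by rewrite /cf_norm E0 sup0.
Qed.

Lemma cf_norm_ge0 f : 0 <= cf_norm f.
Proof.
have [[_ [x _ _]]|/nonemptyPn E0] :=
  pselect ([set rnorm (cfeval f x) | x in [set: X]] !=set0).
  exact: le_trans (rnorm_ge0 _) (ler_cf_norm f x).
by rewrite /cf_norm E0 sup0.
Qed.

Lemma ler_cf_normD f g :
  real_complex R (cf_norm (f + g))
    <= real_complex R (cf_norm f) + real_complex R (cf_norm g).
Proof.
rewrite -rmorphD/= lecR cf_norm_ler ?addr_ge0 ?cf_norm_ge0// => x.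
by rewrite (le_trans (ler_rnormD _ _))// lerD ?ler_cf_norm.
Qed.

Lemma rnormZ (k : R[i]) (a : A) : rnorm (k *: a) = complex.Re `|k| * rnorm a.
Proof.
apply: complexI; by rewrite toCM !rnormE normCReK normrZ.
Qed.

Lemma cf_normZ (k : R[i]) f :
  real_complex R (cf_norm (k *: f)) = `|k| * real_complex R (cf_norm f).
Proof.
have le (l : R[i]) (g : CXA) : cf_norm (l *: g) <= complex.Re `|l| * cf_norm g.
  rewrite cf_norm_ler ?mulr_ge0 ?cf_norm_ge0 ?normCRe_ge0// => x.
  by rewrite [leLHS]rnormZ ler_wpM2l ?normCRe_ge0// ler_cf_norm.
rewrite -(normCReK k) -toCM; congr (real_complex R _).
apply/eqP; rewrite eq_le le andTb; have [->|k0] := eqVneq k 0.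
  by rewrite normr0 mul0r cf_norm_ge0.
have kp : 0 < complex.Re `|k| by rewrite -ltcR normCReK normr_gt0.
rewrite -ler_pdivlMl//; have := le k^-1 (k *: f).
rewrite scalerA mulVf// scale1r normfV => /le_trans; apply.
rewrite le_eqVlt; apply/orP; left; apply/eqP; congr (_ * _); apply: complexI.
by rewrite toCV normCReK -normfV normCReK.
Qed.

Lemma cf_norm0_eq0 f : real_complex R (cf_norm f) = 0 -> f = 0.
Proof.
move=> /complexI f0; apply: cfP => x; apply/eqP.
rewrite -normr_eq0 -rnormE; apply/eqP; congr (real_complex R _).
by apply/eqP; rewrite eq_le rnorm_ge0 andbT -f0 ler_cf_norm.
Qed.

HB.instance Definition _ := Lmodule_isNormed.Build R[i] CXA
  ler_cf_normD cf_normZ cf_norm0_eq0.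

Lemma ler_ev_norm f x : `|cfeval f x| <= `|f|.
Proof. by rewrite -rnormE lecR ler_cf_norm. Qed.

Lemma ler_ev_normB f g x : `|cfeval f x - cfeval g x| <= `|f - g|.
Proof. exact: (ler_ev_norm (f - g) x). Qed.

Lemma cf_norm_leP f (c : R) : 0 <= c ->
  (forall x, `|cfeval f x| <= real_complex R c) -> `|f| <= real_complex R c.
Proof.
by move=> c0 fc; rewrite lecR cf_norm_ler// => x; rewrite -lecR rnormE.
Qed.

Lemma cf_complete (F : set_system CXA) : ProperFilter F -> cauchy F -> cvg F.
Proof.
move=> FF /cauchyP cF.
have cFx x : cauchy ((cfeval^~ x) @ F).
  apply/cauchyP => e /cF[f Ff]; exists (cfeval f x).
  change (F [set h | ball (cfeval f x) e (cfeval h x)]); apply: filterS Ff => h.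
  rewrite -!ball_normE/=; exact: le_lt_trans (ler_ev_normB f h x).
pose g x := lim ((cfeval^~ x) @ F).
have gP x : (cfeval^~ x) @ F --> g x by apply: cauchy_cvg (cFx x).
have unif (e : R[i]) : 0 < e ->
    \forall f \near F, forall x, `|g x - cfeval f x| < e.
  move=> e0; have e3 : 0 < e / 3 by rewrite divr_gt0.
  have [f0 Ff0] := cF _ e3.
  apply: filterS (Ff0) => f; rewrite -ball_normE/= => ff0 x.
  have /filter_ex[h [f0h gh]] : F (ball f0 (e / 3) `&`
      [set h | `|g x - cfeval h x| < e / 3]).
    by apply: filterI => //; exact: (cvgr_dist_lt _ _ (gP x)).
  move: f0h; rewrite -ball_normE/= => f0h.
  rewrite -(subrKA (cfeval h x)) -[X in _ + X](subrKA (cfeval f0 x)).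
  rewrite (split3 e).
  rewrite (le_lt_trans (ler_normD _ _))// ltrD//.
  rewrite (le_lt_trans (ler_normD _ _))// ltrD//.
    by rewrite distrC (le_lt_trans (ler_ev_normB f0 h x)).
  exact: le_lt_trans (ler_ev_normB f0 f x) ff0.
have cg : continuous g.
  move=> x; apply/cvgrPdist_lt => e e0.
  have e3 : 0 < e / 3 by rewrite divr_gt0.
  have [f fg] := filter_ex (unif _ e3).
  near=> y.
  rewrite -(subrKA (cfeval f x)) -[X in _ + X](subrKA (cfeval f y)).
  rewrite (split3 e).
  rewrite (le_lt_trans (ler_normD _ _))// ltrD//.
  rewrite (le_lt_trans (ler_normD _ _))// ltrD//; last by rewrite distrC.
  near: y; exact: (cvgr_dist_lt _ _ (@ev_continuous f x)).
apply/cvg_ex; exists (mkcf cg); apply/cvgrPdist_le => e e0.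
have eE : real_complex R (complex.Re e) = e by rewrite RRe_real// gtr0_real.
have e0' : 0 <= complex.Re e by rewrite -ler0c eE ltW.
apply: filterS (unif _ e0) => f fg; rewrite -eE cf_norm_leP// => x.
by rewrite eE ltW//; exact: fg.
Unshelve. all: by end_near. Qed.

HB.instance Definition _ := Uniform_isComplete.Build CXA cf_complete.

Lemma cf_mulA : associative cf_mul.
Proof. by move=> f g h; apply: cfP => x; exact: cmulA. Qed.
Lemma cf_mulDl : left_distributive cf_mul +%R.
Proof. by move=> f g h; apply: cfP => x; exact: cmulDl. Qed.
Lemma cf_mulDr : right_distributive cf_mul +%R.
Proof. by move=> f g h; apply: cfP => x; exact: cmulDr. Qed.
Lemma cf_mulZl (k : R[i]) f g : cf_mul (k *: f) g = k *: cf_mul f g.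
Proof. by apply: cfP => x; exact: cmulZl. Qed.
Lemma cf_mulZr (k : R[i]) f g : cf_mul f (k *: g) = k *: cf_mul f g.
Proof. by apply: cfP => x; exact: cmulZr. Qed.
Lemma cf_starK : involutive cf_star.
Proof. by move=> f; apply: cfP => x; exact: cstarK. Qed.
Lemma cf_starD : {morph cf_star : f g / f + g}.
Proof. by move=> f g; apply: cfP => x; exact: cstarD. Qed.
Lemma cf_starZ (k : R[i]) f : cf_star (k *: f) = conjc k *: cf_star f.
Proof. by apply: cfP => x; exact: cstarZ. Qed.
Lemma cf_starM f g : cf_star (cf_mul f g) = cf_mul (cf_star g) (cf_star f).
Proof. by apply: cfP => x; exact: cstarM. Qed.

Lemma normr_cf_mul f g : `|cf_mul f g| <= `|f| * `|g|.
Proof.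
rewrite -[leRHS]toCM cf_norm_leP// ?mulr_ge0 ?cf_norm_ge0// => x.
by rewrite toCM (le_trans (normr_cmul _ _))// ler_pM// ler_ev_norm.
Qed.

Lemma normr_cf_star_mul f : `|cf_mul (cf_star f) f| = `|f| ^+ 2.
Proof.
apply/eqP; rewrite eq_le; apply/andP; split.
  rewrite expr2 (le_trans (normr_cf_mul _ _))// ler_pM//.
  apply: cf_norm_leP => [|x]; first exact: cf_norm_ge0.
  by rewrite [leLHS]normr_cstar ler_ev_norm.
rewrite expr2 -[leLHS]toCM lecR -expr2.
set N := cf_norm (cf_mul _ _).
have N0 : 0 <= N := cf_norm_ge0 _.
rewrite -[leRHS]sqr_sqrtr// ler_pXn2r// ?nnegrE ?cf_norm_ge0 ?sqrtr_ge0//.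
rewrite cf_norm_ler ?sqrtr_ge0// => x.
rewrite -(@ler_pXn2r _ 2)// ?nnegrE ?rnorm_ge0 ?sqrtr_ge0//.
rewrite sqr_sqrtr// -rnorm_cstar_cmul.
exact: ler_cf_norm (cf_mul (cf_star f) f) x.
Qed.

HB.instance Definition _ := isCStarAlgebra.Build R CXA
  cf_mulA cf_mulDl cf_mulDr cf_mulZl cf_mulZr cf_starK cf_starD cf_starZ
  cf_starM normr_cf_mul normr_cf_star_mul.

End ContFun.

(* The stabilization of B by the compact operators on l^2 is realized as the
   algebra of compact operators on the Hilbert module l^2(B): matrices over B
   indexed by nat * nat which are the norm limits of their finite truncations,
   i.e. the completion of the increasing union of the algebras M_n(B). *)
Definition infmx (R : realType) (B : cstarAlgType R) := nat -> nat -> B.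

Section Stabilization.
Context (R : realType) (B : cstarAlgType R).
Implicit Types (S T a b c : infmx B) (v : nat -> B).

(* The norm of the Hilbert module B^n. *)
Definition vec_norm (n : nat) v : R :=
  Num.sqrt (rnorm (\sum_(i < n) cmul (cstar (v i)) (v i))).

Definition mx_app (n : nat) T v : nat -> B :=
  fun i => \sum_(j < n) cmul (T i j) (v j).

(* Supremum over n of the norms of the n x n corners of T as operators on B^n;
   M_n(B) acts faithfully on B^n, so this is its C*-norm. *)
Definition infmx_norm T : \bar R :=
  ereal_sup [set y | exists (n : nat) v,
    vec_norm n v <= 1 /\ y = (vec_norm n (mx_app n T v))%:E].

Definition mx_trunc (n : nat) T : infmx B :=
  fun i j => if (i < n)%N && (j < n)%N then T i j else 0.

Definition stab : set (infmx B) :=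
  [set T | infmx_norm (T - mx_trunc n T) @[n --> \oo] --> 0%E].

(* The entrywise limits exist whenever S and T are in [stab]. *)
Definition mx_mul S T : infmx B :=
  fun i j => limn (fun n => \sum_(k < n) cmul (S i k) (T k j)).

Definition mx_adj T : infmx B := fun i j => cstar (T j i).

Definition mx_pos : set (infmx B) :=
  [set a | stab a /\ exists2 c, stab c & a = mx_mul (mx_adj c) c].

Definition cuntz_le a b :=
  exists v : nat -> infmx B, (forall n, stab (v n)) /\
    infmx_norm (mx_mul (mx_mul (v n) b) (mx_adj (v n)) - a) @[n --> \oo] --> 0%E.

Definition cuntz_equiv a b := cuntz_le a b /\ cuntz_le b a.

(* The value at a of the polynomial 'X * q, which has no constant term since
   [stab] has no unit. *)
Definition mx_horner_mulX (q : {poly R}) a : infmx B :=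
  \sum_(i < size q) real_complex R q`_i *: iter i (mx_mul a) a.

(* c = f(a) for a positive a and a continuous f with f 0 = 0: c is the limit of
   the p(a) for real polynomials p with p(0) = 0 that converge uniformly to f on
   [0, |a|], an interval containing the spectrum of a. *)
Definition is_funcalc (f : R -> R) a c :=
  stab c /\ forall e : R, 0 < e -> exists q : {poly R},
    (forall t : R, 0 <= t -> (t%:E <= infmx_norm a)%E -> `|t * q.[t] - f t| <= e)
    /\ (infmx_norm (mx_horner_mulX q a - c)%R <= e%:E)%E.

(* c = (a - e)_+ *)
Definition is_cutdown (e : R) a c := is_funcalc (fun t => Num.max (t - e) 0) a c.

(* The direct sum, with M_2 of the stabilization identified with the
   stabilization by splitting the index set nat into even and odd numbers. *)
Definition mx_dsum a b : infmx B := fun i j =>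
  if odd i == odd j then (if odd i then b else a) i./2 j./2 else 0.

Definition cu_class a : set (infmx B) :=
  [set b | mx_pos b /\ cuntz_equiv a b].

Definition Cu : set (set (infmx B)) := [set cu_class a | a in mx_pos].

Implicit Types x y : set (infmx B).

Definition cu_le x y := exists a b,
  [/\ mx_pos a, mx_pos b, x = cu_class a, y = cu_class b & cuntz_le a b].

Definition cu_ll x y := exists a b,
  [/\ mx_pos a, mx_pos b, x = cu_class a, y = cu_class b &
    exists (e : R) c, [/\ 0 < e, is_cutdown e b c & cuntz_le a c]].

Definition cu_zero : set (infmx B) := cu_class 0.

(* The union of the classes of a (+) b over all representatives a of x and b of
   y; all these classes coincide. *)
Definition cu_add x y : set (infmx B) :=
  [set c | mx_pos c /\
    exists a b, [/\ x a, y b & cuntz_equiv (mx_dsum a b) c]].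

Definition cu_natmul (n : nat) x := iter n (cu_add x) cu_zero.

Definition cu_compact x := cu_ll x x.

Definition properly_infinite x := cu_le (cu_natmul 2 x) x.

Definition almost_unperforated := forall x y (k : nat), Cu x -> Cu y ->
  cu_le (cu_natmul k.+1 x) (cu_natmul k y) -> cu_le x y.

Definition almost_divisible := forall x' x (N : nat), Cu x' -> Cu x ->
  cu_ll x' x ->
  exists y, [/\ Cu y, cu_le (cu_natmul N y) x & cu_le x' (cu_natmul N.+1 y)].

Definition pure := almost_unperforated /\ almost_divisible.

End Stabilization.

Arguments stab {R} B.
Arguments Cu {R} B.
Arguments cu_zero {R} B.
Arguments pure {R} B.

Definition closed_two_sided_ideal (R : realType) (A : cstarAlgType R)
    (I : set A) :=
  [/\ closed I, I 0, (forall a b, I a -> I b -> I (a + b)),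
      (forall (k : R[i]) a, I a -> I (k *: a)) &
      (forall a b, I a -> I (cmul a b) /\ I (cmul b a))].

(* pi : A -> Q exhibits Q as the quotient C*-algebra A / I: it is a surjective
   *-homomorphism with kernel I, and Q carries the quotient norm. *)
Record is_quotient (R : realType) (A Q : cstarAlgType R) (I : set A)
    (pi : A -> Q) : Prop := IsQuotient {
  quotient_ideal : closed_two_sided_ideal I ;
  quotientD : {morph pi : a b / a + b} ;
  quotientZ : forall (k : R[i]) a, pi (k *: a) = k *: pi a ;
  quotientM : {morph pi : a b / cmul a b} ;
  quotient_star : {morph pi : a / cstar a} ;
  quotient_surj : forall q, exists a, pi a = q ;
  quotient_ker : forall a, pi a = 0 <-> I a ;
  quotient_norm : forall a, rnorm (pi a) = inf [set rnorm (a + i) | i in I]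
}.

(* Main.v *)
(* Write D for the stabilization of A and work in the C*-algebra F of maps x : X -> D that are
   uniformly continuous in finitely many coordinates of X; positive elements of C(X, D) are
   approximated by such maps, so it suffices to prove almost unperforation and almost
   divisibility for elements of F.

   Cancellation in A.  If u + w <= d + w' with w' << w and w <= M u, then adding up gives
   n u + w <= n d + w', and in the quotient by the ideal generated by d the class of w becomes
   compact and properly infinite, hence zero; so w <= L d and n u <= (n + L) d for all n.
   With almost unperforation this yields an approximate cancellation law in Cu(A).

   Comparison with room.  Over a grid in m coordinates, if a number C' of copies of x(t) depending
   only on m lies below y(t) for all t, then x <= y in F: roots of x supported under y are chosen
   cell by cell so that neighbouring ones are almost orthogonal, the room coming from the
   cancellation law, and are glued by a partition of unity.

   Almost divisibility of A and a staircase of partition functions produce from x a map w with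
   q w(t) <= (C + 1) x(t) and (x(t) - e)_+ <= (q + 1) (w(t) - d)_+.  Hence x contains a piece W that
   is C' times smaller than x pointwise while (x - e)_+ <= L W up to a negligible error, with L
   depending only on m.

   Comparison without room.  Let (k + 1) x(t) <= k y(t) for all t.  By the previous steps W lies
   below both x and y; passing to complements of W in x and in y preserves the inequality up to the
   error.  After N steps the rest of x is so small compared with what has been removed that the
   comparison with room applies.  Almost divisibility in F follows from the staircase, applied with
   large parameters, and this comparison. *)
From HB Require Import structures.
From mathcomp Require Import all_boot all_order all_algebra.
From mathcomp Require Import complex.
From mathcomp Require Import all_classical all_reals all_analysis.
From mathcomp Require Import ring lra.
Require Import Defs.

Set Implicit Arguments.
Unset Strict Implicit.
Unset Printing Implicit Defensive.

Import Order.TTheory GRing.Theory Num.Theory.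
Import numFieldNormedType.Exports.

Local Open Scope classical_set_scope.
Local Open Scope ring_scope.

(** Pointwise comparison does not glue by itself: witnesses chosen at neighbouring points are
    unrelated, and in a combination of roots the cross terms [st r * r'] are not small. Almost
    orthogonal roots kill these terms but cost a multiple of x(t) that grows with the number m of
    coordinates: a cell of the grid has 3^m neighbours, and 2^m colours are used. This is harmless
    because m is fixed first: the elements to be compared and the tolerance determine the
    coordinates, and all numbers of copies and of steps are chosen afterwards. When a piece W is
    split off, only a cut-down of W is known to sit in x beside the complement, whereas up to all of
    W is lost from y. So W is built as a direct sum of successive cut-downs of one element; cutting
    W then shifts the layers, and the difference is a single layer w, n times smaller than x(t),
    which the gap between k + 1 and k absorbs. Turning such bounds into a comparison of the
    remainders requires cancellation, and this is the only place where the hypothesis on quotients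
    enters: a compact properly infinite class would absorb the remainder. *)

Record cstar_data (R : realType) := CStarData {
  cs_car : lmodType R[i] ;
  cs_norm : cs_car -> R ;
  cs_mul : cs_car -> cs_car -> cs_car ;
  cs_star : cs_car -> cs_car ;
  cs_normD : forall x y, cs_norm (x + y) <= cs_norm x + cs_norm y ;
  cs_normZ : forall (k : R[i]) x, cs_norm (k *: x) = complex.Re `|k| * cs_norm x ;
  cs_norm0 : forall x, cs_norm x = 0 -> x = 0 ;
  cs_complete : forall u : nat -> cs_car,
    (forall n, cs_norm (u n.+1 - u n) <= 2^-1 ^+ n) ->
    exists l, forall e : R, 0 < e ->
      exists N, forall n, (N <= n)%N -> cs_norm (u n - l) <= e ;
  cs_mulA : associative cs_mul ;
  cs_mulDl : left_distributive cs_mul +%R ;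
  cs_mulDr : right_distributive cs_mul +%R ;
  cs_mulZl : forall (k : R[i]) x y, cs_mul (k *: x) y = k *: cs_mul x y ;
  cs_mulZr : forall (k : R[i]) x y, cs_mul x (k *: y) = k *: cs_mul x y ;
  cs_starK : involutive cs_star ;
  cs_starD : {morph cs_star : x y / x + y} ;
  cs_starZ : forall (k : R[i]) x, cs_star (k *: x) = conjc k *: cs_star x ;
  cs_starM : forall x y, cs_star (cs_mul x y) = cs_mul (cs_star y) (cs_star x) ;
  cs_normM : forall x y, cs_norm (cs_mul x y) <= cs_norm x * cs_norm y ;
  cs_normC : forall x, cs_norm x ^+ 2 <= cs_norm (cs_mul (cs_star x) x)
}.

(** The stabilization, the quotients and the algebras of sections are all presented by [cstar_data]:
    a real norm, limits only for sequences with geometric increments, and one inequality of the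
    C*-identity. The passage from these data to the full structure is made once, on this alias. *)
Definition cs_of (R : realType) (d : cstar_data R) : Type := cs_car d.

Section CsOf.
Context (R : realType) (d : cstar_data R).
Local Notation toC := (real_complex R).
Local Notation T := (cs_of d).
Local Notation N := (@cs_norm R d).

HB.instance Definition _ := GRing.Lmodule.copy T (cs_car d).

Lemma cs_norm_0 : N 0 = 0.
Proof. by rewrite -(scale0r (0 : cs_car d)) cs_normZ normr0/= mul0r. Qed.

Lemma cs_normN x : N (- x) = N x.
Proof. by rewrite -scaleN1r cs_normZ normrN normr1/= mul1r. Qed.

Lemma cs_norm_ge0 x : 0 <= N x.
Proof.
by have := cs_normD x (- x); rewrite subrr cs_norm_0 cs_normN; lra.
Qed.

Fact cs_normD_subproof (x y : T) :
  toC (N (x + y)) <= toC (N x) + toC (N y).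
Proof. by rewrite -rmorphD/= lecR cs_normD. Qed.

Fact cs_normZ_subproof (k : R[i]) (x : T) : toC (N (k *: x)) = `|k| * toC (N x).
Proof. by rewrite -(normCReK k) -toCM cs_normZ. Qed.

Fact cs_norm0_subproof (x : T) : toC (N x) = 0 -> x = 0.
Proof. by move=> /complexI /cs_norm0. Qed.

HB.instance Definition _ := Lmodule_isNormed.Build R[i] T
  cs_normD_subproof cs_normZ_subproof cs_norm0_subproof.

Lemma cs_of_normE (x : T) : `|x| = toC (N x). Proof. by []. Qed.

Fact cs_complete_subproof (F : set_system T) : ProperFilter F -> cauchy F -> cvg F.
Proof.
move=> FF /cauchyP cF.
have p0 n : 0 < (2^-1 ^+ n.+2 : R) by rewrite exprn_gt0// invr_gt0.
(* Two members of the filter meet, so consecutive centres are at distance less than 2^-(n+2) +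
   2^-(n+3), within the geometric bound 2^-n. *)
have /choice[f fP] : forall n, exists x, F (ball x (toC (2^-1 ^+ n.+2))).
  by move=> n; apply: cF; rewrite ltcR.
have fd n : N (f n.+1 - f n) <= 2^-1 ^+ n.
  have [h []] := filter_ex (filterI (fP n) (fP n.+1)).
  rewrite -!ball_normE/= !cs_of_normE !ltcR => h1 h2.
  have := cs_normD (f n.+1 - h) (h - f n); rewrite subrKA -(cs_normN (h - f n)).
  rewrite opprB; have := p0 n; move: h1 h2; rewrite !exprS; lra.
have [l lP] := cs_complete fd.
apply/cvg_ex; exists (l : T); apply/cvgrPdist_le => e e0.
have eE : toC (complex.Re e) = e by rewrite RRe_real// gtr0_real.
have e0' : 0 < complex.Re e by rewrite -ltcR eE.
have [m mP] := lP _ (divr_gt0 e0' (ltr0n _ 2)).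
have [k] : exists k, 2^-1 ^+ k < complex.Re e / 2.
  have : (2^-1 : R) ^+ n @[n --> \oo] --> 0.
    by apply: cvg_expr; rewrite gtr0_norm// invf_lt1// ltr1n.
  move=> /cvgrPdist_lt /(_ _ (divr_gt0 e0' (ltr0n _ 2)))[k _ /(_ k (leqnn _))].
  rewrite /= sub0r normrN ger0_norm ?exprn_ge0 ?invr_ge0// => ?; by exists k.
move=> kP; pose n := maxn m k.
apply: filterS (fP n) => x; rewrite -ball_normE/= -eE !cs_of_normE lecR ltcR.
move=> fx; have := mP n (leq_maxl _ _).
have : (2^-1 : R) ^+ n.+2 <= 2^-1 ^+ k.
  apply: ler_wiXn2l; rewrite ?invr_ge0// ?invf_le1 ?ler1n//.
  by rewrite (leq_trans (leq_maxr m k))// -addn2 leq_addr.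
have := cs_normD (l - f n) (f n - x); rewrite subrKA -(cs_normN (l - f n)) opprB.
lra.
Qed.

HB.instance Definition _ := Uniform_isComplete.Build T cs_complete_subproof.

Lemma cs_norm_star_le (x : cs_car d) : N x <= N (cs_star x).
Proof.
have := le_trans (cs_normC x) (cs_normM _ _); rewrite expr2.
have := cs_norm_ge0 x; rewrite le_eqVlt => /orP[/eqP <- _|x0].
  exact: cs_norm_ge0.
by rewrite ler_pM2r.
Qed.

Fact cs_normM_subproof (x y : T) : `|(cs_mul x y : T)| <= `|x| * `|y|.
Proof. by rewrite !cs_of_normE -toCM lecR cs_normM. Qed.

Fact cs_normC_subproof (x : T) : `|(cs_mul (cs_star x) x : T)| = `|x| ^+ 2.
Proof.
rewrite !cs_of_normE -rmorphXn/=; congr toC; apply/eqP; rewrite eq_le cs_normC.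
rewrite andbT (le_trans (cs_normM _ _))// expr2 ler_wpM2r ?cs_norm_ge0//.
by rewrite -{2}[x]cs_starK cs_norm_star_le.
Qed.

HB.instance Definition _ := isCStarAlgebra.Build R T
  (@cs_mulA R d) (@cs_mulDl R d) (@cs_mulDr R d) (@cs_mulZl R d)
  (@cs_mulZr R d) (@cs_starK R d) (@cs_starD R d) (@cs_starZ R d)
  (@cs_starM R d) cs_normM_subproof cs_normC_subproof.

Lemma cs_of_rnormE (x : T) : rnorm x = N x.
Proof. by []. Qed.

End CsOf.

(** * Norms and the minimal unitization *)

Section RnormTheory.
Context (R : realType) (A : cstarAlgType R).
Local Notation toC := (real_complex R).
Implicit Types x y z : A.

Lemma rnorm0 : rnorm (0 : A) = 0.
Proof. by apply: complexI; rewrite rnormE normr0. Qed.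

Lemma rnorm0_eq0 x : rnorm x = 0 -> x = 0.
Proof. by move=> /(congr1 toC); rewrite rnormE => /normr0_eq0. Qed.

Lemma rnormN x : rnorm (- x) = rnorm x.
Proof. by apply: complexI; rewrite !rnormE normrN. Qed.

Lemma rdistC x y : rnorm (x - y) = rnorm (y - x).
Proof. by rewrite -rnormN opprB. Qed.

Lemma ler_rnormB x y : rnorm (x - y) <= rnorm x + rnorm y.
Proof. by rewrite -(rnormN y) ler_rnormD. Qed.

Lemma ler_rdistD z x y : rnorm (x - y) <= rnorm (x - z) + rnorm (z - y).
Proof. by rewrite -[X in rnorm X](subrKA z) ler_rnormD. Qed.

Lemma ler_rnorm_sum (I : Type) (s : seq I) (P : pred I) (F : I -> A) :
  rnorm (\sum_(i <- s | P i) F i) <= \sum_(i <- s | P i) rnorm (F i).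
Proof.
elim/big_rec2: _ => [|i y1 y2 _ ih]; first by rewrite rnorm0.
by rewrite (le_trans (ler_rnormD _ _))// lerD2l.
Qed.

Lemma rnormZr (k : R) x : rnorm (toC k *: x) = `|k| * rnorm x.
Proof. by rewrite rnormZ; congr (_ * _); apply: complexI; rewrite normCReK normc_def /= expr0n addr0 sqrtr_sqr. Qed.

Lemma rnorm_cstar x : rnorm (cstar x) = rnorm x.
Proof. by apply: complexI; rewrite !rnormE normr_cstar. Qed.

Lemma cmul0l x : cmul 0 x = 0.
Proof. by rewrite -[X in cmul X _](scale0r 0) cmulZl scale0r. Qed.

Lemma cmul0r x : cmul x 0 = 0.
Proof. by rewrite -[X in cmul _ X](scale0r 0) cmulZr scale0r. Qed.

Lemma cstar_sum (I : Type) (s : seq I) (P : pred I) (F : I -> A) :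
  cstar (\sum_(i <- s | P i) F i) = \sum_(i <- s | P i) cstar (F i).
Proof. by apply: (big_morph _ (@cstarD _ _)); rewrite cstar0. Qed.

Lemma cmul_suml (I : Type) (s : seq I) (P : pred I) (F : I -> A) y :
  cmul (\sum_(i <- s | P i) F i) y = \sum_(i <- s | P i) cmul (F i) y.
Proof. by apply: (big_morph (cmul^~ y)) => [? ?|]; rewrite ?cmulDl ?cmul0l. Qed.

Lemma cmul_sumr (I : Type) (s : seq I) (P : pred I) (F : I -> A) y :
  cmul y (\sum_(i <- s | P i) F i) = \sum_(i <- s | P i) cmul y (F i).
Proof. by apply: (big_morph (cmul y)) => [? ?|]; rewrite ?cmulDr ?cmul0r. Qed.

Lemma cstarZr (k : R) x : cstar (toC k *: x) = toC k *: cstar x.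
Proof. by rewrite cstarZ conjc_real. Qed.

Lemma rnorm_complete (u : nat -> A) :
  (forall e : R, 0 < e -> exists N, forall n m, (N <= n)%N -> (N <= m)%N ->
     rnorm (u n - u m) <= e) ->
  exists l, forall e : R, 0 < e ->
    exists N, forall n, (N <= n)%N -> rnorm (u n - l) <= e.
Proof.
move=> cu.
have cF : cauchy (u @ \oo).
  apply/cauchyP => e e0.
  have eE : toC (complex.Re e) = e by rewrite RRe_real// gtr0_real.
  have e0' : 0 < complex.Re e / 2 by rewrite divr_gt0// -ltcR eE.
  have [N NP] := cu _ e0'; exists (u N); exists N => // n /= Nn.
  rewrite -ball_normE/= -eE -rnormE ltcR (le_lt_trans (NP _ _ _ _))//.
  by move: e0'; lra.
have /cvg_ex[l lP] : cvg (u @ \oo) by exact: cauchy_cvg cF.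
exists l => e e0; move: lP => /cvgrPdist_le/(_ (toC e)).
rewrite ltcR => /(_ e0)[N _ NP]; exists N => n /NP /=.
by rewrite -rnormE lecR rdistC.
Qed.

Lemma rnorm_le_eq x y : (forall e : R, 0 < e -> rnorm (x - y) <= e) -> x = y.
Proof.
move=> xy; apply/eqP; rewrite -subr_eq0; apply/eqP/rnorm0_eq0/eqP.
by rewrite eq_le rnorm_ge0 andbT; apply/ler_addgt0Pr => e /xy; rewrite add0r.
Qed.

End RnormTheory.

Lemma half_pow_lt (R : realType) (e : R) : 0 < e -> exists k, 2^-1 ^+ k < e.
Proof.
move=> e0; have : (2^-1 : R) ^+ n @[n --> \oo] --> 0.
  by apply: cvg_expr; rewrite gtr0_norm// invf_lt1// ltr1n.
move=> /cvgrPdist_lt /(_ _ e0)[k _ /(_ k (leqnn _))].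
by rewrite /= sub0r normrN ger0_norm ?exprn_ge0 ?invr_ge0// => ?; exists k.
Qed.

Lemma scalar_complete (R : realType) (u : nat -> R[i]) :
  (forall e : R, 0 < e -> exists N, forall n m, (N <= n)%N -> (N <= m)%N ->
     complex.Re `|u n - u m| <= e) ->
  exists l, forall e : R, 0 < e ->
    exists N, forall n, (N <= n)%N -> complex.Re `|u n - l| <= e.
Proof.
have real_complete (v : nat -> R) : (forall e : R, 0 < e -> exists N, forall n m,
      (N <= n)%N -> (N <= m)%N -> `|v n - v m| <= e) ->
    exists l, forall e : R, 0 < e -> exists N, forall n, (N <= n)%N -> `|v n - l| <= e.
  move=> cv; have cF : cauchy (v @ \oo).
    apply/cauchyP => e e0; have e2 := divr_gt0 e0 (ltr0n _ 2).
    have [N NP] := cv _ e2; exists (v N); exists N => // n /= Nn.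
    by rewrite -ball_normE/= (le_lt_trans (NP _ _ _ _))//; move: e2; lra.
  have /cvg_ex[l lP] : cvg (v @ \oo) by exact: cauchy_cvg cF.
  exists l => e e0; move: lP => /cvgrPdist_le/(_ _ e0)[N _ NP].
  by exists N => n /NP /=; rewrite distrC.
have reB (z w : R[i]) : complex.Re (z - w) = complex.Re z - complex.Re w.
  by case: z w => ? ? [].
have imB (z w : R[i]) : complex.Im (z - w) = complex.Im z - complex.Im w.
  by case: z w => ? ? [].
have reN (z : R[i]) : `|complex.Re z| <= complex.Re `|z|.
  by rewrite -lecR normCReK normc_ge_Re.
have imN (z : R[i]) : `|complex.Im z| <= complex.Re `|z|.
  case: z => x y /=; rewrite -(ler_pXn2r (n := 2))// ?nnegrE ?sqrtr_ge0//.
  by rewrite sqr_sqrtr ?addr_ge0 ?sqr_ge0// real_normK ?num_real// lerDr sqr_ge0.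
have leN (z : R[i]) : complex.Re `|z| <= `|complex.Re z| + `|complex.Im z|.
  case: z => x y /=; rewrite -(ler_pXn2r (n := 2))// ?nnegrE ?sqrtr_ge0 ?addr_ge0//.
  rewrite sqr_sqrtr ?addr_ge0 ?sqr_ge0// sqrrD !real_normK ?num_real//.
  by rewrite -addrA [X in _ <= _ + X]addrC addrA lerDl mulrn_wge0 ?mulr_ge0.
move=> cu.
have [|l1 l1P] := real_complete (fun n => complex.Re (u n)).
  move=> e /cu[N NP]; exists N => n m Nn Nm.
  by rewrite -reB (le_trans (reN _)) ?NP.
have [|l2 l2P] := real_complete (fun n => complex.Im (u n)).
  move=> e /cu[N NP]; exists N => n m Nn Nm.
  by rewrite -imB (le_trans (imN _)) ?NP.
exists (Complex l1 l2) => e e0; have e2 := divr_gt0 e0 (ltr0n _ 2).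
have [N1 N1P] := l1P _ e2; have [N2 N2P] := l2P _ e2.
exists (maxn N1 N2) => n; rewrite geq_max => /andP[n1 n2].
by rewrite (le_trans (leN _))// reB imB (splitr e) lerD ?N1P ?N2P.
Qed.

Section Unitization.
Context (R : realType) (A : cstarAlgType R).
Local Notation toC := (real_complex R).
Local Notation V := (A * R[i])%type.
Implicit Types (u v : V) (x y : A).

Definition uact u x : A := u.2 *: x + cmul u.1 x.

(** The norm of the left action on A, completed by the modulus of the scalar part: if A has a unit
    e, then (-e, 1) acts as zero and the action alone is only a seminorm. *)
Definition unorm u : R :=
  Num.max (complex.Re `|u.2|) (sup [set rnorm (uact u x) | x in [set x | rnorm x <= 1]]).

Definition umul u v : V := (u.2 *: v.1 + v.2 *: u.1 + cmul u.1 v.1, u.2 * v.2).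
Definition ustar u : V := (cstar u.1, conjc u.2).

Lemma uactD u v x : uact (u + v) x = uact u x + uact v x.
Proof. by rewrite /uact/= scalerDl cmulDl addrACA. Qed.

Lemma uactZ (k : R[i]) u x : uact (k *: u) x = k *: uact u x.
Proof. by rewrite /uact/= cmulZl scalerDr -[LHS]/((k * u.2) *: x + _) scalerA. Qed.

Lemma uactZr (k : R[i]) u x : uact u (k *: x) = k *: uact u x.
Proof. by rewrite /uact/= cmulZr scalerDr !scalerA mulrC. Qed.

Lemma uactM u v x : uact (umul u v) x = uact u (uact v x).
Proof.
rewrite /uact/= !scalerDr !scalerA cmulDr cmulDl cmulDl !cmulZl cmulZr cmulA.
by rewrite -!addrA; congr (_ + _); rewrite !addrA.
Qed.

Lemma uact_adj u x y : cmul (cstar (uact u x)) y = cmul (cstar x) (uact (ustar u) y).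
Proof.
by rewrite /uact/= cstarD cmulDl cmulDr cstarZ cmulZl cmulZr cstarM cmulA.
Qed.

Lemma uact_ub u : 
  ubound [set rnorm (uact u x) | x in [set x | rnorm x <= 1]] (complex.Re `|u.2| + rnorm u.1).
Proof.
move=> _ [x /= x1 <-]; rewrite (le_trans (ler_rnormD _ _))// rnormZ lerD//.
  by rewrite ler_piMr// normCRe_ge0.
by rewrite (le_trans (rnorm_cmul _ _))// ler_piMr// rnorm_ge0.
Qed.

Lemma uact_le u x : rnorm (uact u x) <= unorm u * rnorm x.
Proof.
have [->|x0] := eqVneq x 0.
  by rewrite /uact scaler0 cmul0r addr0 rnorm0 mulr0.
have xp : 0 < rnorm x.
  by rewrite lt_neqAle rnorm_ge0 andbT eq_sym; apply: contra_neq x0 => /rnorm0_eq0.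
rewrite -ler_pdivrMr// le_max; apply/orP; right; apply: ub_le_sup.
  by exists (complex.Re `|u.2| + rnorm u.1); exact: uact_ub.
exists (toC (rnorm x)^-1 *: x) => /=.
  by rewrite rnormZr ger0_norm ?invr_ge0 ?rnorm_ge0// mulVf// gt_eqF.
by rewrite uactZr rnormZr ger0_norm ?invr_ge0 ?rnorm_ge0// mulrC.
Qed.

Lemma unorm_le u c : 0 <= c -> complex.Re `|u.2| <= c ->
  (forall x, rnorm (uact u x) <= c * rnorm x) -> unorm u <= c.
Proof.
move=> c0 uc ux; rewrite ge_max uc/=; apply: ge_sup.
  by exists (rnorm (uact u 0)); exists 0 => //=; rewrite rnorm0.
by move=> _ [x /= x1 <-]; rewrite (le_trans (ux x))// ler_piMr.
Qed.

Lemma unorm2 u : complex.Re `|u.2| <= unorm u.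
Proof. by rewrite le_max lexx. Qed.

Lemma unorm_ge0 u : 0 <= unorm u.
Proof. exact: le_trans (normCRe_ge0 _) (unorm2 u). Qed.

Lemma unormD u v : unorm (u + v) <= unorm u + unorm v.
Proof.
apply: unorm_le => [||x]; first by rewrite addr_ge0 ?unorm_ge0.
  rewrite (@le_trans _ _ (complex.Re `|u.2| + complex.Re `|v.2|)) ?lerD ?unorm2//.
  by rewrite -lecR toCD !normCReK ler_normD.
rewrite uactD (le_trans (ler_rnormD _ _))// mulrDl lerD ?uact_le//.
Qed.

Lemma reMnorm (k l : R[i]) : complex.Re `|k * l| = complex.Re `|k| * complex.Re `|l|.
Proof. by apply: complexI; rewrite toCM !normCReK normrM. Qed.

Lemma unormZ_le (k : R[i]) u : unorm (k *: u) <= complex.Re `|k| * unorm u.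
Proof.
apply: unorm_le => [||x]; first by rewrite mulr_ge0 ?unorm_ge0 ?normCRe_ge0.
  by rewrite reMnorm ler_wpM2l ?normCRe_ge0 ?unorm2.
by rewrite uactZ rnormZ -mulrA ler_wpM2l ?normCRe_ge0 ?uact_le.
Qed.

Lemma unormZ (k : R[i]) u : unorm (k *: u) = complex.Re `|k| * unorm u.
Proof.
apply/eqP; rewrite eq_le unormZ_le andTb; have [->|k0] := eqVneq k 0.
  by rewrite normr0 mul0r unorm_ge0.
have kp : 0 < complex.Re `|k| by rewrite -ltcR normCReK normr_gt0.
rewrite -ler_pdivlMl//; have := unormZ_le k^-1 (k *: u).
rewrite scalerA mulVf// scale1r normfV => /le_trans; apply.
rewrite le_eqVlt; apply/orP; left; apply/eqP; congr (_ * _); apply: complexI.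
by rewrite toCV normCReK -normfV normCReK.
Qed.

(** Comes from evaluating the action at [cstar u.1]. Together with [unorm_le1] it makes the norm
    equivalent to that of the product, whence completeness. *)
Lemma unorm1_le u : rnorm u.1 <= complex.Re `|u.2| + unorm u.
Proof.
have := uact_le u (cstar u.1).
have : rnorm (cmul u.1 (cstar u.1)) = rnorm u.1 * rnorm u.1.
  by rewrite -{1}(cstarK u.1) rnorm_cstar_cmul rnorm_cstar expr2.
have -> : cmul u.1 (cstar u.1) = uact u (cstar u.1) - u.2 *: cstar u.1.
  by rewrite /uact addrC addKr.
have := ler_rnormB (uact u (cstar u.1)) (u.2 *: cstar u.1).
rewrite rnormZ rnorm_cstar => h1 h2 h3.
have := rnorm_ge0 u.1; rewrite le_eqVlt => /orP[/eqP <-|u0].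
  by rewrite addr_ge0 ?unorm_ge0 ?normCRe_ge0.
by rewrite -(ler_pM2r u0) -h2 (le_trans h1)// mulrDl addrC lerD2l.
Qed.

Lemma unorm_le1 u : unorm u <= complex.Re `|u.2| + rnorm u.1.
Proof.
apply: unorm_le => [||x]; rewrite ?addr_ge0 ?rnorm_ge0 ?normCRe_ge0//.
  by rewrite lerDl rnorm_ge0.
by rewrite (le_trans (ler_rnormD _ _))// rnormZ mulrDl lerD// rnorm_cmul.
Qed.

Lemma unormN u : unorm (- u) = unorm u.
Proof. by rewrite -scaleN1r unormZ normrN normr1/= mul1r. Qed.

Lemma unorm0' : unorm (0 : V) = 0.
Proof. by rewrite -[X in unorm X](scale0r 0) unormZ normr0/= mul0r. Qed.

Lemma unorm0 u : unorm u = 0 -> u = 0.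
Proof.
case: u => a l u0; have := unorm2 (a, l); have := unorm1_le (a, l).
rewrite u0/= addr0 => al l0.
have l00 : complex.Re `|l| = 0 by apply/eqP; rewrite eq_le l0 normCRe_ge0.
have a0 : rnorm a <= 0 by rewrite -l00.
congr pair; first by apply: rnorm0_eq0; apply/eqP; rewrite eq_le a0 rnorm_ge0.
by apply/eqP; rewrite -normr_eq0 -normCReK l00.
Qed.

Lemma umulA : associative umul.
Proof.
move=> [a k] [b l] [c m]; rewrite /umul/=; congr pair; last by rewrite mulrA.
rewrite !scalerDr !scalerA !cmulDr !cmulDl !cmulZl !cmulZr cmulA.
rewrite (mulrC m k) (mulrC m l) -!addrA; congr (_ + _); congr (_ + _).
by rewrite [LHS](AC (1*(1*(1*(1*1)))) (2*(4*(1*(3*5))))).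
Qed.

Lemma umulDl : left_distributive umul +%R.
Proof.
move=> [a k] [b l] [c m]; rewrite /umul/=; congr pair; last by rewrite mulrDl.
by rewrite /= scalerDl scalerDr cmulDl [LHS](AC (2*2*2) ((1*3*5)*(2*4*6))).
Qed.

Lemma umulDr : right_distributive umul +%R.
Proof.
move=> [c m] [a k] [b l]; rewrite /umul/=; congr pair; last by rewrite mulrDr.
by rewrite /= scalerDl scalerDr cmulDr [LHS](AC (2*2*2) ((1*3*5)*(2*4*6))).
Qed.

Lemma umulZl (k : R[i]) u v : umul (k *: u) v = k *: umul u v.
Proof.
case: u v => [a l] [b m]; congr pair; last by rewrite /= -[RHS]/(k * (l * m)) -mulrA.
rewrite -[LHS]/((k * l) *: b + m *: (k *: a) + cmul (k *: a) b).
by rewrite /= !scalerDr cmulZl !scalerA (mulrC k m).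
Qed.

Lemma umulZr (k : R[i]) u v : umul u (k *: v) = k *: umul u v.
Proof.
case: u v => [a l] [b m]; congr pair; last by rewrite /= mulrCA.
by rewrite /= !scalerDr cmulZr !scalerA (mulrC k l).
Qed.

Lemma ustarK : involutive ustar.
Proof. by case=> a l; rewrite /ustar/= cstarK conjcK. Qed.

Lemma ustarD : {morph ustar : u v / u + v}.
Proof. by case=> a l [b m]; rewrite /ustar/= cstarD rmorphD. Qed.

Lemma ustarZ (k : R[i]) u : ustar (k *: u) = conjc k *: ustar u.
Proof. by case: u => a l; rewrite /ustar/= cstarZ rmorphM. Qed.

Lemma ustarM u v : ustar (umul u v) = umul (ustar v) (ustar u).
Proof.
case: u v => a l [b m]; rewrite /ustar/umul/= !cstarD !cstarZ cstarM rmorphM mulrC.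
by congr pair; rewrite (addrC (conjc l *: _)).
Qed.

Lemma unormM u v : unorm (umul u v) <= unorm u * unorm v.
Proof.
apply: unorm_le => [||x]; first by rewrite mulr_ge0 ?unorm_ge0.
  by rewrite reMnorm ler_pM ?normCRe_ge0 ?unorm2.
by rewrite uactM (le_trans (uact_le _ _))// -mulrA ler_wpM2l ?unorm_ge0 ?uact_le.
Qed.

Lemma unormC u : unorm u ^+ 2 <= unorm (umul (ustar u) u).
Proof.
set c := unorm (umul _ _); have c0 : 0 <= c by exact: unorm_ge0.
rewrite -[leRHS]sqr_sqrtr// ler_pXn2r ?nnegrE ?unorm_ge0 ?sqrtr_ge0//.
apply: unorm_le => [||x]; first exact: sqrtr_ge0.
  rewrite -(@ler_pXn2r _ 2)// ?nnegrE ?normCRe_ge0 ?sqrtr_ge0// sqr_sqrtr//.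
  apply: le_trans (unorm2 _); rewrite /umul/= expr2 -reMnorm -!lecR !normCReK.
  by rewrite !normrM norm_conjC.
rewrite -(@ler_pXn2r _ 2)// ?nnegrE ?mulr_ge0 ?rnorm_ge0 ?sqrtr_ge0// exprMn.
rewrite sqr_sqrtr// -rnorm_cstar_cmul uact_adj -uactM.
rewrite (le_trans (rnorm_cmul _ _))// rnorm_cstar expr2 mulrCA.
by rewrite ler_wpM2l ?rnorm_ge0// uact_le.
Qed.

Lemma unorm_complete (u : nat -> V) :
  (forall n, unorm (u n.+1 - u n) <= 2^-1 ^+ n) ->
  exists l, forall e : R, 0 < e ->
    exists N, forall n, (N <= n)%N -> unorm (u n - l) <= e.
Proof.
move=> cu.
have tel n m : (n <= m)%N -> unorm (u m - u n) <= 2 * 2^-1 ^+ n - 2 * 2^-1 ^+ m.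
  elim: m => [|m ih]; first by rewrite leqn0 => /eqP ->; rewrite !subrr unorm0'.
  rewrite leq_eqVlt => /orP[/eqP->|]; first by rewrite !subrr unorm0'.
  rewrite ltnS => /ih {}ih; have := unormD (u m.+1 - u m) (u m - u n).
  by rewrite subrKA; move: ih (cu m); rewrite [_ ^+ m.+1]exprS; lra.
have tel2 (e : R) : 0 < e -> exists N, forall n m, (N <= n)%N -> (N <= m)%N -> 
    unorm (u n - u m) <= e.
  move=> e0; have [k kP] := half_pow_lt (divr_gt0 e0 (ltr0n _ 2)); exists k => n m kn km.
  wlog nm : n m kn km / (n <= m)%N => [h|].
    by case/orP: (leq_total n m) => /h; [apply|rewrite -unormN opprB; apply].
  rewrite -unormN opprB (le_trans (tel _ _ nm))//.
  have : (2^-1 : R) ^+ n <= 2^-1 ^+ k.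
    by apply: ler_wiXn2l; rewrite ?invr_ge0// ?invf_le1 ?ler1n.
  have : 0 <= (2^-1 : R) ^+ m by rewrite exprn_ge0 ?invr_ge0.
  by move: kP; lra.
have c2 : exists l : R[i], forall e : R, 0 < e -> 
    exists N, forall n, (N <= n)%N -> complex.Re `|(u n).2 - l| <= e.
  have [|l lP] := @scalar_complete R (fun n => (u n).2).
    move=> e /tel2[N NP]; exists N => n m Nn Nm.
    by rewrite (le_trans _ (NP n m Nn Nm))// (unorm2 (u n - u m)).
  by exists l.
have [l2 l2P] := c2.
have [|l1 l1P] := @rnorm_complete _ _ (fun n => (u n).1).
  move=> e e0; have e2 := divr_gt0 e0 (ltr0n _ 2).
  have [N NP] := tel2 _ e2; exists N => n m Nn Nm.
  rewrite (le_trans (unorm1_le (u n - u m)))//= (splitr e) lerD ?NP//.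
  by rewrite (le_trans (unorm2 (u n - u m))) ?NP.
exists (l1, l2) => e e0; have e2 := divr_gt0 e0 (ltr0n _ 2).
have [N1 N1P] := l1P _ e2; have [N2 N2P] := l2P _ e2.
exists (maxn N1 N2) => n; rewrite geq_max => /andP[n1 n2].
by rewrite (le_trans (unorm_le1 _))//= (splitr e) lerD ?N1P ?N2P.
Qed.

End Unitization.

(* Unital C*-algebras, kept apart from the topological hierarchy so that they can be rings. *)
HB.mixin Record isUCStar (R : realType) U & GRing.Algebra R[i] U := {
  nm : U -> R ;
  st : U -> U ;
  nmD : forall u v, nm (u + v) <= nm u + nm v ;
  nmZ : forall (k : R[i]) u, nm (k *: u) = complex.Re `|k| * nm u ;
  nm0_eq0 : forall u, nm u = 0 -> u = 0 ;
  nm_complete0 : forall u : nat -> U,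
    (forall n, nm (u n.+1 - u n) <= 2^-1 ^+ n) ->
    exists l, forall e : R, 0 < e ->
      exists N, forall n, (N <= n)%N -> nm (u n - l) <= e ;
  stK : involutive st ;
  stD : {morph st : u v / u + v} ;
  stZ : forall (k : R[i]) u, st (k *: u) = conjc k *: st u ;
  stM : forall u v, st (u * v) = st v * st u ;
  nmM : forall u v, nm (u * v) <= nm u * nm v ;
  nmC_le : forall u, nm u ^+ 2 <= nm (st u * u)
}.

#[short(type="ucstarAlgType")]
HB.structure Definition UCStarAlgebra (R : realType) :=
  {U of GRing.Algebra R[i] U & isUCStar R U}.

Definition unitz (R : realType) (A : cstarAlgType R) : Type := (A * R[i])%type.

Section UnitzRing.
Context (R : realType) (A : cstarAlgType R).
Local Notation U := (unitz A).

HB.instance Definition _ := GRing.Lmodule.copy U (A * R[i])%type.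

Definition uone : U := (0 : A, 1 : R[i]).

Fact umul1l : left_id uone (@umul R A).
Proof. by case=> a l; rewrite /umul/= scale1r scaler0 cmul0l !addr0 mul1r. Qed.
Fact umul1r : right_id uone (@umul R A).
Proof. by case=> a l; rewrite /umul/= scale1r scaler0 cmul0r add0r addr0 mulr1. Qed.
Fact uone_neq0 : uone != 0 :> U.
Proof. by apply/eqP => -[/eqP]; rewrite oner_eq0. Qed.

HB.instance Definition _ := GRing.Zmodule_isNzRing.Build U
  (@umulA R A) umul1l umul1r (@umulDl R A) (@umulDr R A) uone_neq0.

HB.instance Definition _ := GRing.Lmodule_isLalgebra.Build R[i] U
  (fun k u v => esym (@umulZl R A k u v)).
HB.instance Definition _ := GRing.Lalgebra_isAlgebra.Build R[i] U
  (fun k u v => esym (@umulZr R A k u v)).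
HB.instance Definition _ := isUCStar.Build R U
  (@unormD R A) (@unormZ R A) (@unorm0 R A) (@unorm_complete R A) (@ustarK R A)
  (@ustarD R A) (@ustarZ R A) (@ustarM R A) (@unormM R A) (@unormC R A).

End UnitzRing.

(** * Order and square roots in a unital C*-algebra, without spectra *)

Section UnitRing.
Context (R : realType) (U : ucstarAlgType R).
Local Notation toC := (real_complex R).
Implicit Types u v x y z h : U.

Lemma toC2 : toC 2 = 1 + 1 :> R[i].
Proof. by rewrite -toCD. Qed.

Lemma nm0 : nm (0 : U) = 0.
Proof. by rewrite -(scale0r (0 : U)) nmZ normr0/= mul0r. Qed.

Lemma nmN x : nm (- x) = nm x.
Proof. by rewrite -scaleN1r nmZ normrN normr1/= mul1r. Qed.

Lemma nm_ge0 x : 0 <= nm x.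
Proof. by have := nmD x (- x); rewrite subrr nm0 nmN; lra. Qed.

Lemma ndistC x y : nm (x - y) = nm (y - x).
Proof. by rewrite -nmN opprB. Qed.

Lemma nmB x y : nm (x - y) <= nm x + nm y.
Proof. by rewrite -(nmN y) nmD. Qed.

Lemma ndistD z x y : nm (x - y) <= nm (x - z) + nm (z - y).
Proof. by rewrite -[X in nm X](subrKA z) nmD. Qed.

Lemma nm_sum (I : Type) (s : seq I) (P : pred I) (F : I -> U) :
  nm (\sum_(i <- s | P i) F i) <= \sum_(i <- s | P i) nm (F i).
Proof.
elim/big_rec2: _ => [|i y1 y2 _ ih]; first by rewrite nm0.
by rewrite (le_trans (nmD _ _))// lerD2l.
Qed.

Lemma nmZr (k : R) x : nm (toC k *: x) = `|k| * nm x.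
Proof.
rewrite nmZ; congr (_ * _); apply: complexI.
by rewrite normCReK normc_def /= expr0n addr0 sqrtr_sqr.
Qed.

Lemma stN x : st (- x) = - st x.
Proof. by rewrite -scaleN1r stZ rmorphN1 scaleN1r. Qed.

Lemma st0 : st (0 : U) = 0.
Proof. by have := stZ 0 (0 : U); rewrite scale0r conjc0 scale0r. Qed.

Lemma stB x y : st (x - y) = st x - st y.
Proof. by rewrite stD stN. Qed.

Lemma stZr (k : R) x : st (toC k *: x) = toC k *: st x.
Proof. by rewrite stZ conjc_real. Qed.

Lemma st_sum (I : Type) (s : seq I) (P : pred I) (F : I -> U) :
  st (\sum_(i <- s | P i) F i) = \sum_(i <- s | P i) st (F i).
Proof. by apply: (big_morph _ (@stD _ _)); rewrite st0. Qed.

Lemma nm_le_eq x y : (forall e : R, 0 < e -> nm (x - y) <= e) -> x = y.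
Proof.
move=> xy; apply/eqP; rewrite -subr_eq0; apply/eqP/nm0_eq0/eqP.
by rewrite eq_le nm_ge0 andbT; apply/ler_addgt0Pr => e /xy; rewrite add0r.
Qed.

Lemma nm_lim_le (f : nat -> U) l c :
  (forall e : R, 0 < e -> exists n, nm (f n - l) <= e) ->
  (forall n, nm (f n) <= c) -> nm l <= c.
Proof.
move=> ul uc; apply/ler_addgt0Pr => e /ul[n nP].
rewrite -[l](subKr (f n)) (le_trans (nmB _ _))// addrC [leRHS]addrC.
by rewrite lerD// uc.
Qed.

Lemma nm_complete (f : nat -> U) :
  (forall e : R, 0 < e -> exists N, forall n m, (N <= n)%N -> (N <= m)%N ->
     nm (f n - f m) <= e) ->
  exists l, forall e : R, 0 < e ->
    exists N, forall n, (N <= n)%N -> nm (f n - l) <= e.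
Proof.
move=> cf; have p n : 0 < (2^-1 ^+ n : R) by rewrite exprn_gt0// invr_gt0.
have /choice[g gP] : forall n, exists N, forall i j, (N <= i)%N -> (N <= j)%N ->
  nm (f i - f j) <= 2^-1 ^+ n by move=> n; exact: cf.
(* Running maxima make the chosen ranks increasing, so consecutive terms both lie beyond [g n]. *)
pose G n := \max_(i < n.+1) g i.
have gG n : (g n <= G n)%N by exact: (leq_bigmax (F := fun i : 'I_n.+1 => g i) ord_max).
have GS n : (G n <= G n.+1)%N by rewrite [X in (_ <= X)%N]/G big_ord_recr/= leq_maxl.
have [|l lP] := nm_complete0 (fun n => f (G n)).
  by move=> n; apply: gP; rewrite ?gG// (leq_trans (gG n)).
exists l => e e0; have e2 := divr_gt0 e0 (ltr0n _ 2).
have [N NP] := lP _ e2; have [M MP] := cf _ e2.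
exists M => n Mn.
have [k kP] : exists k, (N <= k)%N /\ nm (f n - f (G k)) <= e / 2.
  have [k0 k0P] := half_pow_lt e2; pose k := maxn N k0.
  have [Mg|gM] := leqP M (G k); first by exists k; rewrite leq_maxl MP.
  (* Here [G k < M <= n], so n lies beyond [g k] and the choice of [g] compares the two terms within
     2^-k, which is less than e / 2 by the choice of [k0]. *)
  exists k; rewrite leq_maxl (le_trans (gP k _ _ _ _)) ?gG//.
    by rewrite (leq_trans (gG k))// (leq_trans (ltnW gM)).
  rewrite (le_trans _ (ltW k0P))//.
  by apply: ler_wiXn2l; rewrite ?invr_ge0// ?invf_le1 ?ler1n ?leq_maxr.
by rewrite (le_trans (ndistD (f (G k)) _ _))// (splitr e) lerD ?NP; case: kP.
Qed.

Lemma nmC u : nm (st u * u) = nm u ^+ 2.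
Proof.
have h v : nm v <= nm (st v).
  have := le_trans (nmC_le v) (nmM _ _); rewrite expr2.
  have := nm_ge0 v; rewrite le_eqVlt => /orP[/eqP <- _|x0]; first exact: nm_ge0.
  by rewrite ler_pM2r.
apply/eqP; rewrite eq_le nmC_le andbT (le_trans (nmM _ _))// expr2.
by rewrite ler_wpM2r ?nm_ge0// -{2}[u]stK h.
Qed.

Lemma nm_st u : nm (st u) = nm u.
Proof.
have h v : nm v <= nm (st v).
  have := le_trans (nmC_le v) (nmM _ _); rewrite expr2.
  have := nm_ge0 v; rewrite le_eqVlt => /orP[/eqP <- _|x0]; first exact: nm_ge0.
  by rewrite ler_pM2r.
by apply/eqP; rewrite eq_le h -{2}[u]stK h.
Qed.

Lemma st1 : st (1 : U) = 1.
Proof. by rewrite -[LHS]mul1r -{1}(stK (1 : U)) -stM mul1r stK. Qed.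

Lemma nm1 : nm (1 : U) = 1.
Proof.
have := nmC 1; rewrite st1 mulr1 expr2 => /esym/eqP.
rewrite -subr_eq0 -{3}[nm 1]mulr1 -mulrBr mulf_eq0 => /orP[/eqP/nm0_eq0/eqP|].
  by rewrite oner_eq0.
by rewrite subr_eq0 => /eqP.
Qed.

Lemma nmX u n : nm (u ^+ n) <= nm u ^+ n.
Proof.
elim: n => [|n ih]; first by rewrite !expr0 nm1.
by rewrite !exprS (le_trans (nmM _ _))// ler_wpM2l// nm_ge0.
Qed.

Definition sc (r : R) : U := toC r *: 1.

Lemma scE r u : sc r * u = toC r *: u.
Proof. by rewrite /sc -scalerAl mul1r. Qed.
Lemma scEr r u : u * sc r = toC r *: u.
Proof. by rewrite /sc -scalerAr mulr1. Qed.
Lemma sc1 : sc 1 = 1. Proof. by rewrite /sc scale1r. Qed.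
Lemma sc0 : sc 0 = 0. Proof. by rewrite /sc scale0r. Qed.
Lemma nm_sc r : nm (sc r) = `|r|.
Proof. by rewrite nmZr nm1 mulr1. Qed.

Definition sa u := st u = u.

Lemma sa0 : sa 0. Proof. exact: st0. Qed.
Lemma sa1 : sa 1. Proof. exact: st1. Qed.
Lemma saD u v : sa u -> sa v -> sa (u + v).
Proof. by move=> su sv; rewrite /sa stD su sv. Qed.
Lemma saN u : sa u -> sa (- u).
Proof. by move=> su; rewrite /sa stN su. Qed.
Lemma saB u v : sa u -> sa v -> sa (u - v).
Proof. by move=> su sv; apply/saD/saN. Qed.
Lemma saZ r u : sa u -> sa (toC r *: u).
Proof. by move=> su; rewrite /sa stZr su. Qed.
Lemma sa_sc r : sa (sc r). Proof. exact/saZ/sa1. Qed.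
Lemma saM u v : sa u -> sa v -> GRing.comm u v -> sa (u * v).
Proof. by move=> su sv c; rewrite /sa stM su sv c. Qed.
Lemma saX u n : sa u -> sa (u ^+ n).
Proof.
move=> su; elim: n => [|n ih]; first exact: sa1.
by rewrite exprS; apply: saM => //; exact: commrX.
Qed.
Lemma sa_lim (f : nat -> U) l :
  (forall e : R, 0 < e -> exists n, nm (f n - l) <= e) ->
  (forall n, sa (f n)) -> sa l.
Proof.
move=> fl sf; apply: nm_le_eq => e e0.
have [n nP] := fl _ (divr_gt0 e0 (ltr0n _ 2)).
rewrite (le_trans (ndistD (f n) _ _))// (splitr e) lerD// -{1}(sf n).
by rewrite -stB nm_st ndistC.
Qed.
Lemma comm_lim (f : nat -> U) l v :
  (forall e : R, 0 < e -> exists n, nm (f n - l) <= e) ->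
  (forall n, GRing.comm v (f n)) -> GRing.comm v l.
Proof.
move=> fl cf; apply: nm_le_eq => e e0.
have d0 : 0 < e / (2 * (nm v + 1)).
  by rewrite divr_gt0// mulr_gt0// ltr_wpDl// nm_ge0.
have [n nP] := fl _ d0.
have -> : v * l - l * v = (f n - l) * v - v * (f n - l).
  by rewrite mulrBl mulrBr cf opprB [RHS]addrC subrKA.
have vp : 0 < nm v + 1 by rewrite ltr_wpDl// nm_ge0.
have vn : nm (f n - l) * nm v <= e / 2.
  rewrite (@le_trans _ _ (e / (2 * (nm v + 1)) * (nm v + 1)))//.
    by rewrite ler_pM ?nm_ge0// lerDl.
  by rewrite invfM mulrA divfK// gt_eqF.
rewrite (le_trans (nmB _ _))// (splitr e) lerD//.
  by rewrite (le_trans (nmM _ _)).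
by rewrite (le_trans (nmM _ _))// mulrC.
Qed.
Lemma sa_nm2 u : sa u -> nm (u * u) = nm u ^+ 2.
Proof. by move=> su; rewrite -{1}su nmC. Qed.
Lemma sa_nmX u k : sa u -> nm (u ^+ (2 ^ k)) = nm u ^+ (2 ^ k).
Proof.
move=> su; elim: k => [|k ih]; first by rewrite !expr1.
by rewrite expnSr !exprM expr2 sa_nm2 ?ih//; exact: saX.
Qed.

Lemma sub_sqr_comm x y : GRing.comm x y -> x ^+ 2 - y ^+ 2 = (x - y) * (x + y).
Proof. by move=> c; rewrite mulrDr !mulrBl c !expr2 addrA subrK. Qed.

(* The binomial iteration for 1 - sqrt (1 - y), dominated by its scalar version at y = 1. *)
Fixpoint sqit y n : U := if n is m.+1 then toC 2^-1 *: (y + sqit y m ^+ 2) else 0.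
Fixpoint rsqit n : R := if n is m.+1 then 2^-1 * (1 + rsqit m ^+ 2) else 0.

Lemma rsqit01 n : 0 <= rsqit n <= 1.
Proof.
elim: n => [|n /andP[h0 h1]] /=; first by rewrite lexx ler01.
have : rsqit n ^+ 2 <= 1 by rewrite expr_le1.
have := sqr_ge0 (rsqit n); lra.
Qed.

Lemma sqit_comm y v n : GRing.comm v y -> GRing.comm v (sqit y n).
Proof.
move=> vy; elim: n => [|n ih] /=; first exact: commr0.
rewrite /GRing.comm -scalerAl -scalerAr; congr (_ *: _).
exact: (commrD vy (commrX 2 ih)).
Qed.

Lemma sqit_sa y n : sa y -> sa (sqit y n).
Proof.
by move=> sy; elim: n => [|n ih] /=; [exact: sa0|apply/saZ/saD => //; exact: saX].
Qed.

Lemma sqit_norm y n : nm y <= 1 -> nm (sqit y n) <= rsqit n.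
Proof.
move=> y1; elim: n => [|n ih] /=; first by rewrite nm0.
rewrite nmZr ger0_norm ?invr_ge0// ler_wpM2l ?invr_ge0//.
rewrite (le_trans (nmD _ _))// lerD// (le_trans (nmX _ _))//.
by rewrite ler_pXn2r ?nnegrE ?nm_ge0//; case/andP: (rsqit01 n).
Qed.

Lemma sqit_dist y n : nm y <= 1 ->
  nm (sqit y n.+1 - sqit y n) <= rsqit n.+1 - rsqit n.
Proof.
move=> y1; elim: n => [|n ih].
  rewrite /= !expr0n/= addr0 !subr0 addr0 nmZr ger0_norm ?invr_ge0//.
  by rewrite ler_wpM2l ?invr_ge0.
rewrite -[sqit y n.+2]/(toC 2^-1 *: (y + sqit y n.+1 ^+ 2)) -[X in _ - X]/(toC 2^-1 *: (y + sqit y n ^+ 2)) -scalerBr nmZr ger0_norm ?invr_ge0//.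
rewrite opprD addrACA subrr add0r.
have c : GRing.comm (sqit y n.+1) (sqit y n).
  by apply/sqit_comm/commr_sym/sqit_comm/commr_refl.
rewrite -[X in _ <= X](_ : 2^-1 * ((rsqit n.+1 - rsqit n) * (rsqit n.+1 + rsqit n)) = _).
  rewrite ler_wpM2l ?invr_ge0// sub_sqr_comm//.
  rewrite (le_trans (nmM _ _))// ler_pM ?nm_ge0//.
  by rewrite (le_trans (nmD _ _))// lerD// sqit_norm.
have E m : rsqit m.+1 = 2^-1 * (1 + rsqit m ^+ 2) by [].
by rewrite (E n.+1) [X in _ = _ - X](E n); ring.
Qed.

Lemma sqit_tel y n m : nm y <= 1 -> (n <= m)%N ->
  nm (sqit y m - sqit y n) <= rsqit m - rsqit n.
Proof.
move=> y1; elim: m => [|m ih]; first by rewrite leqn0 => /eqP ->; rewrite !subrr nm0.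
rewrite leq_eqVlt => /orP[/eqP->|]; first by rewrite !subrr nm0.
rewrite ltnS => /ih {}ih; have := nmD (sqit y m.+1 - sqit y m) (sqit y m - sqit y n).
by rewrite subrKA; have := sqit_dist m y1; lra.
Qed.

Lemma rsqit_cauchy (e : R) : 0 < e ->
  exists N, forall n m, (N <= n)%N -> (n <= m)%N -> rsqit m - rsqit n <= e.
Proof.
move=> e0; pose S := [set rsqit n | n in [set: nat]].
have hS : has_sup S.
  split; first by exists (rsqit 0); exists 0%N.
  by exists 1 => _ [n _ <-]; case/andP: (rsqit01 n).
have [_ [N _ <-] NP] := sup_adherent e0 hS.
have mono n m : (n <= m)%N -> rsqit n <= rsqit m.
  (* The telescoped estimate at [y = 0] exhibits the increment as an upper bound of a norm. *)
  move=> nm; rewrite -subr_ge0; apply: le_trans (sqit_tel (y := 0) _ nm).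
    exact: nm_ge0.
  by rewrite nm0.
exists N => n m Nn nm.
have : rsqit m <= sup S by apply: ub_le_sup; [case: hS|exists m].
by have := mono _ _ Nn; move: NP; lra.
Qed.

Lemma sqrt_aux y : sa y -> nm y <= 1 -> exists g, [/\ sa g, nm g <= 1,
  (1 - g) * (1 - g) = 1 - y & forall v, GRing.comm v y -> GRing.comm v g].
Proof.
move=> sy y1.
have [e e0|g gP] := nm_complete (f := sqit y).
  have [N NP] := rsqit_cauchy e0; exists N => n m.
  wlog nm : n m / (n <= m)%N => [h|] Nn Nm.
    by case/orP: (leq_total n m) => /h; [apply|rewrite ndistC; apply].
  by rewrite ndistC (le_trans (sqit_tel y1 nm))// NP.
have gP' (e : R) : 0 < e -> exists n, nm (sqit y n - g) <= e.
  by move=> /gP[N /(_ N (leqnn _))]; exists N.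
have g1 : nm g <= 1.
  apply: nm_lim_le gP' _ => n; rewrite (le_trans (sqit_norm _ y1))//.
  by case/andP: (rsqit01 n).
exists g; split => //.
- by apply: sa_lim gP' _ => n; exact: sqit_sa.
- suff : g + g = y + g ^+ 2.
    move=> gg; have -> : y = g + g - g ^+ 2 by rewrite gg addrK.
    rewrite mulrBl mul1r mulrBr mulr1 -expr2 !opprB opprD.
    by rewrite [LHS](AC (2*2) (1*(3*(2*4)))).
  apply: nm_le_eq => e e0; have [N NP] := gP _ (divr_gt0 e0 (ltr0n _ 4)).
  have a1 := NP _ (leqnn _); have a2 := NP _ (leqnSn _).
  have -> : g + g - (y + g ^+ 2) =
      (sqit y N ^+ 2 - g ^+ 2) - toC 2 *: (sqit y N.+1 - g).
    rewrite /= scalerBr scalerA -rmorphM/= mulfV// scale1r.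
    rewrite (_ : toC 2 *: g = g + g); last by rewrite (_ : 2 = 1 + 1)// rmorphD/= scalerDl !scale1r.
    by rewrite opprB [RHS]addrC !opprD !addrA addrNK.
  have c : GRing.comm (sqit y N) g.
    by apply: comm_lim gP' _ => n; apply/sqit_comm/commr_sym/sqit_comm/commr_refl.
  rewrite (le_trans (nmB _ _))// nmZr ger0_norm// sub_sqr_comm//.
  have : nm ((sqit y N - g) * (sqit y N + g)) <= e / 4 * 2.
    rewrite (le_trans (nmM _ _))// ler_pM ?nm_ge0//.
    rewrite (le_trans (nmD _ _))// -[2]/(1 + 1) lerD//.
    by rewrite (le_trans (sqit_norm _ y1))//; case/andP: (rsqit01 N).
  by move: a2; lra.
- by move=> v vy; apply: comm_lim gP' _ => n; exact: sqit_comm.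
Qed.

Lemma sqrt_one_sub y : sa y -> nm y <= 1 -> exists h, [/\ sa h, nm (1 - h) <= 1,
  h * h = 1 - y & forall v, GRing.comm v y -> GRing.comm v h].
Proof.
move=> sy y1; have [g [sg g1 gg cg]] := sqrt_aux sy y1; exists (1 - g); split => //.
- exact: saB sa1 sg.
- by rewrite opprB addrC subrK.
- move=> v /cg c; exact: (commrB (commr1 v) c).
Qed.

Lemma st_im u : sa u -> st ('i%C *: u) = - ('i%C *: u).
Proof.
move=> su; rewrite stZ su -scaleNr; congr (_ *: _).
by apply/eqP; rewrite eq_complex /= oppr0 !eqxx.
Qed.

(** For u = h + i k' the product [st u * u] equals h^2 + k'^2, while h is the real part of u and so
    has at most the norm of u. This is the substitute for spectral theory in the order estimates
    below. *)
Lemma comm_sq_le h k' : sa h -> sa k' -> GRing.comm h k' ->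
  nm h ^+ 2 <= nm (h * h + k' * k').
Proof.
move=> sh sk c; pose u := h + 'i%C *: k'.
have su : st u = h - 'i%C *: k' by rewrite /u stD sh st_im.
have E : st u * u = h * h + k' * k'.
  have ii : 'i%C * 'i%C = -1 :> R[i].
    by apply/eqP; rewrite eq_complex /= !mul0r !mulr1 !mulr0 sub0r addr0 oppr0 !eqxx.
  rewrite su /u mulrBl !mulrDr -!scalerAl -!scalerAr scalerA ii scaleN1r.
  by rewrite opprD opprK addrA (c : h * k' = k' * h) addrK.
rewrite -E nmC ler_pXn2r ?nnegrE ?nm_ge0//.
have -> : h = toC 2^-1 *: (u + st u).
  rewrite su /u addrACA subrr addr0 -{2 3}[h]scale1r -scalerDl.
  by rewrite -toC2 scalerA -toCM mulVf// scale1r.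
rewrite nmZr ger0_norm ?invr_ge0// (le_trans (ler_wpM2l _ (nmD _ _))) ?invr_ge0//.
by rewrite nm_st; have := nm_ge0 u; lra.
Qed.

Lemma sq_norm1 h : sa h -> nm h <= 1 -> nm (1 - h * h) <= 1.
Proof.
move=> sh h1; have hh1 : nm (h * h) <= 1.
  by rewrite sa_nm2// expr_le1 ?nm_ge0.
have [k' [sk _ kk ck]] := sqrt_one_sub (saM sh sh (erefl _)) hh1.
have c : GRing.comm k' h by apply/commr_sym/ck/commrM.
rewrite -kk sa_nm2//; apply: (le_trans (comm_sq_le sk sh c)).
by rewrite kk subrK nm1.
Qed.

(** Positivity expressed by the norm: the spectrum lies in the disc of centre r and radius r. In
    this form sums of positive elements are visibly positive, and square roots come directly from
    the binomial iteration. *)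
Definition npos u := sa u /\ exists2 r : R, 0 <= r & nm (sc r - u) <= r.

Lemma npos_sa u : npos u -> sa u. Proof. by case. Qed.

Lemma npos0 : npos 0.
Proof. by split; [exact: sa0|exists 0; rewrite // sc0 subrr nm0]. Qed.

Lemma npos1 : npos 1.
Proof. by split; [exact: sa1|exists 1; rewrite // sc1 subrr nm0]. Qed.

Lemma nposD u v : npos u -> npos v -> npos (u + v).
Proof.
move=> [su [r r0 ur]] [sv [s s0 vs]]; split; first exact: saD.
exists (r + s); first exact: addr_ge0.
have -> : sc (r + s) - (u + v) = (sc r - u) + (sc s - v).
  by rewrite /sc rmorphD scalerDl opprD addrACA.
by rewrite (le_trans (nmD _ _))// lerD.
Qed.

Lemma nposZ r u : 0 <= r -> npos u -> npos (toC r *: u).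
Proof.
move=> r0 [su [s s0 us]]; split; first exact: saZ.
exists (r * s); first exact: mulr_ge0.
rewrite /sc rmorphM -scalerA -scalerBr nmZr ger0_norm// ler_wpM2l//.
Qed.

Lemma npos_sum (I : Type) (s : seq I) (P : pred I) (F : I -> U) :
  (forall i, P i -> npos (F i)) -> npos (\sum_(i <- s | P i) F i).
Proof. by move=> FP; apply: big_ind => //; [exact: npos0|exact: nposD]. Qed.

Lemma npos_sqrt u : npos u -> exists h, [/\ npos h, h * h = u &
  forall v, GRing.comm v u -> GRing.comm v h].
Proof.
move=> [su [r r0 ur]]; move: r0; rewrite le_eqVlt => /orP[/eqP r0|r0].
  have -> : u = 0.
    apply: nm0_eq0; apply/eqP; rewrite eq_le nm_ge0 andbT.
    by move: ur; rewrite -r0 sc0 sub0r nmN.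
  exists 0; split; [exact: npos0|by rewrite mul0r|by move=> v _; exact: commr0].
pose y := 1 - toC r^-1 *: u.
have sy : sa y by apply/saB/saZ => //; exact: sa1.
have rr : toC r^-1 *: sc r = 1.
  by rewrite /sc scalerA -rmorphM/= mulVf ?gt_eqF// scale1r.
have y1 : nm y <= 1.
  rewrite /y -[X in X - _]rr -scalerBr nmZr ger0_norm ?invr_ge0 ?(ltW r0)//.
  by rewrite ler_pdivrMl// mulr1.
have [h [sh h1 hh ch]] := sqrt_one_sub sy y1.
have nh : npos h by split=> //; exists 1 => //; rewrite sc1.
exists (toC (Num.sqrt r) *: h); split.
- exact/nposZ/nh/sqrtr_ge0.
- rewrite -scalerAl -scalerAr scalerA hh -rmorphM -expr2 sqr_sqrtr ?ltW// /y.
  by rewrite opprB addrC subrK scalerA -rmorphM/= mulfV ?gt_eqF// scale1r.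
- move=> v c; rewrite /GRing.comm -scalerAl -scalerAr; congr (_ *: _); apply: ch.
  apply: commrB; first exact: commr1.
  by rewrite /GRing.comm -scalerAl -scalerAr c.
Qed.

Lemma npos_sq h : sa h -> npos (h * h).
Proof.
move=> sh; split; first exact: saM.
have [->|h0] := eqVneq h 0; first by exists 0; rewrite // mul0r sc0 subrr nm0.
have hp : 0 < nm h.
  by rewrite lt_neqAle nm_ge0 andbT eq_sym; apply: contra_neq h0 => /nm0_eq0.
exists (nm h ^+ 2); first exact: sqr_ge0.
have -> : sc (nm h ^+ 2) - h * h = toC (nm h ^+ 2) *:
    (1 - (toC (nm h)^-1 *: h) * (toC (nm h)^-1 *: h)).
  rewrite -scalerAl -scalerAr scalerA scalerBr scalerA -rmorphM -rmorphM -expr2.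
  by rewrite -exprMn mulfV ?gt_eqF// expr1n scale1r.
rewrite nmZr ger0_norm ?sqr_ge0// -[leRHS]mulr1 ler_wpM2l ?sqr_ge0//.
apply: sq_norm1; first exact: saZ.
by rewrite nmZr ger0_norm ?invr_ge0 ?(ltW hp)// mulVf// gt_eqF.
Qed.

(** Dividing a root of u by the square root of r reduces this to [sq_norm1]. Thus every bound of the
    norm may serve as the radius in [npos]. *)
Lemma npos_normP u r : npos u -> nm u <= r -> nm (sc r - u) <= r.
Proof.
move=> /npos_sqrt[h [/npos_sa sh <- _]]; rewrite sa_nm2// => hr.
have r0 : 0 <= r by rewrite (le_trans _ hr)// sqr_ge0.
move: r0; rewrite le_eqVlt => /orP[/eqP r0|r0].
  move: hr; rewrite -r0 => hr.
  have h0 : h = 0.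
    by apply: nm0_eq0; apply/eqP; rewrite -sqrf_eq0 eq_le hr sqr_ge0.
  by rewrite h0 mul0r sc0 subrr nm0.
have s0 : 0 < Num.sqrt r by rewrite sqrtr_gt0.
have -> : sc r - h * h = toC r *:
    (1 - (toC (Num.sqrt r)^-1 *: h) * (toC (Num.sqrt r)^-1 *: h)).
  rewrite -scalerAl -scalerAr scalerA scalerBr scalerA -!toCM.
  suff -> : r * ((Num.sqrt r)^-1 * (Num.sqrt r)^-1) = 1 by rewrite scale1r.
  by rewrite -invfM -[X in r / X]expr2 sqr_sqrtr ?(ltW r0)// mulfV ?gt_eqF.
rewrite nmZr (ger0_norm (ltW r0)) -[leRHS]mulr1 ler_wpM2l ?(ltW r0)//.
apply: sq_norm1; first exact: saZ.
rewrite nmZr ger0_norm ?invr_ge0 ?(ltW s0)// ler_pdivrMl// mulr1.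
by rewrite -(@ler_pXn2r _ 2)// ?nnegrE ?nm_ge0 ?sqrtr_ge0// sqr_sqrtr// (ltW r0).
Qed.

Lemma npos_comm u v : npos u -> npos v -> GRing.comm u v -> npos (u * v).
Proof.
move=> /npos_sqrt[h [/npos_sa sh hh ch]] /npos_sqrt[k' [/npos_sa sk kk ck]] c.
have chk : GRing.comm h k'.
  by apply/ck/commr_sym/ch/commr_sym.
have -> : u * v = (h * k') * (h * k').
  by rewrite -hh -kk -!mulrA; congr (_ * _); rewrite mulrA {1}(chk : h * k' = k' * h) mulrA.
exact/npos_sq/saM.
Qed.

Lemma npos_opp_eq0 u : npos u -> npos (- u) -> u = 0.
Proof.
move=> nu nv.
have [h [/npos_sa sh hh ch]] := npos_sqrt nu.
have [k' [/npos_sa sk kk ck]] := npos_sqrt nv.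
have c : GRing.comm h k'.
  by apply/ck; rewrite -hh; apply/commrN/commrM.
have := comm_sq_le sh sk c; rewrite hh kk subrr nm0 => h0.
have -> : u = h * h by [].
suff -> : h = 0 by rewrite mul0r.
by apply: nm0_eq0; apply/eqP; rewrite -sqrf_eq0 eq_le h0 sqr_ge0.
Qed.

Lemma npos_le u v : npos u -> npos (v - u) -> nm u <= nm v.
Proof.
move=> nu nvu.
have nv : npos v by rewrite -(subrK u v); exact: nposD.
have := npos_normP nv (lexx _); set r := nm v => h.
have r0 : 0 <= r := nm_ge0 v.
have n1 : npos (sc r - v).
  split; first by apply/saB/npos_sa => //; exact: sa_sc.
  by exists r => //; rewrite subKr.
have n2 : npos (sc r - u) by rewrite -(subrKA v); exact: nposD.
have [a [/npos_sa sa aa ca]] := npos_sqrt nu.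
have [b [/npos_sa sb bb cb]] := npos_sqrt n2.
have c : GRing.comm a b.
  apply/cb/commrB; first by rewrite /GRing.comm scE scEr.
  by rewrite -aa; apply: commrM.
by have := comm_sq_le sa sb c; rewrite -sa_nm2// aa bb addrC subrK nm_sc ger0_norm.
Qed.

(** If z = 1 + s with s > 0, Bernoulli's inequality squared makes z^(2n) grow at least like n^2 s^2,
    against a linear bound. Only exponents 2^k occur because [sa_nmX] computes norms of just these
    powers. *)
Lemma pow2_bound (z C : R) : 0 <= z -> 0 <= C ->
  (forall k, z ^+ (2 ^ k) <= 1 + (2 ^ k)%:R * C) -> z <= 1.
Proof.
move=> z0 C0 zC; rewrite leNgt; apply/negP => z1; pose s := z - 1.
have s0 : 0 < s by rewrite subr_gt0.
have zn n : 1 + n%:R * s <= z ^+ n.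
  elim: n => [|n ih]; first by rewrite mul0r addr0 expr0.
  rewrite exprS (le_trans _ (ler_wpM2l z0 ih))// -natr1 (_ : z = 1 + s) /s; last by ring.
  have : 0 <= n%:R * s ^+ 2 by rewrite mulr_ge0// sqr_ge0.
  by rewrite /s; lra.
have s2 : 0 < s ^+ 2 by rewrite exprn_gt0.
pose k := Num.bound (2 * C / s ^+ 2); pose n := (2 ^ k)%N.
have nP : 2 * C < n%:R * s ^+ 2.
  have q0 : 0 <= 2 * C / s ^+ 2 by rewrite divr_ge0// ?mulr_ge0// ltW.
  rewrite -ltr_pdivrMr//; apply: lt_le_trans (archi_boundP q0) _.
  by rewrite ler_nat ltnW// ltn_expl.
have n1 : 0 < n%:R :> R by rewrite ltr0n expn_gt0.
have := zC k.+1; rewrite expnS mul2n -addnn -/n exprD natrD.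
have h1 : 0 < n%:R * s by rewrite mulr_gt0.
have : (1 + n%:R * s) ^+ 2 <= (z ^+ n) ^+ 2.
  by rewrite ler_pXn2r ?zn// nnegrE ?exprn_ge0// addr_ge0// ltW.
have : 0 < n%:R * (n%:R * s ^+ 2 - 2 * C) by rewrite mulr_gt0// subr_gt0.
by move: h1; rewrite !expr2; lra.
Qed.

(** Usually deduced from the equality of the nonzero spectra of [st y * y] and t = [y * st y]. Here
    t is positive because t + [st y * y] is twice the sum of the squares of the real and imaginary
    parts of y. From t y = - y p follows (r + t)^n y = y (r - p)^n, so (r + t)^n t is at most r^n
    |y|^2 in norm. Hence the powers of 1 + t / r grow at most linearly, 1 + t / r has norm at most
    1, and - t is positive as well. *)
Lemma kv_aux y p : npos p -> st y * y = - p -> p = 0.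
Proof.
move=> np yp.
pose t := y * st y.
have nt : npos t.
  pose a := toC 2^-1 *: (y + st y); pose b := (toC 2^-1 * 'i%C) *: (y - st y).
  have sa_a : sa a by apply/saZ; rewrite /sa stD stK addrC.
  have sb : sa b.
    rewrite /b -scalerA; apply/saZ; rewrite /sa stZ stB stK.
    rewrite -opprB scalerN -scaleNr; congr (_ *: _).
    by apply/eqP; rewrite eq_complex /= oppr0 opprK !eqxx.
  have E : t + st y * y = toC 2 *: (a * a + b * b).
    rewrite /a /b -!scalerAl -!scalerAr !scalerA.
    have -> : toC 2^-1 * 'i%C * (toC 2^-1 * 'i%C) = - (toC 2^-1 * toC 2^-1).
      apply/eqP; rewrite eq_complex /=.
      by rewrite !(mulr0, mul0r, mulr1, subr0, addr0, add0r, sub0r, oppr0) !eqxx.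
    rewrite scaleNr -scalerBr scalerA.
    have -> : (y + st y) * (y + st y) - (y - st y) * (y - st y) = 
        toC 2 *: (t + st y * y).
      rewrite mulrBl !mulrBr mulrDl !mulrDr !opprB /t.
      rewrite [LHS](AC ((2*2)*(2*2)) (((1*8)*(4*6))*((2*3)*(7*5)))) /=.
      by rewrite !addrN !add0r toC2 scalerDl scale1r.
    by rewrite scalerA -!toCM (_ : 2 * (2^-1 * 2^-1) * 2 = 1 :> R) ?scale1r//; lra.
  have -> : t = toC 2 *: (a * a + b * b) + p by rewrite -E yp addrNK.
  by apply: nposD => //; apply: nposZ => //; apply: nposD; exact: npos_sq.
have tX n r : (sc r + t) ^+ n * y = y * (sc r - p) ^+ n.
  elim: n => [|n ih]; first by rewrite mul1r mulr1.
  rewrite exprSr -mulrA mulrDl /t -mulrA yp mulrN scE -scEr.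
  by rewrite -mulrBr mulrA ih -mulrA -exprSr.
pose r := nm p + 1; have r0 : 0 < r by rewrite ltr_wpDl// nm_ge0.
have rp : nm (sc r - p) <= r by apply: npos_normP; rewrite // lerDl.
have tn n : nm ((sc r + t) ^+ n * t) <= r ^+ n * nm y ^+ 2.
  rewrite /t mulrA tX (le_trans (nmM _ _))// nm_st expr2 mulrA ler_wpM2r ?nm_ge0//.
  rewrite (le_trans (nmM _ _))// mulrC ler_wpM2r ?nm_ge0// (le_trans (nmX _ _))//.
  by apply: lerXn2r; rewrite ?nnegrE ?nm_ge0// ltW.
pose t' := toC r^-1 *: t; pose C := r^-1 * nm y ^+ 2.
have st' : sa t' by apply/saZ/npos_sa.
have tE : sc r + t = toC r *: (1 + t').
  by rewrite scalerDr scalerA -toCM mulfV ?gt_eqF// scale1r.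
have tn' n : nm ((1 + t') ^+ n * t') <= C.
  have := tn n; rewrite tE exprZn (_ : t = toC r *: t'); last first.
    by rewrite scalerA -toCM mulfV ?gt_eqF// scale1r.
  rewrite -scalerAl -scalerAr scalerA -rmorphXn -toCM nmZr ger0_norm; last first.
    by rewrite mulr_ge0// ?exprn_ge0// ltW.
  by rewrite -mulrA ler_pM2l ?exprn_gt0// /C mulrC -ler_pdivlMr// mulrC.
have C0 : 0 <= C by rewrite mulr_ge0 ?sqr_ge0// invr_ge0 ltW.
have pE n : (1 + t') ^+ n = 1 + \sum_(i < n) (1 + t') ^+ i * t'.
  elim: n => [|n ih]; first by rewrite big_ord0 addr0.
  by rewrite exprSr mulrDr mulr1 {1}ih big_ord_recr/= addrA.
have pn n : nm ((1 + t') ^+ n) <= 1 + n%:R * C.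
  rewrite pE (le_trans (nmD _ _))// nm1 lerD2l (le_trans (nm_sum _ _ _))//.
  rewrite (@le_trans _ _ (\sum_(i < n) C)) ?ler_sum//.
  by rewrite sumr_const card_ord mulr_natl.
have t1 : nm (1 + t') <= 1.
  have s1 : sa (1 + t') by apply/saD => //; exact: sa1.
  apply: pow2_bound C0 _ => [|k]; first exact: nm_ge0.
  by rewrite -sa_nmX// pn.
have nt' : npos (- t).
  split; first exact/saN/npos_sa.
  exists r; first exact: ltW.
  by rewrite opprK tE nmZr gtr0_norm// ler_piMr// ltW.
have t0 := npos_opp_eq0 nt nt'.
have y0 : y = 0.
  apply: nm0_eq0; apply/eqP; rewrite -sqrf_eq0 -nm_st -nmC stK.
  by rewrite -/t t0 nm0.
by apply: oppr_inj; rewrite -yp y0 mulr0 oppr0.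
Qed.

(** With b = [st x * x], m the square root of b^2 and n = m - b (twice the negative part of b), the
    element x n satisfies [st (x * n) * (x * n)] = n b n = - n^2 m. By [kv_aux] n^2 m = 0, and n^2 =
    2 m n then gives n^3 = 0, so n = 0 and b = m. *)
Lemma npos_kv x : npos (st x * x).
Proof.
pose b := st x * x; have sb : sa b by rewrite /sa stM stK.
have [m [nm_ mm cm]] := npos_sqrt (npos_sq sb).
have smm := npos_sa nm_.
have bm : b * m = m * b by apply: cm; rewrite /GRing.comm mulrA.
pose n := m - b.
have sn : sa n by apply: saB.
have nn : n * n = toC 2 *: (m * n * 1) .
  rewrite /n mulr1 mulrBl !mulrBr mm bm toC2 scalerDl scale1r opprB.
  by [].
have nb : n * b = - (m * n).
  by rewrite /n mulrBl mulrBr mm opprB.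
have mn : GRing.comm m n by rewrite /GRing.comm /n mulrBl mulrBr bm.
have np : npos (n * n * m).
  by apply: npos_comm => //; [exact: npos_sq|apply/commr_sym/commrM].
have y0 : n * n * m = 0.
  apply: (@kv_aux (x * n)) => //.
  rewrite (_ : _ * _ = n * b * n); last by rewrite stM sn /b !mulrA.
  rewrite nb mulNr; congr (- _).
  by rewrite (mn : m * n = n * m) -!mulrA (mn : m * n = n * m).
have n3 : n * n * n = 0.
  rewrite nn mulr1 -scalerAl (_ : m * n * n = 0) ?scaler0//.
  by rewrite (mn : m * n = n * m) -!mulrA (mn : m * n = n * m) mulrA.
have n0 : n = 0.
  have : nm n ^+ 4 = 0.
    have := sa_nmX 2 sn; rewrite (_ : (2 ^ 2)%N = 4%N)// => <-.
    by rewrite (_ : 4 = 3 + 1)%N// exprD expr1 !exprS expr0 mulr1 mulrA n3 mul0r nm0.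
  by move/eqP; rewrite expf_eq0 /= => /eqP /nm0_eq0.
by rewrite -/b (_ : b = m)//; apply/eqP; rewrite eq_sym -subr_eq0 -/n n0.
Qed.

Lemma npos_stM x u : npos u -> npos (st x * u * x).
Proof.
move=> /npos_sqrt[h [/npos_sa sh <- _]].
have -> : st x * (h * h) * x = st (h * x) * (h * x) by rewrite stM sh !mulrA.
exact: npos_kv.
Qed.

End UnitRing.

(** * Polynomial approximation *)

Section Bernstein.
Context (R : realType).
Implicit Types (p q : {poly R}) (f g : R -> R).

Definition bern n k : {poly R} := 'C(n, k)%:R *: ('X ^+ k * (1 - 'X) ^+ (n - k)).

Definition ffr (k j : nat) : R := (k ^_ j)%:R.

Lemma bin_ffactD n i j : (j <= n)%N ->
  ('C(n, i + j) * (i + j) ^_ j = n ^_ j * 'C(n - j, i))%N.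
Proof.
elim: j n => [|j ih] [|n] //; rewrite ?addn0 ?ffactn0 ?muln1 ?mul1n ?subn0//.
rewrite ltnS => jn; rewrite addnS !ffactSS subSS mulnA [('C(_, _) * _)%N]mulnC.
by rewrite -mul_bin_diag /= -!mulnA ih.
Qed.

(** Multiply the binomial expansion of ((1 - X) + X)^(n - j) by X^j: the Bernstein coefficients of a
    monomial are ratios of falling factorials. *)
Lemma bern_ffact n j : (j <= n)%N ->
  'X^j = \sum_(k < n.+1) (ffr k j / ffr n j) *: bern n k.
Proof.
move=> jn; have nj0 : ffr n j != 0 by rewrite pnatr_eq0 -lt0n ffact_gt0.
have := exprDn (1 - 'X : {poly R}) 'X (n - j); rewrite subrK expr1n => E.
rewrite -[LHS]mulr1 E mulr_sumr.
rewrite -(big_mkord xpredT (fun k => (ffr k j / ffr n j) *: bern n k)).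
rewrite (@big_cat_nat _ _ _ j)//= ?(leq_trans jn)//.
rewrite [X in _ = X + _]big1_seq ?add0r; last first.
  move=> k /andP[_]; rewrite mem_index_iota => /andP[_ kj].
  by rewrite /ffr ffact_small// mul0r scale0r.
transitivity (\sum_(0 + j <= i < n.+1) (ffr i j / ffr n j) *: bern n i); last by rewrite add0n.
rewrite big_addn subSn// big_mkord; apply: eq_bigr => i _.
rewrite /bern scalerA -mulrnAr mulrCA -[_ *+ 'C(_, _)]scaler_nat -!scalerAr.
rewrite [(i + j)%N]addnC -subnDA mulrC exprD; congr (_ *: _).
  apply/(mulIf nj0); rewrite mulrAC divfK//.
  by rewrite /ffr -!natrM addnC mulnC -bin_ffactD// mulnC addnC.
Qed.

Lemma bern_sum1 n : \sum_(k < n.+1) bern n k = 1.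
Proof.
rewrite -[RHS](expr0 'X) (@bern_ffact n 0)//; apply: eq_bigr => k _.
by rewrite /ffr !ffactn0 divr1 scale1r.
Qed.

Definition bcoef n p k : R := \sum_(j < size p) p`_j * (ffr k j / ffr n j).

Lemma bern_poly n p : (size p <= n.+1)%N ->
  p = \sum_(k < n.+1) bcoef n p k *: bern n k.
Proof.
move=> pn; rewrite -{1}[p]coefK poly_def.
rewrite (eq_bigr (fun j : 'I_(size p) => \sum_(k < n.+1) 
    (p`_j * (ffr k j / ffr n j)) *: bern n k)) => [|j _].
  by rewrite exchange_big/=; apply: eq_bigr => k _; rewrite scaler_suml.
rewrite {1}(@bern_ffact n j); last by rewrite -ltnS (leq_trans (ltn_ord j)).
by rewrite scaler_sumr; apply: eq_bigr => k _; rewrite scalerA.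
Qed.

Lemma ffr_bound n k j : (k <= n)%N -> (j <= n)%N -> (0 < n)%N ->
  `|ffr k j / ffr n j - (k%:R / n%:R) ^+ j| <= (j * j)%:R / n%:R.
Proof.
move=> kn + n0; have np : 0 < n%:R :> R by rewrite ltr0n.
have b0 : 0 <= k%:R / n%:R :> R by rewrite divr_ge0.
have b1 : k%:R / n%:R <= 1 :> R by rewrite ler_pdivrMr// mul1r ler_nat.
elim: j => [|j ih] jn.
  by rewrite /ffr !ffactn0 divr1 expr0 subrr normr0 divr_ge0.
have njp : 0 < (n - j)%:R :> R by rewrite ltr0n subn_gt0.
pose a : R := (k - j)%:R / (n - j)%:R.
have a0 : 0 <= a by rewrite divr_ge0.
have ab : `|a - k%:R / n%:R| <= j%:R / n%:R.
  have aleb : a <= k%:R / n%:R.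
    rewrite /a ler_pdivrMr// mulrAC ler_pdivlMr// -!natrM ler_nat.
    by rewrite mulnBl mulnBr leq_sub2l// mulnC leq_mul2l kn orbT.
  rewrite ler0_norm ?subr_le0// opprB lerBlDr.
  have [kj|jk] := leqP k j.
    rewrite (@le_trans _ _ (j%:R / n%:R))//; first by rewrite ler_pM2r ?invr_gt0// ler_nat.
    by rewrite lerDl.
  rewrite -lerBlDl -mulrBl -natrB ?(ltnW jk)// /a ler_wpM2l//.
  by rewrite lef_pV2 ?posrE// ler_nat leq_subr.
have a1 : a <= 1 by rewrite /a ler_pdivrMr// mul1r ler_nat leq_sub2r.
have -> : ffr k j.+1 / ffr n j.+1 = ffr k j / ffr n j * a.
  by rewrite /ffr !ffactnSr !natrM invfM mulrACA.
rewrite exprSr; clearbody a.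
have -> : ffr k j / ffr n j * a - (k%:R / n%:R) ^+ j * (k%:R / n%:R) =
   (ffr k j / ffr n j - (k%:R / n%:R) ^+ j) * a + (k%:R / n%:R) ^+ j * (a - k%:R / n%:R).
  by ring.
rewrite (le_trans (ler_normD _ _))// !normrM.
rewrite (@le_trans _ _ ((j * j)%:R / n%:R + j%:R / n%:R))// ?lerD//.
- rewrite -[leRHS]mulr1 ler_pM// ?ih ?(ltnW jn)// ger0_norm//.
- rewrite -[leRHS]mul1r ler_pM// normrX ger0_norm// exprn_ile1//.
- rewrite -mulrDl ler_pM2r ?invr_gt0// -natrD ler_nat -mulSnr leq_mul2l.
  by rewrite leqnSn orbT.
Qed.

(** Ratios of falling factorials differ from powers of k / n by O(1 / n). Hence bounds of p on
    [0, 1] become bounds of its Bernstein coefficients, which is how they reach operators in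
    [ph_norm1]. *)
Lemma bcoef_bound p : exists2 K : R, 0 <= K & forall n k, (size p <= n.+1)%N -> (0 < n)%N ->
  (k <= n)%N -> `|bcoef n p k - p.[k%:R / n%:R]| <= K / n%:R.
Proof.
exists (\sum_(j < size p) `|p`_j| * (j * j)%:R).
  by apply: sumr_ge0 => j _; rewrite mulr_ge0.
move=> n k pn n0 kn; rewrite /bcoef horner_coef -sumrB (le_trans (ler_norm_sum _ _ _))//.
rewrite mulr_suml ler_sum// => j _; rewrite -mulrBr normrM -mulrA ler_wpM2l//.
by apply: ffr_bound; rewrite // -ltnS (leq_trans (ltn_ord j)).
Qed.

Lemma bern_ge0 n k t : 0 <= t <= 1 -> 0 <= (bern n k).[t].
Proof.
move=> /andP[t0 t1]; rewrite /bern hornerZ hornerM hornerXn.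
rewrite horner_exp hornerD hornerN hornerX hornerC.
by rewrite mulr_ge0// mulr_ge0// exprn_ge0// subr_ge0.
Qed.

Lemma bern_moment n j t : (j <= n)%N ->
  \sum_(k < n.+1) ffr k j * (bern n k).[t] = ffr n j * t ^+ j.
Proof.
move=> jn; have nj0 : ffr n j != 0 by rewrite pnatr_eq0 -lt0n ffact_gt0.
have := congr1 (horner^~ t) (bern_ffact jn); rewrite hornerXn horner_sum => ->.
rewrite mulr_sumr; apply: eq_bigr => k _.
rewrite [in RHS](hornerZ (ffr k j / ffr n j)) mulrA.
by rewrite [ffr n j * _]mulrC divfK.
Qed.

Lemma bern_var n t : (1 < n)%N -> 0 <= t <= 1 ->
  \sum_(k < n.+1) (k%:R / n%:R - t) ^+ 2 * (bern n k).[t] <= n%:R^-1.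
Proof.
move=> n1 /andP[t0 t1]; have np : 0 < n%:R :> R by rewrite ltr0n (ltnW n1).
have n0 : n%:R != 0 :> R by rewrite gt_eqF.
have m0 := bern_moment t (leq0n n); have m1 := bern_moment t (ltnW n1).
have m2 := bern_moment t n1.
have -> : \sum_(k < n.+1) (k%:R / n%:R - t) ^+ 2 * (bern n k).[t] =
   n%:R^-1 ^+ 2 * (\sum_(k < n.+1) ffr k 2 * (bern n k).[t])
   + (n%:R^-1 ^+ 2 - 2 * t / n%:R) * (\sum_(k < n.+1) ffr k 1 * (bern n k).[t])
   + t ^+ 2 * (\sum_(k < n.+1) ffr k 0 * (bern n k).[t]).
  rewrite !mulr_sumr -!big_split/=; apply: eq_bigr => k _.
  rewrite /ffr ffactn0 ffactn1 ffactnS ffactn1 natrM.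
  have -> : k%:R * k.-1%:R = k%:R ^+ 2 - k%:R :> R.
    by case: (k : nat) => [|m]; rewrite ?mul0r ?expr0n ?subrr//= -natr1; ring.
  by ring.
rewrite m0 m1 m2 /ffr ffactn0 ffactn1 ffactnS ffactn1 natrM -subn1 natrB ?(ltnW n1)//.
have -> : n%:R^-1 ^+ 2 * (n%:R * (n%:R - 1) * t ^+ 2) +
   (n%:R^-1 ^+ 2 - 2 * t / n%:R) * (n%:R * t ^+ 1) + t ^+ 2 * (1%:R * t ^+ 0) =
   n%:R^-1 * (t * (1 - t)) by field.
by rewrite ler_piMr ?invr_ge0 ?ltW//; nra.
Qed.

Definition lip f := exists2 L : R, 0 <= L &
  forall s t, 0 <= s -> 0 <= t -> `|f s - f t| <= L * `|s - t|.

(** A wider class than [lip], which is not stable under products. All intervals [0, r] are allowed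
    because the calculus is applied to elements of arbitrary norm. *)
Definition appr f := forall r e : R, 0 < r -> 0 < e ->
  exists p, forall t, 0 <= t -> t <= r -> `|p.[t] - f t| <= e.

Lemma lip_appr1 f (e : R) : lip f -> 0 < e ->
  exists p, forall t, 0 <= t -> t <= 1 -> `|p.[t] - f t| <= e.
Proof.
(* Since |s - t| <= h + (s - t)^2 / h, the variance bound 1 / n <= h^2 leaves an error L (h + h),
   which is at most e. *)
move=> [L L0 fL] e0; pose h := e / (2 * (L + 1)).
have L1 : 0 < L + 1 by rewrite ltr_wpDl.
have h0 : 0 < h by rewrite divr_gt0// mulr_gt0.
pose n := (Num.bound (h ^+ 2)^-1).+2.
have q0 : 0 <= (h ^+ 2)^-1 by rewrite invr_ge0 sqr_ge0.
have nP : n%:R^-1 <= h ^+ 2.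
  rewrite -[leRHS]invrK lef_pV2 ?posrE ?invr_gt0 ?exprn_gt0// ?ltr0n//.
  by apply: le_trans (ltW (archi_boundP q0)) _; rewrite ler_nat; exact: leqW (leqnSn _).
exists (\sum_(k < n.+1) f (k%:R / n%:R) *: bern n k) => t t0 t1.
have t01 : 0 <= t <= 1 by rewrite t0.
have s1 : \sum_(k < n.+1) (bern n k).[t] = 1.
  by rewrite -horner_sum bern_sum1 hornerC.
have -> : (\sum_(k < n.+1) f (k%:R / n%:R) *: bern n k).[t] - f t =
   \sum_(k < n.+1) (f (k%:R / n%:R) - f t) * (bern n k).[t].
  rewrite horner_sum -[X in _ - X]mulr1 -s1 mulr_sumr -sumrB; apply: eq_bigr => k _.
  by rewrite hornerZ mulrBl.
apply: (le_trans (ler_norm_sum _ _ _)).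
apply: (@le_trans _ _ (\sum_(k < n.+1) L * (h * (bern n k).[t] +
    h^-1 * ((k%:R / n%:R - t) ^+ 2 * (bern n k).[t])))).
  apply: ler_sum => k _; rewrite normrM (ger0_norm (bern_ge0 _ _ t01)).
  rewrite mulrA -mulrDl mulrA ler_wpM2r ?bern_ge0//.
  apply: (le_trans (fL _ _ _ t0)); first by rewrite divr_ge0.
  rewrite ler_wpM2l//; set x := _ - t; rewrite -[x ^+ 2]real_normK ?num_real//.
  have x0 := normr_ge0 x; move: `|x| x0 => y y0.
  have [yh|hy] := leP y h; first by rewrite (le_trans yh)// lerDl mulr_ge0 ?sqr_ge0 ?invr_ge0 ?ltW.
  rewrite (@le_trans _ _ (h^-1 * y ^+ 2))//; last by rewrite lerDr ltW.
  by rewrite expr2 mulrA ler_peMl// mulrC ler_pdivlMr// mul1r ltW.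
rewrite -mulr_sumr big_split/= -!mulr_sumr s1 mulr1.
have v1 : h^-1 * \sum_(k < n.+1) (k%:R / n%:R - t) ^+ 2 * (bern n k).[t] <= h.
  rewrite ler_pdivrMl// -expr2 (le_trans _ nP)// bern_var//.
have : L * (h + h) <= e.
  rewrite /h; have -> : L * (e / (2 * (L + 1)) + e / (2 * (L + 1))) = e * (L / (L + 1)).
    by field; rewrite gt_eqF.
  by rewrite ler_piMr ?ltW// ltr_pdivrMr// mul1r ltrDl.
by apply: le_trans; rewrite ler_wpM2l// lerD2l.
Qed.

Lemma lip_appr f : lip f -> appr f.
Proof.
move=> [L L0 fL] r e r0 e0.
have [|p pP] := @lip_appr1 (fun t => f (r * t)) e _ e0.
  exists (L * r); first by rewrite mulr_ge0// ltW.
  move=> s t s0 t0; rewrite (le_trans (fL _ _ _ _)) ?mulr_ge0 ?(ltW r0)//.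
  by rewrite -mulrBr normrM (gtr0_norm r0) mulrA.
exists (p \Po (r^-1 *: 'X)) => t t0 tr; rewrite horner_comp !hornerE.
have := pP (r^-1 * t); rewrite mulrA divff ?gt_eqF// mul1r; apply.
  by rewrite mulr_ge0// invr_ge0 ltW.
by rewrite ler_pdivrMl// mulr1.
Qed.

Lemma appr_poly p : appr (horner p).
Proof. by move=> r e _ e0; exists p => t _ _; rewrite subrr normr0 ltW. Qed.

Lemma appr_cst (c : R) : appr (fun=> c).
Proof. by move=> r e _ e0; exists c%:P => t _ _; rewrite hornerC subrr normr0 ltW. Qed.

Lemma appr_id : appr id.
Proof. by move=> r e _ e0; exists 'X => t _ _; rewrite hornerX subrr normr0 ltW. Qed.

Lemma eq_appr f g : (forall t, 0 <= t -> f t = g t) -> appr f -> appr g.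
Proof.
by move=> fg af r e r0 e0; have [p pP] := af r e r0 e0; exists p => t t0 tr; rewrite -fg// pP.
Qed.

Lemma apprD f g : appr f -> appr g -> appr (fun t => f t + g t).
Proof.
move=> af ag r e r0 e0; have e2 := divr_gt0 e0 (ltr0n _ 2).
have [p pP] := af r _ r0 e2; have [q qP] := ag r _ r0 e2.
exists (p + q) => t t0 tr; rewrite hornerD opprD addrACA (le_trans (ler_normD _ _))//.
by rewrite (splitr e) lerD ?pP ?qP.
Qed.

Lemma poly_bound p (r : R) : exists2 B : R, 0 <= B & forall t, 0 <= t -> t <= r -> `|p.[t]| <= B.
Proof.
elim/poly_ind: p => [|p c [B B0 BP]].
  by exists 0 => // t _ _; rewrite horner0 normr0.
exists (B * `|r| + `|c|) => [|t t0 tr]; first by rewrite addr_ge0// mulr_ge0.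
rewrite hornerMXaddC (le_trans (ler_normD _ _))// lerD2r normrM ler_pM ?BP//.
by rewrite ger0_norm// (le_trans tr)// ler_norm.
Qed.

Lemma appr_bound f (r : R) : appr f -> 0 < r -> exists2 B : R, 0 <= B &
  forall t, 0 <= t -> t <= r -> `|f t| <= B.
Proof.
move=> af r0; have [p pP] := af r 1 r0 ltr01; have [B B0 BP] := poly_bound p r.
exists (1 + B) => [|t t0 tr]; first by rewrite addr_ge0.
rewrite -[f t](subrK p.[t]) (le_trans (ler_normD _ _))// lerD ?BP//.
by rewrite distrC pP.
Qed.

Lemma apprM f g : appr f -> appr g -> appr (fun t => f t * g t).
Proof.
move=> af ag r e r0 e0; have [B B0 BP] := appr_bound af r0.
have [D D0 DP] := appr_bound ag r0.
pose d := Num.min 1 (e / (B + D + 1)).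
have s0 : 0 < B + D + 1 by rewrite ltr_wpDl// addr_ge0.
have d0 : 0 < d by rewrite lt_min ltr01 divr_gt0.
have d1 : d <= 1 by rewrite ge_min lexx.
have de : d * (B + D + 1) <= e by rewrite -ler_pdivlMr// ge_min lexx orbT.
have [p pP] := af r _ r0 d0; have [q qP] := ag r _ r0 d0.
exists (p * q) => t t0 tr; rewrite hornerM.
have -> : p.[t] * q.[t] - f t * g t =
  (p.[t] - f t) * (q.[t] - g t) + (p.[t] - f t) * g t + f t * (q.[t] - g t) by ring.
rewrite (le_trans _ de)// (le_trans (ler_normD _ _))//.
rewrite (le_trans (lerD (ler_normD _ _) (lexx _)))// !normrM.
rewrite (_ : d * (B + D + 1) = d * 1 + d * D + B * d); last by ring.
by rewrite !lerD// ler_pM// ?pP ?qP ?BP ?DP// (le_trans (qP _ _ _)).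
Qed.

Lemma apprZ (c : R) f : appr f -> appr (fun t => c * f t).
Proof. by move=> af; exact: apprM (appr_cst c) af. Qed.

Lemma apprB f g : appr f -> appr g -> appr (fun t => f t - g t).
Proof.
by move=> af ag; apply: eq_appr (apprD af (apprZ (-1) ag)) => t _; rewrite mulN1r.
Qed.

Lemma appr_comp f g : appr f -> appr g -> (forall t, 0 <= t -> 0 <= f t) ->
  appr (fun t => g (f t)).
Proof.
move=> af ag f0 r e r0 e0; have [B B0 BP] := appr_bound af r0.
have e2 := divr_gt0 e0 (ltr0n _ 2).
have [q qP] := ag (B + 1) _ (ltr_wpDl B0 ltr01) e2.
have aq : appr (fun t => q.[f t]).
  elim/poly_ind: {qP} q => [|q c ih].
    by apply: eq_appr (appr_cst 0) => t _; rewrite horner0.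
  apply: eq_appr (apprD (apprM ih af) (appr_cst c)) => t _.
  by rewrite hornerMXaddC.
have [p pP] := aq r _ r0 e2; exists p => t t0 tr.
rewrite -(subrKA q.[f t]) (le_trans (ler_normD _ _))// (splitr e) lerD ?pP//.
by rewrite qP ?f0// (le_trans (ler_norm _))// (le_trans (BP _ _ _))// lerDl.
Qed.

End Bernstein.

Section PolyCalc.
Context (R : realType) (U : ucstarAlgType R).
Local Notation toC := (real_complex R).
Implicit Types (u v x : U) (p q : {poly R}).

Definition ph u p : U := horner_alg u (map_poly toC p).

Lemma phD u p q : ph u (p + q) = ph u p + ph u q.
Proof. by rewrite /ph !rmorphD. Qed.
Lemma phM u p q : ph u (p * q) = ph u p * ph u q.
Proof. by rewrite /ph !rmorphM. Qed.
Lemma phX u : ph u 'X = u.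
Proof. by rewrite /ph map_polyX horner_algX. Qed.
Lemma phC u (c : R) : ph u c%:P = sc U c.
Proof. by rewrite /ph map_polyC horner_algC. Qed.
Lemma phZ u (c : R) p : ph u (c *: p) = toC c *: ph u p.
Proof. by rewrite -mul_polyC phM phC scE. Qed.
Lemma ph0 u : ph u 0 = 0.
Proof. by rewrite /ph !rmorph0. Qed.
Lemma ph1 u : ph u 1 = 1.
Proof. by rewrite /ph !rmorph1. Qed.
Lemma phB u p q : ph u (p - q) = ph u p - ph u q.
Proof. by rewrite /ph !rmorphB. Qed.
Lemma phXn u p n : ph u (p ^+ n) = ph u p ^+ n.
Proof. by rewrite /ph !rmorphXn. Qed.
Lemma ph_sum u (I : Type) (s : seq I) (P : pred I) (F : I -> {poly R}) :
  ph u (\sum_(i <- s | P i) F i) = \sum_(i <- s | P i) ph u (F i).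
Proof. by rewrite /ph !rmorph_sum. Qed.
Lemma ph_MXaddC u p (c : R) : ph u (p * 'X + c%:P) = ph u p * u + sc U c.
Proof. by rewrite phD phM phX phC. Qed.

Lemma ph_comm u v p : GRing.comm v u -> GRing.comm v (ph u p).
Proof.
move=> c; elim/poly_ind: p => [|p a ih]; first by rewrite ph0; exact: commr0.
rewrite ph_MXaddC; apply: commrD; first exact: commrM.
by rewrite /GRing.comm scE scEr.
Qed.

Lemma ph_intertw x u v p : x * u = v * x -> x * ph u p = ph v p * x.
Proof.
move=> c; elim/poly_ind: p => [|p a ih]; first by rewrite !ph0 mulr0 mul0r.
by rewrite !ph_MXaddC mulrDr mulrDl scE scEr mulrA ih -!mulrA c.
Qed.

Lemma ph_sa u p : sa u -> sa (ph u p).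
Proof.
move=> su; elim/poly_ind: p => [|p a ih]; first by rewrite ph0; exact: sa0.
rewrite ph_MXaddC; apply: saD (sa_sc _ _); apply: saM => //.
by apply/commr_sym/ph_comm.
Qed.

Lemma ph_comp u p q : ph (ph u p) q = ph u (q \Po p).
Proof.
elim/poly_ind: q => [|q c ih]; first by rewrite comp_poly0 !ph0.
by rewrite ph_MXaddC comp_polyD comp_polyM comp_polyX comp_polyC phD phM phC ih.
Qed.

Lemma npos_pow u n : npos u -> npos (u ^+ n).
Proof.
move=> nu; elim: n => [|n ih]; first exact: npos1.
by rewrite exprS; apply: npos_comm => //; exact: commrX.
Qed.

Lemma npos_one_sub u : npos u -> nm u <= 1 -> npos (1 - u).
Proof.
move=> nu u1; split; first by apply/saB/npos_sa => //; exact: sa1.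
by exists 1 => //; rewrite sc1 subKr.
Qed.

Lemma npos_bern u n k : npos u -> nm u <= 1 -> npos (ph u (bern R n k)).
Proof.
move=> nu u1; rewrite phZ phM !phXn phB phX ph1; apply: nposZ => //.
apply: npos_comm; [exact: npos_pow|apply/npos_pow/npos_one_sub|] => //.
apply: commrX; apply: commr_sym; apply: commrX; apply: commr_sym.
by apply: commrB; [exact: commr1|exact: commr_refl].
Qed.

(** The product of the two commuting positive elements is c^2 - u^2, so u^2 <= c^2 and norms can be
    compared. *)
Lemma nm_le_npos u (c : R) : 0 <= c -> npos (sc U c - u) -> npos (sc U c + u) -> nm u <= c.
Proof.
move=> c0 n1 n2.
have su : sa u.
  by have /npos_sa := n2; rewrite -{2}[u](addKr (sc U c)) => h; apply: saD h; exact/saN/sa_sc.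
have cu : GRing.comm (sc U c) u by rewrite /GRing.comm scE scEr.
have c12 : GRing.comm (sc U c - u) (sc U c + u).
  by apply: commrD; apply/commr_sym/commrB; rewrite // ?commr_refl//; exact: commr_sym.
have := npos_comm n1 n2 c12; rewrite -sub_sqr_comm// => n3.
have := npos_le (npos_sq su) n3; rewrite (sa_nm2 su) expr2 (sa_nm2 (sa_sc _ _)).
by rewrite -expr2 nm_sc ger0_norm// ler_pXn2r// nnegrE ?nm_ge0.
Qed.

(** For large n both c + e - p and c + e + p have nonnegative Bernstein coefficients, and the
    Bernstein polynomials take positive values at u. This norm estimate is what makes the functional
    calculus well defined. *)
Lemma ph_norm1 u p (c : R) : npos u -> nm u <= 1 ->
  (forall t, 0 <= t -> t <= 1 -> `|p.[t]| <= c) -> nm (ph u p) <= c.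
Proof.
move=> nu u1 pc; have c0 : 0 <= c by exact: le_trans (pc 0 (lexx _) ler01).
have [K K0 KP] := bcoef_bound p.
apply/ler_addgt0Pr => e e0.
pose n := maxn (size p) (Num.bound (K / e)).+1.
have n0 : (0 < n)%N by rewrite leq_max orbT.
have np : 0 < n%:R :> R by rewrite ltr0n.
have pn : (size p <= n.+1)%N by rewrite leqW// leq_maxl.
have Kn : K / n%:R <= e.
  rewrite ler_pdivrMr// mulrC -ler_pdivrMr//; have q0 : 0 <= K / e by rewrite divr_ge0// ltW.
  by rewrite (le_trans (ltW (archi_boundP q0)))// ler_nat /n leq_max leqnSn orbT.
have cb k : (k <= n)%N -> `|bcoef n p k| <= c + e.
  move=> kn; rewrite -[bcoef _ _ _](subrK p.[k%:R / n%:R]) (le_trans (ler_normD _ _))//.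
  rewrite addrC lerD//; last exact: le_trans (KP _ _ pn n0 kn) Kn.
  by apply: pc; [rewrite divr_ge0|rewrite ler_pdivrMr// mul1r ler_nat].
have S1 : sc U (c + e) = \sum_(k < n.+1) toC (c + e) *: ph u (bern R n k).
  by rewrite -scaler_sumr -ph_sum bern_sum1 ph1.
rewrite {1}(bern_poly pn) ph_sum; apply: nm_le_npos; first by rewrite addr_ge0// ltW.
  rewrite S1 -sumrB; apply: npos_sum => k _; rewrite phZ -scalerBl -rmorphB.
  apply: nposZ (npos_bern _ _ nu u1); rewrite subr_ge0 (le_trans (ler_norm _))// cb//.
  by rewrite -ltnS.
rewrite S1 -big_split/=; apply: npos_sum => k _; rewrite phZ -scalerDl -rmorphD.
apply: nposZ (npos_bern _ _ nu u1); rewrite -[X in _ + X]opprK subr_ge0.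
by rewrite (le_trans (ler_norm _))// normrN cb// -ltnS.
Qed.

Lemma ph_norm u p (r c : R) : npos u -> nm u <= r -> 
  (forall t, 0 <= t -> t <= r -> `|p.[t]| <= c) -> nm (ph u p) <= c.
Proof.
move=> nu ur pc; have r0 : 0 <= r := le_trans (nm_ge0 u) ur.
move: r0; rewrite le_eqVlt => /orP[/eqP r0|r0].
  have u0 : u = 0 by apply: nm0_eq0; apply/eqP; rewrite eq_le nm_ge0 r0 ur.
  have p0 := pc 0 (lexx _); rewrite -r0 in p0.
  elim/poly_ind: p pc p0 => [|p a _] _ /(_ (lexx _)); first by rewrite horner0 ph0 nm0 normr0.
  by rewrite hornerMXaddC mulr0 add0r ph_MXaddC u0 mulr0 add0r nm_sc.
have -> : u = ph (toC r^-1 *: u) (r *: 'X).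
  by rewrite phZ phX scalerA -toCM divff ?gt_eqF// scale1r.
rewrite ph_comp; apply: ph_norm1.
- by apply: nposZ => //; rewrite invr_ge0 ltW.
- by rewrite nmZr ger0_norm ?invr_ge0 ?(ltW r0)// ler_pdivrMl// mulr1.
- move=> t t0 t1; rewrite horner_comp !hornerE; apply: pc.
    by rewrite mulr_ge0// ltW.
  by rewrite ler_piMr// ltW.
Qed.

End PolyCalc.

(** * Functional calculus of positive elements *)

Section FunCalc.
Context (R : realType) (U : ucstarAlgType R).
Local Notation toC := (real_complex R).
Implicit Types (u v x : U) (p q : {poly R}) (f g : R -> R).

Definition isfc u f c := forall e : R, 0 < e -> exists p,
  (forall t, 0 <= t -> t <= nm u -> `|p.[t] - f t| <= e) /\ nm (ph u p - c) <= e.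

Lemma isfc_approx u f c p (e : R) : npos u -> isfc u f c ->
  (forall t, 0 <= t -> t <= nm u -> `|p.[t] - f t| <= e) -> nm (ph u p - c) <= e.
Proof.
move=> nu fcc pe; apply/ler_addgt0Pr => d d0; have d2 := divr_gt0 d0 (ltr0n _ 2).
have [q [q1 q2]] := fcc _ d2.
rewrite (le_trans (ndistD (ph u q) _ _))// (splitr d) addrA lerD// -phB.
apply: ph_norm (lexx _) _ => // t t0 tr; rewrite hornerD hornerN.
by rewrite -(subrKA (f t)) (le_trans (ler_normD _ _))// lerD ?pe// distrC q1.
Qed.

Fact fc_ex : exists F : U -> (R -> R) -> U, forall u f, npos u -> appr f -> isfc u f (F u f).
Proof.
suff ex u f : npos u -> appr f -> exists c, isfc u f c.
  by exists (fun u f => xget 0 [set c | isfc u f c]) => u f nu /(ex _ _ nu)[c cP]; exact: (xgetPex (0 : U) (ex_intro _ c cP)).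
move=> nu af.
have r0 : 0 < nm u + 1 by rewrite ltr_wpDl// nm_ge0.
have p0 n : 0 < (2^-1 ^+ n.+1 : R) by rewrite exprn_gt0// invr_gt0.
have /choice[p pP] := fun n => af _ _ r0 (p0 n).
have pp n t : 0 <= t -> t <= nm u -> `|(p n).[t] - f t| <= 2^-1 ^+ n.+1.
  by move=> t0 tu; apply: pP => //; rewrite (le_trans tu)// lerDl.
have [|c cP] := nm_complete0 (fun n => ph u (p n)).
  move=> n; rewrite -phB; apply: ph_norm (lexx _) _ => // t t0 tu.
  rewrite hornerD hornerN -(subrKA (f t)) (le_trans (ler_normD _ _))//.
  rewrite [leRHS](_ : _ = 2^-1 ^+ n.+1 + 2^-1 ^+ n.+1); last by rewrite exprS; lra.
  rewrite lerD//; last by rewrite distrC pp.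
  rewrite (le_trans (pp _ _ t0 tu))//.
  by apply: ler_wiXn2l; rewrite ?invr_ge0// ?invf_le1 ?ler1n.
exists c => e e0; have [N NP] := cP _ e0; have [k kP] := half_pow_lt e0.
exists (p (maxn N k)); rewrite NP ?leq_maxl//; split=> // t t0 tu.
rewrite (le_trans (pp _ _ t0 tu))// (le_trans _ (ltW kP))//.
by apply: ler_wiXn2l; rewrite ?invr_ge0// ?invf_le1 ?ler1n// ltnW// ltnS leq_maxr.
Qed.

(* Only meaningful for positive u and f approximable by polynomials on bounded intervals;
   sealed by [cid] so that conversion never unfolds it. *)
Definition fc : U -> (R -> R) -> U := sval (cid fc_ex).

Lemma fcP u f : npos u -> appr f -> isfc u f (fc u f).
Proof. exact: (svalP (cid fc_ex)). Qed.

Lemma fc_approx u f p (r e : R) : npos u -> appr f -> nm u <= r ->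
  (forall t, 0 <= t -> t <= r -> `|p.[t] - f t| <= e) -> nm (ph u p - fc u f) <= e.
Proof.
move=> nu af ur pe; apply: isfc_approx (fcP nu af) _ => // t t0 tu.
by apply: pe => //; exact: le_trans tu ur.
Qed.

Lemma fc_unique u f c : npos u -> appr f -> isfc u f c -> c = fc u f.
Proof.
move=> nu af cP; apply: nm_le_eq => e e0; have e2 := divr_gt0 e0 (ltr0n _ 2).
have [p [p1 p2]] := cP _ e2.
rewrite (le_trans (ndistD (ph u p) _ _))// (splitr e) lerD//; first by rewrite ndistC.
exact: fc_approx (lexx _) p1.
Qed.

Lemma fc_lim u f : npos u -> appr f -> exists F : nat -> {poly R},
  forall e : R, 0 < e -> exists n, nm (ph u (F n) - fc u f) <= e.
Proof.
move=> nu af; have p0 n : 0 < (2^-1 ^+ n : R) by rewrite exprn_gt0// invr_gt0.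
have /choice[p pP] := fun n => fcP nu af (p0 n).
exists p => e e0; have [k kP] := half_pow_lt e0; exists k.
by case: (pP k) => _ /le_trans; apply; exact: ltW.
Qed.

Lemma fc_poly u p : npos u -> fc u (horner p) = ph u p.
Proof.
move=> nu; apply/esym/fc_unique => //; first exact: appr_poly.
by move=> e e0; exists p; rewrite subrr nm0 ltW//; split=> // t _ _; rewrite subrr normr0 ltW.
Qed.

Lemma fc_ext u f g : npos u -> appr f -> appr g ->
  (forall t, 0 <= t -> t <= nm u -> f t = g t) -> fc u f = fc u g.
Proof.
move=> nu af ag fg; apply: fc_unique => // e /(fcP nu af)[p [p1 p2]].
by exists p; split=> // t t0 tu; rewrite -fg// p1.
Qed.

Lemma fc_id u : npos u -> fc u id = u.
Proof.
move=> nu; rewrite -[RHS](phX u) -fc_poly//; apply: fc_ext => //; [exact: appr_id|exact: appr_poly|].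
by move=> t _ _; rewrite hornerX.
Qed.

Lemma fc_cst u (c : R) : npos u -> fc u (fun=> c) = sc U c.
Proof.
move=> nu; rewrite -(phC u) -fc_poly//; apply: fc_ext => //; [exact: appr_cst|exact: appr_poly|].
by move=> t _ _; rewrite hornerC.
Qed.

Lemma fcD u f g : npos u -> appr f -> appr g ->
  fc u (fun t => f t + g t) = fc u f + fc u g.
Proof.
move=> nu af ag; apply/esym/fc_unique => //; first exact: apprD.
move=> e e0; have e2 := divr_gt0 e0 (ltr0n _ 2).
have [p [p1 p2]] := fcP nu af e2; have [q [q1 q2]] := fcP nu ag e2.
exists (p + q); split => [t t0 tu|].
  by rewrite hornerD opprD addrACA (le_trans (ler_normD _ _))// (splitr e) lerD ?p1 ?q1.
by rewrite phD opprD addrACA (le_trans (nmD _ _))// (splitr e) lerD.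
Qed.

Lemma fc_norm u f (c : R) : npos u -> appr f ->
  (forall t, 0 <= t -> t <= nm u -> `|f t| <= c) -> nm (fc u f) <= c.
Proof.
move=> nu af fc_; apply/ler_addgt0Pr => e e0; have e2 := divr_gt0 e0 (ltr0n _ 2).
have [p [p1 p2]] := fcP nu af e2.
rewrite -[fc u f](subKr (ph u p)) (le_trans (nmB _ _))// (splitr e) addrA lerD//.
apply: ph_norm (lexx _) _ => // t t0 tu.
by rewrite -[p.[t]](subrK (f t)) addrC (le_trans (ler_normD _ _))// lerD ?fc_ ?p1.
Qed.

Lemma fcM u f g : npos u -> appr f -> appr g ->
  fc u (fun t => f t * g t) = fc u f * fc u g.
Proof.
move=> nu af ag; apply/esym/fc_unique => //; first exact: apprM.
move=> e e0.
have r0 : 0 < nm u + 1 by rewrite ltr_wpDl// nm_ge0.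
have ru : nm u <= nm u + 1 by rewrite lerDl.
have [B B0 BP] := appr_bound af r0; have [D D0 DP] := appr_bound ag r0.
pose d := Num.min 1 (e / (B + D + 1)).
have s0 : 0 < B + D + 1 by rewrite ltr_wpDl// addr_ge0.
have d0 : 0 < d by rewrite lt_min ltr01 divr_gt0.
have d1 : d <= 1 by rewrite ge_min lexx.
have de : d * (B + D + 1) <= e by rewrite -ler_pdivlMr// ge_min lexx orbT.
have [p [p1 p2]] := fcP nu af d0; have [q [q1 q2]] := fcP nu ag d0.
have E : d * (B + D + 1) = d * 1 + d * D + B * d by ring.
exists (p * q); split => [t t0 tu|].
  have tr : t <= nm u + 1 by exact: le_trans tu ru.
  rewrite hornerM.
  have -> : p.[t] * q.[t] - f t * g t =
    (p.[t] - f t) * (q.[t] - g t) + (p.[t] - f t) * g t + f t * (q.[t] - g t) by ring.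
  rewrite (le_trans _ de)// (le_trans (ler_normD _ _))//.
  rewrite (le_trans (lerD (ler_normD _ _) (lexx _)))// !normrM E.
  by rewrite !lerD// ler_pM// ?p1 ?q1 ?BP ?DP// (le_trans (q1 _ _ _)).
have fB : nm (fc u f) <= B.
  by apply: fc_norm => // t t0 tu; apply: BP => //; exact: le_trans tu ru.
have gD : nm (fc u g) <= D.
  by apply: fc_norm => // t t0 tu; apply: DP => //; exact: le_trans tu ru.
rewrite phM; set P := ph u p; set Q := ph u q; set F := fc u f; set G := fc u g.
have -> : P * Q - F * G = (P - F) * (Q - G) + (P - F) * G + F * (Q - G).
  by rewrite -mulrDr subrK mulrBl mulrBr addrA subrK.
rewrite (le_trans _ de)// (le_trans (nmD _ _))//.
rewrite (le_trans (lerD (nmD _ _) (lexx _)))// E.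
rewrite !lerD// (le_trans (nmM _ _))// ler_pM ?nm_ge0//.
by rewrite (le_trans q2).
Qed.

Lemma fcZ u (c : R) f : npos u -> appr f -> fc u (fun t => c * f t) = toC c *: fc u f.
Proof. by move=> nu af; rewrite fcM ?fc_cst ?scE//; exact: appr_cst. Qed.

Lemma fcB u f g : npos u -> appr f -> appr g ->
  fc u (fun t => f t - g t) = fc u f - fc u g.
Proof.
move=> nu af ag; rewrite (@fc_ext _ _ (fun t => f t + -1 * g t))//.
- by rewrite fcD ?fcZ//; [rewrite rmorphN1 scaleN1r|exact: apprZ].
- exact: apprB.
- by apply: apprD => //; exact: apprZ.
- by move=> t _ _; rewrite mulN1r.
Qed.

Lemma fc_comm u v f : npos u -> appr f -> GRing.comm v u -> GRing.comm v (fc u f).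
Proof.
move=> nu af c; have [F FP] := fc_lim nu af.
by apply: comm_lim FP _ => n; exact: ph_comm.
Qed.

Lemma fc_sa u f : npos u -> appr f -> sa (fc u f).
Proof.
move=> nu af; have [F FP] := fc_lim nu af.
by apply: sa_lim FP _ => n; apply: ph_sa; exact: npos_sa.
Qed.

Lemma fc_npos u f : npos u -> appr f ->
  (forall t, 0 <= t -> t <= nm u -> 0 <= f t) -> npos (fc u f).
Proof.
move=> nu af f0; split; first exact: fc_sa.
have r0 : 0 < nm u + 1 by rewrite ltr_wpDl// nm_ge0.
have [B B0 BP] := appr_bound af r0; exists B => //.
rewrite -(fc_cst B nu) -fcB//; last exact: appr_cst.
apply: fc_norm => //; first exact: apprB (appr_cst _) af.
move=> t t0 tu; have := f0 t t0 tu; have := BP t t0 (le_trans tu _); rewrite lerDl => /(_ ler01).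
move=> h1 h2; have h3 := le_trans (ler_norm _) h1.
by rewrite ger0_norm ?subr_ge0// lerBlDr lerDl.
Qed.

Lemma fc_dist u f g (c : R) : npos u -> appr f -> appr g ->
  (forall t, 0 <= t -> t <= nm u -> `|f t - g t| <= c) -> nm (fc u f - fc u g) <= c.
Proof. by move=> nu af ag h; rewrite -fcB//; apply: fc_norm => //; exact: apprB. Qed.

Lemma fc_comp u f g : npos u -> appr f -> appr g -> (forall t, 0 <= t -> 0 <= f t) ->
  fc (fc u f) g = fc u (fun t => g (f t)).
Proof.
move=> nu af ag f0; have ac := appr_comp af ag f0.
have nf : npos (fc u f) by apply: fc_npos => // t t0 _; exact: f0.
have r0 : 0 < nm u + 1 by rewrite ltr_wpDl// nm_ge0.
have [B B0 BP] := appr_bound af r0.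
have fB : nm (fc u f) <= B.
  by apply: fc_norm => // t t0 tu; apply: BP; rewrite // (le_trans tu)// lerDl.
apply: nm_le_eq => e e0; have e2 := divr_gt0 e0 (ltr0n _ 2).
have [q qP] := ag (B + 1) _ (ltr_wpDl B0 ltr01) e2.
have h1 : nm (ph (fc u f) q - fc (fc u f) g) <= e / 2.
  by apply: fc_approx qP => //; rewrite (le_trans fB)// lerDl.
have aq p : appr (fun t => p.[f t]) by apply: appr_comp (appr_poly p) _.
have E p : ph (fc u f) p = fc u (fun t => p.[f t]).
  elim/poly_ind: p => [|p c ih].
    rewrite ph0 (@fc_ext _ _ (fun=> 0))// ?fc_cst ?sc0//; first exact: appr_cst.
    by move=> t _ _; rewrite horner0.
  rewrite ph_MXaddC ih (@fc_ext _ (fun t => (p * 'X + c%:P).[f t]) (fun t => p.[f t] * f t + c))//.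
  - rewrite fcD ?fcM ?fc_cst//; first exact: apprM.
    exact: appr_cst.
  - by apply: apprD (appr_cst _); exact: apprM.
  - by move=> t _ _; rewrite hornerMXaddC.
have h2 : nm (ph (fc u f) q - fc u (fun t => g (f t))) <= e / 2.
  rewrite E; apply: fc_dist => // t t0 tu; apply: qP; first exact: f0.
  rewrite (le_trans (ler_norm _))// (le_trans (BP _ t0 _)) ?lerDl//.
  by rewrite (le_trans tu)// lerDl.
rewrite (le_trans (ndistD (ph (fc u f) q) _ _))// (splitr e) lerD//.
by rewrite ndistC.
Qed.

Lemma fc_intertw x u v f : npos u -> npos v -> appr f -> x * u = v * x ->
  x * fc u f = fc v f * x.
Proof.
move=> nu nv af c; apply: nm_le_eq => e e0.
have x1 : 0 < 2 * (nm x + 1) by rewrite mulr_gt0// ltr_wpDl// nm_ge0.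
have r0 : 0 < nm u + nm v + 1 by rewrite ltr_wpDl// addr_ge0// nm_ge0.
have d0 := divr_gt0 e0 x1.
have [p pP] := af _ _ r0 d0.
have h1 := fc_approx nu af _ pP; have h2 := fc_approx nv af _ pP.
rewrite (le_trans (ndistD (x * ph u p) _ _))// {2}(ph_intertw p c) -mulrBr -mulrBl.
have h (y : U) : nm y <= e / (2 * (nm x + 1)) -> nm y * nm x <= e / 2.
  move=> ye; rewrite (le_trans (ler_wpM2r (nm_ge0 _) ye))// invfM mulrA.
  rewrite -[leRHS]mulr1 -[X in X <= _]mulrA ler_wpM2l ?divr_ge0 ?(ltW e0)//.
  by rewrite mulrC ler_pdivrMr ?mul1r ?lerDl// ltr_wpDl// nm_ge0.
rewrite (splitr e) lerD// (le_trans (nmM _ _))//.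
  by rewrite mulrC h// ndistC h1// -addrA lerDl addr_ge0 ?nm_ge0.
by rewrite h// h2// addrAC lerDr addr_ge0 ?nm_ge0.
Qed.

End FunCalc.

(** * Cuntz comparison *)

Section TestFunctions.
Context (R : realType).
Implicit Types (s t a b c e : R).

Definition cutf e t : R := Num.max (t - e) 0.
Definition ramp a b t : R := Num.min 1 (Num.max 0 ((t - a) / (b - a))).
Definition resf e t : R := (t + e)^-1.

Lemma cutf_ge0 e t : 0 <= cutf e t. Proof. by rewrite le_max lexx orbT. Qed.
Lemma cutf_lo e t : t <= e -> cutf e t = 0.
Proof. by move=> te; apply/max_idPr; rewrite subr_le0. Qed.
Lemma cutf_hi e t : e <= t -> cutf e t = t - e.
Proof. by move=> te; apply/max_idPl; rewrite subr_ge0. Qed.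

Lemma ramp_ge0 a b t : 0 <= ramp a b t.
Proof. by rewrite le_min ler01 le_max lexx. Qed.
Lemma ramp_le1 a b t : ramp a b t <= 1.
Proof. by rewrite ge_min lexx. Qed.
Lemma ramp_lo a b t : a < b -> t <= a -> ramp a b t = 0.
Proof.
move=> ab ta; rewrite /ramp (max_idPl _) ?min_r//.
by rewrite ler_pdivrMr ?subr_gt0// mul0r subr_le0.
Qed.
Lemma ramp_hi a b t : a < b -> b <= t -> ramp a b t = 1.
Proof.
move=> ab tb; rewrite /ramp min_l// le_max ler_pdivlMr ?subr_gt0// mul1r.
by rewrite lerD2r tb orbT.
Qed.
Lemma ramp_le a b t : a < b -> a <= t -> ramp a b t <= (t - a) / (b - a).
Proof.
move=> ab ta; rewrite /ramp ge_min max_r ?lexx ?orbT//.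
by rewrite divr_ge0 ?subr_ge0// ltW.
Qed.

Lemma lip_cutf e : lip (cutf e).
Proof.
exists 1 => // s t _ _; rewrite mul1r /cutf.
have mx (x y : R) : `|Num.max x 0 - Num.max y 0| <= `|x - y|.
  wlog xy : x y / x <= y => [w|].
    by case/orP: (le_total x y) => /w//; rewrite distrC (distrC y).
  rewrite [leRHS]ler0_norm ?subr_le0// !maxEle.
  by case: (leP x 0) => h; case: (leP y 0) => k; rewrite ler0_norm; lra.
by rewrite (le_trans (mx _ _))// opprB addrA subrK.
Qed.

Lemma lip_ramp a b : a < b -> lip (ramp a b).
Proof.
move=> ab; have d0 : 0 < (b - a)^-1 by rewrite invr_gt0 subr_gt0.
exists (b - a)^-1 => [|s t _ _]; first exact: ltW.
rewrite /ramp; set x := (s - a) / _; set y := (t - a) / _.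
have -> : (b - a)^-1 * `|s - t| = `|x - y|.
  by rewrite /x /y -mulrBl opprB addrA subrK normrM (gtr0_norm d0) mulrC.
move: x y => x y; rewrite /= in x y *; wlog xy : x y / x <= y => [w|].
  by case/orP: (le_total x y) => /w//; rewrite distrC (distrC y).
rewrite [leRHS]ler0_norm ?subr_le0// !minEle !maxEle.
case: (leP 0 x) => h; case: (leP 0 y) => k; rewrite ?ler10;
  (try case: (leP 1 x) => ?); (try case: (leP 1 y) => ?); rewrite ler0_norm; lra.
Qed.

Lemma lip_resf e : 0 < e -> lip (resf e).
Proof.
move=> e0; exists (e^-1 * e^-1) => [|s t s0 t0]; first by rewrite mulr_ge0 ?invr_ge0 ?ltW.
have s1 : 0 < s + e by rewrite ltr_wpDl.
have t1 : 0 < t + e by rewrite ltr_wpDl.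
have -> : resf e s - resf e t = (s + e)^-1 * (t + e)^-1 * (t - s).
  by rewrite /resf; field; rewrite !gt_eqF.
rewrite !normrM (distrC t) ler_wpM2r// ger0_norm ?invr_ge0 ?(ltW s1)//.
rewrite ger0_norm ?invr_ge0 ?(ltW t1)// ler_pM// ?invr_ge0 ?(ltW s1) ?(ltW t1)//.
  by rewrite lef_pV2 ?posrE// lerDr.
by rewrite lef_pV2 ?posrE// lerDr.
Qed.

Lemma appr_cutf e : appr (cutf e). Proof. exact/lip_appr/lip_cutf. Qed.
Lemma appr_ramp a b : a < b -> appr (ramp a b). Proof. by move=> ?; exact/lip_appr/lip_ramp. Qed.
Lemma appr_resf e : 0 < e -> appr (resf e). Proof. by move=> ?; exact/lip_appr/lip_resf. Qed.

End TestFunctions.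

Section Cuntz.
Context (R : realType) (U : ucstarAlgType R).
Local Notation toC := (real_complex R).
Implicit Types (a b c u v w x y z : U).

(** The witness may lie anywhere in the unital algebra; [cle_inB] later moves it into D when b is a
    positive element of D. *)
Definition cle a b := forall e : R, 0 < e -> exists v, nm (v * b * st v - a) <= e.

Lemma cle_refl a : cle a a.
Proof. by move=> e e0; exists 1; rewrite mul1r st1 mulr1 subrr nm0 ltW. Qed.

Lemma cle_conj z b : cle (z * b * st z) b.
Proof. by move=> e e0; exists z; rewrite subrr nm0 ltW. Qed.

Lemma cle_trans b a c : cle a b -> cle b c -> cle a c.
Proof.
move=> ab bc e e0; have e2 := divr_gt0 e0 (ltr0n _ 2).
have [v vP] := ab _ e2.
have k0 : 0 < nm v * nm v + 1 by rewrite ltr_wpDl// mulr_ge0// nm_ge0.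
have [w wP] := bc _ (divr_gt0 e2 k0); exists (v * w).
rewrite (le_trans (ndistD (v * b * st v) _ _))// (splitr e) lerD//.
have -> : v * w * c * st (v * w) - v * b * st v = v * (w * c * st w - b) * st v.
  by rewrite stM mulrBr mulrBl !mulrA.
rewrite (le_trans (nmM _ _))// nm_st (le_trans (ler_wpM2r (nm_ge0 _) (nmM _ _)))//.
rewrite mulrAC (le_trans (ler_wpM2l _ wP))// ?mulr_ge0 ?nm_ge0//.
by rewrite mulrCA ler_piMr ?(ltW e2)// ler_pdivrMr// mul1r lerDl.
Qed.

Lemma cle_lim a b : (forall e : R, 0 < e -> exists2 a', nm (a' - a) <= e & cle a' b) -> cle a b.
Proof.
move=> h e e0; have e2 := divr_gt0 e0 (ltr0n _ 2).
have [a' aa' /(_ _ e2)[v vP]] := h _ e2; exists v.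
by rewrite (le_trans (ndistD a' _ _))// (splitr e) lerD.
Qed.

Lemma cle0 b : cle 0 b.
Proof. by move=> e e0; exists 0; rewrite !mul0r subrr nm0 ltW. Qed.

Lemma cleZ (c : R) a : 0 <= c -> cle (toC c *: a) a.
Proof.
move=> c0; have := cle_conj (sc U (Num.sqrt c)) a.
by rewrite sa_sc scE scEr scalerA -toCM -expr2 sqr_sqrtr.
Qed.

Lemma npos_leN (a : U) (k : R) : npos a -> nm a <= k -> npos (sc U k - a).
Proof.
move=> na ak; split; first by apply/saB/npos_sa => //; exact: sa_sc.
by exists k; [exact: le_trans (nm_ge0 a) ak|rewrite subKr].
Qed.

Lemma npos_conj z b : npos b -> npos (z * b * st z).
Proof. by move=> nb; rewrite -{1}[z]stK; exact: npos_stM. Qed.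

Lemma nm_conj_le z b c : npos b -> npos (c - b) -> nm (z * b * st z) <= nm (z * c * st z).
Proof.
move=> nb ncb; apply: npos_le; first exact: npos_conj.
by rewrite -mulrBl -mulrBr; exact: npos_conj.
Qed.

(** The witness is v = p (y + d)^-1 q with p, q the roots of x, y. Then v y [st v] - x = - p h^2 p,
    where h^2 = 1 - r(y)^2 and r(t) = t / (t + d). The norm of p h^2 p is that of h x h, at most
    that of h y h, and t (1 - r^2) = d r (1 + r) <= 2 d. *)
Lemma cle_le x y : npos x -> npos (y - x) -> cle x y.
Proof.
move=> nx nyx; have ny : npos y by rewrite -(subrK x y); exact: nposD.
have [p [np pp _]] := npos_sqrt nx; have [q [nq qq cq]] := npos_sqrt ny.
have sp := npos_sa np; have sq := npos_sa nq.
move=> e e0; pose d := e / 2; have d0 : 0 < d by rewrite divr_gt0.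
have ar := appr_resf d0; pose g := fc y (resf d).
have cg : GRing.comm g y by apply/commr_sym/fc_comm => //; exact: commr_refl.
have sg : sa g by exact: fc_sa.
pose W t : R := 1 - t * resf d t * (t * resf d t).
have aw : appr W by apply: apprB (appr_cst _) _; do 2! apply: apprM => //; exact: appr_id.
have tr t : 0 <= t -> 0 <= t * resf d t <= 1.
  move=> t0; have td : 0 < t + d by rewrite ltr_wpDl.
  by rewrite divr_ge0 ?(ltW td)//= ler_pdivrMr// mul1r lerDl ltW.
have nw : npos (fc y W).
  apply: fc_npos => // t t0 _; have /andP[h0 h1] := tr t t0.
  by rewrite subr_ge0 mulr_ile1.
have Ew : fc y W = 1 - g * y * y * g.
  rewrite fcB ?fcM ?fc_id ?fc_cst ?sc1//; do ?[exact: appr_cst|exact: appr_id|apply: apprM => //].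
  by rewrite -/g (cg : g * y = y * g) !mulrA.
have [h [nh hh ch]] := npos_sqrt nw; have sh := npos_sa nh.
have chy : h * y = y * h.
  by apply/esym/ch/fc_comm => //; exact: commr_refl.
exists (p * g * q).
have -> : p * g * q * y * st (p * g * q) - x = - (p * h * st (p * h)).
  have qyq : q * y * q = y * y by rewrite -qq !mulrA.
  have -> : p * g * q * y * st (p * g * q) = p * (g * (q * y * q) * g) * p.
    by rewrite !stM sg sp sq !mulrA.
  rewrite qyq (mulrA g y y).
  have -> : g * y * y * g = 1 - h * h by rewrite hh Ew subKr.
  by rewrite stM sh sp mulrBr mulr1 mulrBl pp addrAC subrr add0r !mulrA.
have E1 : nm (p * h * st (p * h)) = nm (h * x * st h).
  rewrite -{1}[p * h]stK nmC nm_st -(nmC (p * h)).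
  by rewrite stM sp sh -pp !mulrA.
rewrite nmN E1 (le_trans (nm_conj_le _ nx nyx))//.
rewrite sh (chy : h * y = y * h) -mulrA hh.
have -> : y * fc y W = fc y (fun t => t * W t).
  by rewrite fcM ?fc_id//; exact: appr_id.
apply: fc_norm => //; first by apply: apprM => //; exact: appr_id.
move=> t t0 _; have /andP[h0 h1] := tr t t0.
have td : 0 < t + d by rewrite ltr_wpDl.
have E : t - t * (t * resf d t) = d * (t * resf d t).
  by rewrite /resf; field; rewrite gt_eqF.
rewrite ger0_norm; last by rewrite mulr_ge0// subr_ge0 mulr_ile1.
rewrite /W; move: (t * resf d t) E h0 h1 => r E h0 h1.
rewrite (_ : t * (1 - r * r) = (t - t * r) * (1 + r)); last by ring.
have ed : e = d * 2 by rewrite /d divfK.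
by rewrite E ed -mulrA ler_pM2l//; nra.
Qed.

(** The witness (a + d)^-1 a^(1/2) turns t into t r^2 with r = t / (t + d), and the defect t - t r^2
    = d r (1 + r) is at most 2 d. *)
Lemma cle_sq a : npos a -> cle a (a * a).
Proof.
move=> na; have [p [np pp cp]] := npos_sqrt na; have sp := npos_sa np.
move=> e e0; pose d := e / 2; have d0 : 0 < d by rewrite divr_gt0.
have ar := appr_resf d0; pose g := fc a (resf d).
have sg : sa g by exact: fc_sa.
have ai := @appr_id R; have a1 := apprM ar ai; have a2 := apprM a1 ai; have a3 := apprM a2 ai.
exists (g * p); rewrite stM sg sp.
have -> : g * p * (a * a) * (p * g) = fc a (fun t => resf d t * t * t * t * resf d t).
  have E2 : p * (a * a) * p = a * a * a by rewrite -pp !mulrA.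
  have -> : g * p * (a * a) * (p * g) = g * (p * (a * a) * p) * g by rewrite !mulrA.
  by rewrite E2 !fcM ?fc_id// -/g !mulrA.
rewrite -{2}(fc_id na); apply: fc_dist => //; first exact: apprM.
move=> t t0 _; have td : 0 < t + d by rewrite ltr_wpDl.
have -> : resf d t * t * t * t * resf d t - t = - (d * (t * resf d t * (1 + t * resf d t))).
  by rewrite /resf; field; rewrite gt_eqF.
have r0 : 0 <= t * resf d t by rewrite divr_ge0// ltW.
have r1 : t * resf d t <= 1 by rewrite ler_pdivrMr// mul1r lerDl ltW.
move: (t * resf d t) r0 r1 => r r0 r1.
rewrite normrN normrM gtr0_norm// ger0_norm ?mulr_ge0 ?addr_ge0//.
have ed : e = d * 2 by rewrite /d divfK.
by rewrite ed ler_pM2l//; nra.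
Qed.

Lemma cle_stC x : cle (st x * x) (x * st x).
Proof.
apply: cle_trans (cle_sq (npos_kv x)) _.
have -> : st x * x * (st x * x) = st x * (x * st x) * st (st x) by rewrite stK !mulrA.
exact: cle_conj.
Qed.

Definition cut (e : R) a := fc a (cutf e).

Lemma npos_cut e a : npos a -> npos (cut e a).
Proof. by move=> na; apply: fc_npos => // [|t _ _]; [exact: appr_cutf|exact: cutf_ge0]. Qed.

Lemma cut_near (e : R) a : npos a -> 0 <= e -> nm (cut e a - a) <= e.
Proof.
move=> na e0; rewrite -{2}(fc_id na); apply: fc_dist => //.
- exact: appr_cutf.
- exact: appr_id.
move=> t t0 _; have [te|et] := leP t e.
  by rewrite cutf_lo// sub0r normrN ger0_norm.
by rewrite cutf_hi ?(ltW et)// addrAC subrr sub0r normrN ger0_norm.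
Qed.

Lemma cut_le (e : R) a : npos a -> 0 <= e -> npos (a - cut e a).
Proof.
move=> na e0; rewrite -{1}(fc_id na) -fcB//; first last.
- exact: appr_cutf.
- exact: appr_id.
apply: fc_npos => //; first by apply: apprB; [exact: appr_id|exact: appr_cutf].
move=> t t0 _; have [te|et] := leP t e; first by rewrite cutf_lo// subr0.
by rewrite cutf_hi ?(ltW et)// opprB addrC subrK.
Qed.

Lemma cut_ge (e : R) a : npos a -> npos (cut e a - (a - sc U e)).
Proof.
move=> na; rewrite -{2}(fc_id na) -(fc_cst e na) -!fcB//; try exact: appr_cst; try exact: appr_id;
  try exact: appr_cutf; last by apply: apprB; [exact: appr_id|exact: appr_cst].
apply: fc_npos => //.
  by apply: apprB; [exact: appr_cutf|apply: apprB; [exact: appr_id|exact: appr_cst]].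
by move=> t t0 _; rewrite subr_ge0 le_max lexx.
Qed.

Lemma cut0 a : npos a -> cut 0 a = a.
Proof.
move=> na; rewrite -[RHS](fc_id na); apply: fc_ext => //.
- exact: appr_cutf.
- exact: appr_id.
by move=> t t0 _; rewrite cutf_hi// subr0.
Qed.

Lemma cut_cut (d e : R) a : npos a -> 0 <= d -> 0 <= e -> cut d (cut e a) = cut (e + d) a.
Proof.
move=> na d0 e0; rewrite /cut fc_comp//; try exact: appr_cutf.
  apply: fc_ext => //; try exact: appr_cutf.
    by apply: appr_comp; [exact: appr_cutf|exact: appr_cutf|move=> t _; exact: cutf_ge0].
  move=> t t0 _; have [te|et] := leP t e.
    by rewrite (cutf_lo te) !cutf_lo// (le_trans te)// lerDl.
  rewrite (cutf_hi (ltW et)); have [h|h] := leP (t - e) d.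
    by rewrite !cutf_lo// addrC -lerBlDr.
  by rewrite !cutf_hi ?(ltW h)// ?opprD ?addrA// addrC -lerBrDr ltW.
by move=> t _; exact: cutf_ge0.
Qed.

Lemma cut_mono (d e : R) a : npos a -> 0 <= d -> d <= e -> cle (cut e a) (cut d a).
Proof.
move=> na d0 de; rewrite -[e](subrK d) addrC -cut_cut ?subr_ge0//.
by apply: cle_le; [apply/npos_cut/npos_cut|apply: cut_le; [exact: npos_cut|rewrite subr_ge0]].
Qed.

Lemma cut_cle (e : R) a : npos a -> 0 <= e -> cle (cut e a) a.
Proof. by move=> na e0; rewrite -{2}(cut0 na); exact: cut_mono. Qed.

(** Rørdam's lemma in order form. Conjugating a - e <= b by a ramp function f of a that vanishes up
    to e gives f (a - e) f <= f b f, and the left side is within d of the cut-down when the ramp has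
    width d. *)
Lemma cle_cut_sub (e : R) a b : npos a -> npos b -> 0 <= e -> npos (b - a + sc U e) ->
  cle (cut e a) b.
Proof.
move=> na nb e0 nba; apply: cle_lim => d d0.
have ed : e < e + d by rewrite ltrDl.
have ar := appr_ramp ed; pose f := fc a (ramp e (e + d)).
have sf : sa f by exact: fc_sa.
pose F t := ramp e (e + d) t * (t - e) * ramp e (e + d) t.
have aF : appr F.
  by apply: apprM => //; apply: apprM => //; apply: apprB; [exact: appr_id|exact: appr_cst].
have EF : fc a F = f * (a - sc U e) * st f.
  rewrite sf !fcM ?fcB ?fc_id ?fc_cst//.
  - exact: appr_id.
  - exact: appr_cst.
  - by apply: apprB; [exact: appr_id|exact: appr_cst].
  - by apply: apprM => //; apply: apprB; [exact: appr_id|exact: appr_cst].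
have nF : npos (fc a F).
  apply: fc_npos => // t t0 _; rewrite /F; have [te|et] := leP t e.
    by rewrite ramp_lo// !mul0r.
  by rewrite !mulr_ge0 ?ramp_ge0// subr_ge0 ltW.
exists (fc a F).
  apply: fc_dist => //; first exact: appr_cutf.
  move=> t t0 _; rewrite /F; have [te|et] := leP t e.
    by rewrite ramp_lo// cutf_lo// !mul0r subrr normr0 ltW.
  rewrite cutf_hi ?(ltW et)//; have [h|h] := leP (e + d) t.
    by rewrite ramp_hi// mul1r mulr1 subrr normr0 ltW.
  have r0 := ramp_ge0 e (e + d) t; have r1 := ramp_le1 e (e + d) t.
  move: (ramp _ _ _) r0 r1 => r r0 r1.
  have s0 : 0 < t - e by rewrite subr_gt0.
  have sd : t - e <= d by rewrite lerBlDr addrC ltW.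
  move: (t - e) s0 sd => s s0 sd.
  rewrite (_ : r * s * r - s = - (s * (1 - r * r))); last by ring.
  have rr : 0 <= 1 - r * r <= 1 by apply/andP; split; nra.
  by rewrite normrN ger0_norm ?mulr_ge0 ?(ltW s0)//; case/andP: rr => *; nra.
apply: cle_trans (cle_conj f b); apply: cle_le => //.
rewrite EF -mulrBl -mulrBr opprB addrCA addrC; exact: npos_conj.
Qed.

Lemma cle_cut_near (e : R) a b : npos a -> npos b -> nm (a - b) <= e -> cle (cut e a) b.
Proof.
move=> na nb ab; have e0 : 0 <= e := le_trans (nm_ge0 _) ab.
apply: cle_cut_sub => //; split.
  by apply: saD (sa_sc _ _); apply: saB; exact: npos_sa.
exists e => //; rewrite opprD addrCA subrr addr0 opprB//.
Qed.

Lemma cle_cutP a b : npos a -> (forall e : R, 0 < e -> cle (cut e a) b) -> cle a b.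
Proof.
move=> na h; apply: cle_lim => e e0; exists (cut e a); last exact: h.
by apply: cut_near => //; exact: ltW.
Qed.

Lemma cle_cut_ex a b (e : R) : npos a -> npos b -> cle a b -> 0 < e ->
  exists2 d : R, 0 < d & cle (cut e a) (cut d b).
Proof.
move=> na nb ab e0; have e2 := divr_gt0 e0 (ltr0n _ 2); have [v vP] := ab _ e2.
have k0 : 0 < nm v * nm v + 1 by rewrite ltr_wpDl// mulr_ge0// nm_ge0.
pose d := e / 2 / (nm v * nm v + 1); have d0 : 0 < d by rewrite divr_gt0.
exists d => //; apply: cle_trans (cle_conj v _).
apply: cle_cut_near => //; first by apply/npos_conj/npos_cut.
rewrite ndistC (le_trans (ndistD (v * b * st v) _ _))// (splitr e) lerD//.
rewrite -mulrBl -mulrBr (le_trans (nmM _ _))// nm_st.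
rewrite (le_trans (ler_wpM2r (nm_ge0 _) (nmM _ _)))// mulrAC.
rewrite (le_trans (ler_wpM2l _ (cut_near nb (ltW d0))))// ?mulr_ge0 ?nm_ge0//.
by rewrite mulrCA ler_piMr ?(ltW e2)// ler_pdivrMr// mul1r lerDl.
Qed.

(** For a contraction z the conjugate of c exceeds the conjugate of [cut d c] by at most d, since d
    (1 - z [st z]) is positive; [cle_cut_sub] then applies. *)
Lemma cut_conj (d : R) z c : npos c -> 0 <= d -> nm z <= 1 ->
  cle (cut d (z * c * st z)) (cut d c).
Proof.
move=> nc d0 z1; apply: cle_trans (cle_conj z _).
apply: cle_cut_sub => //; [exact: npos_conj|exact/npos_conj/npos_cut|].
have -> : z * cut d c * st z - z * c * st z + sc U d =
    z * (cut d c - (c - sc U d)) * st z + toC d *: (1 - z * st z).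
  rewrite !mulrBr !mulrBl scEr -scalerAl scalerBr -/(sc U d) opprB.
  by rewrite [RHS](AC (1*2*2) (1*3*4*(2*5)))/= subrr addr0.
apply: nposD; first by apply: npos_conj; exact: cut_ge.
apply: nposZ => //; apply: npos_one_sub; first by rewrite -{1}[z]stK; exact: npos_kv.
by rewrite -{1}[z]stK nmC nm_st expr_le1 ?nm_ge0.
Qed.

End Cuntz.

(* A reflexive decision procedure for linear identities with real coefficients. *)
Section LmodTac.
Context (R : realType) (U : ucstarAlgType R).
Local Notation toC := (real_complex R).

Inductive lexp := LVar of nat | LZero | LAdd of lexp & lexp | LOpp of lexp
  | LScale of R & lexp.

Fixpoint leval (env : seq U) e : U := match e with
  | LVar i => nth 0 env i
  | LZero => 0
  | LAdd a b => leval env a + leval env b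
  | LOpp a => - leval env a
  | LScale r a => toC r *: leval env a
  end.

Fixpoint lcoef e (i : nat) : R := match e with
  | LVar j => if Nat.eqb i j then 1 else 0
  | LZero => 0
  | LAdd a b => lcoef a i + lcoef b i
  | LOpp a => - lcoef a i
  | LScale r a => r * lcoef a i
  end.

Fixpoint lagree (e1 e2 : lexp) n : Prop :=
  if n is m.+1 then lcoef e1 m = lcoef e2 m /\ lagree e1 e2 m else True.

Lemma leval_coef env e :
  leval env e = \sum_(i < size env) toC (lcoef e i) *: nth 0 env i.
Proof.
elim: e => [j||a iha b ihb|a ih|r a ih] /=.
- have [js|sj] := ltnP j (size env); last first.
    rewrite nth_default// big1// => i _.
    case: (PeanoNat.Nat.eqb_spec i j) => [ij|_]; last by rewrite scale0r.
    by have := ltn_ord i; rewrite ij ltnNge sj.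
  rewrite (bigD1 (Ordinal js))//= PeanoNat.Nat.eqb_refl scale1r big1 ?addr0// => i ij.
  case: (PeanoNat.Nat.eqb_spec i j) => [h|_]; last by rewrite scale0r.
  by move: ij; rewrite -val_eqE/= h eqxx.
- by rewrite big1// => i _; rewrite scale0r.
- by rewrite iha ihb -big_split/=; apply: eq_bigr => i _; rewrite toCD scalerDl.
- by rewrite ih -sumrN; apply: eq_bigr => i _; rewrite rmorphN scaleNr.
- by rewrite ih scaler_sumr; apply: eq_bigr => i _; rewrite scalerA toCM.
Qed.

Lemma leval_eq env e1 e2 : lagree e1 e2 (size env) -> leval env e1 = leval env e2.
Proof.
rewrite !leval_coef; elim: (size env) => [|n ih] /=; first by rewrite !big_ord0.
by move=> [h /ih]; rewrite !big_ord_recr/= h => ->.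
Qed.

End LmodTac.

Ltac lmod_idx x l := lazymatch l with
  | (?y :: ?l')%SEQ => match goal with
    | _ => let _ := match goal with _ => unify x y end in constr:(0%N)
    | _ => let i := lmod_idx x l' in constr:(S i)
    end
  end.
Ltac lmod_add x l := match goal with
  | _ => let i := lmod_idx x l in l
  | _ => constr:((x :: l)%SEQ)
  end.
Ltac lmod_atoms e l := lazymatch e with
  | (?a + ?b)%R => let l1 := lmod_atoms a l in lmod_atoms b l1
  | (- ?a)%R => lmod_atoms a l
  | (0)%R => l
  | (real_complex _ ?r *: ?a)%R => lmod_atoms a l
  | _ => lmod_add e l
  end.
Ltac lmod_reify R l e := lazymatch e with
  | (?a + ?b)%R => let x := lmod_reify R l a in let y := lmod_reify R l b in constr:(LAdd x y)
  | (- ?a)%R => let x := lmod_reify R l a in constr:(LOpp x)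
  | (0)%R => constr:(LZero R)
  | (real_complex _ ?r *: ?a)%R => let x := lmod_reify R l a in constr:(LScale r x)
  | _ => let i := lmod_idx e l in constr:(LVar R i)
  end.
Ltac lmod_field := first [ring | by field | by field; rewrite ?gt_eqF | idtac].
Ltac lmod := try unfold sc; lazymatch goal with |- @eq ?T ?x ?y =>
  match T with context [?U] =>
  lazymatch type of U with UCStarAlgebra.type ?R =>
  let l := constr:(@nil (UCStarAlgebra.sort U)) in
  let l := lmod_atoms x l in let l := lmod_atoms y l in
  let a := lmod_reify R l x in let b := lmod_reify R l y in
  refine (@leval_eq R U l a b _); cbn [lagree lcoef Nat.eqb size];
  repeat split; lmod_field end end end.

(** * Orthogonal complements of a subordinate element *)

Section Complement.
Context (R : realType) (U : ucstarAlgType R).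
Local Notation toC := (real_complex R).
Implicit Types (a b c u v w x y z : U).

Lemma cle_fc_le a (f g : R -> R) (K : R) : npos a -> appr f -> appr g -> 0 <= K ->
  (forall t, 0 <= t -> t <= nm a -> 0 <= f t) ->
  (forall t, 0 <= t -> t <= nm a -> f t <= K * g t) -> cle (fc a f) (fc a g).
Proof.
move=> na af ag K0 f0 fg; have aK := apprZ K ag.
apply: cle_trans (cleZ (fc a g) K0); rewrite -fcZ//; apply: cle_le.
  exact: fc_npos.
rewrite -fcB//; apply: fc_npos => //; first exact: apprB.
by move=> t t0 ta; rewrite subr_ge0 fg.
Qed.

(** Replaces a polar decomposition: z = x (S - c)_+ has [st z * z] = f(S) and [z * st z] = f(T) with
    f(t) = t (t - c)_+^2, so f(S) and f(T) are comparable. On the support of f one has t >= c, which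
    links f(S) to the cut-down of S; the bound t <= |T| links f(T) to that of T. *)
Lemma cut_stC (c : R) x : 0 < c -> cle (cut c (st x * x)) (cut c (x * st x)).
Proof.
move=> c0; set S := st x * x; set T := x * st x.
have nS : npos S := npos_kv x.
have nT : npos T by rewrite /T -{1}[x]stK; exact: npos_kv.
have ac := @appr_cutf R c; have ai := @appr_id R.
pose f t := cutf c t * t * cutf c t.
have af : appr f by apply: apprM => //; exact: apprM.
have sfS := fc_sa nS ac; have sfT := fc_sa nT ac.
have E1 : fc S f = st (x * fc S (cutf c)) * (x * fc S (cutf c)).
  by rewrite !fcM ?fc_id//; [rewrite stM sfS /S !mulrA|exact: apprM].
have E2 : fc T f = x * fc S (cutf c) * st (x * fc S (cutf c)).
  rewrite !fcM ?fc_id//; last exact: apprM.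
  by rewrite (fc_intertw nS nT ac) ?stM ?sfT ?/T ?mulrA.
apply: (@cle_trans _ _ (fc S f)); last apply: (@cle_trans _ _ (fc T f)).
- apply: (@cle_trans _ _ (cut c S * cut c S)); first exact/cle_sq/npos_cut.
  rewrite /cut -fcM//; apply: (@cle_fc_le _ _ _ c^-1) => //.
  + exact: apprM.
  + by rewrite invr_ge0 ltW.
  + by move=> t _ _; rewrite mulr_ge0 ?cutf_ge0.
  + move=> t t0 _; rewrite /f; have [tc|ct] := leP t c; first by rewrite cutf_lo// !mul0r mulr0.
    rewrite mulrCA -!mulrA ler_wpM2l ?cutf_ge0// mulrA ler_peMl ?cutf_ge0//.
    by rewrite ler_pdivlMr// mul1r ltW.
- by rewrite E1 E2; exact: cle_stC.
- have B0 := ler_wpDl (nm_ge0 T) (ler01 (R:=R)).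
  apply: (@cle_fc_le _ _ _ (nm T * nm T)) => //.
  + by rewrite mulr_ge0// nm_ge0.
  + by move=> t t0 _; rewrite !mulr_ge0 ?cutf_ge0.
  + move=> t t0 tT; rewrite /f ler_wpM2r ?cutf_ge0// ler_pM ?cutf_ge0//.
    have [tc|ct] := leP t c; first by rewrite cutf_lo ?nm_ge0.
    by rewrite cutf_hi ?(ltW ct)// lerBlDr (le_trans tT)// lerDl ltW.
Qed.

(** The elements [fc y (ramp 0 t)] form an approximate unit of the hereditary subalgebra generated
    by y, and the compression of k by one of them lies below a multiple of y. *)
Lemma cle_her k y : npos k -> npos y ->
  (forall e : R, 0 < e -> exists2 t : R, 0 < t & nm ((1 - fc y (ramp 0 t)) * k) <= e) ->
  cle k y.
Proof.
move=> nk ny h; apply: cle_lim => e e0.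
have [t t0 kP] := h _ (divr_gt0 e0 (ltr0n _ 2)).
have ar := appr_ramp t0; pose r := fc y (ramp 0 t).
have sr : sa r by exact: fc_sa.
have r1 : nm r <= 1.
  by apply: fc_norm => // s _ _; rewrite ger0_norm ?ramp_ge0 ?ramp_le1.
exists (r * k * st r).
  have -> : r * k * st r - k = - (r * st ((1 - r) * k) + (1 - r) * k).
    rewrite stM stB st1 sr (npos_sa nk) mulrBr mulr1 mulrBl mul1r mulrBr.
    by rewrite opprD !opprB addrA subrK mulrA.
  rewrite nmN (le_trans (nmD _ _))// (splitr e) lerD//.
  rewrite (le_trans (nmM _ _))// nm_st -[leRHS]mul1r ler_pM ?nm_ge0//.
apply: (@cle_trans _ _ (toC (nm k) *: (r * r))).
  apply: cle_le; first exact: npos_conj.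
  have -> : toC (nm k) *: (r * r) - r * k * st r = r * (sc U (nm k) - k) * st r.
    by rewrite sr mulrBr mulrBl scEr -scalerAl.
  by apply: npos_conj; exact: npos_leN.
apply: cle_trans (cleZ _ (nm_ge0 _)) _; rewrite -fcM// -{2}(fc_id ny).
apply: (@cle_fc_le _ _ _ t^-1) => //.
- exact: apprM.
- exact: appr_id.
- by rewrite invr_ge0 ltW.
- by move=> s _ _; rewrite mulr_ge0 ?ramp_ge0.
- move=> s s0 _; have := ramp_le t0 s0; rewrite !subr0 mulrC.
  by apply: le_trans; rewrite ler_piMl ?ramp_ge0 ?ramp_le1.
Qed.

Lemma ramp_abs y h (t : R) : npos y -> 0 < t -> sa h -> h * h = y ->
  nm ((1 - fc y (ramp 0 t)) * h) ^+ 2 <= t.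
Proof.
move=> ny t0 sh hh; have ar := appr_ramp t0; pose r := fc y (ramp 0 t).
have sr : sa r by exact: fc_sa.
rewrite -nm_st -nmC stK stM sh stB st1 sr.
have -> : (1 - r) * h * (h * (1 - r)) = (1 - r) * y * (1 - r) by rewrite -hh !mulrA.
have a1 : appr (fun s => 1 - ramp 0 t s) by apply: apprB => //; exact: appr_cst.
have -> : 1 - r = fc y (fun s => 1 - ramp 0 t s).
  by rewrite fcB ?fc_cst ?sc1//; exact: appr_cst.
rewrite -{2}(fc_id ny) -!fcM//; try exact: appr_id; last by apply: apprM => //; exact: appr_id.
apply: fc_norm => //; first by apply: apprM => //; apply: apprM => //; exact: appr_id.
move=> s s0 _; have r0 := ramp_ge0 0 t s; have r1 := ramp_le1 0 t s.
have [st|ts] := leP s t; last by rewrite ramp_hi ?(ltW ts)// subrr !mul0r normr0 ltW.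
move: (ramp _ _ _) r0 r1 => p p0 p1; rewrite ger0_norm ?mulr_ge0 ?subr_ge0//.
by rewrite (le_trans _ st)// mulrAC ler_piMl// mulr_ile1 ?subr_ge0// gerBl.
Qed.

Lemma nm_sq_le x y (c : R) : npos (toC c *: (y * st y) - x * st x) -> 0 <= c ->
  forall z, nm (z * x) <= (1 + c) * nm (z * y).
Proof.
move=> n c0 z.
have h u : nm (z * u) ^+ 2 = nm (z * (u * st u) * st z).
  by rewrite -nm_st -nmC stK stM !mulrA.
have nx u : npos (u * st u) by rewrite -{1}[u]stK; exact: npos_kv.
have c1 : 0 <= 1 + c by rewrite addr_ge0.
rewrite -(@ler_pXn2r _ 2)// ?nnegrE ?mulr_ge0 ?nm_ge0// exprMn.
apply: (@le_trans _ _ (c * nm (z * y) ^+ 2)).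
  rewrite !h (le_trans (nm_conj_le z (nx x) n))//.
  by rewrite -scalerAr -scalerAl nmZr ger0_norm.
by rewrite ler_wpM2r ?sqr_ge0//; nra.
Qed.

(** Young's inequality for the cross terms, read off from the positivity of the conjugate of y by a
    / k - k b. *)
Lemma npos_quad a b y (k : R) : npos y -> k != 0 ->
  npos (toC (1 + k ^- 2) *: (a * y * st a) + toC (1 + k ^+ 2) *: (b * y * st b)
        - (a + b) * y * st (a + b)).
Proof.
move=> ny k0; have := npos_conj (toC k^-1 *: a - toC k *: b) ny.
congr npos; rewrite stB !stZr stD !(mulrDl, mulrBl, mulrDr, mulrBr, mulNr, mulrN).
rewrite -!scalerAr -!scalerAl; lmod.
Qed.

(** If v y [st v] is close to w, then x = y^(1/2) [st v] gives S = [st x * x] close to w and T =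
    [x * st x] below a multiple of y. The part s is a cut-down of T. A ramp g of T acts as a unit on
    s, so d = (1 - g) y (1 - g) is orthogonal to s, and g y g lies below w because g lives on a
    cut-down of T. [npos_quad] bounds y by (1 + eta^-1) g y g + (1 + eta) d; keeping the coefficient
    of d near 1 lets cut-downs of y be controlled by cut-downs of d. *)
Lemma complement w y (delta eta : R) : npos w -> npos y -> cle w y -> 0 < delta -> 0 < eta ->
  exists s d E, [/\ npos s, npos d, s * d = 0, cle (cut delta w) s & cle (s + d) y] /\
   [/\ npos E, cle E w, npos (E + toC (1 + eta) *: d - y) &
       forall g : R, 0 <= g -> cle (cut g d) (cut g y)].
Proof.
(* One e for the distance of [v * y * st v] from w, two for the cut of T. *)
move=> nw ny wy delta0 eta0; pose e := delta / 3; have e0 : 0 < e by rewrite divr_gt0.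
have [v vP] := wy _ e0.
have [h [nh hh ch]] := npos_sqrt ny; have sh := npos_sa nh.
pose x := h * st v; pose S := st x * x; pose T := x * st x.
have ES : S = v * y * st v by rewrite /S /x stM stK sh -hh !mulrA.
have nS : npos S := npos_kv x.
have nT : npos T by rewrite /T -{1}[x]stK; exact: npos_kv.
have ee : e < e + e by rewrite ltrDl.
have ar := appr_ramp ee; pose g := fc T (ramp e (e + e)).
have sg : sa g by exact: fc_sa.
have ng : npos g by apply: fc_npos => // t _ _; exact: ramp_ge0.
have g1 : nm g <= 1.
  by apply: fc_norm => // t _ _; rewrite ger0_norm ?ramp_ge0 ?ramp_le1.
have ac := @appr_cutf R (e + e); pose s := cut (e + e) T.
have ns : npos s by exact: npos_cut.
pose d := (1 - g) * y * st (1 - g).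
have nd : npos d by exact: npos_conj.
have s1g : sa (1 - g) by apply: saB => //; exact: sa1.
have sg1 : s * (1 - g) = 0.
  have a1 : appr (fun t => 1 - ramp e (e + e) t) by apply: apprB => //; exact: appr_cst.
  have -> : 1 - g = fc T (fun t => 1 - ramp e (e + e) t).
    by rewrite fcB ?fc_cst ?sc1//; exact: appr_cst.
  rewrite -fcM// -(sc0 U) -(fc_cst 0 nT); apply: fc_ext => //; [exact: apprM|exact: appr_cst|].
  move=> t _ _; have [h1|h1] := leP t (e + e); first by rewrite cutf_lo// mul0r.
  by rewrite ramp_hi ?(ltW h1)// subrr mulr0.
have gcut : cle g (cut e T).
  apply: (@cle_fc_le _ _ _ e^-1) => //; first exact: appr_cutf.
  - by rewrite invr_ge0 ltW.
  - by move=> t _ _; exact: ramp_ge0.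
  - move=> t _ _; have [te|et] := leP t e; first by rewrite ramp_lo ?cutf_lo ?mulr0.
    by rewrite cutf_hi ?(ltW et)// (le_trans (ramp_le ee (ltW et)))// addrK mulrC.
have cutTS (c : R) : 0 < c -> cle (cut c T) (cut c S).
  by move=> c0; have := cut_stC (st x) c0; rewrite stK.
pose M := nm v ^+ 2; have M0 : 0 <= M by exact: sqr_ge0.
have TM : npos (toC M *: y - T).
  have -> : toC M *: y - T = h * (sc U M - st v * v) * st h.
    by rewrite sh mulrBr mulrBl scEr -scalerAl hh /T /x stM stK sh !mulrA.
  by apply: npos_conj; apply: npos_leN; [exact: npos_kv|rewrite nmC].
exists s, d, (toC (1 + eta^-1) *: (g * y * st g)); split; split => //.
- by rewrite /d !mulrA sg1 !mul0r.
- apply: (@cle_trans _ _ (cut (e + e) S)); last by apply: cut_stC; rewrite addr_gt0.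
  apply: cle_cut_sub => //; [exact: npos_cut|exact: ltW|].
  have -> : cut (e + e) S - w + sc U delta =
      (cut (e + e) S - (S - sc U (e + e))) + (sc U e - (w - S)).
    by rewrite /e; lmod.
  apply: nposD; first exact: cut_ge.
  split; first by apply: saB (sa_sc _ _) _; apply: saB; exact: npos_sa.
  by exists e; rewrite ?(ltW e0)// subKr ndistC ES.
(* The norm of z (s + d) is at most K times that of z h, uniformly in z. With z = 1 -
   [fc y (ramp 0 t)] this places s + d in the hereditary subalgebra generated by y. *)
- have [r [nr rr _]] := npos_sqrt ns; have sr := npos_sa nr.
  pose q := (1 - g) * h.
  have dq : d = q * st q by rewrite /d -hh /q stM sh !mulrA.
  pose Mg := e^-1 * M; have Mg0 : 0 <= Mg by rewrite mulr_ge0// invr_ge0 ltW.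
  have bs z : nm (z * r) <= (1 + M) * nm (z * h).
    apply: nm_sq_le => //; rewrite sr sh hh rr -(subrKA T).
    by apply: nposD => //; apply: cut_le => //; rewrite addr_ge0// ltW.
  have bg z : nm (z * g) <= (1 + Mg) * nm (z * h).
    apply: nm_sq_le => //; rewrite sg sh hh -[_ - _](subrKA (toC e^-1 *: T)).
    apply: nposD.
      rewrite /Mg toCM -scalerA -scalerBr; apply: nposZ => //.
      by rewrite invr_ge0 ltW.
    rewrite /g -fcM// -{1}(fc_id nT) -fcZ//; last exact: appr_id.
    rewrite -fcB//; last 2 first.
    + by apply: apprZ; exact: appr_id.
    + exact: apprM.
    apply: fc_npos => //.
      by apply: apprB; [apply: apprZ; exact: appr_id|exact: apprM].
    move=> t t0 _; rewrite subr_ge0; have r0 := ramp_ge0 e (e + e) t.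
    have r1 := ramp_le1 e (e + e) t; rewrite (@le_trans _ _ (ramp e (e + e) t))//.
      by rewrite ler_piMl.
    have [te|et] := leP t e.
      by rewrite ramp_lo// mulr_ge0// invr_ge0 ltW.
    rewrite (le_trans (ramp_le ee (ltW et)))// addrK mulrC ler_wpM2l ?invr_ge0 ?(ltW e0)//.
    by rewrite gerBl ltW.
  pose K := (1 + M) * nm r + (1 + (1 + Mg) * nm h) * nm q.
  have K0 : 0 <= K by rewrite addr_ge0// mulr_ge0 ?nm_ge0// addr_ge0// mulr_ge0 ?nm_ge0// addr_ge0.
  have bk z : nm (z * (s + d)) <= K * nm (z * h).
    have -> : z * (s + d) = z * r * r + (z * h - z * g * h) * st q.
      rewrite mulrDr -(mulrA z r r) rr dq mulrA; congr (_ + _ * _).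
      by rewrite /q mulrBl mul1r mulrBr mulrA.
    have h1 : nm (z * r * r) <= (1 + M) * nm r * nm (z * h).
      by rewrite (le_trans (nmM _ _))// mulrAC ler_wpM2r ?nm_ge0.
    have h2 : nm ((z * h - z * g * h) * st q) <= (1 + (1 + Mg) * nm h) * nm q * nm (z * h).
      rewrite (le_trans (nmM _ _))// nm_st mulrAC ler_wpM2r ?nm_ge0//.
      rewrite (le_trans (nmB _ _))// mulrDl mul1r lerD2l (le_trans (nmM _ _))//.
      by rewrite mulrAC ler_wpM2r ?nm_ge0.
    by apply: (le_trans (nmD _ _)); rewrite (le_trans (lerD h1 h2))// -mulrDl.
  apply: cle_her => //; first exact: nposD.
  move=> c c0; have t0 : 0 < c / (K + 1) by rewrite divr_gt0// ltr_wpDl.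
  exists ((c / (K + 1)) ^+ 2); first by rewrite exprn_gt0.
  rewrite (le_trans (bk _))//.
  have := ramp_abs ny (exprn_gt0 2 t0) sh hh; rewrite ler_pXn2r ?nnegrE ?nm_ge0 ?(ltW t0)//.
  move=> h1; rewrite (le_trans (ler_wpM2l K0 h1))// mulrCA ler_piMr ?(ltW c0)//.
  by rewrite ler_pdivrMr ?ltr_wpDl// mul1r lerDl.
- apply: nposZ; last exact: npos_conj.
  by rewrite addr_ge0// invr_ge0 ltW.
- apply: cle_trans (cleZ _ _) _; first by rewrite addr_ge0// invr_ge0 ltW.
  apply: (@cle_trans _ _ g); last first.
    apply: cle_trans gcut _; apply: cle_trans (cutTS _ e0) _.
    by apply: cle_cut_near => //; rewrite ES.
  apply: (@cle_trans _ _ (toC (nm y) *: (g * g))).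
    apply: cle_le; first exact: npos_conj.
    have -> : toC (nm y) *: (g * g) - g * y * st g = g * (sc U (nm y) - y) * st g.
      by rewrite sg mulrBr mulrBl scEr -scalerAl.
    by apply: npos_conj; exact: npos_leN.
  apply: cle_trans (cleZ _ (nm_ge0 _)) _.
  rewrite /g -fcM//; apply: (@cle_fc_le _ _ _ 1) => //; first exact: apprM.
  + by move=> t _ _; rewrite mulr_ge0 ?ramp_ge0.
  + by move=> t _ _; rewrite mul1r ler_piMl ?ramp_ge0 ?ramp_le1.
- have k0 : Num.sqrt eta != 0 by rewrite gt_eqF// sqrtr_gt0.
  have := npos_quad g (1 - g) ny k0.
  by rewrite [g + (1 - g)]addrC subrK st1 mulr1 mul1r sqr_sqrtr ?(ltW eta0).
- move=> c c0; apply: cut_conj => //.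
  have -> : 1 - g = fc T (fun t => 1 - ramp e (e + e) t).
    by rewrite fcB ?fc_cst ?sc1//; exact: appr_cst.
  apply: fc_norm => //; first by apply: apprB => //; exact: appr_cst.
  move=> t _ _; have := ramp_ge0 e (e + e) t; have := ramp_le1 e (e + e) t.
  by move=> r1 r0; rewrite ger0_norm ?subr_ge0// gerBl.
Qed.

End Complement.

(** * Matrices over a C*-algebra and the stabilization *)

Section Inj.
Context (R : realType) (B : cstarAlgType R).
Local Notation toC := (real_complex R).
Implicit Types (a b c x y : B).

Definition inj b : unitz B := (b, 0).

Lemma injD a b : inj (a + b) = inj a + inj b.
Proof. by congr pair; rewrite addr0. Qed.
Lemma injN a : inj (- a) = - inj a.
Proof. by congr pair; rewrite oppr0. Qed.
Lemma injB a b : inj (a - b) = inj a - inj b.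
Proof. by rewrite injD injN. Qed.
Lemma inj0 : inj 0 = 0.
Proof. by []. Qed.
Lemma injZ (k : R[i]) a : inj (k *: a) = k *: inj a.
Proof. by rewrite /inj -[RHS]/(k *: a, k * 0) mulr0. Qed.
Lemma injM a b : inj (cmul a b) = inj a * inj b.
Proof. by congr pair; rewrite /= ?scale0r ?add0r ?mulr0. Qed.
Lemma inj_st a : inj (cstar a) = st (inj a).
Proof. by congr pair; rewrite conjc0. Qed.
Lemma inj_sum (I : Type) (s : seq I) (P : pred I) (F : I -> B) :
  inj (\sum_(i <- s | P i) F i) = \sum_(i <- s | P i) inj (F i).
Proof. by apply: (big_morph _ injD). Qed.
Lemma inj_inj a b : inj a = inj b -> a = b.
Proof. by case. Qed.

Lemma nm_inj a : nm (inj a) = rnorm a.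
Proof.
apply/eqP; rewrite eq_le; apply/andP; split.
  by rewrite (le_trans (unorm_le1 _))//= expr0n/= addr0 sqrtr0 add0r.
by have := unorm1_le (inj a); rewrite /= expr0n/= addr0 sqrtr0 add0r.
Qed.

Definition inB (u : unitz B) := u.2 = 0.

Lemma inBP u : inB u -> u = inj u.1.
Proof. by case: u => a l; rewrite /inB /= => ->. Qed.
Lemma inB_inj a : inB (inj a). Proof. by []. Qed.
Lemma inB_mulr u v : inB u -> inB (u * v).
Proof. by rewrite /inB => u0; rewrite -[LHS]/(u.2 * v.2) u0 mul0r. Qed.
Lemma inB_mull u v : inB v -> inB (u * v).
Proof. by rewrite /inB => u0; rewrite -[LHS]/(u.2 * v.2) u0 mulr0. Qed.
Lemma inB_st u : inB u -> inB (st u).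
Proof. by rewrite /inB => u0; rewrite -[LHS]/(conjc u.2) u0 conjc0. Qed.
Lemma inBD u v : inB u -> inB v -> inB (u + v).
Proof. by rewrite /inB => u0 v0; rewrite -[LHS]/(u.2 + v.2) u0 v0 addr0. Qed.
Lemma inBZ (k : R[i]) u : inB u -> inB (k *: u).
Proof. by rewrite /inB => u0; rewrite -[LHS]/(k * u.2) u0 mulr0. Qed.
Lemma inBN u : inB u -> inB (- u).
Proof. by rewrite -scaleN1r; exact: inBZ. Qed.
Lemma inB_lim u : (forall e : R, 0 < e -> exists2 v, inB v & nm (v - u) <= e) -> inB u.
Proof.
move=> h; apply/eqP; rewrite -normr_eq0 -normCReK.
suff -> : complex.Re `|u.2| = 0 by [].
apply/eqP; rewrite eq_le normCRe_ge0 andbT; apply/ler_addgt0Pr => e /h[v v0 vu].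
rewrite add0r (le_trans _ vu)//; apply: le_trans (unorm2 (v - u)).
by rewrite -[(v - u).2]/(v.2 - u.2) v0 sub0r normrN.
Qed.

Lemma inB_fc u (f : R -> R) : inB u -> npos u -> appr f -> f 0 = 0 -> inB (fc u f).
Proof.
move=> u0 nu af f0; apply: inB_lim => e e0; have e2 := divr_gt0 e0 (ltr0n _ 2).
have [p [p1 p2]] := fcP nu af e2; exists (ph u (p - (p.[0])%:P)).
  have [q ->] : exists q, p - (p.[0])%:P = q * 'X.
    elim/poly_ind: (p) => [|q c _]; first by exists 0; rewrite horner0 mul0r subrr.
    by exists q; rewrite hornerMXaddC mulr0 add0r addrK.
  by rewrite phM phX; exact: inB_mull.
rewrite phB phC addrAC (le_trans (nmB _ _))// (splitr e) lerD// nm_sc.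
by have := p1 0 (lexx _) (nm_ge0 _); rewrite f0 subr0.
Qed.

Definition pos a := npos (inj a).

Lemma posP a : pos a <-> exists x, a = cmul (cstar x) x.
Proof.
split=> [na|[x ->]]; last by rewrite /pos injM inj_st; exact: npos_kv.
have [h [nh hh _]] := npos_sqrt na; exists h.1; apply: inj_inj.
have h0 : inB h.
  have /eqP : h.2 * h.2 = 0 by have := congr1 snd hh.
  by rewrite mulf_eq0 orbb => /eqP.
by rewrite injM inj_st -(inBP h0) (npos_sa nh) hh.
Qed.

End Inj.

Lemma cs_aux (R : realType) (U : ucstarAlgType R) (X W P : U) (A : R) :
  X - real_complex R A *: (st W * W) = X - real_complex R A *: (st W * W)
    - real_complex R A *: (st W * W) + st W * P * W + st W * (sc U A - P) * W.
Proof. by rewrite mulrBr mulrBl scEr -scalerAl; lmod. Qed.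

(** * Hilbert modules and the norm of infinite matrices *)

Section HilbertModule.
Context (R : realType) (B : cstarAlgType R).
Local Notation toC := (real_complex R).
Implicit Types (n m : nat) (u v w : nat -> B) (S T : infmx B) (c d : R).

Definition ip n u v : B := \sum_(i < n) cmul (cstar (u i)) (v i).

Lemma inj_ip n u v : inj (ip n u v) = \sum_(i < n) st (inj (u i)) * inj (v i).
Proof. by rewrite inj_sum; apply: eq_bigr => i _; rewrite injM inj_st. Qed.

Lemma npos_ip n u : npos (inj (ip n u u)).
Proof. by rewrite inj_ip; apply: npos_sum => i _; exact: npos_kv. Qed.

Lemma vec_norm_ge0 n u : 0 <= vec_norm n u.
Proof. exact: sqrtr_ge0. Qed.

Lemma vec_norm2 n u : vec_norm n u ^+ 2 = rnorm (ip n u u).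
Proof. by rewrite sqr_sqrtr// rnorm_ge0. Qed.

Lemma vec_norm_term n u (i : nat) : (i < n)%N -> rnorm (u i) <= vec_norm n u.
Proof.
move=> ni; rewrite -(@ler_pXn2r _ 2) ?nnegrE ?rnorm_ge0 ?vec_norm_ge0// vec_norm2.
rewrite -rnorm_cstar_cmul -!nm_inj injM inj_st; apply: npos_le; first exact: npos_kv.
rewrite inj_ip (bigD1 (Ordinal ni))//= addrAC subrr add0r.
by apply: npos_sum => j _; exact: npos_kv.
Qed.

Lemma vec_norm_mono n m u : (n <= m)%N -> vec_norm n u <= vec_norm m u.
Proof.
move=> nm_; rewrite -(@ler_pXn2r _ 2) ?nnegrE ?vec_norm_ge0// !vec_norm2 -!nm_inj.
apply: npos_le; first exact: npos_ip.
rewrite !inj_ip -!(big_mkord xpredT (fun i => st (inj (u i)) * inj (u i))).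
rewrite (@big_cat_nat _ _ _ n)//= addrAC subrr add0r.
by apply: npos_sum => j _; exact: npos_kv.
Qed.

(** Expand the sum of the squares of A v_i - u_i W with A = |u|^2 and W = <u, v>, then replace the
    inner product <u, u> by the scalar A that dominates it. The scalar factor A is what makes the
    expansion work with noncommuting coefficients. *)
Lemma cauchy_schwarz n u v : rnorm (ip n u v) <= vec_norm n u * vec_norm n v.
Proof.
have [u0|u0] := eqVneq (vec_norm n u) 0.
  rewrite u0 mul0r /ip big1 ?rnorm0// => i _.
  suff -> : u i = 0 by rewrite cstar0 cmul0l.
  by apply: rnorm0_eq0; apply/eqP; rewrite eq_le rnorm_ge0 andbT -u0 vec_norm_term.
have up : 0 < vec_norm n u by rewrite lt_neqAle eq_sym u0 vec_norm_ge0.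
rewrite -(@ler_pXn2r _ 2)// ?nnegrE ?rnorm_ge0 ?mulr_ge0 ?vec_norm_ge0// exprMn.
set A := vec_norm n u ^+ 2; rewrite vec_norm2.
have A0 : 0 < A by rewrite exprn_gt0.
rewrite -rnorm_cstar_cmul -!nm_inj injM inj_st.
set W := inj (ip n u v); set P := inj (ip n u u); set Q := inj (ip n v v).
have nP : nm P <= A by rewrite /A vec_norm2 nm_inj.
have E : toC (A ^+ 2) *: Q - toC A *: (st W * W) =
   \sum_(i < n) st (toC A *: inj (v i) - inj (u i) * W) * (toC A *: inj (v i) - inj (u i) * W)
   + st W * (sc _ A - P) * W.
  have EW : st W = \sum_(i < n) st (inj (v i)) * inj (u i).
    by rewrite /W inj_ip st_sum; apply: eq_bigr => i _; rewrite stM stK.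
  have -> : \sum_(i < n) st (toC A *: inj (v i) - inj (u i) * W) *
       (toC A *: inj (v i) - inj (u i) * W) =
     toC (A ^+ 2) *: Q - toC A *: (st W * W) - toC A *: (st W * W) + st W * P * W.
    rewrite (eq_bigr (fun i : 'I_n => toC (A ^+ 2) *: (st (inj (v i)) * inj (v i))
      - toC A *: (st (inj (v i)) * inj (u i) * W)
      - toC A *: (st W * (st (inj (u i)) * inj (v i)))
      + st W * (st (inj (u i)) * inj (u i)) * W)) => [|i _].
      rewrite big_split/= !sumrB -!scaler_sumr -!mulr_suml -!mulr_sumr.
      by rewrite -EW -!inj_ip.
    rewrite stB stZr stM mulrBr !mulrBl -!scalerAr -!scalerAl !mulrA.
    by rewrite !scalerA -toCM -expr2; lmod.
  exact: cs_aux.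
have n1 : npos (toC A *: (st W * W)) by apply: nposZ (npos_kv _); exact: ltW.
have n2 : npos (toC (A ^+ 2) *: Q - toC A *: (st W * W)).
  rewrite E; apply: nposD; first by apply: npos_sum => i _; exact: npos_kv.
  by apply: npos_stM; apply: npos_leN => //; exact: npos_ip.
have := npos_le n1 n2; rewrite !nmZr !ger0_norm ?(ltW A0) ?sqr_ge0//.
move=> h; rewrite -(ler_pM2l A0); apply: le_trans h _.
by rewrite [A ^+ 2]expr2 [leLHS]mulrAC [leLHS]mulrC mulrCA.
Qed.

Definition form n T u v : B := ip n u (mx_app n T v).

(** A bound for the sesquilinear forms of all corners, equivalent to [infmx_norm T <= c]. In this
    form adjoints and entrywise limits are immediate, and no infinite norms have to be handled. *)
Definition mxb T c := 0 <= c /\ forall n u v,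
  rnorm (form n T u v) <= c * (vec_norm n u * vec_norm n v).

Lemma formE n T u v :
  form n T u v = \sum_(i < n) \sum_(j < n) cmul (cstar (u i)) (cmul (T i j) (v j)).
Proof. by apply: eq_bigr => i _; rewrite cmul_sumr. Qed.

Lemma mxb_app T c n v : mxb T c -> vec_norm n (mx_app n T v) <= c * vec_norm n v.
Proof.
move=> [c0 Tc]; have := vec_norm_ge0 n (mx_app n T v).
rewrite le_eqVlt => /orP[/eqP <-|x0]; first by rewrite mulr_ge0 ?vec_norm_ge0.
rewrite -(ler_pM2l x0) -expr2 vec_norm2.
by rewrite (le_trans (Tc _ _ _))// mulrCA.
Qed.

Lemma app_mxb T c : 0 <= c -> (forall n v, vec_norm n (mx_app n T v) <= c * vec_norm n v) ->
  mxb T c.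
Proof.
move=> c0 h; split=> // n u v; rewrite (le_trans (cauchy_schwarz _ _ _))//.
by rewrite mulrCA ler_wpM2l ?vec_norm_ge0.
Qed.

Lemma vec_normZ n v (k : R) : 0 <= k -> vec_norm n (fun i => toC k *: v i) = k * vec_norm n v.
Proof.
move=> k0; apply/eqP; rewrite -(@eqrXn2 _ 2) ?mulr_ge0 ?vec_norm_ge0//; apply/eqP.
rewrite exprMn !vec_norm2 /ip -[k ^+ 2]ger0_norm ?sqr_ge0// -rnormZr scaler_sumr.
congr rnorm; apply: eq_bigr => i _; rewrite cstarZr cmulZl cmulZr scalerA -toCM.
by rewrite -expr2.
Qed.

Lemma mx_appZ n T v (k : R[i]) : mx_app n T (fun i => k *: v i) = fun i => k *: mx_app n T v i.
Proof. by apply/funext => i; rewrite /mx_app scaler_sumr; apply: eq_bigr => j _; rewrite cmulZr. Qed.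

Lemma infmx_norm_le T c : mxb T c -> (infmx_norm T <= c%:E)%E.
Proof.
move=> Tc; apply: ge_ereal_sup => _ [n [v [v1 ->]]]; rewrite lee_fin.
by rewrite (le_trans (mxb_app _ _ Tc))// ler_piMr//; case: Tc.
Qed.

Lemma infmx_norm_mxb T c : (infmx_norm T <= c%:E)%E -> mxb T c.
Proof.
move=> Tc; have h n v : vec_norm n v <= 1 -> vec_norm n (mx_app n T v) <= c.
  move=> v1; rewrite -lee_fin (le_trans _ Tc)//; apply: ereal_sup_ubound.
  by exists n, v.
have c0 : 0 <= c.
  apply: le_trans (vec_norm_ge0 0 _) (h 0 (fun=> 0) _).
  by rewrite /vec_norm big_ord0 rnorm0 sqrtr0.
apply: app_mxb => // n v; have := vec_norm_ge0 n v.
rewrite le_eqVlt => /orP[/eqP v0|v0].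
  suff -> : mx_app n T v = mx_app n T (fun=> 0).
    have -> : mx_app n T (fun=> 0) = fun=> 0.
      by apply/funext => i; rewrite /mx_app big1// => j _; rewrite cmul0r.
    rewrite /vec_norm big1 ?rnorm0 ?sqrtr0 ?mulr_ge0 ?vec_norm_ge0// => i _.
    by rewrite cmul0r.
  apply/funext => i; apply: eq_bigr => j _; congr cmul; apply: rnorm0_eq0.
  by apply/eqP; rewrite eq_le rnorm_ge0 andbT v0 vec_norm_term.
have := h n (fun i => toC (vec_norm n v)^-1 *: v i); rewrite mx_appZ.
rewrite !vec_normZ ?invr_ge0 ?(ltW v0)// mulVf ?gt_eqF// => /(_ (lexx _)).
by rewrite ler_pdivrMl// mulrC.
Qed.

Lemma infmx_norm_ge0 T : (0 <= infmx_norm T)%E.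
Proof.
apply: ereal_sup_ubound; exists 0%N, (fun=> 0).
by rewrite /vec_norm !big_ord0 rnorm0 sqrtr0.
Qed.

Definition mxn T : R := fine (infmx_norm T).

Lemma mxn_ge0 T : 0 <= mxn T.
Proof. by rewrite fine_ge0// infmx_norm_ge0. Qed.

Lemma mxn_fin T c : mxb T c -> infmx_norm T = (mxn T)%:E.
Proof.
move=> /infmx_norm_le h; rewrite /mxn fineK// ge0_fin_numE ?infmx_norm_ge0//.
by rewrite (le_lt_trans h)// ltry.
Qed.

Lemma mxnP T c : mxb T c -> mxb T (mxn T).
Proof. by move=> /mxn_fin Tc; apply: infmx_norm_mxb; rewrite Tc. Qed.

Lemma mxn_le T c : mxb T c -> mxn T <= c.
Proof. by move=> Tc; rewrite -lee_fin -(mxn_fin Tc) infmx_norm_le. Qed.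

Lemma mxb_le T c d : c <= d -> mxb T c -> mxb T d.
Proof.
move=> cd [c0 Tc]; split=> [|n u v]; first exact: le_trans cd.
by rewrite (le_trans (Tc _ _ _))// ler_wpM2r// mulr_ge0 ?vec_norm_ge0.
Qed.

Lemma formD n S T u v : form n (S + T) u v = form n S u v + form n T u v.
Proof.
rewrite !formE -big_split/=; apply: eq_bigr => i _; rewrite -big_split/=.
by apply: eq_bigr => j _; rewrite cmulDl cmulDr.
Qed.

Lemma mxbD S T c d : mxb S c -> mxb T d -> mxb (S + T) (c + d).
Proof.
move=> [c0 Sc] [d0 Td]; split=> [|n u v]; first exact: addr_ge0.
by rewrite formD (le_trans (ler_rnormD _ _))// mulrDl lerD.
Qed.

Lemma mxbZ (k : R[i]) T c : mxb T c -> mxb (k *: T) (complex.Re `|k| * c).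
Proof.
move=> [c0 Tc]; split=> [|n u v]; first by rewrite mulr_ge0// normCRe_ge0.
have -> : form n (k *: T) u v = k *: form n T u v.
  rewrite !formE scaler_sumr; apply: eq_bigr => i _; rewrite scaler_sumr.
  by apply: eq_bigr => j _; rewrite -cmulZr -cmulZl.
by rewrite rnormZ -mulrA ler_wpM2l ?normCRe_ge0.
Qed.

Lemma mxbN T c : mxb T c -> mxb (- T) c.
Proof. by move=> /(mxbZ (-1)); rewrite normrN normr1/= mul1r scaleN1r. Qed.

Lemma mxbB S T c d : mxb S c -> mxb T d -> mxb (S - T) (c + d).
Proof. by move=> Sc Td; apply: mxbD => //; exact: mxbN. Qed.

Lemma mxb0 : mxb 0 0.
Proof.
split=> // n u v; rewrite formE big1 ?rnorm0 ?mul0r// => i _.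
by rewrite big1// => j _; rewrite cmul0l cmul0r.
Qed.

Lemma mxb_adj T c : mxb T c -> mxb (mx_adj T) c.
Proof.
move=> [c0 Tc]; split=> // n u v.
have -> : form n (mx_adj T) u v = cstar (form n T v u).
  rewrite !formE cstar_sum exchange_big/=; apply: eq_bigr => i _.
  rewrite cstar_sum; apply: eq_bigr => j _.
  by rewrite !cstarM cstarK /mx_adj cmulA.
by rewrite rnorm_cstar (le_trans (Tc _ _ _))// [vec_norm n v * _]mulrC.
Qed.

Lemma mxb_entry T c i j : mxb T c -> rnorm (T i j) <= c.
Proof.
move=> Tc; pose n := (maxn i j).+1.
have ni : (i < n)%N by rewrite ltnS leq_maxl.
have nj : (j < n)%N by rewrite ltnS leq_maxr.
pose v k : B := if k == j then cstar (T i j) else 0.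
have vn : vec_norm n v = rnorm (T i j).
  rewrite /vec_norm (bigD1 (Ordinal nj))//= big1 => [|k]; last first.
    by rewrite -val_eqE/= /v => /negbTE ->; rewrite cmul0r.
  by rewrite addr0 /v eqxx rnorm_cstar_cmul rnorm_cstar sqrtr_sqr ger0_norm ?rnorm_ge0.
have := le_trans (vec_norm_term _ ni) (mxb_app n v Tc).
rewrite vn /mx_app (bigD1 (Ordinal nj))//= big1 => [|k]; last first.
  by rewrite -val_eqE/= /v => /negbTE ->; rewrite cmul0r.
rewrite addr0 /v eqxx -{1}(cstarK (T i j)) rnorm_cstar_cmul rnorm_cstar.
have := rnorm_ge0 (T i j); rewrite le_eqVlt => /orP[/eqP <- _|t0].
  by case: Tc.
by rewrite expr2 ler_pM2r.
Qed.

Definition vtrunc n v : nat -> B := fun i => if (i < n)%N then v i else 0.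

Lemma vtrunc_norm n m v : vec_norm m (vtrunc n v) <= vec_norm m v.
Proof.
rewrite -(@ler_pXn2r _ 2) ?nnegrE ?vec_norm_ge0// !vec_norm2 -!nm_inj.
apply: npos_le; first exact: npos_ip.
rewrite !inj_ip -sumrB; apply: npos_sum => i _; rewrite /vtrunc.
case: ifP => _; first by rewrite subrr; exact: npos0.
by rewrite inj0 mulr0 subr0; exact: npos_kv.
Qed.

Lemma mxb_trunc n T c : mxb T c -> mxb (mx_trunc n T) c.
Proof.
move=> [c0 Tc]; split=> // m u v.
have -> : form m (mx_trunc n T) u v = form m T (vtrunc n u) (vtrunc n v).
  rewrite !formE; apply: eq_bigr => i _; apply: eq_bigr => j _.
  rewrite /mx_trunc /vtrunc; case: (i < n)%N => /=; last by rewrite cmul0l cmul0r cstar0 cmul0l.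
  by case: (j < n)%N => //; rewrite cmul0l !cmul0r.
rewrite (le_trans (Tc _ _ _))// ler_wpM2l// ler_pM ?vec_norm_ge0 ?vtrunc_norm//.
Qed.

Lemma vec_norm_ext n m v : (n <= m)%N -> vec_norm m (vtrunc n v) = vec_norm n v.
Proof.
move=> nm_; rewrite /vec_norm -!(big_mkord xpredT (fun i => cmul (cstar (vtrunc n v i)) (vtrunc n v i))).
rewrite (@big_cat_nat _ _ _ n)//= [X in _ + X]big1_seq ?addr0; last first.
  move=> k /andP[_]; rewrite mem_index_iota /vtrunc => /andP[nk _].
  by rewrite ltnNge nk cmul0r.
by rewrite big_mkord; congr (Num.sqrt (rnorm _)); apply: eq_bigr => i _; rewrite /vtrunc ltn_ord.
Qed.

Lemma mxb_trunc_sum n T : mxb (mx_trunc n T) (\sum_(i < n) \sum_(j < n) rnorm (T i j)).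
Proof.
split.
  by do 2 (apply: sumr_ge0 => ? _); exact: rnorm_ge0.
move=> m u v; pose G i j := rnorm (mx_trunc n T i j).
have h : rnorm (form m (mx_trunc n T) u v) <=
    (\sum_(i < m) \sum_(j < m) G i j) * (vec_norm m u * vec_norm m v).
  rewrite formE (le_trans (ler_rnorm_sum _ _ _))// mulr_suml ler_sum// => i _.
  rewrite (le_trans (ler_rnorm_sum _ _ _))// mulr_suml ler_sum// => j _.
  rewrite (le_trans (rnorm_cmul _ _))// rnorm_cstar.
  rewrite (le_trans (ler_wpM2l (rnorm_ge0 _) (rnorm_cmul _ _)))// mulrCA.
  by rewrite ler_wpM2l ?rnorm_ge0// ler_pM ?rnorm_ge0 ?vec_norm_term.
rewrite (le_trans h)// ler_wpM2r ?mulr_ge0 ?vec_norm_ge0//.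
have G0 i j : (n <= i)%N || (n <= j)%N -> G i j = 0.
  by rewrite /G /mx_trunc !ltnNge -negb_or => ->; rewrite rnorm0.
have GE i j : (i < n)%N -> (j < n)%N -> G i j = rnorm (T i j).
  by rewrite /G /mx_trunc => -> ->.
have w (F : nat -> R) : (forall k, 0 <= F k) -> (forall k, (n <= k)%N -> F k = 0) ->
    \sum_(k < m) F k <= \sum_(k < n) F k.
  move=> F0 Fn; rewrite -!(big_mkord xpredT F); have [mn|nm_] := leqP m n.
    by rewrite [leRHS](@big_cat_nat _ _ _ m)//= lerDl sumr_ge0.
  rewrite [leLHS](@big_cat_nat _ _ _ n)//= ?(ltnW nm_)// [X in _ + X]big1_seq ?addr0//.
  by move=> k /andP[_]; rewrite mem_index_iota => /andP[/Fn].
apply: (@le_trans _ _ (\sum_(i < n) \sum_(j < m) G i j)).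
  apply: (w (fun i => \sum_(j < m) G i j)) => [k|k nk].
    by apply: sumr_ge0 => j _; exact: rnorm_ge0.
  by rewrite big1// => j _; rewrite G0// nk.
apply: ler_sum => i _; rewrite (le_trans (w _ _ _))// => [k|k nk|]; first exact: rnorm_ge0.
  by rewrite G0// nk orbT.
by apply: ler_sum => j _; rewrite GE.
Qed.

Lemma mxb_finite n T : exists c, mxb (mx_trunc n T) c.
Proof. by eexists; exact: mxb_trunc_sum. Qed.

End HilbertModule.

Lemma sub_subl (V : zmodType) (x y z : V) : x - y - (x - z) = - (y - z).
Proof. by rewrite !opprB [x - y]addrC [z - x]addrC addrA addrK addrC. Qed.

(** * Products of infinite matrices *)

Section StabMul.
Context (R : realType) (B : cstarAlgType R).
Local Notation toC := (real_complex R).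
Implicit Types (n m : nat) (u v w : nat -> B) (S T : infmx B) (c d : R).

Lemma infmx_cvg0P (F : nat -> infmx B) : infmx_norm (F n) @[n --> \oo] --> 0%E <->
  forall e : R, 0 < e -> exists N, forall n, (N <= n)%N -> mxb (F n) e.
Proof.
split=> [|h].
  move=> /fine_cvgP[[N1 _ fN] /cvgrPdist_le h] e e0.
  have [N2 _ NP] := h _ e0; exists (maxn N1 N2) => n; rewrite geq_max => /andP[n1 n2].
  apply: infmx_norm_mxb; have := NP n n2 => /=; rewrite sub0r normrN => le1.
  have /fineK <- : infmx_norm (F n) \is a fin_num := fN n n1.
  by rewrite lee_fin; exact: le_trans (ler_norm _) le1.
apply/fine_cvgP; split.
  have [N NP] := h 1 ltr01; exists N => // n /NP /infmx_norm_le le1.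
  by rewrite /= ge0_fin_numE ?infmx_norm_ge0// (le_lt_trans le1)// ltry.
apply/cvgrPdist_le => e /h[N NP]; exists N => // n /NP Tn /=.
by rewrite sub0r normrN ger0_norm ?mxn_ge0//; exact: mxn_le Tn.
Qed.

Lemma stabP T : stab B T <-> forall e : R, 0 < e -> exists N, forall n, (N <= n)%N ->
  mxb (T - mx_trunc n T) e.
Proof. exact: infmx_cvg0P. Qed.

Lemma stab_fin T : stab B T -> mxb T (mxn T).
Proof.
move=> /stabP/(_ 1 ltr01)[N /(_ N (leqnn _)) h1]; have [c h2] := mxb_finite N T.
by apply: mxnP; rewrite -[T](subrK (mx_trunc N T)); exact: mxbD h1 h2.
Qed.

Definition pprod n S T : infmx B := fun i j => \sum_(k < n) cmul (S i k) (T k j).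

Lemma ip_appl n m S u (w : nat -> B) :
  \sum_(i < m) cmul (cstar (u i)) (\sum_(k < n) cmul (S i k) (w k)) =
  ip n (fun k => \sum_(i < m) cmul (mx_adj S k i) (u i)) w.
Proof.
rewrite (eq_bigr (fun i : 'I_m => \sum_(k < n) cmul (cstar (u i)) (cmul (S i k) (w k)))).
  rewrite exchange_big/=; apply: eq_bigr => k _.
  rewrite cstar_sum cmul_suml; apply: eq_bigr => i _.
  by rewrite /mx_adj cstarM cstarK cmulA.
by move=> i _; rewrite cmul_sumr.
Qed.

Lemma mx_app_le n m T v c : mxb T c ->
  vec_norm n (fun k => \sum_(j < m) cmul (T k j) (v j)) <= c * vec_norm m v.
Proof.
move=> Tc; pose N := maxn n m.
have E k : \sum_(j < m) cmul (T k j) (v j) = mx_app N T (vtrunc m v) k.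
  rewrite /mx_app -!(big_mkord xpredT (fun j => cmul (T k j) (_ j))).
  rewrite [RHS](@big_cat_nat _ _ _ m)//= ?leq_maxr// [X in _ + X]big1_seq ?addr0; last first.
    move=> j /andP[_]; rewrite mem_index_iota /vtrunc => /andP[mj _].
    by rewrite ltnNge mj cmul0r.
  rewrite !big_mkord; apply: eq_bigr => j _; rewrite /vtrunc ltn_ord//.
rewrite (_ : (fun k => _) = mx_app N T (vtrunc m v)); last by apply/funext => k; rewrite E.
rewrite (le_trans (vec_norm_mono _ (leq_maxl n m)))//.
by rewrite (le_trans (mxb_app _ _ Tc))// vec_norm_ext// leq_maxr.
Qed.

Lemma mxb_pprod n S T c d : mxb S c -> mxb T d -> mxb (pprod n S T) (c * d).
Proof.
move=> Sc Td; have c0 : 0 <= c by case: Sc. have d0 : 0 <= d by case: Td.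
split=> [|m u v]; first exact: mulr_ge0.
have -> : form m (pprod n S T) u v =
    ip n (fun k => \sum_(i < m) cmul (mx_adj S k i) (u i))
         (fun k => \sum_(j < m) cmul (T k j) (v j)).
  rewrite -ip_appl; apply: eq_bigr => i _; congr cmul; rewrite /mx_app.
  under eq_bigr do rewrite cmul_suml.
  rewrite exchange_big/=; apply: eq_bigr => k _; rewrite cmul_sumr.
  by apply: eq_bigr => j _; rewrite cmulA.
rewrite (le_trans (cauchy_schwarz _ _ _))// mulrACA ler_pM ?vec_norm_ge0//.
  by apply: mx_app_le; exact: mxb_adj.
exact: mx_app_le.
Qed.

Lemma pprodBr n S T T' : pprod n S (T - T') = pprod n S T - pprod n S T'.
Proof.
apply/funext => i; apply/funext => j; rewrite -[RHS]/(pprod n S T i j - pprod n S T' i j).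
by rewrite /pprod -sumrB; apply: eq_bigr => k _; rewrite cmulBr.
Qed.

Lemma pprodBl n S S' T : pprod n (S - S') T = pprod n S T - pprod n S' T.
Proof.
apply/funext => i; apply/funext => j; rewrite -[RHS]/(pprod n S T i j - pprod n S' T i j).
by rewrite /pprod -sumrB; apply: eq_bigr => k _; rewrite cmulBl.
Qed.

Lemma pprod_trunc n N S T : (N <= n)%N -> pprod n S (mx_trunc N T) = pprod N S (mx_trunc N T).
Proof.
move=> Nn; apply/funext => i; apply/funext => j; rewrite /pprod.
rewrite -!(big_mkord xpredT (fun k => cmul (S i k) (mx_trunc N T k j))).
rewrite (@big_cat_nat _ _ _ N)//= [X in _ + X]big1_seq ?addr0// => k /andP[_].
by rewrite mem_index_iota /mx_trunc => /andP[Nk _]; rewrite ltnNge Nk/= cmul0r.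
Qed.

(** Each form involves finitely many entries, so entrywise convergence carries a uniform bound to
    the limit. This upgrades entrywise limits to limits in norm. *)
Lemma mxb_lim (F : nat -> infmx B) T c : (forall n, mxb (F n) c) ->
  (forall i j (e : R), 0 < e -> exists N, forall n, (N <= n)%N -> rnorm (F n i j - T i j) <= e) ->
  mxb T c.
Proof.
move=> Fc FT; have c0 : 0 <= c by case: (Fc 0%N).
split=> // m u v; apply/ler_addgt0Pr => e e0.
pose K := \sum_(i < m) \sum_(j < m) rnorm (u i) * rnorm (v j) + 1.
have K0 : 0 < K.
  by rewrite ltr_wpDl// sumr_ge0// => i _; rewrite sumr_ge0// => j _; rewrite mulr_ge0 ?rnorm_ge0.
have [N NP] : exists N, forall i j, (i < m)%N -> (j < m)%N -> rnorm (F N i j - T i j) <= e / K.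
  have /choice[g gP] : forall ij : nat * nat, exists N, forall n, (N <= n)%N ->
      rnorm (F n ij.1 ij.2 - T ij.1 ij.2) <= e / K by move=> ij; apply: FT; exact: divr_gt0.
  exists (\max_(i < m) \max_(j < m) g (i : nat, j : nat)) => i j im jm.
  apply: (gP (i, j)); apply: leq_trans (leq_bigmax (Ordinal im)).
  exact: (leq_bigmax (F := fun k : 'I_m => g (_, k : nat)) (Ordinal jm)).
have -> : form m T u v = form m (F N) u v - form m (F N - T) u v.
  by apply/eqP; rewrite eq_sym subr_eq -formD addrC subrK.
rewrite (le_trans (ler_rnormB _ _))// lerD//; first by case: (Fc N).
rewrite formE (le_trans (ler_rnorm_sum _ _ _))//.
have : e / K * \sum_(i < m) \sum_(j < m) rnorm (u i) * rnorm (v j) <= e.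
  rewrite -[leRHS]mulr1 -mulrA ler_wpM2l ?(ltW e0)// mulrC ler_pdivrMr// mul1r /K.
  by rewrite lerDl.
apply: le_trans; rewrite mulr_sumr ler_sum// => i _.
rewrite (le_trans (ler_rnorm_sum _ _ _))// mulr_sumr ler_sum// => j _.
rewrite (le_trans (rnorm_cmul _ _))// rnorm_cstar.
rewrite (le_trans (ler_wpM2l (rnorm_ge0 _) (rnorm_cmul _ _)))//.
rewrite mulrCA mulrA mulrC -mulrA [X in _ <= X]mulrC -mulrA mulrC -mulrA.
rewrite [leLHS](_ : _ = rnorm (u i) * rnorm (v j) * rnorm (F N i j - T i j)); last by ring.
by rewrite [leRHS](_ : _ = rnorm (u i) * rnorm (v j) * (e / K)) ?ler_wpM2l ?mulr_ge0 ?rnorm_ge0 ?NP//; ring.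
Qed.

Lemma limn_rnorm (f : nat -> B) l : (forall e : R, 0 < e -> exists N, forall n, (N <= n)%N ->
  rnorm (f n - l) <= e) -> limn f = l.
Proof.
move=> h; apply: cvg_lim => //; apply/cvgrPdist_le => e e0.
have eE : toC (complex.Re e) = e by rewrite RRe_real// gtr0_real.
have e0' : 0 < complex.Re e by rewrite -ltcR eE.
have [N NP] := h _ e0'; exists N => // n /= Nn.
by rewrite -eE -rnormE lecR rdistC NP.
Qed.

Lemma pprod_cauchy S T (e : R) : stab B S -> stab B T -> 0 < e -> exists N, forall n m,
  (N <= n)%N -> (N <= m)%N -> mxb (pprod n S T - pprod m S T) e.
Proof.
move=> /stab_fin Sf sT e0; have d0 : 0 < e / (2 * (mxn S + 1)).
  by rewrite divr_gt0// mulr_gt0// ltr_wpDl// mxn_ge0.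
have S1 : 0 < mxn S + 1 by rewrite ltr_wpDl// mxn_ge0.
have [N NP] := (stabP T).1 sT _ d0; exists N => n m Nn Nm.
(* The part [mx_trunc N T] contributes the same to both products, as n and m are at least N; only
   the small tail of T remains. *)
have -> : pprod n S T - pprod m S T =
    pprod n S (T - mx_trunc N T) - pprod m S (T - mx_trunc N T).
  by rewrite !pprodBr !pprod_trunc// opprB addrA subrK.
have le2 : mxn S * (e / (2 * (mxn S + 1))) <= e / 2.
  rewrite mulrA ler_pdivrMr ?mulr_gt0//.
  rewrite [leRHS](_ : _ = mxn S * e + e); last by field.
  by rewrite lerDl ltW.
apply: (@mxb_le _ _ _ (mxn S * (e / (2 * (mxn S + 1))) + mxn S * (e / (2 * (mxn S + 1))))).
  by rewrite [leRHS](splitr e) lerD.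
by apply: mxbB; apply: mxb_pprod => //; exact: NP.
Qed.

Lemma mx_mulP S T : stab B S -> stab B T -> forall e : R, 0 < e -> exists N, forall n,
  (N <= n)%N -> mxb (pprod n S T - mx_mul S T) e.
Proof.
move=> sS sT.
have h i j (e : R) : 0 < e -> exists N, forall n, (N <= n)%N ->
    rnorm (pprod n S T i j - mx_mul S T i j) <= e.
  have [d d0|l lP] := rnorm_complete (u := fun n => pprod n S T i j).
    have [N NP] := pprod_cauchy sS sT d0; exists N => n m Nn Nm.
    exact: (mxb_entry i j (NP n m Nn Nm)).
  have -> : mx_mul S T i j = l by exact: limn_rnorm lP.
  exact: lP.
move=> e e0; have [N NP] := pprod_cauchy sS sT e0; exists N => n Nn.
apply: (@mxb_lim (fun m => pprod n S T - pprod (maxn N m) S T)).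
  by move=> m; apply: NP => //; exact: leq_maxl.
move=> i j d d0; have [M MP] := h i j d d0; exists M => m Mm.
have -> : (pprod n S T - pprod (maxn N m) S T) i j - (pprod n S T - mx_mul S T) i j =
    - (pprod (maxn N m) S T i j - mx_mul S T i j).
  rewrite -[(pprod n S T - _) i j]/(pprod n S T i j - pprod (maxn N m) S T i j).
  rewrite -[(pprod n S T - mx_mul _ _) i j]/(pprod n S T i j - mx_mul S T i j).
  exact: sub_subl.
by rewrite rnormN MP// (leq_trans Mm)// leq_maxr.
Qed.

End StabMul.

Lemma small_mul (R : realType) (c e : R) : 0 <= c -> 0 <= e -> c * (e / (c + 1)) <= e.
Proof.
move=> c0 e0; have c1 : 0 < c + 1 by rewrite ltr_wpDl.
by rewrite mulrCA ler_piMr// ler_pdivrMr// mul1r lerDl.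
Qed.

Section StabAlg.
Context (R : realType) (B : cstarAlgType R).
Local Notation toC := (real_complex R).
Implicit Types (n m : nat) (u v w : nat -> B) (S T W : infmx B) (c d e : R).

Lemma mx_ext S T : (forall i j, S i j = T i j) -> S = T.
Proof. by move=> h; apply/funext => i; apply/funext => j. Qed.

Lemma mxDE S T i j : (S + T) i j = S i j + T i j. Proof. by []. Qed.
Lemma mxBE S T i j : (S - T) i j = S i j - T i j. Proof. by []. Qed.
Lemma mxZE (k : R[i]) S i j : (k *: S) i j = k *: S i j. Proof. by []. Qed.
Lemma mxb_eq S T : (forall e, 0 < e -> mxb (S - T) e) -> S = T.
Proof.
move=> h; apply: mx_ext => i j; apply: rnorm_le_eq => e e0.
exact: (mxb_entry i j (h _ e0)).
Qed.

Lemma mxb_split S T W c d : mxb (S - W) c -> mxb (W - T) d -> mxb (S - T) (c + d).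
Proof. by move=> h1 h2; rewrite -(subrKA W); exact: mxbD. Qed.

Lemma mxb_distC S T c : mxb (S - T) c -> mxb (T - S) c.
Proof. by move=> /mxbN; rewrite opprB. Qed.

Lemma mx_truncB n S T : mx_trunc n (S - T) = mx_trunc n S - mx_trunc n T.
Proof.
by apply: mx_ext => i j; rewrite mxBE /mx_trunc; case: ifP; rewrite ?subr0.
Qed.

Lemma mx_trunc_id n m T : (n <= m)%N -> mx_trunc m (mx_trunc n T) = mx_trunc n T.
Proof.
move=> nm_; apply: mx_ext => i j; rewrite /mx_trunc.
case: ifP => // /negbT h; case: ifP => // /andP[h1 h2]; case/negP: h.
by rewrite (leq_trans h1)// (leq_trans h2).
Qed.

Lemma stab_approx T : (forall e, 0 < e -> exists n F, mx_trunc n F = F /\ mxb (T - F) e) ->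
  stab B T.
Proof.
move=> h; apply/stabP => e e0; have [N [F [FN TF]]] := h _ (divr_gt0 e0 (ltr0n _ 2)).
exists N => n Nn; rewrite (_ : T - _ = (T - F) - mx_trunc n (T - F)).
  by rewrite (splitr e); apply: mxbB => //; exact: mxb_trunc.
by rewrite mx_truncB -[in mx_trunc n F]FN mx_trunc_id// FN opprB addrA subrK.
Qed.

Lemma stab_near T : stab B T -> forall e, 0 < e -> exists N, forall n, (N <= n)%N ->
  mxb (T - mx_trunc n T) e.
Proof. by move=> /stabP. Qed.

Lemma stab_lim T : (forall e, 0 < e -> exists2 S, stab B S & mxb (T - S) e) -> stab B T.
Proof.
move=> h; apply: stab_approx => e e0; have e2 := divr_gt0 e0 (ltr0n _ 2).
have [S sS TS] := h _ e2; have [N /(_ N (leqnn _)) SN] := stab_near sS e2.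
exists N, (mx_trunc N S); rewrite mx_trunc_id//; split=> //.
by rewrite (splitr e); exact: mxb_split TS SN.
Qed.

Lemma stab_fs n T : mx_trunc n T = T -> stab B T.
Proof.
move=> TN; apply: stab_approx => e e0; exists n, T; split=> //.
by rewrite subrr; apply: mxb_le (mxb0 _); exact: ltW.
Qed.

Lemma stab0 : stab B 0.
Proof. by apply: (@stab_fs 0); apply: mx_ext => i j. Qed.

Lemma stabD S T : stab B S -> stab B T -> stab B (S + T).
Proof.
move=> sS sT; apply/stabP => e e0; have e2 := divr_gt0 e0 (ltr0n _ 2).
have [N1 h1] := stab_near sS e2; have [N2 h2] := stab_near sT e2.
exists (maxn N1 N2) => n; rewrite geq_max => /andP[n1 n2].
rewrite (_ : _ - _ = (S - mx_trunc n S) + (T - mx_trunc n T)).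
  by rewrite (splitr e); apply: mxbD; [exact: h1|exact: h2].
apply: mx_ext => i j; rewrite !(mxBE, mxDE) /mx_trunc; case: ifP => _.
  by rewrite opprD addrACA.
by rewrite !subr0.
Qed.

Lemma stabZ (k : R[i]) T : stab B T -> stab B (k *: T).
Proof.
move=> sT; apply/stabP => e e0; have k1 : 0 < complex.Re `|k| + 1.
  by rewrite ltr_wpDl// normCRe_ge0.
have [N h] := stab_near sT (divr_gt0 e0 k1).
exists N => n Nn; rewrite (_ : _ - _ = k *: (T - mx_trunc n T)).
  apply: mxb_le (mxbZ _ (h _ Nn)); rewrite mulrCA ler_piMr ?(ltW e0)//.
  by rewrite ler_pdivrMr// mul1r lerDl.
apply: mx_ext => i j; rewrite !(mxBE, mxZE) /mx_trunc; case: ifP => _.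
  by rewrite scalerBr.
by rewrite !subr0.
Qed.

Lemma stabN T : stab B T -> stab B (- T).
Proof. by move=> /(stabZ (-1)); rewrite scaleN1r. Qed.

Lemma stab_adj T : stab B T -> stab B (mx_adj T).
Proof.
move=> sT; apply/stabP => e e0; have [N h] := stab_near sT e0.
exists N => n Nn; rewrite (_ : _ - _ = mx_adj (T - mx_trunc n T)).
  exact: mxb_adj (h _ Nn).
apply: mx_ext => i j; rewrite !mxBE /mx_adj mxBE cstarB /mx_trunc andbC.
by case: ifP => _//; rewrite cstar0.
Qed.

Lemma stab_pprod n S T : stab B S -> stab B T -> stab B (pprod n S T).
Proof.
move=> sS sT; apply: stab_lim => e e0.
have S1 : 0 < mxn S + 1 by rewrite ltr_wpDl// mxn_ge0.
have T1 : 0 < mxn T + 1 by rewrite ltr_wpDl// mxn_ge0.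
have e2 := divr_gt0 e0 (ltr0n _ 2).
have [N1 h1] := stab_near sT (divr_gt0 e2 S1).
have [N2 h2] := stab_near sS (divr_gt0 e2 T1).
pose N := maxn N1 N2; exists (pprod n (mx_trunc N S) (mx_trunc N T)).
  apply: (@stab_fs N); apply: mx_ext => i j; rewrite /mx_trunc /pprod.
  case: (ltnP i N) => //= iN; last by rewrite big1// => k _; rewrite cmul0l.
  case: (ltnP j N) => //= jN.
  by rewrite big1// => k _; rewrite andbF cmul0r.
apply: (@mxb_le _ _ _ ((mxn S) * (e / 2 / (mxn S + 1)) + (e / 2 / (mxn T + 1)) * mxn T)).
  rewrite [leRHS](splitr e) lerD//; first by rewrite small_mul ?mxn_ge0 ?(ltW e2).
  by rewrite mulrC small_mul ?mxn_ge0 ?(ltW e2).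
apply: (@mxb_split _ _ (pprod n S (mx_trunc N T))).
  rewrite -pprodBr; apply: mxb_pprod; first exact: stab_fin.
  by apply: h1; rewrite leq_maxl.
rewrite -pprodBl; apply: mxb_pprod; first by apply: h2; rewrite leq_maxr.
by apply: mxb_trunc; exact: stab_fin.
Qed.

Lemma mx_mul_near S T : stab B S -> stab B T -> forall e, 0 < e -> exists N, forall n,
  (N <= n)%N -> mxb (mx_mul S T - pprod n S T) e.
Proof.
move=> sS sT e e0; have [N NP] := mx_mulP sS sT e0.
by exists N => n /NP /mxb_distC.
Qed.

Lemma stab_mul S T : stab B S -> stab B T -> stab B (mx_mul S T).
Proof.
move=> sS sT; apply: stab_lim => e e0; have [N NP] := mx_mul_near sS sT e0.
by exists (pprod N S T); [exact: stab_pprod|exact: NP].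
Qed.

Lemma mx_mul_uniq S T W : stab B S -> stab B T ->
  (forall e, 0 < e -> exists N, forall n, (N <= n)%N -> mxb (W - pprod n S T) e) ->
  mx_mul S T = W.
Proof.
move=> sS sT h; apply: mxb_eq => e e0; have e2 := divr_gt0 e0 (ltr0n _ 2).
have [N1 h1] := mx_mul_near sS sT e2; have [N2 h2] := h _ e2.
rewrite (splitr e); apply: (@mxb_split _ _ (pprod (maxn N1 N2) S T)).
  by apply: h1; rewrite leq_maxl.
by apply: mxb_distC; apply: h2; rewrite leq_maxr.
Qed.

Lemma mxb_mul S T c d : stab B S -> stab B T -> mxb S c -> mxb T d -> mxb (mx_mul S T) (c * d).
Proof.
move=> sS sT Sc Td; apply: (@mxb_lim _ _ (fun n => pprod n S T)).
  by move=> n; exact: mxb_pprod.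
move=> i j e e0; have [N NP] := mx_mulP sS sT e0; exists N => n Nn.
exact: (mxb_entry i j (NP _ Nn)).
Qed.

Lemma pprodDl n S S' T : pprod n (S + S') T = pprod n S T + pprod n S' T.
Proof.
apply: mx_ext => i j; rewrite mxDE /pprod -big_split; apply: eq_bigr => k _.
exact: cmulDl.
Qed.

Lemma pprodDr n S T T' : pprod n S (T + T') = pprod n S T + pprod n S T'.
Proof.
apply: mx_ext => i j; rewrite mxDE /pprod -big_split; apply: eq_bigr => k _.
exact: cmulDr.
Qed.

Lemma pprodZl n (k : R[i]) S T : pprod n (k *: S) T = k *: pprod n S T.
Proof.
apply: mx_ext => i j; rewrite mxZE /pprod scaler_sumr; apply: eq_bigr => l _.
by rewrite -cmulZl.
Qed.

Lemma pprodZr n (k : R[i]) S T : pprod n S (k *: T) = k *: pprod n S T.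
Proof.
apply: mx_ext => i j; rewrite mxZE /pprod scaler_sumr; apply: eq_bigr => l _.
by rewrite -cmulZr.
Qed.

Lemma pprodA n m S T W : pprod n (pprod m S T) W = pprod m S (pprod n T W).
Proof.
apply: mx_ext => i j; rewrite /pprod.
under eq_bigr do rewrite cmul_suml.
rewrite exchange_big/=; apply: eq_bigr => k _; rewrite cmul_sumr.
by apply: eq_bigr => l _; rewrite cmulA.
Qed.

Lemma pprod_adj n S T : mx_adj (pprod n S T) = pprod n (mx_adj T) (mx_adj S).
Proof.
apply: mx_ext => i j; rewrite /mx_adj /pprod cstar_sum; apply: eq_bigr => k _.
by rewrite cstarM.
Qed.

Lemma mx_adjB S T : mx_adj (S - T) = mx_adj S - mx_adj T.
Proof. by apply: mx_ext => i j; rewrite mxBE /mx_adj mxBE cstarB. Qed.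

Lemma mx_mulDl S S' T : stab B S -> stab B S' -> stab B T ->
  mx_mul (S + S') T = mx_mul S T + mx_mul S' T.
Proof.
move=> s1 s2 s3; apply: mx_mul_uniq => //; first exact: stabD.
move=> e e0; have e2 := divr_gt0 e0 (ltr0n _ 2).
have [N1 h1] := mx_mul_near s1 s3 e2; have [N2 h2] := mx_mul_near s2 s3 e2.
exists (maxn N1 N2) => n; rewrite geq_max => /andP[n1 n2].
rewrite pprodDl opprD addrACA (splitr e).
by apply: mxbD; [exact: h1|exact: h2].
Qed.

Lemma mx_mulDr S T T' : stab B S -> stab B T -> stab B T' ->
  mx_mul S (T + T') = mx_mul S T + mx_mul S T'.
Proof.
move=> s1 s2 s3; apply: mx_mul_uniq => //; first exact: stabD.
move=> e e0; have e2 := divr_gt0 e0 (ltr0n _ 2).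
have [N1 h1] := mx_mul_near s1 s2 e2; have [N2 h2] := mx_mul_near s1 s3 e2.
exists (maxn N1 N2) => n; rewrite geq_max => /andP[n1 n2].
rewrite pprodDr opprD addrACA (splitr e).
by apply: mxbD; [exact: h1|exact: h2].
Qed.

Lemma mxbZ_small (k : R[i]) T e : 0 < e -> mxb T (e / (complex.Re `|k| + 1)) -> mxb (k *: T) e.
Proof.
move=> e0 /(mxbZ k); apply: mxb_le; have k1 : 0 < complex.Re `|k| + 1.
  by rewrite ltr_wpDl// normCRe_ge0.
by rewrite mulrCA ler_piMr ?(ltW e0)// ler_pdivrMr// mul1r lerDl.
Qed.

Lemma mx_mulZl (k : R[i]) S T : stab B S -> stab B T -> mx_mul (k *: S) T = k *: mx_mul S T.
Proof.
move=> s1 s2; apply: mx_mul_uniq => //; first exact: stabZ.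
move=> e e0; have k1 : 0 < complex.Re `|k| + 1 by rewrite ltr_wpDl// normCRe_ge0.
have [N h] := mx_mul_near s1 s2 (divr_gt0 e0 k1); exists N => n Nn.
by rewrite pprodZl -scalerBr; apply: mxbZ_small => //; exact: h.
Qed.

Lemma mx_mulZr (k : R[i]) S T : stab B S -> stab B T -> mx_mul S (k *: T) = k *: mx_mul S T.
Proof.
move=> s1 s2; apply: mx_mul_uniq => //; first exact: stabZ.
move=> e e0; have k1 : 0 < complex.Re `|k| + 1 by rewrite ltr_wpDl// normCRe_ge0.
have [N h] := mx_mul_near s1 s2 (divr_gt0 e0 k1); exists N => n Nn.
by rewrite pprodZr -scalerBr; apply: mxbZ_small => //; exact: h.
Qed.

Lemma mx_mul_adj S T : stab B S -> stab B T ->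
  mx_adj (mx_mul S T) = mx_mul (mx_adj T) (mx_adj S).
Proof.
move=> s1 s2; apply/esym/mx_mul_uniq; [exact: stab_adj|exact: stab_adj|].
move=> e e0; have [N h] := mx_mul_near s1 s2 e0; exists N => n Nn.
by rewrite -pprod_adj -mx_adjB; apply: mxb_adj; exact: h.
Qed.

Lemma mx_mulA S T W : stab B S -> stab B T -> stab B W ->
  mx_mul S (mx_mul T W) = mx_mul (mx_mul S T) W.
Proof.
move=> s1 s2 s3; apply: mxb_eq => e e0; have e4 : 0 < e / 4 by rewrite divr_gt0.
have S1 : 0 < mxn S + 1 by rewrite ltr_wpDl// mxn_ge0.
have W1 : 0 < mxn W + 1 by rewrite ltr_wpDl// mxn_ge0.
have [N1 h1] := mx_mul_near s1 (stab_mul s2 s3) e4.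
have [N2 h2] := mx_mul_near (stab_mul s1 s2) s3 e4.
have [N3 h3] := mx_mul_near s2 s3 (divr_gt0 e4 S1).
have [N4 h4] := mx_mul_near s1 s2 (divr_gt0 e4 W1).
pose m := maxn N1 N4; pose n := maxn N2 N3.
rewrite (_ : e = e / 4 + (e / 4 + (e / 4 + e / 4))); last by field.
apply: (@mxb_split _ _ (pprod m S (mx_mul T W))); first by apply: h1; rewrite leq_maxl.
apply: (@mxb_split _ _ (pprod m S (pprod n T W))).
  rewrite -pprodBr; apply: (@mxb_le _ _ _ (mxn S * (e / 4 / (mxn S + 1)))).
    by rewrite mulrCA ler_piMr ?(ltW e4)// ler_pdivrMr// mul1r lerDl.
  by apply: mxb_pprod (h3 _ (leq_maxr _ _)); exact: stab_fin.
rewrite -pprodA; apply: (@mxb_split _ _ (pprod n (mx_mul S T) W)); last first.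
  by apply/mxb_distC/h2; rewrite leq_maxl.
apply: mxb_distC; rewrite -pprodBl.
apply: (@mxb_le _ _ _ ((e / 4 / (mxn W + 1)) * mxn W)).
  by rewrite mulrAC -mulrA ler_piMr ?(ltW e4)// ler_pdivrMr// mul1r lerDl.
by apply: mxb_pprod (h4 _ (leq_maxr _ _)) _; exact: stab_fin.
Qed.

Lemma mxb_star_mul S c : stab B S -> mxb (mx_mul (mx_adj S) S) c -> mxb S (Num.sqrt c).
Proof.
move=> sS Sc; have c0 : 0 <= c by case: Sc.
apply: app_mxb => [|n v]; first exact: sqrtr_ge0.
rewrite -(@ler_pXn2r _ 2) ?nnegrE ?mulr_ge0 ?sqrtr_ge0 ?vec_norm_ge0// exprMn (sqr_sqrtr c0).
apply/ler_addgt0Pr => e e0.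
pose d := e / (vec_norm n v ^+ 2 + 1).
have v1 : 0 < vec_norm n v ^+ 2 + 1 by rewrite ltr_wpDl// sqr_ge0.
have d0 : 0 < d by rewrite divr_gt0.
have [N NP] := mx_mulP (stab_adj sS) sS d0; pose m := maxn n N.
rewrite vec_norm2; apply: (@le_trans _ _ (rnorm (ip m (mx_app n S v) (mx_app n S v)))).
  by rewrite -!vec_norm2 ler_pXn2r ?nnegrE ?vec_norm_ge0// vec_norm_mono// leq_maxl.
(* The number m of rows may exceed the number n of columns, so the square of the first m rows of S v
   is a value of the form of [pprod m], and m can be taken where [pprod m] is close to the
   product. *)
have -> : ip m (mx_app n S v) (mx_app n S v) = form n (pprod m (mx_adj S) S) v v.
  transitivity (\sum_(i < n) cmul (cstar (v i)) (\sum_(k < m) cmul (mx_adj S i k) (mx_app n S v k))).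
    rewrite (ip_appl m n (mx_adj S) v (mx_app n S v)); apply: eq_bigr => k _.
    congr cmul; congr cstar.
    by apply: eq_bigr => i _; rewrite /mx_adj cstarK.
  apply: eq_bigr => i _; congr cmul; rewrite /mx_app /pprod.
  under [RHS]eq_bigr do rewrite cmul_suml.
  rewrite exchange_big/=; apply: eq_bigr => k _; rewrite cmul_sumr.
  by apply: eq_bigr => j _; rewrite cmulA.
have -> : pprod m (mx_adj S) S = mx_mul (mx_adj S) S + (pprod m (mx_adj S) S - mx_mul (mx_adj S) S).
  by rewrite addrC subrK.
rewrite formD (le_trans (ler_rnormD _ _))// lerD//; first by rewrite expr2; case: Sc.
have [_ h] : mxb (pprod m (mx_adj S) S - mx_mul (mx_adj S) S) d by apply: NP; exact: leq_maxr.
by rewrite (le_trans (h _ _ _))// -expr2 /d mulrAC -mulrA ler_piMr ?(ltW e0)// ler_pdivrMr// mul1r lerDl.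
Qed.

Lemma stab_complete (f : nat -> infmx B) : (forall n, stab B (f n)) ->
  (forall e, 0 < e -> exists N, forall n m, (N <= n)%N -> (N <= m)%N -> mxb (f n - f m) e) ->
  exists2 T, stab B T & forall e, 0 < e -> exists N, forall n, (N <= n)%N -> mxb (f n - T) e.
Proof.
move=> sf cf.
have /choice[T TP] : forall ij : nat * nat, exists l, forall e, 0 < e ->
    exists N, forall n, (N <= n)%N -> rnorm (f n ij.1 ij.2 - l) <= e.
  move=> [i j]; apply: (@rnorm_complete _ _ (fun n => f n i j)) => e /cf[N NP].
  by exists N => n m Nn Nm; exact: (mxb_entry i j (NP _ _ Nn Nm)).
pose T' : infmx B := fun i j => T (i, j).
have lim e : 0 < e -> exists N, forall n, (N <= n)%N -> mxb (f n - T') e.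
  move=> /cf[N NP]; exists N => n Nn.
  apply: (@mxb_lim _ _ (fun m => f n - f (maxn N m))) => [m|i j d d0].
    by apply: NP => //; exact: leq_maxl.
  have [M MP] := TP (i, j) _ d0; exists M => m Mm.
  rewrite (_ : _ - _ = - (f (maxn N m) i j - T' i j)).
    by rewrite rnormN; apply: MP; rewrite (leq_trans Mm)// leq_maxr.
  exact: sub_subl.
exists T' => //; apply: stab_lim => e /lim[N NP]; exists (f N) => //.
exact/mxb_distC/NP.
Qed.

End StabAlg.

(** * The stabilization as a C*-algebra *)

Section StabT.
Context (R : realType) (B : cstarAlgType R).
Local Notation toC := (real_complex R).
Implicit Types (n m : nat) (S T W : infmx B) (c d e : R).

Record stab_car := StabCar { smx : infmx B ; smxP : stab B smx }.

Lemma smx_inj x y : smx x = smx y -> x = y.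
Proof.
by case: x y => [a pa] [b pb] /= ab; subst b; congr StabCar; exact: Prop_irrelevance.
Qed.

HB.instance Definition _ := gen_eqMixin stab_car.
HB.instance Definition _ := gen_choiceMixin stab_car.

Implicit Types x y z : stab_car.
Definition sc_add x y := StabCar (stabD (smxP x) (smxP y)).
Definition sc_opp x := StabCar (stabN (smxP x)).
Definition sc_zero := StabCar (stab0 B).
Definition sc_scale (k : R[i]) x := StabCar (stabZ k (smxP x)).

Fact sc_addA : associative sc_add.
Proof. by move=> x y z; apply: smx_inj; exact: addrA. Qed.
Fact sc_addC : commutative sc_add.
Proof. by move=> x y; apply: smx_inj; exact: addrC. Qed.
Fact sc_add0 : left_id sc_zero sc_add.
Proof. by move=> x; apply: smx_inj; exact: add0r. Qed.
Fact sc_addN : left_inverse sc_zero sc_opp sc_add.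
Proof. by move=> x; apply: smx_inj; exact: addNr. Qed.
HB.instance Definition _ :=
  GRing.isZmodule.Build stab_car sc_addA sc_addC sc_add0 sc_addN.

Fact sc_scaleA (k l : R[i]) x : sc_scale k (sc_scale l x) = sc_scale (k * l) x.
Proof. by apply: smx_inj; exact: scalerA. Qed.
Fact sc_scale1 : left_id 1 sc_scale.
Proof. by move=> x; apply: smx_inj; exact: scale1r. Qed.
Fact sc_scaleDr : right_distributive sc_scale +%R.
Proof. by move=> k x y; apply: smx_inj; exact: scalerDr. Qed.
Fact sc_scaleDl x : {morph sc_scale^~ x : k l / k + l}.
Proof. by move=> k l; apply: smx_inj; exact: scalerDl. Qed.
HB.instance Definition _ := GRing.Zmodule_isLmodule.Build R[i] stab_car
  sc_scaleA sc_scale1 sc_scaleDr sc_scaleDl.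

Definition sc_norm x := mxn (smx x).
Definition sc_mul x y := StabCar (stab_mul (smxP x) (smxP y)).
Definition sc_star x := StabCar (stab_adj (smxP x)).

Lemma smx_mxb x : mxb (smx x) (sc_norm x).
Proof. exact: stab_fin (smxP x). Qed.

Lemma sc_norm_le x c : mxb (smx x) c -> sc_norm x <= c.
Proof. exact: mxn_le. Qed.

Fact sc_normD x y : sc_norm (x + y) <= sc_norm x + sc_norm y.
Proof. by apply: sc_norm_le; apply: mxbD; exact: smx_mxb. Qed.

Fact sc_normZ (k : R[i]) x : sc_norm (k *: x) = complex.Re `|k| * sc_norm x.
Proof.
have le (l : R[i]) z : sc_norm (l *: z) <= complex.Re `|l| * sc_norm z.
  by apply: sc_norm_le; apply: mxbZ; exact: smx_mxb.
apply/eqP; rewrite eq_le le andTb; have [->|k0] := eqVneq k 0.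
  by rewrite normr0 mul0r; exact: mxn_ge0.
have kp : 0 < complex.Re `|k| by rewrite -ltcR normCReK normr_gt0.
rewrite -ler_pdivlMl//; have := le k^-1 (k *: x).
rewrite scalerA mulVf// scale1r normfV => /le_trans; apply.
rewrite le_eqVlt; apply/orP; left; apply/eqP; congr (_ * _); apply: complexI.
by rewrite toCV normCReK -normfV normCReK.
Qed.

Fact sc_norm0 x : sc_norm x = 0 -> x = 0.
Proof.
move=> x0; apply: smx_inj; apply: mxb_eq => e e0; rewrite subr0.
by apply: mxb_le (smx_mxb x); rewrite x0 ltW.
Qed.

Fact sc_complete (u : nat -> stab_car) :
  (forall n, sc_norm (u n.+1 - u n) <= 2^-1 ^+ n) ->
    exists l, forall e : R, 0 < e ->
      exists N, forall n, (N <= n)%N -> sc_norm (u n - l) <= e.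
Proof.
move=> hu; pose f n := smx (u n).
have tel n m : mxb (f (n + m)%N - f n) (2 * 2^-1 ^+ n - 2 * 2^-1 ^+ (n + m)).
  elim: m => [|m IH]; first by rewrite addn0 !subrr; exact: mxb0.
  rewrite addnS; apply: mxb_le (mxb_split (smx_mxb (u (n + m).+1 - u (n + m)%N)) IH).
  rewrite (le_trans (lerD (hu _) (lexx _)))// exprS mulVKf//; lra.
have [|T sT TP] := @stab_complete _ _ f (fun n => smxP (u n)).
  move=> e e0; have [k kP] := half_pow_lt (divr_gt0 e0 (ltr0n _ 4)).
  have tel2 m : (k <= m)%N -> mxb (f m - f k) (e / 2).
    move=> km; rewrite -(subnKC km); apply: mxb_le (tel _ _).
    have : 0 <= (2^-1 : R) ^+ (k + (m - k)) by rewrite exprn_ge0// invr_ge0.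
    by move: kP; lra.
  exists k => n m kn km; rewrite (splitr e); apply: mxb_split (tel2 _ kn) _.
  exact/mxb_distC/tel2.
exists (StabCar sT) => e e0; have [N NP] := TP e e0; exists N => n Nn.
by apply: sc_norm_le; exact: NP.
Qed.

Fact sc_mulA : associative sc_mul.
Proof. by move=> x y z; apply: smx_inj; apply: mx_mulA; exact: smxP. Qed.
Fact sc_mulDl : left_distributive sc_mul +%R.
Proof. by move=> x y z; apply: smx_inj; apply: mx_mulDl; exact: smxP. Qed.
Fact sc_mulDr : right_distributive sc_mul +%R.
Proof. by move=> x y z; apply: smx_inj; apply: mx_mulDr; exact: smxP. Qed.
Fact sc_mulZl (k : R[i]) x y : sc_mul (k *: x) y = k *: sc_mul x y.
Proof. by apply: smx_inj; apply: mx_mulZl; exact: smxP. Qed.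
Fact sc_mulZr (k : R[i]) x y : sc_mul x (k *: y) = k *: sc_mul x y.
Proof. by apply: smx_inj; apply: mx_mulZr; exact: smxP. Qed.
Fact sc_starK : involutive sc_star.
Proof. by move=> x; apply: smx_inj; apply: mx_ext => i j; exact: cstarK. Qed.
Fact sc_starD : {morph sc_star : x y / x + y}.
Proof. by move=> x y; apply: smx_inj; apply: mx_ext => i j; exact: cstarD. Qed.
Fact sc_starZ (k : R[i]) x : sc_star (k *: x) = conjc k *: sc_star x.
Proof. by apply: smx_inj; apply: mx_ext => i j; exact: cstarZ. Qed.
Fact sc_starM x y : sc_star (sc_mul x y) = sc_mul (sc_star y) (sc_star x).
Proof. by apply: smx_inj; apply: mx_mul_adj; exact: smxP. Qed.
Fact sc_normM x y : sc_norm (sc_mul x y) <= sc_norm x * sc_norm y.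
Proof. by apply: sc_norm_le; apply: mxb_mul; (exact: smxP || exact: smx_mxb). Qed.
Fact sc_normC x : sc_norm x ^+ 2 <= sc_norm (sc_mul (sc_star x) x).
Proof.
have /sc_norm_le h := mxb_star_mul (smxP x) (smx_mxb (sc_mul (sc_star x) x)).
rewrite -[leRHS]sqr_sqrtr ?mxn_ge0// ler_pXn2r ?nnegrE ?sqrtr_ge0 ?mxn_ge0//.
Qed.

Definition stab_data : cstar_data R := CStarData
  sc_normD sc_normZ sc_norm0 sc_complete sc_mulA sc_mulDl sc_mulDr sc_mulZl sc_mulZr
  sc_starK sc_starD sc_starZ sc_starM sc_normM sc_normC.

Definition stabT : cstarAlgType R := cs_of stab_data.

Definition mxs (x : stabT) : infmx B := smx x.
Definition smk T (sT : stab B T) : stabT := StabCar sT.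

Lemma mxs_inj (x y : stabT) : mxs x = mxs y -> x = y.
Proof. exact: smx_inj. Qed.
Lemma mxsK T (sT : stab B T) : mxs (smk sT) = T. Proof. by []. Qed.
Lemma mxs_stab (x : stabT) : stab B (mxs x). Proof. exact: smxP. Qed.
Lemma mxsM (x y : stabT) : mxs (cmul x y) = mx_mul (mxs x) (mxs y). Proof. by []. Qed.
Lemma mxs_star (x : stabT) : mxs (cstar x) = mx_adj (mxs x). Proof. by []. Qed.
Lemma mxsD (x y : stabT) : mxs (x + y) = mxs x + mxs y. Proof. by []. Qed.
Lemma mxsB (x y : stabT) : mxs (x - y) = mxs x - mxs y. Proof. by []. Qed.
Lemma mxsZ (k : R[i]) (x : stabT) : mxs (k *: x) = k *: mxs x. Proof. by []. Qed.
Lemma mxs_norm (x : stabT) : rnorm x = mxn (mxs x). Proof. by []. Qed.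
Lemma mxs_mxb (x : stabT) : mxb (mxs x) (rnorm x). Proof. exact: smx_mxb. Qed.
Lemma mxs_le (x : stabT) c : mxb (mxs x) c -> rnorm x <= c. Proof. exact: mxn_le. Qed.

End StabT.

(* The range projections of the isometries [sl false] and [sl true] are
   orthogonal; they embed D (+) D in D. *)
Record stable_str (R : realType) (D : cstarAlgType R) := StableStr {
  sl : bool -> D -> D ;
  slD : forall j, {morph sl j : x y / x + y} ;
  slZ : forall j (k : R[i]) x, sl j (k *: x) = k *: sl j x ;
  slM : forall j x y, sl j (cmul x y) = cmul (sl j x) y ;
  slI : forall i j x y, cmul (cstar (sl i x)) (sl j y) = if i == j then cmul (cstar x) y else 0
}.

Section StabStable.
Context (R : realType) (B : cstarAlgType R).
Local Notation toC := (real_complex R).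
Implicit Types (n m : nat) (S T W : infmx B) (c d e : R) (v w : nat -> B) (j : bool).

Definition spl (V : zmodType) j (w : nat -> V) : nat -> V :=
  fun i => if odd i == j then w i./2 else 0.

Lemma big_double (V : nmodType) n (G : nat -> V) :
  \sum_(i < n.*2) G i = \sum_(h < n) (G h.*2 + G h.*2.+1).
Proof.
elim: n => [|n IH]; first by rewrite !big_ord0.
by rewrite doubleS !big_ord_recr/= IH addrA.
Qed.

Lemma spl_norm n j w : vec_norm n.*2 (spl j w) = vec_norm n w.
Proof.
congr (Num.sqrt (rnorm _)).
rewrite (big_double n (fun i => cmul (cstar (spl j w i)) (spl j w i))).
apply: eq_bigr => h _; rewrite /spl /= !odd_double /= uphalf_double doubleK.
by case: j; rewrite /= !(cmul0r, add0r, addr0).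
Qed.

Definition Lmx j T : infmx B := fun i k => spl j (fun h => T h k) i.

Lemma mxb_Lmx j T c : mxb T c -> mxb (Lmx j T) c.
Proof.
move=> Tc; apply: app_mxb => [|n v]; first by case: Tc.
rewrite (_ : mx_app n (Lmx j T) v = spl j (mx_app n T v)).
  rewrite (le_trans (vec_norm_mono _ (_ : (n <= n.*2)%N))) ?spl_norm ?mxb_app//.
  by rewrite -addnn leq_addr.
apply/funext => i; rewrite /mx_app /Lmx /spl; case: ifP => _//.
by rewrite big1// => k _; rewrite cmul0l.
Qed.

Lemma LmxB j S T : Lmx j (S - T) = Lmx j S - Lmx j T.
Proof.
by apply: mx_ext => i k; rewrite mxBE /Lmx /spl; case: ifP; rewrite ?subr0.
Qed.

Lemma stab_Lmx j T : stab B T -> stab B (Lmx j T).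
Proof.
move=> sT; apply: stab_approx => e e0; have [N /(_ N (leqnn _)) h] := stab_near sT e0.
exists N.*2, (Lmx j (mx_trunc N T)); split; last by rewrite -LmxB; exact: mxb_Lmx.
apply: mx_ext => i k; rewrite /Lmx /spl /mx_trunc.
have [kN|kN] := ltnP k N; last by rewrite !andbF !if_same.
rewrite (leq_trans kN) -?addnn ?leq_addr// !andbT; case: ifP => // /negbT.
rewrite -leqNgt => /half_leq; rewrite addnn doubleK => iN.
by rewrite ltnNge iN if_same.
Qed.

Lemma Lmx_mul j S T : stab B S -> stab B T -> Lmx j (mx_mul S T) = mx_mul (Lmx j S) T.
Proof.
move=> sS sT; apply/esym/mx_mul_uniq => //; first exact: stab_Lmx.
move=> e /(mx_mul_near sS sT)[N NP]; exists N => n Nn.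
rewrite (_ : pprod n (Lmx j S) T = Lmx j (pprod n S T)).
  by rewrite -LmxB; apply: mxb_Lmx; exact: NP.
apply: mx_ext => i k; rewrite /Lmx /spl /pprod; case: ifP => _//.
by rewrite big1// => l _; rewrite cmul0l.
Qed.

Lemma Lmx_ip i j S T : stab B S -> stab B T ->
  mx_mul (mx_adj (Lmx i S)) (Lmx j T) = if i == j then mx_mul (mx_adj S) T else 0.
Proof.
move=> sS sT; have sS' := stab_adj sS.
have E n : pprod n.*2 (mx_adj (Lmx i S)) (Lmx j T) = if i == j then pprod n (mx_adj S) T else 0.
  apply: mx_ext => a b; rewrite {1}/pprod.
  rewrite (big_double n (fun k => cmul (mx_adj (Lmx i S) a k) (Lmx j T k b))).
  transitivity (\sum_(h < n) if i == j then cmul (mx_adj S a h) (T h b) else 0).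
    apply: eq_bigr => h _; rewrite /mx_adj /Lmx /spl /= !odd_double/= uphalf_double doubleK.
    by case: i j => -[]; rewrite /= ?cstar0 ?cmul0l ?cmul0r ?addr0 ?add0r.
  by case: eqP => // _; rewrite big1.
have nn n : (n <= n.*2)%N by rewrite -addnn leq_addr.
have sL1 := stab_adj (stab_Lmx i sS); have sL2 := stab_Lmx j sT.
apply: mxb_eq => e e0; have e2 := divr_gt0 e0 (ltr0n _ 2).
have [N1 h1] := mx_mul_near sL1 sL2 e2; have [N2 h2] := mx_mul_near sS' sT e2.
pose n := maxn N1 N2; rewrite (splitr e).
apply: (@mxb_split _ _ _ _ (pprod n.*2 (mx_adj (Lmx i S)) (Lmx j T))).
  by apply: h1; rewrite (leq_trans _ (nn _))// leq_maxl.
rewrite E; case: eqP => _; last by rewrite subrr; apply: mxb_le (mxb0 _); exact: ltW.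
by apply/mxb_distC/h2; rewrite leq_maxr.
Qed.

Definition stabL j (x : stabT B) : stabT B := smk (stab_Lmx j (mxs_stab x)).

Fact stabLD j : {morph stabL j : x y / x + y}.
Proof.
move=> x y; apply: mxs_inj; apply: mx_ext => i k; rewrite mxsD mxDE !mxsK /Lmx /spl.
by case: ifP; rewrite ?addr0.
Qed.

Fact stabLZ j (k : R[i]) x : stabL j (k *: x) = k *: stabL j x.
Proof.
apply: mxs_inj; apply: mx_ext => i l; rewrite mxsZ mxZE !mxsK /Lmx /spl.
by case: ifP; rewrite ?scaler0.
Qed.

Fact stabLM j x y : stabL j (cmul x y) = cmul (stabL j x) y.
Proof. by apply: mxs_inj; rewrite mxsM !mxsK; apply: Lmx_mul; exact: mxs_stab. Qed.

Fact stabLI i j x y :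
  cmul (cstar (stabL i x)) (stabL j y) = if i == j then cmul (cstar x) y else 0.
Proof.
apply: mxs_inj; rewrite mxsM mxs_star Lmx_ip; [|exact: mxs_stab..].
by case: eqP.
Qed.

Definition stab_stable : stable_str (stabT B) := StableStr stabLD stabLZ stabLM stabLI.

Lemma mx_dsumE (a b : stabT B) :
  mx_dsum (mxs a) (mxs b) = mxs (stabL false (cstar (stabL false (cstar a)))
                               + stabL true (cstar (stabL true (cstar b)))).
Proof.
apply: mx_ext => i k; rewrite -[RHS]/(Lmx false (mx_adj (Lmx false (mx_adj (mxs a)))) i k
  + Lmx true (mx_adj (Lmx true (mx_adj (mxs b)))) i k) /Lmx /spl /mx_adj /mx_dsum.
by case: (odd i); case: (odd k); rewrite /= ?cstarK ?cstar0 ?addr0 ?add0r.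
Qed.

End StabStable.

(** * The Cuntz semigroup of a stable C*-algebra *)

Section Orthogonal.
Context (R : realType) (U : ucstarAlgType R).
Local Notation toC := (real_complex R).
Implicit Types (u v p q : U) (f : R -> R) (P Q : {poly R}).

Lemma ph_orth p q Q : p * q = 0 -> q * p = 0 ->
  ph (p + q) (Q * 'X) = ph p (Q * 'X) + ph q (Q * 'X).
Proof.
move=> pq qp; elim/poly_ind: Q => [|Q c IH]; first by rewrite !mul0r !ph0 addr0.
rewrite !phM !phX !phD !phC IH !phM !phX mulrDl !mulrDr !mulrDl.
rewrite -[_ * p * q]mulrA pq -[_ * q * p]mulrA qp !mulr0.
by rewrite !(addr0, add0r) addrACA.
Qed.

Lemma fc_orthD p q f : npos p -> npos q -> p * q = 0 -> appr f -> f 0 = 0 ->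
  fc (p + q) f = fc p f + fc q f.
Proof.
move=> np nq pq af f0; have qp : q * p = 0.
  by rewrite -[LHS]stK stM (npos_sa np) (npos_sa nq) pq st0.
have npq := nposD np nq; apply/esym/fc_unique => // e e0.
pose r := nm p + nm q + 1; have e4 : 0 < e / 4 by rewrite divr_gt0.
have r0 : 0 < r by rewrite ltr_wpDl// addr_ge0// nm_ge0.
have pr : nm p <= r by rewrite /r -addrA lerDl addr_ge0// nm_ge0.
have qr : nm q <= r by rewrite /r addrAC lerDr addr_ge0// nm_ge0.
have pqr : nm (p + q) <= r by rewrite (le_trans (nmD _ _))// lerDl.
have [P PP] := af r _ r0 e4.
pose P' := P - (P.[0])%:P; have P'P t : 0 <= t -> t <= r -> `|P'.[t] - f t| <= e / 2.
  move=> t0 tr; rewrite hornerD hornerN hornerC -addrAC addrAC.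
  rewrite (_ : P.[t] - P.[0] - f t = (P.[t] - f t) - (P.[0] - f 0)); last by rewrite f0; ring.
  rewrite (le_trans (ler_normB _ _))// (_ : e / 2 = e / 4 + e / 4); last by field.
  by rewrite lerD// PP// ltW.
have [Q EQ] : exists Q, P' = Q * 'X.
  rewrite /P'; elim/poly_ind: (P) => [|Q c _]; first by exists 0; rewrite horner0 mul0r subrr.
  by exists Q; rewrite hornerMXaddC mulr0 add0r addrK.
exists P'; split=> [t t0 tpq|].
  by rewrite (le_trans (P'P _ t0 (le_trans tpq pqr)))// ler_pdivrMr// ler_peMr ?(ltW e0)// ler1n.
rewrite EQ ph_orth// -EQ opprD addrACA (splitr e) (le_trans (nmD _ _))// lerD//.
  by apply: (fc_approx (r := r)).
by apply: (fc_approx (r := r)).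
Qed.

Lemma fc_at0 f : appr f -> fc (0 : U) f = sc U (f 0).
Proof.
move=> af; have n0 := npos0 U; rewrite -(fc_cst _ n0); apply: fc_ext => //; first exact: appr_cst.
by move=> t t0; rewrite nm0 => t1; congr f; apply/eqP; rewrite eq_le t0 t1.
Qed.

Lemma fc_orth0 p q f : npos p -> appr f -> f 0 = 0 -> q * p = 0 -> q * fc p f = 0.
Proof.
move=> np af f0 qp; rewrite (@fc_intertw _ _ q p 0)//; last 2 first.
- exact: npos0.
- by rewrite qp mul0r.
by rewrite fc_at0// f0 sc0 mul0r.
Qed.

Lemma npos_orthC p q : npos p -> npos q -> p * q = 0 -> q * p = 0.
Proof. by move=> np nq pq; rewrite -[LHS]stK stM (npos_sa np) (npos_sa nq) pq st0. Qed.

Lemma cut_orthD (c : R) p q : npos p -> npos q -> p * q = 0 -> 0 <= c ->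
  cut c (p + q) = cut c p + cut c q.
Proof.
move=> np nq pq c0; apply: fc_orthD => //; first exact: appr_cutf.
by rewrite cutf_lo.
Qed.

Lemma cut_orth (c : R) p q : npos p -> 0 <= c -> q * p = 0 -> q * cut c p = 0.
Proof. by move=> np c0; apply: fc_orth0 => //; [exact: appr_cutf|rewrite cutf_lo]. Qed.

Lemma ramp_unit p (e : R) : npos p -> 0 < e -> exists2 t : R, 0 < t &
  nm (fc p (ramp 0 t) * p * fc p (ramp 0 t) - p) <= e.
Proof.
move=> np e0; exists (e / 2); first exact: divr_gt0.
have t0 : 0 < e / 2 by exact: divr_gt0.
have ar := appr_ramp t0; have ai := @appr_id R.
have ari := apprM ar ai; have arir := apprM ari ar.
have -> : fc p (ramp 0 (e / 2)) * p * fc p (ramp 0 (e / 2)) - p =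
    fc p (fun t => ramp 0 (e / 2) t * t * ramp 0 (e / 2) t - t).
  by rewrite fcB// fcM// fcM// fc_id.
apply: fc_norm => //.
  by apply: apprB (@appr_id R); apply: apprM => //; apply: apprM => //; exact: appr_id.
move=> t tge _; have [te|te] := leP (e / 2) t.
  by rewrite ramp_hi// mul1r mulr1 subrr normr0 ltW.
have r0 := ramp_ge0 0 (e / 2) t; have r1 := ramp_le1 0 (e / 2) t.
rewrite distrC ger0_norm; last first.
  rewrite subr_ge0 -mulrA mulrCA ler_piMr//.
  by rewrite (le_trans (ler_wpM2l r0 r1))// mulr1.
by rewrite (@le_trans _ _ t)// ?lerBlDr ?lerDl ?mulr_ge0//; lra.
Qed.

(** The witnesses v and w are unrelated. Composed with approximate units g of p' and h of q', each
    of which annihilates the other summand, they can be added, and all cross terms vanish. *)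
Lemma cle_orth p q p' q' : npos p' -> npos q' -> p' * q' = 0 ->
  cle p p' -> cle q q' -> cle (p + q) (p' + q').
Proof.
move=> np nq pq lep leq e e0; have qp := npos_orthC np nq pq.
have e4 : 0 < e / 4 by rewrite divr_gt0.
have [v vP] := lep _ e4; have [w wP] := leq _ e4.
have small (z : U) : 0 < e / 4 / (nm z * nm z + 1).
  by rewrite divr_gt0// ltr_wpDl// mulr_ge0// nm_ge0.
have [t t0 tP] := ramp_unit np (small v); have [s s0 sP] := ramp_unit nq (small w).
have at_ := appr_ramp t0; have as_ := appr_ramp s0.
set g := fc p' _ in tP; set h := fc q' _ in sP.
have gs : st g = g by exact: fc_sa.
have hs : st h = h by exact: fc_sa.
have gq : q' * g = 0 by apply: fc_orth0 => //; rewrite ramp_lo.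
have hp : p' * h = 0 by apply: fc_orth0 => //; rewrite ramp_lo.
have gq' : g * q' = 0.
  by rewrite -[LHS]stK stM gs (npos_sa nq) gq st0.
have hp' : h * p' = 0 by rewrite -[LHS]stK stM hs (npos_sa np) hp st0.
exists (v * g + w * h).
have -> : (v * g + w * h) * (p' + q') * st (v * g + w * h) =
    v * (g * p' * g) * st v + w * (h * q' * h) * st w.
  have E1 : (v * g + w * h) * (p' + q') = v * g * p' + w * h * q'.
    rewrite mulrDr !mulrDl -[w * h * p']mulrA hp' mulr0 addr0.
    by rewrite -[v * g * q']mulrA gq' mulr0 add0r.
  rewrite E1 stD !stM gs hs mulrDr !mulrDl !mulrA.
  have E3 : v * g * p' * h = 0 by rewrite -mulrA hp mulr0.
  have E4 : w * h * q' * g = 0 by rewrite -mulrA gq mulr0.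
  by rewrite E3 E4 !mul0r addr0 add0r.
have aux (z x x' : U) : nm (x' - x) <= e / 4 / (nm z * nm z + 1) -> nm (z * x' * st z - z * x * st z) <= e / 4.
  move=> xx; rewrite -mulrBl -mulrBr (le_trans (nmM _ _))// nm_st.
  rewrite (le_trans (ler_wpM2r (nm_ge0 _) (nmM _ _)))// mulrAC.
  by rewrite (le_trans (ler_wpM2l _ xx))// ?mulr_ge0 ?nm_ge0// small_mul ?mulr_ge0 ?nm_ge0// ltW.
rewrite opprD addrACA (le_trans (nmD _ _))// (_ : e = e / 2 + e / 2); last by field.
rewrite lerD//.
  rewrite (le_trans (ndistD (v * p' * st v) _ _))// (_ : e / 2 = e / 4 + e / 4); last by field.
  by rewrite lerD// aux.
rewrite (le_trans (ndistD (w * q' * st w) _ _))// (_ : e / 2 = e / 4 + e / 4); last by field.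
by rewrite lerD// aux.
Qed.

End Orthogonal.

Section CuMonoid.
Context (R : realType) (D : cstarAlgType R) (s : stable_str D).
Local Notation toC := (real_complex R).
Local Notation U := (unitz D).
Implicit Types (u v w p q : U) (c d e : R) (j : bool).

(** The positive elements of D, seen in its unitization, where the functional calculus is
    available. *)
Definition pB u := npos u /\ inB u.

Lemma pB_npos u : pB u -> npos u. Proof. by case. Qed.
Lemma pB_inB u : pB u -> inB u. Proof. by case. Qed.
Lemma pB0 : pB 0. Proof. by split; first exact: npos0. Qed.
Lemma pBD u v : pB u -> pB v -> pB (u + v).
Proof. by move=> [a b] [a' b']; split; [exact: nposD|exact: inBD]. Qed.
Lemma pBZ c u : 0 <= c -> pB u -> pB (toC c *: u).
Proof. by move=> c0 [a b]; split; [exact: nposZ|exact: inBZ]. Qed.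
Lemma pB_fc u (f : R -> R) : pB u -> appr f -> f 0 = 0 ->
  (forall t, 0 <= t -> 0 <= f t) -> pB (fc u f).
Proof.
move=> [a b] af f0 fp; split; last exact: inB_fc.
by apply: fc_npos => // t t0 _; exact: fp.
Qed.
Lemma pB_cut c u : 0 <= c -> pB u -> pB (cut c u).
Proof.
by move=> c0 pu; apply: pB_fc => //; [exact: appr_cutf|rewrite cutf_lo|move=> t _; exact: cutf_ge0].
Qed.
Lemma pB_kv z : inB z -> pB (st z * z).
Proof. by move=> bz; split; [exact: npos_kv|exact: inB_mull]. Qed.
Lemma pB_vk z : inB z -> pB (z * st z).
Proof. by move=> bz; rewrite -{1}[z]stK; apply: pB_kv; exact: inB_st. Qed.
Lemma pB_sqrt u : pB u -> exists h, [/\ pB h, h * h = u & sa h].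
Proof.
move=> [a b]; have [h [nh hh _]] := npos_sqrt a; exists h; split=> //; last exact: npos_sa.
split=> //; have /eqP : h.2 * h.2 = 0 by have := congr1 snd hh; rewrite b.
by rewrite mulf_eq0 orbb => /eqP.
Qed.

(** The conjugate of u by the j-th isometry. Since only left multiplication by the isometry is
    given, the right factor is obtained through the adjoint. *)
Definition io j u : U := inj (sl s j (cstar (sl s j (cstar u.1)))).

Lemma ioD j u v : io j (u + v) = io j u + io j v.
Proof. by rewrite /io -injD -slD -cstarD -slD -cstarD. Qed.

Lemma ioZ j c u : io j (toC c *: u) = toC c *: io j u.
Proof. by rewrite /io /= cstarZr slZ cstarZr slZ injZ. Qed.

Lemma io0 j : io j 0 = 0.
Proof. by have := ioZ j 0 0; rewrite !scale0r. Qed.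

Definition isl j u : U := inj (sl s j u.1).

Lemma isl_inB j u : inB (isl j u). Proof. exact: inB_inj. Qed.

Lemma islI i j u v : inB u -> inB v -> st (isl i u) * isl j v = if i == j then st u * v else 0.
Proof.
move=> /inBP -> /inBP ->; rewrite /isl -inj_st -injM slI.
by case: eqP => // _; rewrite injM inj_st.
Qed.

Lemma islM j u v : inB u -> inB v -> isl j (u * v) = isl j u * v.
Proof. by move=> /inBP -> /inBP ->; rewrite -injM /isl /= slM injM. Qed.

Lemma ioM j u v : inB u -> inB v -> io j (u * v) = isl j u * st (isl j (st v)).
Proof.
move=> /inBP -> /inBP ->; rewrite -injM -inj_st /io /isl /= cstarM slM cstarM cstarK slM injM.
by rewrite -inj_st.
Qed.

Lemma io_sq j h : inB h -> sa h -> io j (h * h) = isl j h * st (isl j h).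
Proof. by move=> bh sh; rewrite ioM// sh. Qed.

Lemma pB_io j u : pB u -> pB (io j u).
Proof.
move=> pu; have [h [ph <- sh]] := pB_sqrt pu.
by rewrite io_sq//; [apply: pB_vk; exact: isl_inB|exact: pB_inB].
Qed.

(** With [io_sq] this exhibits u = h^2 and its copy [io j u] as the two products of one element with
    its adjoint, so they are equivalent, even after any cut. *)
Lemma io_kv j h : inB h -> sa h -> st (isl j h) * isl j h = h * h.
Proof. by move=> bh sh; rewrite islI// eqxx sh. Qed.

Lemma io_cutl j u c : pB u -> 0 < c -> cle (cut c (io j u)) (cut c u).
Proof.
move=> pu c0; have [h [ph <- sh]] := pB_sqrt pu; have bh := pB_inB ph.
rewrite io_sq// -(io_kv j bh sh) -{1}[isl j h]stK.
have := cut_stC (st (isl j h)) c0; rewrite !stK.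
exact.
Qed.

Lemma io_cutr j u c : pB u -> 0 < c -> cle (cut c u) (cut c (io j u)).
Proof.
move=> pu c0; have [h [ph <- sh]] := pB_sqrt pu; have bh := pB_inB ph.
by rewrite io_sq// -(io_kv j bh sh); exact: cut_stC.
Qed.

Lemma io_clel j u : pB u -> cle (io j u) u.
Proof.
move=> pu; have [h [ph <- sh]] := pB_sqrt pu; have bh := pB_inB ph.
by rewrite io_sq// -(io_kv j bh sh); have := cle_stC (st (isl j h)); rewrite stK.
Qed.

Lemma io_cler j u : pB u -> cle u (io j u).
Proof.
move=> pu; have [h [ph <- sh]] := pB_sqrt pu; have bh := pB_inB ph.
by rewrite io_sq// -(io_kv j bh sh); exact: cle_stC.
Qed.

Lemma io_orth i j u v : pB u -> pB v -> i != j -> io i u * io j v = 0.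
Proof.
move=> pu pv ij; have [h [ph <- sh]] := pB_sqrt pu; have [k [pk <- sk]] := pB_sqrt pv.
have bh := pB_inB ph; have bk := pB_inB pk.
have -> : io i (h * h) = isl i h * st (isl i h) by rewrite io_sq.
rewrite io_sq// mulrA -[_ * _ * isl j k]mulrA islI// (negbTE ij).
by rewrite mulr0 mul0r.
Qed.

Lemma io_orth0 j u v : pB u -> pB v -> u * v = 0 -> io j u * io j v = 0.
Proof.
move=> pu pv uv.
have su := npos_sa (pB_npos pu); have sv := npos_sa (pB_npos pv).
have bu := pB_inB pu; have bv := pB_inB pv.
have suE : st (io j u) = io j u by exact: npos_sa (pB_npos (pB_io j pu)).
rewrite -suE /io -inj_st -injM slI eqxx cstarK.
suff E : isl j u * st (isl j v) = 0.
  move: E; rewrite /isl -inj_st -injM => /inj_inj E.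
  have uE : cstar u.1 = u.1 by have := congr1 fst su.
  have vE : cstar v.1 = v.1 by have := congr1 fst sv.
  by rewrite uE vE E.
set W := isl j u * _; suff : nm (st W) = 0.
  by move=> /nm0_eq0 W0; rewrite -[W]stK W0 st0.
apply/eqP; rewrite -sqrf_eq0 -nmC stK /W stM stK.
rewrite -mulrA [st (isl j v) * _]mulrA islI// eqxx sv.
have -> : isl j u * (v * v * st (isl j u)) = isl j (u * v) * v * st (isl j u).
  by rewrite islM// !mulrA.
have -> : isl j (u * v) = 0.
  rewrite uv /isl -[(0 : U).1]/(0 : D) (_ : sl s j 0 = 0) ?inj0//.
  by have := slZ s j 0 0; rewrite !scale0r.
by rewrite !mul0r nm0.
Qed.

End CuMonoid.

(** * Direct sums and Cuntz classes *)

Section CuMonoid.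
Context (R : realType) (D : cstarAlgType R) (s : stable_str D).
Local Notation toC := (real_complex R).
Local Notation U := (unitz D).
Local Notation io := (io s).
Implicit Types (u v w p q : U) (c d e : R) (j : bool).

Definition ds u v := io false u + io true v.

Lemma pB_ds u v : pB u -> pB v -> pB (ds u v).
Proof. by move=> pu pv; apply: pBD; exact: pB_io. Qed.

Lemma ds_orth u v : pB u -> pB v -> io false u * io true v = 0.
Proof. by move=> pu pv; exact: io_orth. Qed.

Lemma ds_mono u v u' v' : pB u' -> pB v' -> pB u -> pB v ->
  cle u u' -> cle v v' -> cle (ds u v) (ds u' v').
Proof.
move=> pu' pv' pu pv uu vv; apply: cle_orth.
- exact: pB_npos (pB_io _ _ _).
- exact: pB_npos (pB_io _ _ _).
- exact: ds_orth.
- by apply: cle_trans (io_clel _ _ pu) _; apply: cle_trans uu _; exact: io_cler.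
- by apply: cle_trans (io_clel _ _ pv) _; apply: cle_trans vv _; exact: io_cler.
Qed.

Lemma add_ds u v : pB u -> pB v -> cle (u + v) (ds u v).
Proof.
move=> pu pv; apply: cle_orth; [exact: pB_npos (pB_io _ _ _)..|exact: ds_orth| |]; exact: io_cler.
Qed.

Lemma ds_add u v : pB u -> pB v -> u * v = 0 -> cle (ds u v) (u + v).
Proof.
by move=> pu pv uv; apply: cle_orth => //; (exact: pB_npos || exact: io_clel).
Qed.

Lemma ds_C u v : pB u -> pB v -> cle (ds u v) (ds v u).
Proof.
move=> pu pv; rewrite /ds [io false v + _]addrC; apply: cle_orth.
- exact: pB_npos (pB_io _ _ _).
- exact: pB_npos (pB_io _ _ _).
- exact: io_orth.
- by apply: cle_trans (io_clel _ _ pu) _; exact: io_cler.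
- by apply: cle_trans (io_clel _ _ pv) _; exact: io_cler.
Qed.

Lemma ds_A u v w : pB u -> pB v -> pB w -> cle (ds u (ds v w)) (ds (ds u v) w).
Proof.
move=> pu pv pw; have i0 := pB_io s false pu; have i1 := pB_io s false pv; have i2 := pB_io s true pw.
have i3 := pB_io s true i1; have n0 := pB_io s false i0; have i4 := pB_io s true pv.
have n1 := pB_io s false i4.
have -> : ds (ds u v) w = io false (io false u) + (io false (io true v) + io true w).
  by rewrite /ds ioD addrA.
apply: cle_orth.
- exact: pB_npos.
- exact: pB_npos (pBD _ _).
- rewrite mulrDr [io false (io false u) * io true w]io_orth// addr0.
  by apply: io_orth0 => //; exact: io_orth.
- exact: io_cler.
- apply: cle_trans (io_clel _ _ (pB_ds pv pw)) _; apply: cle_orth.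
  + exact: pB_npos.
  + exact: pB_npos.
  + exact: io_orth.
  + apply: cle_trans (io_clel _ _ pv) _; apply: cle_trans (io_cler _ _ i4).
    exact: io_cler.
  + exact: cle_refl.
Qed.

Lemma ds_cut u v c : pB u -> pB v -> 0 < c ->
  cle (cut c (ds u v)) (ds (cut c u) (cut c v)) /\ cle (ds (cut c u) (cut c v)) (cut c (ds u v)).
Proof.
move=> pu pv c0; have c0' := ltW c0; have [pi pj] := (pB_io s false pu, pB_io s true pv).
have [pcu pcv] := (pB_cut c0' pu, pB_cut c0' pv).
rewrite /ds cut_orthD//; [|exact: pB_npos|exact: pB_npos|exact: io_orth].
split; apply: cle_orth.
- exact: pB_npos (pB_io _ _ _).
- exact: pB_npos (pB_io _ _ _).
- exact: io_orth.
- by apply: cle_trans (io_cutl _ _ pu c0) _; exact: io_cler.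
- by apply: cle_trans (io_cutl _ _ pv c0) _; exact: io_cler.
- exact: pB_npos (pB_cut _ _).
- exact: pB_npos (pB_cut _ _).
- apply: cut_orth => //; first exact: pB_npos.
  apply: npos_orthC; [exact: pB_npos|exact: pB_npos (pB_cut _ _)|].
  by apply: cut_orth => //; [exact: pB_npos|exact: io_orth].
- by apply: cle_trans (io_clel _ _ pcu) _; exact: io_cutr.
- by apply: cle_trans (io_clel _ _ pcv) _; exact: io_cutr.
Qed.

Definition eqvU u v := [/\ pB u, pB v, cle u v & cle v u].

Definition nrmU u := if `[< pB u >] then u else 0.
(** A class is encoded by a chosen representative, so that antisymmetry of the order becomes an
    equality; [nrmU] makes the choice total by sending elements outside [pB] to 0. *)
Definition repU u : U := xget 0 [set v | eqvU (nrmU u) v].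

Lemma pB_nrm u : pB (nrmU u).
Proof. by rewrite /nrmU; case: asboolP => // _; exact: pB0. Qed.

Lemma nrm_id u : pB u -> nrmU u = u.
Proof. by rewrite /nrmU; case: asboolP. Qed.

Lemma repUP u : eqvU (nrmU u) (repU u).
Proof.
apply: (xgetPex (0 : U)); exists (nrmU u).
by split; (exact: pB_nrm || exact: cle_refl).
Qed.

Lemma repU_eq u v : eqvU u v -> repU u = repU v.
Proof.
move=> [pu pv uv vu]; rewrite /repU !nrm_id//; congr xget.
apply/seteqP; split=> w [_ pw uw wu]; (split; [by []|exact: pw|exact: cle_trans uw|]).
  exact: cle_trans uv.
exact: cle_trans vu.
Qed.

Lemma repUK u : repU (repU u) = repU u.
Proof.
have [pu pv uv vu] := repUP u; rewrite -(@repU_eq (nrmU u) (repU u))//.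
by rewrite /repU (nrm_id (pB_nrm u)).
Qed.

Record cu_raw := Cu0 { cuv0 : U ; cuvP0 : repU cuv0 = cuv0 }.
(* [s] is a phantom argument which determines the additive structure. *)
Definition cu := let _ := s in cu_raw.
Definition cuv (x : cu) : U := cuv0 x.
Lemma cuvP x : repU (cuv x) = cuv x. Proof. exact: cuvP0. Qed.
Fact cl_ex0 : exists f : U -> cu, forall u, cuv (f u) = repU u.
Proof. by exists (fun u => Cu0 (repUK u)). Qed.
(** Defined through an opaque existence statement, like [cule] below, so that conversion does not
    open the choice of representatives. *)
Definition cl : U -> cu := sval (cid cl_ex0).
Lemma cuv_clE u : cuv (cl u) = repU u. Proof. exact: (svalP (cid cl_ex0)). Qed.

Lemma cu_inj (x y : cu) : cuv x = cuv y -> x = y.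
Proof.
case: x y => [a pa] [b pb]; rewrite /cuv /= => ab; subst b.
by congr Cu0; exact: Prop_irrelevance.
Qed.

Lemma pB_cuv x : pB (cuv x).
Proof. by rewrite -cuvP; have [] := repUP (cuv x). Qed.

Lemma cuvK x : cl (cuv x) = x. Proof. by apply: cu_inj; rewrite cuv_clE; exact: cuvP. Qed.

Lemma cuv_cl u : pB u -> eqvU u (cuv (cl u)).
Proof. by move=> pu; have := repUP u; rewrite nrm_id// cuv_clE. Qed.

Lemma cl_ex x : exists2 u, pB u & x = cl u.
Proof. by exists (cuv x); [exact: pB_cuv|rewrite cuvK]. Qed.

Fact cule_ex : exists r : cu -> cu -> Prop, forall x y, r x y <-> cle (cuv x) (cuv y).
Proof. by exists (fun x y => cle (cuv x) (cuv y)). Qed.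
Definition cule : cu -> cu -> Prop := sval (cid cule_ex).
Lemma culeE x y : cule x y <-> cle (cuv x) (cuv y). Proof. exact: (svalP (cid cule_ex)). Qed.
Definition cuadd x y := cl (ds (cuv x) (cuv y)).

Lemma cule_cl u v : pB u -> pB v -> cule (cl u) (cl v) <-> cle u v.
Proof.
move=> pu pv; have [_ _ a b] := cuv_cl pu; have [_ _ c d] := cuv_cl pv.
rewrite culeE; split=> h; first by apply: cle_trans a _; apply: cle_trans h _.
by apply: cle_trans b _; apply: cle_trans h _.
Qed.

Lemma cule_refl x : cule x x. Proof. by apply/culeE; exact: cle_refl. Qed.
Lemma cule_trans y x z : cule x y -> cule y z -> cule x z.
Proof. by rewrite !culeE; exact: cle_trans. Qed.
Lemma cule_anti x y : cule x y -> cule y x -> x = y.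
Proof.
rewrite !culeE => xy yx; apply: cu_inj; rewrite -cuvP -[RHS]cuvP; apply: repU_eq.
by split=> //; exact: pB_cuv.
Qed.

Lemma cl_ds u v : pB u -> pB v -> cl (ds u v) = cuadd (cl u) (cl v).
Proof.
move=> pu pv; have [_ pu' a b] := cuv_cl pu; have [_ pv' c d] := cuv_cl pv.
by apply: cule_anti; apply/cule_cl; (exact: pB_ds || exact: ds_mono).
Qed.

Fact cuaddC : commutative cuadd.
Proof.
move=> x y; have px := pB_cuv x; have py := pB_cuv y.
by apply: cule_anti; apply/cule_cl; (exact: pB_ds || exact: ds_C).
Qed.

Fact cuaddA : associative cuadd.
Proof.
suff le x y z : cule (cuadd x (cuadd y z)) (cuadd (cuadd x y) z).
  move=> x y z; apply: cule_anti => //.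
  rewrite cuaddC [cuadd x y]cuaddC [X in cule _ X]cuaddC [cuadd y z]cuaddC; exact: le.
have [u pu ->] := cl_ex x; have [v pv ->] := cl_ex y; have [w pw ->] := cl_ex z.
rewrite -!cl_ds//; [|exact: pB_ds..].
by apply/cule_cl; [apply: pB_ds => //; exact: pB_ds|apply: pB_ds => //; exact: pB_ds|exact: ds_A].
Qed.

Fact cuadd0 : left_id (cl 0) cuadd.
Proof.
move=> x; have [u pu ->] := cl_ex x; have p0 := @pB0 R D.
rewrite -cl_ds//; apply: cule_anti; apply/cule_cl; rewrite /ds ?io0 ?add0r//; try exact: pB_io.
  exact: io_clel.
exact: io_cler.
Qed.

HB.instance Definition _ := gen_eqMixin cu.
HB.instance Definition _ := gen_choiceMixin cu.
HB.instance Definition _ := GRing.isNmodule.Build cu cuaddA cuaddC cuadd0.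

Implicit Types x y z : cu.
Local Notation "x ⊑ y" := (cule x y) (at level 70).

Lemma cl0 : cl 0 = 0. Proof. by []. Qed.
Lemma cl_dsD u v : pB u -> pB v -> cl (ds u v) = cl u + cl v.
Proof. exact: cl_ds. Qed.

Lemma cuaddE x y : x + y = cl (ds (cuv x) (cuv y)). Proof. by []. Qed.

Lemma cule0 x : 0 ⊑ x.
Proof.
have [u pu ->] := cl_ex x; have p0 := @pB0 R D.
by rewrite -cl0; apply/cule_cl => //; exact: cle0.
Qed.

Lemma culeD x y x' y' : x ⊑ x' -> y ⊑ y' -> x + y ⊑ x' + y'.
Proof.
move=> xx yy; rewrite !cuaddE; apply/cule_cl; try exact: pB_ds (pB_cuv _) (pB_cuv _).
by apply: ds_mono; [exact: pB_cuv..|exact/culeE|exact/culeE].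
Qed.

Lemma culeDl x y : x ⊑ x + y.
Proof. by rewrite -{1}[x]addr0; apply: culeD (cule_refl _) (cule0 _). Qed.
Lemma culeDr x y : y ⊑ x + y. Proof. by rewrite addrC; exact: culeDl. Qed.

Lemma cule_mulrn n x y : x ⊑ y -> x *+ n ⊑ y *+ n.
Proof.
move=> xy; elim: n => [|n IH]; first exact: cule_refl.
by rewrite !mulrS; exact: culeD.
Qed.

Lemma cule_wmulrn n m x : (n <= m)%N -> x *+ n ⊑ x *+ m.
Proof. by move=> /subnKC <-; rewrite mulrnDr; exact: culeDl. Qed.

Lemma cl_addle u v : pB u -> pB v -> cl (u + v) ⊑ cl u + cl v.
Proof.
by move=> pu pv; rewrite -cl_dsD//; apply/cule_cl; [exact: pBD|exact: pB_ds|exact: add_ds].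
Qed.

Lemma cl_orth u v : pB u -> pB v -> u * v = 0 -> cl (u + v) = cl u + cl v.
Proof.
move=> pu pv uv; apply: cule_anti; first exact: cl_addle.
rewrite -cl_dsD//; apply/cule_cl; [exact: pB_ds|exact: pBD|exact: ds_add].
Qed.

Lemma cl_sumle (I : Type) (r : seq I) (P : pred I) (F : I -> U) :
  (forall i, P i -> pB (F i)) -> cl (\sum_(i <- r | P i) F i) ⊑ \sum_(i <- r | P i) cl (F i).
Proof.
move=> pF; have pS (r' : seq I) : pB (\sum_(i <- r' | P i) F i).
  by apply: big_ind => //; [exact: pB0|exact: pBD].
elim: r => [|i r IH]; first by rewrite !big_nil; exact: cule_refl.
rewrite !big_cons; case: ifP => Pi; last exact: IH.
by apply: cule_trans (cl_addle (pF _ Pi) (pS r)) _; exact: culeD (cule_refl _) IH.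
Qed.

Lemma cule_sum (I : Type) (r : seq I) (P : pred I) (F G : I -> cu) :
  (forall i, P i -> F i ⊑ G i) -> \sum_(i <- r | P i) F i ⊑ \sum_(i <- r | P i) G i.
Proof.
move=> FG; elim: r => [|i r IH]; first by rewrite !big_nil; exact: cule_refl.
by rewrite !big_cons; case: ifP => // Pi; apply: culeD => //; exact: FG.
Qed.

Definition cull x y := exists2 d : R, 0 < d & x ⊑ cl (cut d (cuv y)).

Lemma cl_cut_le u v : pB u -> pB v -> cl u ⊑ cl v -> forall c, 0 < c -> exists2 d : R, 0 < d &
  cl (cut c u) ⊑ cl (cut d v).
Proof.
move=> pu pv /cule_cl uv c c0.
have [d d0 dP] := cle_cut_ex (pB_npos pu) (pB_npos pv) (uv pu pv) c0.
by exists d => //; apply/cule_cl => //; exact: pB_cut (ltW _) _.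
Qed.

(** A comparison of representatives carries cut-downs to cut-downs by [cl_cut_le], so the choice
    hidden in [cull] only changes d. *)
Lemma cull_cl x v : pB v -> cull x (cl v) <-> exists2 d : R, 0 < d & x ⊑ cl (cut d v).
Proof.
move=> pv; have [_ pw vw wv] := cuv_cl pv; split=> -[d d0 h].
  have [|e e0 eP] := cl_cut_le pw pv _ d0; first exact/cule_cl.
  by exists e; [exact: e0|exact: cule_trans eP].
have [|e e0 eP] := cl_cut_le pv pw _ d0; first exact/cule_cl.
by exists e; [exact: e0|exact: cule_trans eP].
Qed.

Lemma cl_cut u c : pB u -> 0 <= c -> cl (cut c u) ⊑ cl u.
Proof.
move=> pu c0; apply/cule_cl => //; first exact: pB_cut.
exact: cut_cle (pB_npos pu) c0.
Qed.

Lemma cl_cut_mono u c d : pB u -> 0 <= c -> c <= d -> cl (cut d u) ⊑ cl (cut c u).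
Proof.
move=> pu c0 cd; apply/cule_cl; [exact: pB_cut (le_trans c0 cd) _|exact: pB_cut|].
exact: cut_mono (pB_npos pu) c0 cd.
Qed.

Lemma cull_cut u c : pB u -> 0 < c -> cull (cl (cut c u)) (cl u).
Proof. by move=> pu c0; apply/cull_cl => //; exists c => //; exact: cule_refl. Qed.

Lemma cullW x y : cull x y -> x ⊑ y.
Proof.
by move=> [d d0 h]; apply: cule_trans h _; rewrite -{2}[y]cuvK; apply: cl_cut (pB_cuv _) (ltW d0).
Qed.

Lemma cull_ler y x z : cull x y -> y ⊑ z -> cull x z.
Proof.
move=> [d d0 h] yz; have [|e e0 eP] := cl_cut_le (pB_cuv y) (pB_cuv z) _ d0; first by rewrite !cuvK.
by exists e; [exact: e0|exact: cule_trans eP].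
Qed.

Lemma cull_lel y x z : x ⊑ y -> cull y z -> cull x z.
Proof. by move=> xy [d d0 h]; exists d => //; exact: cule_trans h. Qed.

Lemma cl_cut_ds u v c : pB u -> pB v -> 0 < c -> cl (cut c (ds u v)) = cl (cut c u) + cl (cut c v).
Proof.
move=> pu pv c0; have c0' := ltW c0; have [a b] := ds_cut pu pv c0.
rewrite -cl_dsD; [|exact: pB_cut..].
by apply: cule_anti; apply/cule_cl => //; first [exact: pB_cut (pB_ds _ _)|exact: pB_ds (pB_cut _ _) (pB_cut _ _)].
Qed.

Lemma cullD x y x' y' : cull x x' -> cull y y' -> cull (x + y) (x' + y').
Proof.
move=> [d d0 dP] [e e0 eP]; rewrite -(cuvK x') -(cuvK y') -cl_dsD; [|exact: pB_cuv..].
apply/cull_cl; first exact: pB_ds (pB_cuv _) (pB_cuv _).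
have m0 : 0 < Num.min d e by rewrite lt_min d0.
exists (Num.min d e) => //; rewrite cl_cut_ds//; [|exact: pB_cuv..].
apply: culeD; [apply: cule_trans dP _|apply: cule_trans eP _].
  by apply: cl_cut_mono (pB_cuv _) (ltW m0) _; rewrite ge_min lexx.
by apply: cl_cut_mono (pB_cuv _) (ltW m0) _; rewrite ge_min lexx orbT.
Qed.

Lemma cull0 x : cull 0 x.
Proof. by exists 1 => //; exact: cule0. Qed.

Lemma cull_mulrn n x y : cull x y -> cull (x *+ n) (y *+ n).
Proof.
by move=> xy; elim: n => [|n IH]; [exact: cull0|rewrite !mulrS; exact: cullD].
Qed.

Lemma cull_interp x y : cull x y -> exists2 z, cull x z & cull z y.
Proof.
move=> [d d0 h]; have d2 := divr_gt0 d0 (ltr0n _ 2).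
exists (cl (cut (d / 2) (cuv y))); last by exists (d / 2) => //; exact: cule_refl.
apply/cull_cl; first exact: pB_cut (ltW d2) (pB_cuv _).
exists (d / 2); first exact: d2.
by rewrite cut_cut; [rewrite -splitr|exact: pB_npos (pB_cuv _)|exact: ltW|exact: ltW].
Qed.

Lemma cule_cutP u x : pB u -> (forall c, 0 < c -> cl (cut c u) ⊑ x) -> cl u ⊑ x.
Proof.
move=> pu h; rewrite -[x]cuvK; apply/cule_cl => //; first exact: pB_cuv.
apply: cle_cutP (pB_npos pu) _ => c c0; apply/cule_cl; [exact: pB_cut (ltW _) _|exact: pB_cuv|].
by rewrite cuvK; exact: h.
Qed.

Lemma cl_cut_near u v c : pB u -> pB v -> nm (u - v) <= c -> cl (cut c u) ⊑ cl v.
Proof.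
move=> pu pv uv; have c0 : 0 <= c := le_trans (nm_ge0 _) uv.
by apply/cule_cl; [exact: pB_cut|exact: pv|exact: cle_cut_near (pB_npos pu) (pB_npos pv) uv].
Qed.

End CuMonoid.
Notation "x ⊑ y" := (cule x y) (at level 70).

(** The witness is multiplied by a ramp function of b, which lies in D and is almost a unit for
    b. *)
Lemma cle_inB (R : realType) (D : cstarAlgType R) (a b : unitz D) : pB b -> cle a b ->
  forall e : R, 0 < e -> exists v : D, nm (inj v * b * st (inj v) - a) <= e.
Proof.
move=> pb ab e e0; have e2 := divr_gt0 e0 (ltr0n _ 2); have [V VP] := ab _ e2.
have z0 : 0 < e / 2 / (nm V * nm V + 1).
  by rewrite divr_gt0// ltr_wpDl// mulr_ge0// nm_ge0.
have [t t0 tP] := ramp_unit (pB_npos pb) z0; have ar := appr_ramp t0.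
set g := fc b _ in tP; have gs : st g = g by exact: fc_sa (pB_npos pb) ar.
have gB : inB g by apply: inB_fc => //; [exact: pB_inB|exact: pB_npos|rewrite ramp_lo].
exists (V * g).1; rewrite -(inBP (inB_mull V gB)) stM gs.
rewrite (le_trans (ndistD (V * b * st V) _ _))// (splitr e) lerD//.
have -> : V * g * b * (g * st V) - V * b * st V = V * (g * b * g - b) * st V.
  by rewrite mulrBr mulrBl !mulrA.
rewrite (le_trans (nmM _ _))// nm_st.
rewrite (le_trans (ler_wpM2r (nm_ge0 _) (nmM _ _)))// mulrAC.
rewrite (le_trans (ler_wpM2l _ tP)) ?mulr_ge0 ?nm_ge0// small_mul ?mulr_ge0 ?nm_ge0//.
exact: ltW.
Qed.

Section Pureness.
Context (R : realType) (D : cstarAlgType R) (s : stable_str D).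
Implicit Types x y : cu s.

Definition cuAU := forall x y (k : nat), x *+ k.+1 ⊑ y *+ k -> x ⊑ y.
Definition cuAD := forall x' x (N : nat), cull x' x ->
  exists2 y, y *+ N ⊑ x & x' ⊑ y *+ N.+1.

End Pureness.

(** * Classes of matrices and the abstract Cuntz semigroup *)

Section Bridge.
Context (R : realType) (B : cstarAlgType R).
Local Notation toC := (real_complex R).
Local Notation D := (stabT B).
Local Notation s := (stab_stable B).
Implicit Types (S T a b c : infmx B).

Definition smk0 a : D := if pselect (stab B a) is left p then smk p else 0.

Lemma mxs_smk0 a : stab B a -> mxs (smk0 a) = a.
Proof. by rewrite /smk0; case: pselect. Qed.

Definition ui a : unitz D := inj (smk0 a).

Lemma smk0K (x : D) : smk0 (mxs x) = x.
Proof. by apply: mxs_inj; rewrite mxs_smk0//; exact: mxs_stab. Qed.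

Lemma mx_pos_stab a : mx_pos a -> stab B a. Proof. by case. Qed.

Lemma mx_posP a : mx_pos a <-> stab B a /\ pB (ui a).
Proof.
split=> [[sa [c sc E]]|[sa [pa _]]].
  split=> //; split; last exact: inB_inj.
  apply/posP; exists (smk0 c); apply: mxs_inj.
  by rewrite mxsM mxs_star !mxs_smk0.
have [x E] := (posP _).1 pa; split=> //; exists (mxs x); first exact: mxs_stab.
by rewrite -[LHS]mxs_smk0// E mxsM mxs_star.
Qed.

Lemma mx_pos_pB a : mx_pos a -> pB (ui a). Proof. by case/mx_posP. Qed.

Lemma cuntz_leP a b : mx_pos a -> mx_pos b -> cuntz_le a b <-> cle (ui a) (ui b).
Proof.
move=> /mx_posP[sa pa] /mx_posP[sb pb].
have E v : stab B v -> mxs (cmul (cmul (smk0 v) (smk0 b)) (cstar (smk0 v)) - smk0 a) =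
    mx_mul (mx_mul v b) (mx_adj v) - a.
  by move=> sv; rewrite mxsB !mxsM mxs_star !mxs_smk0.
split=> [[v [sv /infmx_cvg0P h]] e e0|ab].
  have [N /(_ N (leqnn _)) NP] := h _ e0; exists (ui (v N)).
  by rewrite /ui -inj_st -!injM -injB nm_inj; apply: mxs_le; rewrite E.
have e0 n : 0 < (2^-1 : R) ^+ n by rewrite exprn_gt0// invr_gt0.
have /choice[v vP] := fun n => cle_inB pb ab (e0 n).
exists (fun n => mxs (v n)); split=> [n|]; first exact: mxs_stab.
apply/infmx_cvg0P => e ep; have [k kP] := half_pow_lt ep; exists k => n kn.
rewrite -E; last exact: mxs_stab.
apply: mxb_le (mxs_mxb _); rewrite smk0K -nm_inj injB !injM inj_st.
apply: le_trans (vP n) _; apply: le_trans (ltW kP).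
by apply: ler_wiXn2l; rewrite ?invr_ge0// ?invf_le1 ?ler1n.
Qed.

Definition mcl a : cu s := cl s (ui a).

Lemma mcl_le a b : mx_pos a -> mx_pos b -> cuntz_le a b <-> mcl a ⊑ mcl b.
Proof.
move=> pa pb; rewrite cuntz_leP//.
by split=> /cule_cl; apply; exact: mx_pos_pB.
Qed.

Lemma mcl_eq a b : mx_pos a -> mx_pos b -> cuntz_equiv a b <-> mcl a = mcl b.
Proof.
move=> pa pb; split=> [[/mcl_le ab /mcl_le ba]|E].
  by apply: cule_anti; [exact: ab|exact: ba].
by split; apply/mcl_le => //; rewrite E; exact: cule_refl.
Qed.

Lemma cu_class_eq a b : mx_pos a -> mx_pos b -> cu_class a = cu_class b <-> mcl a = mcl b.
Proof.
move=> pa pb; split=> [E|E].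
  have : cu_class a b by rewrite E; split; [exact: pb|exact/(mcl_eq pb pb)].
  by case=> _ /(mcl_eq pa pb).
apply/seteqP; split=> c [pc].
  by move=> /(mcl_eq pa pc) ac; split; [exact: pc|apply/(mcl_eq pb pc); rewrite -E].
by move=> /(mcl_eq pb pc) ac; split; [exact: pc|apply/(mcl_eq pa pc); rewrite E].
Qed.

Lemma mcl_surj (z : cu s) : exists2 a, mx_pos a & z = mcl a.
Proof.
have [u pu ->] := cl_ex z; have E : ui (mxs u.1) = u by rewrite /ui smk0K -inBP//; case: pu.
exists (mxs u.1); last by rewrite /mcl E.
by apply/mx_posP; split; [exact: mxs_stab|rewrite E].
Qed.

Lemma cu_leP a b : mx_pos a -> mx_pos b -> cu_le (cu_class a) (cu_class b) <-> mcl a ⊑ mcl b.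
Proof.
move=> pa pb; split=> [[a' [b' [pa' pb' /cu_class_eq Ea /cu_class_eq Eb /mcl_le h]]]|h].
  by rewrite (Ea pa pa') (Eb pb pb'); exact: (h pa' pb').
by exists a, b; split; [exact: pa|exact: pb|by []|by []|exact/(mcl_le pa pb)].
Qed.

Lemma mx_pos_dsum a b : mx_pos a -> mx_pos b -> mx_pos (mx_dsum a b) /\
  mcl (mx_dsum a b) = mcl a + mcl b.
Proof.
move=> pa pb; have [sa sb] := (mx_pos_stab pa, mx_pos_stab pb).
have E : mx_dsum a b = mxs (ds s (ui a) (ui b)).1.
  by rewrite -{1}(mxs_smk0 sa) -{1}(mxs_smk0 sb) mx_dsumE.
have Eu : ui (mx_dsum a b) = ds s (ui a) (ui b).
  rewrite E /ui smk0K -inBP//; exact: pB_inB (pB_ds _ (mx_pos_pB pa) (mx_pos_pB pb)).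
split; last by rewrite /mcl Eu cl_dsD//; exact: mx_pos_pB.
apply/mx_posP; split; first by rewrite E; exact: mxs_stab.
by rewrite Eu; apply: pB_ds; exact: mx_pos_pB.
Qed.

Lemma cu_addE a b : mx_pos a -> mx_pos b ->
  cu_add (cu_class a) (cu_class b) = cu_class (mx_dsum a b).
Proof.
move=> pa pb; have [pd Ed] := mx_pos_dsum pa pb.
apply/seteqP; split=> c.
  move=> [pc [a' [b' [[pa' /(mcl_eq pa pa') ea] [pb' /(mcl_eq pb pb') eb]]]]].
  have [pd' Ed'] := mx_pos_dsum pa' pb' => /(mcl_eq pd' pc) ec.
  by split; [exact: pc|apply/(mcl_eq pd pc); rewrite Ed ea eb -Ed' ec].
move=> [pc ec]; split; first exact: pc.
by exists a, b; split; [split; [exact: pa|exact/(mcl_eq pa pa)]|split; [exact: pb|exact/(mcl_eq pb pb)]|exact: ec].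
Qed.

Lemma mx_pos0 : mx_pos (0 : infmx B).
Proof.
apply/mx_posP; split; first exact: stab0.
rewrite /ui (_ : smk0 0 = 0); first exact: pB0.
by apply: mxs_inj; rewrite mxs_smk0//; exact: stab0.
Qed.

Lemma mcl0 : mcl 0 = 0.
Proof.
rewrite /mcl /ui (_ : smk0 0 = 0) ?cl0//.
by apply: mxs_inj; rewrite mxs_smk0//; exact: stab0.
Qed.

Lemma cu_natmulE n a : mx_pos a -> exists c, [/\ mx_pos c,
  cu_natmul n (cu_class a) = cu_class c & mcl c = mcl a *+ n].
Proof.
move=> pa; elim: n => [|n [c [pc Ec Mc]]].
  by exists 0; split; [exact: mx_pos0| |rewrite mcl0].
have [pd Ed] := mx_pos_dsum pa pc; exists (mx_dsum a c); split; first exact: pd.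
  by rewrite /cu_natmul iterS -/(cu_natmul n _) Ec; exact: cu_addE.
by rewrite Ed Mc mulrS.
Qed.

Lemma ui_horner (q : {poly R}) a : stab B a -> stab B (mx_horner_mulX q a) /\
  ui (mx_horner_mulX q a) = ph (ui a) (q * 'X).
Proof.
move=> sa; pose F i : D := iter i (cmul (smk0 a)) (smk0 a).
have mF i : mxs (F i) = iter i (mx_mul a) a.
  elim: i => [|i IH]; first exact: mxs_smk0.
  by rewrite /F !iterS mxsM mxs_smk0// -/(F i) IH.
have iF i : inj (F i) = ui a ^+ i.+1.
  by elim: i => [|i IH]; [rewrite expr1|rewrite /F iterS injM -/(F i) IH -exprS].
pose S : D := \sum_(i < size q) toC q`_i *: F i.
have mS : mxs S = mx_horner_mulX q a.
  rewrite /S /mx_horner_mulX; elim/big_ind2: _ => // [x x' y y' <- <-//|i _].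
  by rewrite mxsZ mF.
rewrite -mS; split; first exact: mxs_stab.
rewrite /ui smk0K /S inj_sum -[in RHS](coefK q) poly_def phM ph_sum phX mulr_suml.
apply: eq_bigr => i _; rewrite injZ iF phZ phXn phX -scalerAl exprSr//.
Qed.

Lemma is_cutdownP (e : R) b c : mx_pos b -> 0 < e -> is_cutdown e b c ->
  mx_pos c /\ ui c = cut e (ui b).
Proof.
move=> pb e0 [sc h]; have [sb pub] := (mx_pos_stab pb, mx_pos_pB pb).
have nb := mxn_fin (stab_fin sb).
have E : ui c = cut e (ui b).
  apply: fc_unique; [exact: pB_npos|exact: appr_cutf|move=> d d0].
  have [q [q1 q2]] := h _ d0; exists (q * 'X); split=> [t t0 tb|].
    rewrite hornerM hornerX mulrC; apply: q1 => //.
    by rewrite nb lee_fin (le_trans tb)// /ui nm_inj mxs_norm mxs_smk0.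
  have [sq <-] := ui_horner q sb; rewrite /ui -injB nm_inj; apply: mxs_le.
  by rewrite mxsB !mxs_smk0//; exact: infmx_norm_mxb.
by split; [apply/mx_posP; split; [exact: sc|rewrite E; exact: pB_cut (ltW e0) pub]|exact: E].
Qed.

Lemma is_cutdown_ex (e : R) b : mx_pos b -> 0 < e -> exists c, is_cutdown e b c.
Proof.
move=> pb e0; have [sb pub] := (mx_pos_stab pb, mx_pos_pB pb).
pose c := mxs (cut e (ui b)).1; exists c; split; first exact: mxs_stab.
have uc : ui c = cut e (ui b).
  by rewrite /ui smk0K -inBP//; exact: pB_inB (pB_cut (ltW e0) pub).
move=> d d0; pose r := nm (ui b) + 1.
have r0 : 0 < r by rewrite ltr_wpDl// nm_ge0.
have br : nm (ui b) <= r by rewrite lerDl.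
have [P PP] := @appr_cutf R e _ _ r0 (divr_gt0 d0 (ltr0n _ 2)).
have [Q EQ] : exists Q, P - (P.[0])%:P = Q * 'X.
  elim/poly_ind: (P) => [|Q k _]; first by exists 0; rewrite horner0 mul0r subrr.
  by exists Q; rewrite hornerMXaddC mulr0 add0r addrK.
have QP t : 0 <= t -> t <= r -> `|(Q * 'X).[t] - cutf e t| <= d.
  move=> t0 tr; rewrite -EQ hornerD hornerN hornerC.
  have c0 : cutf e 0 = 0 by rewrite cutf_lo// ltW.
  rewrite (_ : _ - _ = (P.[t] - cutf e t) - (P.[0] - cutf e 0)); last by rewrite c0; ring.
  by rewrite (le_trans (ler_normB _ _))// (splitr d) lerD// PP// ltW.
have [sq uq] := ui_horner Q sb.
exists Q; split=> [t t0 tb|].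
  rewrite mulrC -[X in _ * X](hornerX t) -hornerM; apply: QP => //.
  apply: le_trans br; rewrite /ui nm_inj mxs_norm mxs_smk0//.
  by move: tb; rewrite (mxn_fin (stab_fin sb)) lee_fin.
apply: infmx_norm_le; have -> : mx_horner_mulX Q b - c = mxs (smk0 (mx_horner_mulX Q b) - smk0 c).
  by rewrite mxsB !mxs_smk0//; exact: mxs_stab.
apply: mxb_le (mxs_mxb _); rewrite -nm_inj injB -/(ui _) -/(ui c) uq uc.
by apply: (fc_approx (r := r)) => //; [exact: pB_npos|exact: appr_cutf].
Qed.

Lemma cu_llP a b : mx_pos a -> mx_pos b -> cu_ll (cu_class a) (cu_class b) <-> cull (mcl a) (mcl b).
Proof.
move=> pa pb; split.
  move=> [a' [b' [pa' pb' /cu_class_eq Ea /cu_class_eq Eb [e [c [e0 /is_cutdownP h ac]]]]]].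
  have [pc Ec] := h pb' e0; rewrite (Ea pa pa') (Eb pb pb').
  apply/cull_cl; first exact: mx_pos_pB.
  by exists e; [exact: e0|rewrite -Ec; exact/(mcl_le pa' pc)].
move=> /cull_cl[|d d0 h]; first exact: mx_pos_pB.
have [c cP] := is_cutdown_ex pb d0; have [pc Ec] := is_cutdownP pb d0 cP.
exists a, b; split; [exact: pa|exact: pb|by []|by []|exists d, c; split; [exact: d0|exact: cP|]].
by apply/(mcl_le pa pc); rewrite {2}/mcl Ec.
Qed.

Lemma Cu_class a : mx_pos a -> Cu B (cu_class a). Proof. by move=> pa; exists a. Qed.

Lemma pureP : pure B <-> cuAU s /\ cuAD s.
Proof.
split=> -[AU AD]; split.
- move=> x y k; have [a pa ->] := mcl_surj x; have [b pb ->] := mcl_surj y.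
  have [c [pc Ec Mc]] := cu_natmulE k.+1 pa; have [d [pd Ed Md]] := cu_natmulE k pb.
  rewrite -Mc -Md => h; apply/(cu_leP pa pb).
  apply: (AU _ _ k); [exact: Cu_class|exact: Cu_class|].
  by rewrite Ec Ed; apply/(cu_leP pc pd).
- move=> x' x N; have [a pa ->] := mcl_surj x'; have [b pb ->] := mcl_surj x => /(cu_llP pa pb) h.
  have [_ [[y py <-] h1 h2]] := AD _ _ N (Cu_class pa) (Cu_class pb) h.
  have [c [pc Ec Mc]] := cu_natmulE N py; have [d [pd Ed Md]] := cu_natmulE N.+1 py.
  exists (mcl y); first by rewrite -Mc; apply/(cu_leP pc pb); rewrite -Ec.
  by rewrite -Md; apply/(cu_leP pa pd); rewrite -Ed.
- move=> _ _ k [a pa <-] [b pb <-].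
  have [c [pc -> Mc]] := cu_natmulE k.+1 pa; have [d [pd -> Md]] := cu_natmulE k pb.
  by move=> /(cu_leP pc pd) h; apply/(cu_leP pa pb); apply: (AU _ _ k); rewrite -Mc -Md.
- move=> _ _ N [a pa <-] [b pb <-] /(cu_llP pa pb) h.
  have [y h1 h2] := AD _ _ N h; have [c pc Ec] := mcl_surj y.
  have [d [pd Ed Md]] := cu_natmulE N pc; have [e [pe Ee Me]] := cu_natmulE N.+1 pc.
  exists (cu_class c); split; first exact: Cu_class.
    by rewrite Ed; apply/(cu_leP pd pb); rewrite Md -Ec.
  by rewrite Ee; apply/(cu_leP pa pe); rewrite Me -Ec.
Qed.

Lemma cu_compact_infinite (x : cu s) : cull x x -> x + x ⊑ x -> x <> 0 ->
  exists X, [/\ Cu B X, X <> cu_zero B, cu_compact X & properly_infinite X].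
Proof.
have [a pa ->] := mcl_surj x => ll inf nz; exists (cu_class a); split.
- exact: Cu_class.
- by move=> /(cu_class_eq pa mx_pos0) E; apply: nz; rewrite E mcl0.
- exact/(cu_llP pa pa).
- have [c [pc Ec Mc]] := cu_natmulE 2 pa; rewrite /properly_infinite Ec.
  by apply/(cu_leP pc pa); rewrite Mc mulr2n.
Qed.

End Bridge.

(** * Homomorphisms and cancellation *)

Section UnitalHom.
Context (R : realType) (U V : ucstarAlgType R) (phi : U -> V).
Local Notation toC := (real_complex R).

Record ushom := UsHom {
  ushD : {morph phi : u v / u + v} ;
  ushZ : forall (k : R[i]) u, phi (k *: u) = k *: phi u ;
  ushM : {morph phi : u v / u * v} ;
  ush1 : phi 1 = 1 ;
  ush_st : {morph phi : u / st u}
}.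

Hypothesis h : ushom.

Lemma ushB u v : phi (u - v) = phi u - phi v.
Proof. by rewrite ushD// -scaleN1r ushZ// scaleN1r. Qed.

Lemma ush_sc (c : R) : phi (sc U c) = sc V c.
Proof. by rewrite /sc ushZ// ush1. Qed.

Lemma ush0 : phi 0 = 0.
Proof. by rewrite -(scale0r 0) ushZ// scale0r. Qed.

Lemma ush_npos u : npos u -> npos (phi u).
Proof.
move=> nu; have [r [nr <- _]] := npos_sqrt nu; rewrite ushM//; apply: npos_sq.
by rewrite /sa -ush_st// (npos_sa nr).
Qed.

Lemma ush_nm u : nm (phi u) <= nm u.
Proof.
rewrite -(@ler_pXn2r _ 2) ?nnegrE ?nm_ge0// -!nmC -ush_st// -ushM//.
set c := nm (st u * u); have nu := npos_kv u.
have n1 : npos (sc V c - phi (st u * u)).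
  by rewrite -ush_sc -ushB; apply: ush_npos; exact: npos_leN.
have := npos_le (ush_npos nu) n1; rewrite nm_sc ger0_norm//; exact: nm_ge0.
Qed.

Lemma ush_ph u p : phi (ph u p) = ph (phi u) p.
Proof.
elim/poly_ind: p => [|p c IH]; first by rewrite !ph0 ush0.
by rewrite !ph_MXaddC ushD// ushM// IH ush_sc.
Qed.

Lemma ush_fc u f : npos u -> appr f -> phi (fc u f) = fc (phi u) f.
Proof.
move=> nu af; apply: fc_unique; [exact: ush_npos|by []|move=> e e0].
have [p [p1 p2]] := fcP nu af e0; exists p; split=> [t t0 tu|].
  by apply: p1 => //; exact: le_trans (ush_nm u).
by rewrite -ush_ph -ushB (le_trans (ush_nm _)).
Qed.

Lemma ush_cut c u : npos u -> phi (cut c u) = cut c (phi u).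
Proof. by move=> nu; apply: ush_fc => //; exact: appr_cutf. Qed.

Lemma ush_cle a b : cle a b -> cle (phi a) (phi b).
Proof.
move=> ab e /ab[v vP]; exists (phi v).
by rewrite -ush_st// -!ushM// -ushB (le_trans (ush_nm _)).
Qed.

End UnitalHom.

Section StarHom.
Context (R : realType) (A B : cstarAlgType R) (phi : A -> B).

Record shom := SHom {
  shD : {morph phi : a b / a + b} ;
  shZ : forall (k : R[i]) a, phi (k *: a) = k *: phi a ;
  shM : {morph phi : a b / cmul a b} ;
  sh_st : {morph phi : a / cstar a}
}.

Definition uz (u : unitz A) : unitz B := (phi u.1, u.2).

Hypothesis h : shom.

Lemma uz_ushom : ushom uz.
Proof.
have p0 : phi 0 = 0 by rewrite -(scale0r 0) shZ// scale0r.
split=> [u v|k u|u v||u]; rewrite /uz; congr pair => //=.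
- exact: shD.
- exact: shZ.
- by rewrite shD// shD// !shZ// shM.
- exact: sh_st.
Qed.

Lemma uz_inj a : uz (inj a) = inj (phi a). Proof. by []. Qed.

Lemma uz_pB u : pB u -> pB (uz u).
Proof. by move=> [nu bu]; split; [exact: ush_npos uz_ushom _ nu|]. Qed.

End StarHom.

Section CuHom.
Context (R : realType) (A B : cstarAlgType R) (s : stable_str A) (s' : stable_str B).
Context (phi : A -> B) (h : shom phi).
Hypothesis hs : forall j a, phi (sl s j a) = sl s' j (phi a).

Lemma uz_ds u v : uz phi (ds s u v) = ds s' (uz phi u) (uz phi v).
Proof. by rewrite /ds (ushD (uz_ushom h)) /io [uz phi (inj _)]uz_inj [X in _ + X]uz_inj !(hs, sh_st h). Qed.

Definition cumap (x : cu s) : cu s' := cl s' (uz phi (cuv x)).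

Lemma cumap_cl u : pB u -> cumap (cl s u) = cl s' (uz phi u).
Proof.
move=> pu; have [_ pv uv vu] := cuv_cl s pu; have hu := uz_ushom h.
by apply: cule_anti; apply/cule_cl; (exact: uz_pB || exact: ush_cle).
Qed.

Lemma cumap_le x y : x ⊑ y -> cumap x ⊑ cumap y.
Proof.
move=> /culeE xy; apply/cule_cl; [exact: uz_pB (pB_cuv _)|exact: uz_pB (pB_cuv _)|].
exact: (ush_cle (uz_ushom h) xy).
Qed.

Lemma cumapD x y : cumap (x + y) = cumap x + cumap y.
Proof.
rewrite cuaddE cumap_cl ?uz_ds ?cl_dsD//; try exact: pB_ds (pB_cuv _) (pB_cuv _).
  exact: uz_pB (pB_cuv _).
exact: uz_pB (pB_cuv _).
Qed.

Lemma cumap0 : cumap 0 = 0.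
Proof.
rewrite -!cl0 cumap_cl; last exact: pB0.
by rewrite (ush0 (uz_ushom h)).
Qed.

Lemma cumap_mulrn x n : cumap (x *+ n) = cumap x *+ n.
Proof. by elim: n => [|n IH]; [exact: cumap0|rewrite !mulrS cumapD IH]. Qed.

Lemma cumap_ll x y : cull x y -> cull (cumap x) (cumap y).
Proof.
move=> [d d0 xy]; have py := pB_cuv y; apply/cull_cl; first exact: uz_pB.
exists d => //; apply: cule_trans (cumap_le xy) _.
rewrite cumap_cl ?(ush_cut (uz_ushom h))//; [exact: cule_refl|exact: pB_npos|exact: pB_cut (ltW d0) py].
Qed.

End CuHom.

Section Cancellation.
Context (R : realType) (D : cstarAlgType R) (s : stable_str D).
Implicit Types x y u w d V : cu s.

(** The only form in which the hypothesis on quotients is used later. The number L does not depend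
    on n, so almost unperforation can absorb it for large n. *)
Definition cuCAN := forall u w w' d (M : nat), u + w ⊑ d + w' -> cull w' w ->
  w ⊑ u *+ M -> exists L, forall n, u *+ n ⊑ d *+ (n + L).

Hypotheses (AU : cuAU s) (CAN : cuCAN).

Lemma AU_lt (a b : nat) x y : (b < a)%N -> x *+ a ⊑ y *+ b -> x ⊑ y.
Proof. by move=> ba h; apply: (AU (k := b)); apply: cule_trans h; exact: cule_wmulrn. Qed.

(** Two cancellations. Since k + 3 copies of w fit below y', the second hypothesis taken (k + 3) k
    times lets k copies of y be cancelled against k copies of y', and w disappears. The gap between
    k + 1 and k then survives on the side of c + V2, and the multiples of V2 are cancelled against
    those of V3. *)
Lemma almost_cancel (k : nat) c V2 V3 y y' w d :
  (c + V2) *+ k.+1 ⊑ y *+ k -> y ⊑ V3 + w + d -> w *+ k.+3 ⊑ y' -> cull y' y -> cull V3 V2 ->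
  c ⊑ d.
Proof.
move=> h1 h2 h3 yy VV; pose K := k.+3.
have e1 : y *+ (k.+2 * k) + y *+ k ⊑ (V3 + d) *+ (K * k) + y' *+ k.
  rewrite -mulrnDr addnC -mulSn; apply: cule_trans (cule_mulrn _ h2) _.
  rewrite -addrA [w + d]addrC addrA mulrnDl; apply: culeD (cule_refl _) _.
  by rewrite mulrnA; exact: cule_mulrn.
have [|L hL] := CAN e1 (cull_mulrn _ yy) (M := 1).
  by rewrite mulr1n; apply: cule_wmulrn; rewrite mulSn leq_addr.
(* As (k + 1)(k + 2) = (k + 3) k + 2, the coefficient a exceeds b as soon as 2 n > (k + 3) k L. *)
pose n := (L * (K * k)).+1; pose a := (k.+1 * (k.+2 * n))%N; pose b := (K * k * (n + L))%N.
have ba : (b < a)%N.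
  rewrite /a /b /K; have E : (k.+1 * (k.+2 * n) = k.+3 * k * n + 2 * n)%N by ring.
  rewrite E mulnDr ltn_add2l mulnC mul2n -addnn /n.
  by rewrite addnS ltnS; exact: leq_addl.
have e2 : (c + V2) *+ a ⊑ (V3 + d) *+ b.
  rewrite /a mulrnA; apply: cule_trans (cule_mulrn _ h1) _.
  apply: cule_trans (_ : _ ⊑ (V3 + d) *+ (K * k) *+ (n + L)) _; last first.
    by rewrite -mulrnA; exact: cule_refl.
  apply: cule_trans (hL n); rewrite -!mulrnA (_ : k * (k.+2 * n) = k.+2 * k * n)%N; last by ring.
  exact: cule_refl.
(* The surplus of at least one copy of V2 stays in u, so that b copies of V2 lie below b copies of
   u, as the second cancellation demands. *)
pose u := c *+ a + V2 *+ (a - b).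
have e3 : u + V2 *+ b ⊑ d *+ b + V3 *+ b.
  rewrite /u -addrA -mulrnDr subnK; last exact: ltnW.
  by rewrite -!mulrnDl [d + V3]addrC.
have [|L' hL'] := CAN e3 (cull_mulrn _ VV) (M := b).
  apply: cule_mulrn; apply: cule_trans (culeDr _ _); rewrite -{1}[V2]mulr1n.
  by apply: cule_wmulrn; rewrite subn_gt0.
pose n' := (L' * b).+1.
apply: (@AU_lt (a * n') (b * (n' + L'))).
  rewrite mulnDr; apply: (@leq_trans (b * n' + n')); last first.
    by rewrite -mulSnr leq_mul2r ba orbT.
  by rewrite ltn_add2l /n' mulnC.
rewrite (mulrnA c a) (mulrnA d b); apply: cule_trans (hL' n').
exact: cule_mulrn (culeDl _ _).
Qed.

End Cancellation.

(** * Quotients *)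

Section Quotient.
Context (R : realType) (A : cstarAlgType R) (I : set A).
Local Notation toC := (real_complex R).
Hypothesis I0 : I 0.
Hypothesis ID : forall a b, I a -> I b -> I (a + b).
Hypothesis IZ : forall (k : R[i]) a, I a -> I (k *: a).
Hypothesis IMr : forall a b, I a -> I (cmul a b).
Hypothesis IMl : forall a b, I b -> I (cmul a b).
Hypothesis Ist : forall a, I a -> I (cstar a).
Hypothesis Icl : forall a, (forall e : R, 0 < e -> exists2 b, I b & rnorm (a - b) <= e) -> I a.
Implicit Types (a b : A) (e : R).

Lemma IN a : I a -> I (- a). Proof. by move=> /(IZ (-1)); rewrite scaleN1r. Qed.
Definition qrep a : A := xget 0 [set b | I (a - b)].

Lemma qrepP a : I (a - qrep a).
Proof. by apply: (xgetPex (0 : A) (P := [set b | I (a - b)])); exists a; rewrite /= subrr. Qed.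

Lemma qrep_eq a b : I (a - b) -> qrep a = qrep b.
Proof.
move=> ab; rewrite /qrep; congr xget; apply/seteqP; split=> c /= h.
  by rewrite -(subrKA a); apply: ID => //; rewrite -opprB; exact: IN.
by rewrite -(subrKA b); exact: ID.
Qed.

Lemma qrepK a : qrep (qrep a) = qrep a.
Proof. by apply: qrep_eq; rewrite -opprB; apply/IN/qrepP. Qed.

Record quo := Quo { qv : A ; qvP : qrep qv = qv }.
Definition qpi a : quo := Quo (qrepK a).

Lemma quo_inj (x y : quo) : qv x = qv y -> x = y.
Proof. by case: x y => [a pa] [b pb] /= ab; subst b; congr Quo; exact: Prop_irrelevance. Qed.

Lemma qvK x : qpi (qv x) = x. Proof. by apply: quo_inj; exact: qvP. Qed.

Lemma qpi_eq a b : qpi a = qpi b <-> I (a - b).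
Proof.
split=> [/(congr1 qv) /= E|ab]; last by apply: quo_inj; exact: qrep_eq.
by rewrite -(subrKA (qrep a)); apply: ID; [exact: qrepP|rewrite E -opprB; apply/IN/qrepP].
Qed.

Lemma qpi_surj (x : quo) : exists a, x = qpi a. Proof. by exists (qv x); rewrite qvK. Qed.

Definition qadd x y := qpi (qv x + qv y).
Definition qopp x := qpi (- qv x).
Definition qscale (k : R[i]) x := qpi (k *: qv x).
Definition qmul x y := qpi (cmul (qv x) (qv y)).
Definition qstar x := qpi (cstar (qv x)).

Lemma qv_pi a : I (a - qv (qpi a)). Proof. exact: qrepP. Qed.

Lemma qaddE a b : qadd (qpi a) (qpi b) = qpi (a + b).
Proof.
by apply/esym/qpi_eq; rewrite opprD addrACA; apply: ID; exact: qv_pi.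
Qed.
Lemma qoppE a : qopp (qpi a) = qpi (- a).
Proof. by apply/esym/qpi_eq; rewrite -opprD; apply: IN; exact: qv_pi. Qed.
Lemma qscaleE (k : R[i]) a : qscale k (qpi a) = qpi (k *: a).
Proof. by apply/esym/qpi_eq; rewrite -scalerBr; apply: IZ; exact: qv_pi. Qed.
Lemma qmulE a b : qmul (qpi a) (qpi b) = qpi (cmul a b).
Proof.
apply/esym/qpi_eq; rewrite -(subrKA (cmul a (qv (qpi b)))) -cmulBr -cmulBl.
by apply: ID; [apply: IMl|apply: IMr]; exact: qv_pi.
Qed.
Lemma qstarE a : qstar (qpi a) = qpi (cstar a).
Proof. by apply/esym/qpi_eq; rewrite -cstarB; apply: Ist; exact: qv_pi. Qed.

HB.instance Definition _ := gen_eqMixin quo.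
HB.instance Definition _ := gen_choiceMixin quo.

Fact qaddA : associative qadd.
Proof. by move=> x y z; have [ax ->] := qpi_surj x; have [ay ->] := qpi_surj y; have [az ->] := qpi_surj z; rewrite !qaddE addrA. Qed.
Fact qaddC : commutative qadd.
Proof. by move=> x y; have [ax ->] := qpi_surj x; have [ay ->] := qpi_surj y; rewrite !qaddE addrC. Qed.
Fact qadd0 : left_id (qpi 0) qadd.
Proof. by move=> x; have [ax ->] := qpi_surj x; rewrite !qaddE add0r. Qed.
Fact qaddN : left_inverse (qpi 0) qopp qadd.
Proof. by move=> x; have [ax ->] := qpi_surj x; rewrite qoppE qaddE addNr. Qed.
HB.instance Definition _ := GRing.isZmodule.Build quo qaddA qaddC qadd0 qaddN.

Fact qscaleA (k l : R[i]) x : qscale k (qscale l x) = qscale (k * l) x.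
Proof. by have [ax ->] := qpi_surj x; rewrite !qscaleE scalerA. Qed.
Fact qscale1 : left_id 1 qscale.
Proof. by move=> x; have [ax ->] := qpi_surj x; rewrite !qscaleE scale1r. Qed.
Fact qscaleDr : right_distributive qscale +%R.
Proof.
move=> k x y; rewrite -[x + y]/(qadd x y) -[RHS]/(qadd _ _).
have [ax ->] := qpi_surj x; have [ay ->] := qpi_surj y.
by rewrite !(qscaleE, qaddE) scalerDr.
Qed.
Fact qscaleDl x : {morph qscale^~ x : k l / k + l}.
Proof. by move=> k l; rewrite -[RHS]/(qadd _ _); have [ax ->] := qpi_surj x; rewrite !(qscaleE, qaddE) scalerDl. Qed.
HB.instance Definition _ := GRing.Zmodule_isLmodule.Build R[i] quo
  qscaleA qscale1 qscaleDr qscaleDl.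

Lemma qpiD a b : qpi (a + b) = qpi a + qpi b. Proof. by rewrite -qaddE. Qed.
Lemma qpiN a : qpi (- a) = - qpi a. Proof. by rewrite -qoppE. Qed.
Lemma qpiB a b : qpi (a - b) = qpi a - qpi b. Proof. by rewrite qpiD qpiN. Qed.
Lemma qpiZ (k : R[i]) a : qpi (k *: a) = k *: qpi a. Proof. by rewrite -qscaleE. Qed.
Lemma qpi0 a : qpi a = 0 <-> I a.
Proof. by rewrite -[0]/(qpi 0) qpi_eq subr0. Qed.

Definition qnorm (x : quo) : R := inf [set rnorm (qv x + i) | i in I].

Lemma qnorm_lb (x : quo) : has_lbound [set rnorm (qv x + i) | i in I].
Proof. by exists 0 => _ [i _ <-]; exact: rnorm_ge0. Qed.

Lemma qnorm_inf (x : quo) : has_inf [set rnorm (qv x + i) | i in I].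
Proof. by split; [exists (rnorm (qv x + 0)); exists 0|exact: qnorm_lb]. Qed.

Lemma qnorm_le a : qnorm (qpi a) <= rnorm a.
Proof.
apply: ge_inf; first exact: qnorm_lb.
exists (a - qv (qpi a)); first exact: qv_pi.
by rewrite addrC subrK.
Qed.

Lemma qnorm_ge0 x : 0 <= qnorm x.
Proof. by apply: lb_le_inf; [exact: (qnorm_inf x).1|move=> _ [i _ <-]; exact: rnorm_ge0]. Qed.

Lemma qnorm_lift (x : quo) e : 0 < e -> exists2 a, x = qpi a & rnorm a < qnorm x + e.
Proof.
move=> e0; have [_ [i Ii <-] h] := inf_adherent e0 (qnorm_inf x).
exists (qv x + i) => //; rewrite -{1}[x]qvK; apply/qpi_eq.
by rewrite opprD addrA subrr add0r; exact: IN.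
Qed.

Lemma qnorm_leP x c : (forall e, 0 < e -> exists2 a, x = qpi a & rnorm a <= c + e) -> qnorm x <= c.
Proof.
move=> h; apply/ler_addgt0Pr => e /h[a -> ac]; exact: le_trans (qnorm_le _) ac.
Qed.

Fact qnormD x y : qnorm (x + y) <= qnorm x + qnorm y.
Proof.
apply: qnorm_leP => e e0; have e2 := divr_gt0 e0 (ltr0n _ 2).
have [a Ea ha] := qnorm_lift x e2; have [b Eb hb] := qnorm_lift y e2.
exists (a + b); first by rewrite qpiD -Ea -Eb.
by rewrite (le_trans (ler_rnormD _ _))// (splitr e) addrACA lerD// ltW.
Qed.

Fact qnormZ (k : R[i]) x : qnorm (k *: x) = complex.Re `|k| * qnorm x.
Proof.
have le (l : R[i]) z : qnorm (l *: z) <= complex.Re `|l| * qnorm z.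
  have l1 : 0 < complex.Re `|l| + 1 by rewrite ltr_wpDl// normCRe_ge0.
  apply: qnorm_leP => e e0; have [a Ea ha] := qnorm_lift z (divr_gt0 e0 l1).
  exists (l *: a); first by rewrite qpiZ -Ea.
  rewrite rnormZ (le_trans (ler_wpM2l (normCRe_ge0 _) (ltW ha)))//.
  by rewrite mulrDr lerD2l small_mul ?normCRe_ge0 ?(ltW e0).
apply/eqP; rewrite eq_le le andTb; have [->|k0] := eqVneq k 0.
  by rewrite normr0 mul0r; exact: qnorm_ge0.
have kp : 0 < complex.Re `|k| by rewrite -ltcR normCReK normr_gt0.
rewrite -ler_pdivlMl//; have := le k^-1 (k *: x).
rewrite scalerA mulVf// scale1r normfV => /le_trans; apply.
rewrite le_eqVlt; apply/orP; left; apply/eqP; congr (_ * _); apply: complexI.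
by rewrite toCV normCReK -normfV normCReK.
Qed.

Fact qnorm0 x : qnorm x = 0 -> x = 0.
Proof.
move=> x0; rewrite -[x]qvK; apply/qpi0; apply: Icl => e e0.
have [a Ea] := qnorm_lift x e0; rewrite x0 add0r => ha.
exists (qv x - a); last by rewrite opprB addrC subrK ltW.
by apply/qpi_eq; rewrite qvK.
Qed.

Fact qcomplete (u : nat -> quo) : (forall n, qnorm (u n.+1 - u n) <= 2^-1 ^+ n) ->
    exists l, forall e : R, 0 < e ->
      exists N, forall n, (N <= n)%N -> qnorm (u n - l) <= e.
Proof.
move=> hu; have p0 n : 0 < (2^-1 ^+ n : R) by rewrite exprn_gt0// invr_gt0.
have /choice[d dP] n : exists d, u n.+1 - u n = qpi d /\ rnorm d <= 2 * 2^-1 ^+ n.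
  have [d Ed hd] := qnorm_lift (u n.+1 - u n) (p0 n); exists d; split=> //.
  by rewrite (le_trans (ltW hd))// mulr_natl mulr2n lerD2r.
pose a n := qv (u 0%N) + \sum_(i < n) d i.
have aE n : qpi (a n) = u n.
  elim: n => [|n IH]; first by rewrite /a big_ord0 addr0 qvK.
  by rewrite /a big_ord_recr/= addrA qpiD IH -(dP n).1 addrC subrK.
have tel n m : rnorm (a (n + m)%N - a n) <= 4 * 2^-1 ^+ n - 4 * 2^-1 ^+ (n + m).
  elim: m => [|m IH]; first by rewrite addn0 !subrr rnorm0.
  rewrite addnS (le_trans (ler_rdistD (a (n + m)%N) _ _))//.
  have -> : a (n + m).+1 - a (n + m)%N = d (n + m)%N.
    by rewrite /a big_ord_recr/= addrA [_ + d _]addrC addrK.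
  by rewrite (le_trans (lerD (dP _).2 IH))// exprS; lra.
have [e e0|l lP] := @rnorm_complete _ _ a.
  have [k kP] := half_pow_lt (divr_gt0 e0 (ltr0n _ 8)).
  have tel2 m : (k <= m)%N -> rnorm (a m - a k) <= e / 2.
    move=> km; rewrite -(subnKC km) (le_trans (tel _ _))//.
    have := ltW (p0 (k + (m - k))%N); by move: kP; lra.
  exists k => n m kn km; rewrite (le_trans (ler_rdistD (a k) _ _))// (splitr e) lerD ?tel2//.
  by rewrite rdistC tel2.
exists (qpi l) => e /lP[N NP]; exists N => n Nn.
by rewrite -aE -qpiB (le_trans (qnorm_le _))// NP.
Qed.

Fact qmulA : associative qmul.
Proof. by move=> x y z; have [ax ->] := qpi_surj x; have [ay ->] := qpi_surj y; have [az ->] := qpi_surj z; rewrite !qmulE cmulA. Qed.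
Fact qmulDl : left_distributive qmul +%R.
Proof. by move=> x y z; have [ax ->] := qpi_surj x; have [ay ->] := qpi_surj y; have [az ->] := qpi_surj z; rewrite -qpiD !qmulE -qpiD cmulDl. Qed.
Fact qmulDr : right_distributive qmul +%R.
Proof. by move=> x y z; have [ax ->] := qpi_surj x; have [ay ->] := qpi_surj y; have [az ->] := qpi_surj z; rewrite -qpiD !qmulE -qpiD cmulDr. Qed.
Fact qmulZl (k : R[i]) x y : qmul (k *: x) y = k *: qmul x y.
Proof. by have [ax ->] := qpi_surj x; have [ay ->] := qpi_surj y; rewrite -qpiZ !qmulE -qpiZ cmulZl. Qed.
Fact qmulZr (k : R[i]) x y : qmul x (k *: y) = k *: qmul x y.
Proof. by have [ax ->] := qpi_surj x; have [ay ->] := qpi_surj y; rewrite -qpiZ !qmulE -qpiZ cmulZr. Qed.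
Fact qstarK : involutive qstar.
Proof. by move=> x; have [ax ->] := qpi_surj x; rewrite !qstarE cstarK. Qed.
Fact qstarD : {morph qstar : x y / x + y}.
Proof. by move=> x y; have [ax ->] := qpi_surj x; have [ay ->] := qpi_surj y; rewrite -qpiD !qstarE -qpiD cstarD. Qed.
Fact qstarZ (k : R[i]) x : qstar (k *: x) = conjc k *: qstar x.
Proof. by have [ax ->] := qpi_surj x; rewrite -qpiZ !qstarE -qpiZ cstarZ. Qed.
Fact qstarM x y : qstar (qmul x y) = qmul (qstar y) (qstar x).
Proof. by have [ax ->] := qpi_surj x; have [ay ->] := qpi_surj y; rewrite !(qmulE, qstarE) cstarM. Qed.

Fact qnormM x y : qnorm (qmul x y) <= qnorm x * qnorm y.
Proof.
apply: qnorm_leP => e e0; pose c := qnorm x + qnorm y + 1.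
have c0 : 0 < c by rewrite ltr_wpDl// addr_ge0 ?qnorm_ge0.
pose d := Num.min 1 (e / c); have d0 : 0 < d by rewrite lt_min ltr01 divr_gt0.
have [a Ea ha] := qnorm_lift x d0; have [b Eb hb] := qnorm_lift y d0.
exists (cmul a b); first by rewrite -qmulE -Ea -Eb.
rewrite (le_trans (rnorm_cmul _ _))// (le_trans (ler_pM (rnorm_ge0 _) (rnorm_ge0 _) (ltW ha) (ltW hb)))//.
rewrite mulrDl !mulrDr -addrA lerD2l.
have d1 : d <= 1 by rewrite ge_min lexx.
have dc : d * c <= e.
  by rewrite -ler_pdivlMr// ge_min lexx orbT.
rewrite (le_trans _ dc)// [qnorm x * d]mulrC -mulrDr -mulrDr ler_wpM2l ?(ltW d0)// /c.
by rewrite -!addrA lerD2l lerD2l.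
Qed.

(* With [g] in the ideal and close to a unit for [i], [1 - g] turns the representative [b] of the
   coset of [a^* a] into an element of norm at most [nm b] close to [a^* a] cut down by [1 - g]. *)
Fact qnormC x : qnorm x ^+ 2 <= qnorm (qmul (qstar x) x).
Proof.
have [a ->] := qpi_surj x; rewrite qstarE qmulE; apply/ler_addgt0Pr => e e0.
have e2 := divr_gt0 e0 (ltr0n _ 2).
have [b Eb hb] := qnorm_lift (qpi (cmul (cstar a) a)) e2.
have Ii : I (b - cmul (cstar a) a) by apply/qpi_eq.
set i := b - _ in Ii.
pose u := inj i; pose n := st u * u; have nn : npos n := npos_kv u.
pose t := (e / 2) ^+ 2; have t0 : 0 < t by rewrite exprn_gt0.
pose g := fc n (ramp 0 t); have ar := appr_ramp t0.
have gs : st g = g by exact: fc_sa.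
have gB : inB g by apply: inB_fc => //; [exact: inB_mull|rewrite ramp_lo].
have g1 : nm (1 - g) <= 1.
  rewrite -[1]sc1 /g -(fc_cst _ nn) -fcB//; last exact: appr_cst.
  apply: fc_norm => //; first exact: apprB (@appr_cst R _) ar.
  move=> r r0 _; rewrite ger0_norm ?subr_ge0 ?ramp_le1//.
  by rewrite lerBlDr lerDl ramp_ge0.
have ug : nm (u * (1 - g)) <= e / 2.
  rewrite -(@ler_pXn2r _ 2) ?nnegrE ?nm_ge0 ?(ltW e2)// -nmC stM stB st1 gs.
  have -> : (1 - g) * st u * (u * (1 - g)) = fc n (fun r => (1 - ramp 0 t r) * r * (1 - ramp 0 t r)).
    have ac := @appr_cst R 1; have ai := @appr_id R; have ab := apprB ac ar.
    have abi := apprM ab ai; rewrite fcM// fcM// fcB// fc_id// fc_cst// sc1.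
    by rewrite !mulrA.
  have ac := @appr_cst R 1; have ai := @appr_id R; have ab := apprB ac ar.
  apply: fc_norm => //; first exact: apprM (apprM ab ai) ab.
  move=> r r0 _; have [tr|rt] := leP t r; first by rewrite ramp_hi// subrr !mul0r normr0 ltW.
  have h0 : 0 <= 1 - ramp 0 t r by rewrite subr_ge0 ramp_le1.
  have h1 : 1 - ramp 0 t r <= 1 by rewrite lerBlDr lerDl ramp_ge0.
  rewrite ger0_norm ?mulr_ge0// (le_trans _ (ltW rt))//.
  by rewrite (le_trans (ler_wpM2l _ h1)) ?mulr_ge0// mulr1 ler_piMl.
have Ig : I g.1.
  have Iph (q : {poly R}) : I (ph n (q * 'X)).1.
    rewrite phM phX /n /u -inj_st -injM; set w := ph _ q.
    rewrite -[X in I X]/(w.2 *: cmul (cstar i) i + 0 *: w.1 + cmul w.1 (cmul (cstar i) i)).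
    by rewrite scale0r addr0; apply: ID; [apply: IZ; exact: IMl|apply: IMl; exact: IMl].
  apply: Icl => d d0; have d2 := divr_gt0 d0 (ltr0n _ 2).
  have [p [p1 p2]] := fcP nn ar d2.
  have [q Eq] : exists q, p - (p.[0])%:P = q * 'X.
    elim/poly_ind: (p) => [|q k _]; first by exists 0; rewrite horner0 mul0r subrr.
    by exists q; rewrite hornerMXaddC mulr0 add0r addrK.
  exists (ph n (q * 'X)).1; first exact: Iph.
  have bq : inB (ph n (q * 'X)) by rewrite phM phX; apply: inB_mull; exact: inB_mull.
  rewrite -nm_inj injB -(inBP gB) -(inBP bq) -Eq phB phC opprB addrCA (le_trans (nmD _ _))//.
  rewrite [leRHS](splitr d) lerD//; last by rewrite ndistC.
  by rewrite nm_sc; have := p1 0 (lexx _) (nm_ge0 _); rewrite ramp_lo// subr0.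
have le1 : qnorm (qpi a) <= nm (inj a * (1 - g)).
  have -> : qpi a = qpi (a - cmul a g.1).
    by apply/qpi_eq; rewrite opprB addrC subrK; exact: IMl.
  by rewrite (le_trans (qnorm_le _))// -nm_inj injB injM -(inBP gB) mulrBr mulr1.
rewrite (le_trans (_ : _ <= nm (inj a * (1 - g)) ^+ 2))//.
  by rewrite ler_pXn2r ?nnegrE ?nm_ge0 ?qnorm_ge0.
rewrite -nmC stM stB st1 gs mulrA -[_ * st (inj a) * inj a]mulrA.
have -> : st (inj a) * inj a = inj b - u by rewrite /u /i injB injM inj_st opprB addrC subrK.
rewrite (mulrBr (1 - g) (inj b) u) (mulrBl (1 - g)) (le_trans (nmB _ _))//.
rewrite (splitr e) addrA lerD//.
  rewrite (le_trans (nmM _ _))// (le_trans (ler_wpM2l (nm_ge0 _) g1))// mulr1.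
  rewrite (le_trans (nmM _ _))// (le_trans (ler_wpM2r (nm_ge0 _) g1))// mul1r nm_inj.
  exact: ltW.
by rewrite -mulrA (le_trans (nmM _ _))// (le_trans (ler_wpM2r (nm_ge0 _) g1))// mul1r.
Qed.

Definition quo_data : cstar_data R := CStarData
  qnormD qnormZ qnorm0 qcomplete qmulA qmulDl qmulDr qmulZl qmulZr
  qstarK qstarD qstarZ qstarM qnormM qnormC.

Definition quoT : cstarAlgType R := cs_of quo_data.
Definition qproj (a : A) : quoT := qpi a.

Lemma qproj_shom : shom qproj.
Proof.
split; [exact: qpiD|exact: qpiZ|move=> a b|move=> a].
  by rewrite -[RHS]/(qmul (qpi a) (qpi b)) qmulE.
by rewrite -[RHS]/(qstar (qpi a)) qstarE.
Qed.

Lemma qproj_quotient : is_quotient I qproj.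
Proof.
have h := qproj_shom; split.
- split=> //.
  + move=> a ca; apply: Icl => e e0; have e0' : 0 < toC e by rewrite ltcR.
    have [b [Ib ab]] := ca _ (nbhsx_ballx a _ e0').
    exists b => //; move: ab; rewrite -ball_normE/= => ab.
    by rewrite -lecR rnormE ltW.
  + by move=> a b Ia; split; [exact: IMr|exact: IMl].
- exact: shD h.
- exact: shZ h.
- exact: shM h.
- exact: sh_st h.
- by move=> q; exists (qv q); exact: qvK.
- exact: qpi0.
- move=> a; rewrite cs_of_rnormE -[LHS]/(qnorm (qpi a)) /qnorm; congr inf.
  apply/seteqP; split=> _ [i Ii <-].
    exists (qv (qpi a) - a + i); last by rewrite addrA [a + _]addrC subrK.
    by apply: ID => //; rewrite -opprB; apply: IN; exact: qv_pi.
  exists (a - qv (qpi a) + i); last by rewrite addrA [_ + (a - _)]addrC subrK.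
  by apply: ID => //; exact: qv_pi.
Qed.

End Quotient.

Lemma half_scale (R : realType) (V : lmodType R[i]) (v : V) :
  real_complex R 2^-1 *: (v + v) = v.
Proof.
by rewrite scalerDr -scalerDl -toCD (_ : 2^-1 + 2^-1 = 1) ?scale1r//; field.
Qed.

Lemma re_norm_toC (R : realType) (k : R) : 0 <= k -> complex.Re `|real_complex R k| = k.
Proof. by move=> k0; rewrite ger0_norm// ler0c. Qed.

Lemma one_sub_sqr (R : realType) (U : ucstarAlgType R) (y g : U) : g * g = 1 - y ->
  (1 - g) + (1 - g) = y + (1 - g) * (1 - g).
Proof. by move=> gg; rewrite mulrBl mul1r mulrBr mulr1 gg; lmod. Qed.

Lemma sqr_one_sub (R : realType) (U : ucstarAlgType R) (b f : U) : f + f = b + f * f ->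
  1 - b = (1 - f) * (1 - f).
Proof.
move=> ff; have -> : b = f + f - f * f by rewrite ff addrK.
by rewrite mulrBl mul1r mulrBr mulr1; lmod.
Qed.

(** * Homomorphisms acting entrywise on the stabilization *)

Section StabHom.
Context (R : realType) (A B : cstarAlgType R) (phi : A -> B) (h : shom phi).
Local Notation toC := (real_complex R).
Implicit Types (S T : infmx A) (n : nat) (c e : R).

Lemma sh0 : phi 0 = 0. Proof. by rewrite -(scale0r 0) shZ// scale0r. Qed.
Lemma shN a : phi (- a) = - phi a. Proof. by rewrite -scaleN1r shZ// scaleN1r. Qed.
Lemma shB a b : phi (a - b) = phi a - phi b. Proof. by rewrite shD// shN. Qed.
Lemma sh_sum (I : Type) (r : seq I) (P : pred I) (F : I -> A) :
  phi (\sum_(i <- r | P i) F i) = \sum_(i <- r | P i) phi (F i).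
Proof. by apply: big_morph; [exact: shD|exact: sh0]. Qed.
Lemma sh_norm a : rnorm (phi a) <= rnorm a.
Proof. by rewrite -!nm_inj -uz_inj; exact: ush_nm (uz_ushom h) _. Qed.

Definition mxmap T : infmx B := fun i j => phi (T i j).

Lemma mxmapB S T : mxmap (S - T) = mxmap S - mxmap T.
Proof. by apply: mx_ext => i j; exact: shB. Qed.

Lemma mxmap_trunc n T : mxmap (mx_trunc n T) = mx_trunc n (mxmap T).
Proof. by apply: mx_ext => i j; rewrite /mxmap /mx_trunc; case: ifP => _ //; exact: sh0. Qed.

Lemma mxmap_pprod n S T : mxmap (pprod n S T) = pprod n (mxmap S) (mxmap T).
Proof.
by apply: mx_ext => i j; rewrite /mxmap /pprod sh_sum; apply: eq_bigr => k _; exact: shM.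
Qed.

Lemma mxmap_adj T : mxmap (mx_adj T) = mx_adj (mxmap T).
Proof. by apply: mx_ext => i j; exact: sh_st. Qed.

End StabHom.

Section FiniteMatrices.
Context (R : realType) (A : cstarAlgType R).
Implicit Types (S T : infmx A) (n : nat) (c e : R).

Definition fins n T := forall i j, (n <= i)%N || (n <= j)%N -> T i j = 0.

Lemma fins_trunc n T : fins n T -> mx_trunc n T = T.
Proof.
move=> fT; apply: mx_ext => i j; rewrite /mx_trunc; case: ifPn => //.
by rewrite negb_and -!leqNgt => /fT.
Qed.

Lemma trunc_fins n T : fins n (mx_trunc n T).
Proof. by move=> i j nij; rewrite /mx_trunc ifN// negb_and -!leqNgt. Qed.

Lemma stab_fins n T : fins n T -> stab A T.
Proof. by move=> /fins_trunc; exact: stab_fs. Qed.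

Lemma fins_pprod n m S T : fins n S -> (n <= m)%N -> pprod m S T = pprod n S T.
Proof.
move=> fS nm_; apply: mx_ext => i j; rewrite /pprod.
rewrite -!(big_mkord xpredT (fun k => cmul (S i k) (T k j))).
rewrite (@big_cat_nat _ _ _ n)//= [X in _ + X]big1_seq ?addr0// => k /andP[_].
by rewrite mem_index_iota => /andP[nk _]; rewrite fS ?nk ?orbT// cmul0l.
Qed.

Lemma mx_mul_fins n S T : fins n S -> fins n T -> mx_mul S T = pprod n S T.
Proof.
move=> fS fT; apply: mx_mul_uniq; [exact: stab_fins fS|exact: stab_fins fT|].
move=> e e0; exists n => m nm_; rewrite (fins_pprod T fS nm_) subrr.
exact: mxb_le (ltW e0) (mxb0 _).
Qed.

Definition rowcut n T : infmx A := fun i j => if (n <= i)%N then T i j else 0.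

Lemma mxb_rowcut n T c : mxb T c -> mxb (rowcut n T) c.
Proof.
move=> Tc; apply: app_mxb => [|m v]; first by case: Tc.
apply: le_trans (mxb_app m v Tc).
rewrite -(@ler_pXn2r _ 2) ?nnegrE ?vec_norm_ge0// !vec_norm2 -!nm_inj.
apply: npos_le; first exact: npos_ip.
rewrite !inj_ip -sumrB; apply: npos_sum => i _; rewrite /mx_app /rowcut.
have [_|_] := leqP n i; first by rewrite subrr; exact: npos0.
have -> : \sum_(j < m) cmul 0 (v j) = 0 by apply: big1 => j _; exact: cmul0l.
by rewrite inj0 mulr0 subr0; exact: npos_kv.
Qed.

Lemma rowcut_pprod n m S T : rowcut n (pprod m S T) = pprod m (rowcut n S) T.
Proof.
apply: mx_ext => i j; rewrite /rowcut /pprod; case: ifP => // _.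
by rewrite big1// => k _; rewrite cmul0l.
Qed.

Lemma rowcut_mul n S T c d : stab A S -> stab A T -> mxb (rowcut n S) c -> mxb T d ->
  mxb (rowcut n (mx_mul S T)) (c * d).
Proof.
move=> sS sT Sc Td; apply: (@mxb_lim _ _ (fun m => pprod m (rowcut n S) T)).
  by move=> m; exact: mxb_pprod.
move=> i j e e0; have [N NP] := mx_mulP sS sT e0; exists N => m Nm.
rewrite -rowcut_pprod /rowcut; case: ifP => _; last by rewrite subrr rnorm0 ltW.
exact: (mxb_entry i j (NP _ Nm)).
Qed.

(* [1 - F] is the square root of [1 - x^* x]. *)
Lemma finite_sqrt n (x : stabT A) : fins n (mxs x) -> rnorm x <= 1 ->
  exists F : stabT A, [/\ fins n (mxs F), cstar F = F & F + F = cmul (cstar x) x + cmul F F].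
Proof.
move=> fx x1; pose y : unitz (stabT A) := inj (cmul (cstar x) x).
have sy : sa y by apply: npos_sa; rewrite /y injM inj_st; exact: npos_kv.
have y1 : nm y <= 1 by rewrite nm_inj rnorm_cstar_cmul expr_le1 ?rnorm_ge0.
have [g [sg g1 gg _]] := sqrt_one_sub sy y1.
pose F := 1 - g; have sF : sa F by apply: saB => //; exact: sa1.
have FF : F + F = y + F * F by exact: one_sub_sqr.
have F1 : nm F <= 1 by exact: g1.
(* The scalar part c of F solves 2 c = c^2, and the norm bound excludes c = 2. *)
clearbody F; have bF : inB F.
  have E : F.2 + F.2 = F.2 * F.2 by have := congr1 snd FF; rewrite /= add0r.
  have : F.2 * (F.2 - 2) = 0 by rewrite mulrBr -E mulr_natr mulr2n subrr.
  move=> /eqP; rewrite mulf_eq0 => /orP[/eqP//|/eqP/subr0_eq F2].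
  have := le_trans (unorm2 F) F1; rewrite F2 -[2]/(1 + 1) -toC2 re_norm_toC//.
  by rewrite -[X in _ <= X](mulr1n 1) ler_nat.
have FE := inBP bF; exists F.1.
have E : F.1 + F.1 = cmul (cstar x) x + cmul F.1 F.1.
  apply: (@inj_inj R (stabT A)); by rewrite !injD (injM F.1 F.1) -FE FF.
have Fst : cstar F.1 = F.1 by apply: (@inj_inj R (stabT A)); rewrite inj_st -FE.
split=> //.
(* The rows of [cmul (cstar x) x] from n on vanish, so those of F satisfy 2 G = G F. As F has norm
   at most 1, the norm of G is at most half of itself. *)
have r0 : mxb (rowcut n (mxs F.1)) 0.
  pose G := rowcut n (mxs F.1); have Gb : mxb G (mxn G) by apply: mxnP; apply: mxb_rowcut; exact: mxs_mxb.
  have Fb : mxb (mxs F.1) 1.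
    by apply: mxb_le (mxs_mxb _); rewrite -nm_inj -FE.
  have GE : G + G = rowcut n (mx_mul (mxs F.1) (mxs F.1)).
    apply: mx_ext => i j; rewrite mxDE /G /rowcut; case: ifP => ni; last by rewrite addr0.
    rewrite -[LHS]/(mxs (F.1 + F.1) i j) E mxsD mxDE mxsM mxs_star (@mx_mul_fins n)//.
      by rewrite /pprod big1 ?add0r// => k _; rewrite /mx_adj fx ?ni ?orbT// cstar0 cmul0l.
    by move=> a b; rewrite orbC => /fx; rewrite /mx_adj => ->; exact: cstar0.
  have h1 : mxb (G + G) (mxn G * 1).
    by rewrite GE; apply: rowcut_mul => //; exact: mxs_stab.
  have h2 : mxb G (mxn G * 2^-1).
    have := mxbZ (real_complex R 2^-1) h1; rewrite mulr1 (_ : _ *: (G + G) = G).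
      by rewrite re_norm_toC ?invr_ge0// mulrC.
    by apply: mx_ext => i j; rewrite mxZE mxDE half_scale.
  have g0 : mxn G = 0.
    have := mxn_le h2; have := mxn_ge0 G; lra.
  by rewrite g0 mul0r in h2.
have rz i j : (n <= i)%N -> mxs F.1 i j = 0.
  move=> ni; apply: rnorm0_eq0; apply/eqP; rewrite eq_le rnorm_ge0 andbT.
  by have := mxb_entry i j r0; rewrite /rowcut ni.
move=> i j /orP[/rz//|nj].
by rewrite -Fst mxs_star /mx_adj rz// cstar0.
Qed.

End FiniteMatrices.

Section StabMap.
Context (R : realType) (A B : cstarAlgType R) (phi : A -> B) (h : shom phi).
Local Notation toC := (real_complex R).
Implicit Types (S T : infmx A) (n : nat) (c e : R).
Local Notation mxmap := (mxmap phi).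

Lemma fins_map n T : fins n T -> fins n (mxmap T).
Proof. by move=> fT i j /fT; rewrite /mxmap => ->; exact: sh0. Qed.

(** The identity 1 - [st x * x] = (1 - F)^2 involves finite matrices only, so it is algebraic and
    survives the entrywise application of phi; the image of x then satisfies the same identity and
    is a contraction. *)
Lemma mxb_map_fins1 n T : fins n T -> mxb T 1 -> mxb (mxmap T) 1.
Proof.
move=> fT T1; pose x := smk (stab_fins fT); have fx := fins_map fT.
pose y := smk (stab_fins fx).
have [|F [fF sF FE]] := @finite_sqrt _ _ n x fT; first exact: mxs_le.
have fF' := fins_map fF; pose F' := smk (stab_fins fF').
have fadj (C : cstarAlgType R) (S : infmx C) : fins n S -> fins n (mx_adj S).
  by move=> fS i j; rewrite orbC => /fS; rewrite /mx_adj => ->; exact: cstar0.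
have E : F' + F' = cmul (cstar y) y + cmul F' F'.
  apply: mxs_inj; rewrite !mxsD !mxsM mxs_star !mxsK.
  rewrite !(@mx_mul_fins _ _ n)//; try exact: fadj.
  rewrite -(mxmap_adj h) -!(mxmap_pprod h).
  have := congr1 (fun z => mxmap (mxs z)) FE.
  rewrite !mxsD !mxsM mxs_star mxsK !(@mx_mul_fins _ _ n)//; try exact: fadj.
  by move=> E'; apply: mx_ext => i j; have := congr1 (fun z : infmx B => z i j) E'; rewrite /mxmap !mxDE !(shD h).
have sF' : sa (inj F').
  rewrite /sa -inj_st; congr inj; apply: mxs_inj; rewrite mxs_star mxsK -(mxmap_adj h).
  by rewrite -mxs_star sF.
have n1 : npos (1 - st (inj y) * inj y).
  rewrite (@sqr_one_sub _ _ _ (inj F')); last by rewrite -inj_st -!injM -!injD E.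
  by apply: npos_sq; apply: saB => //; exact: sa1.
have y1 : rnorm y <= 1.
  rewrite -nm_inj -(@ler_pXn2r _ 2) ?nnegrE ?nm_ge0// expr1n -nmC.
  by rewrite -(nm1 (unitz (stabT B))); apply: npos_le => //; exact: npos_kv.
exact: mxb_le (mxs_mxb y).
Qed.

Lemma mxb_map T c : mxb T c -> mxb (mxmap T) c.
Proof.
move=> Tc; have c0 : 0 <= c by case: Tc.
suff fin n : mxb (mxmap (mx_trunc n T)) c.
  apply: mxb_lim fin _ => i j e e0; exists (maxn i j).+1 => n nij.
  rewrite /mxmap /mx_trunc (leq_ltn_trans (leq_maxl i j) nij) (leq_ltn_trans (leq_maxr i j) nij).
  by rewrite subrr rnorm0 ltW.
have Tn := mxb_trunc n Tc; set S := mx_trunc n T in Tn *.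
have fS : fins n S := @trunc_fins _ _ n T.
have k e : 0 < e -> mxb (mxmap S) (c + e).
  move=> e0; have ce : 0 < c + e by rewrite ltr_wpDl.
  have f1 : fins n (toC (c + e)^-1 *: S).
    by move=> i j ij; rewrite mxZE fS// scaler0.
  have b1 : mxb (toC (c + e)^-1 *: S) 1.
    apply: mxb_le (mxbZ _ Tn); rewrite re_norm_toC ?invr_ge0 ?(ltW ce)//.
    by rewrite mulrC ler_pdivrMr// mul1r lerDl ltW.
  have := mxbZ (toC (c + e)) (mxb_map_fins1 f1 b1); rewrite re_norm_toC ?(ltW ce)// mulr1.
  congr mxb; apply: mx_ext => i j; rewrite mxZE /mxmap mxZE (shZ h) scalerA -toCM.
  by rewrite mulfV ?gt_eqF// scale1r.
split=> // m u v; apply/ler_addgt0Pr => e e0.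
have K0 : 0 < vec_norm m u * vec_norm m v + 1 by rewrite ltr_wpDl// mulr_ge0 ?vec_norm_ge0.
have [_ /(_ m u v)/le_trans] := k _ (divr_gt0 e0 K0); apply.
by rewrite mulrDl lerD2l mulrC small_mul ?mulr_ge0 ?vec_norm_ge0// ltW.
Qed.

Lemma stab_map T : stab A T -> stab B (mxmap T).
Proof.
move=> /stabP sT; apply/stabP => e /sT[N NP]; exists N => n /NP.
by move=> /mxb_map; rewrite mxmapB// mxmap_trunc.
Qed.

Definition stmap (x : stabT A) : stabT B := smk (stab_map (mxs_stab x)).

Lemma mxs_stmap x : mxs (stmap x) = mxmap (mxs x). Proof. by []. Qed.

Lemma stmap_shom : shom stmap.
Proof.
split=> [a b|k a|a b|a]; apply: mxs_inj.
- by apply: mx_ext => i j; exact: shD.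
- by apply: mx_ext => i j; exact: shZ.
- rewrite mxsM !mxs_stmap; apply/esym/mx_mul_uniq; [exact: stab_map (mxs_stab _)..|].
  move=> e e0; have [N NP] := mx_mul_near (mxs_stab a) (mxs_stab b) e0; exists N => n Nn.
  by rewrite -(mxmap_pprod h) -(mxmapB h); apply: mxb_map; rewrite mxsM; exact: NP.
- by rewrite mxs_star !mxs_stmap mxs_star mxmap_adj.
Qed.

Lemma stmap_sl j a : stmap (sl (stab_stable A) j a) = sl (stab_stable B) j (stmap a).
Proof.
apply: mxs_inj; apply: mx_ext => i k.
rewrite -[LHS]/(phi (Lmx j (mxs a) i k)) -[RHS]/(Lmx j (mxmap (mxs a)) i k) /Lmx /spl.
by case: ifP => // _; exact: sh0.
Qed.

End StabMap.

Section CutSub.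
Context (R : realType) (U : ucstarAlgType R).
Local Notation toC := (real_complex R).
Implicit Types a b u v w : U.

Lemma cle_00 a : cle a 0 -> a = 0.
Proof.
move=> h; apply: nm_le_eq => e /h[v]; rewrite mulr0 mul0r sub0r nmN.
by rewrite subr0.
Qed.

(* From b <= k a + c and a <= (a - g)_+ + g. *)
Lemma cle_cut_dom a b (k c g : R) : npos a -> npos b -> 0 <= k -> 0 <= g -> 0 <= c ->
  npos (toC k *: a + sc U c - b) -> cle (cut (k * g + c) b) (cut g a).
Proof.
move=> na nb k0 g0 c0 nab.
have nc := npos_cut g na; apply: cle_trans (cleZ (cut g a) k0).
apply: cle_cut_sub => //; [exact: nposZ|by rewrite addr_ge0 ?mulr_ge0|].
have := nposD (nposZ k0 (cut_ge g na)) nab; congr npos; lmod.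
Qed.

Lemma npos_sum2 u v : npos (toC 2 *: (st u * u) + toC 2 *: (st v * v) - st (u + v) * (u + v)).
Proof.
have := npos_kv (u - v); congr npos; rewrite stB stD !mulrDl !mulrDr !mulNr !mulrN; lmod.
Qed.

Lemma genID_aux (a b p q x t : U) :
  toC 2 *: (p - (a - t) + (q - (b - t))) + (toC 2 *: a + toC 2 *: b - x) =
  toC 2 *: (p + q) - x + toC 2 *: (t + t).
Proof. lmod. Qed.

Lemma genI_lim_aux (a b x t : U) :
  toC 2 *: a + toC 2 *: b - x + toC 2 *: (t - b) = toC 2 *: a + toC 2 *: t - x.
Proof. lmod. Qed.

End CutSub.

(** * The ideal generated by a Cuntz class *)

Section IdealGenerated.
Context (R : realType) (D : cstarAlgType R) (s : stable_str D) (z : cu s).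
Local Notation toC := (real_complex R).
Local Notation U := (unitz D).
Implicit Types u v w : U.

(* The elements whose class lies in the ideal generated by [z]. *)
Definition genI u := forall d : R, 0 < d -> exists L, cl s (cut d (st u * u)) ⊑ z *+ L.

Lemma genI_dom u v : inB u -> inB v -> forall (k : R), 0 <= k ->
  (forall c : R, 0 < c -> npos (toC k *: (st u * u) + sc U c - st v * v)) -> genI u -> genI v.
Proof.
move=> bu bv k k0 h Ju d d0; have d2 := divr_gt0 d0 (ltr0n _ 2).
have k1 : 0 < k + 1 by rewrite ltr_wpDl.
have g0 := divr_gt0 d2 k1; have [L hL] := Ju _ g0; exists L.
have [pu pv] := (pB_kv bu, pB_kv bv).
apply: cule_trans hL; apply/cule_cl; [exact: pB_cut (ltW d0) pv|exact: pB_cut (ltW g0) pu|].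
have h1 : k * (d / 2 / (k + 1)) <= d / 2 by apply: small_mul k0 (ltW d2).
have h2 := cle_cut_dom (pB_npos pu) (pB_npos pv) k0 (ltW g0) (ltW d2) (h _ d2).
apply: cle_trans h2; apply: cut_mono (pB_npos pv) _ _.
  by apply: addr_ge0 (ltW d2); exact: mulr_ge0 k0 (ltW g0).
by rewrite [leRHS](splitr d) lerD2r.
Qed.

Lemma genI_left u w : inB u -> genI u -> genI (w * u).
Proof.
move=> bu; have w0 : 0 <= nm (st w * w) := nm_ge0 _.
apply: (genI_dom bu (inB_mull w bu) w0) => c c0.
have n1 : npos (st u * (sc U (nm (st w * w)) - st w * w) * u).
  by apply: npos_stM; apply: npos_leN (npos_kv w) (lexx _).
have := nposD n1 (nposZ (ltW c0) (npos1 U)); congr npos.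
by rewrite stM mulrBr mulrBl scEr -scalerAl !mulrA addrAC.
Qed.

Lemma genI_star u : inB u -> genI u -> genI (st u).
Proof.
move=> bu Ju d d0; have [L hL] := Ju _ d0; exists L; rewrite stK.
apply: cule_trans hL; apply/cule_cl; [exact: pB_cut (ltW d0) (pB_vk bu)|exact: pB_cut (ltW d0) (pB_kv bu)|].
by have := cut_stC (st u) d0; rewrite stK.
Qed.

Lemma genI_right u w : inB u -> genI u -> genI (u * w).
Proof.
move=> bu Ju; rewrite -[u * w]stK stM; apply: genI_star; first exact: inB_mull (inB_st bu).
by apply: genI_left; [exact: inB_st|exact: genI_star].
Qed.

Lemma genID u v : inB u -> inB v -> genI u -> genI v -> genI (u + v).
Proof.
move=> bu bv Ju Jv d d0; have d4 : 0 < d / 4 by rewrite divr_gt0.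
have [L1 h1] := Ju _ d4; have [L2 h2] := Jv _ d4; exists (L1 + L2)%N.
have [pu pv] := (pB_kv bu, pB_kv bv); have puv := pB_kv (inBD bu bv).
have [cu_ cv] := (pB_cut (ltW d4) pu, pB_cut (ltW d4) pv).
rewrite mulrnDr; apply: cule_trans (culeD h1 h2).
apply: cule_trans (cl_addle s cu_ cv); apply/cule_cl; [exact: pB_cut (ltW d0) puv|exact: pBD|].
apply: cle_trans (cleZ (_ : U) (_ : 0 <= 2)) => //; apply: cle_cut_sub.
- exact: pB_npos.
- by apply: nposZ => //; exact: pB_npos (pBD _ _).
- exact: ltW.
have n1 := cut_ge (d / 4) (pB_npos pu); have n2 := cut_ge (d / 4) (pB_npos pv).
have := nposD (nposZ (ler0n R 2) (nposD n1 n2)) (npos_sum2 u v); congr npos.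
have -> : sc U d = toC 2 *: (sc U (d / 4) + sc U (d / 4)).
  by rewrite /sc -scalerDl scalerA -toCD -toCM; congr (toC _ *: _); field.
exact: genID_aux.
Qed.

Lemma genI_lim u : inB u ->
  (forall e : R, 0 < e -> exists v, [/\ inB v, genI v & nm (u - v) <= e]) -> genI u.
Proof.
(* The minimum with 1 makes e^2 at most d / 4. *)
move=> bu h d d0; pose e := Num.min 1 (d / 4).
have e0 : 0 < e by rewrite lt_min ltr01 divr_gt0.
have [v [bv Jv uv]] := h _ e0; have d4 : 0 < d / 4 by rewrite divr_gt0.
have [L hL] := Jv _ d4; exists L.
have [pu pv] := (pB_kv bu, pB_kv bv).
apply: cule_trans hL; apply/cule_cl; [exact: pB_cut (ltW d0) pu|exact: pB_cut (ltW d4) pv|].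
have n1 : npos (toC 2 *: (st v * v) + sc U (d / 2) - st u * u).
  have n2 := npos_sum2 v (u - v); rewrite (_ : v + (u - v) = u) in n2; last by rewrite addrC subrK.
  have n3 : npos (sc U (d / 4) - st (u - v) * (u - v)).
    apply: npos_leN (npos_kv _) _; rewrite nmC expr2 (le_trans (ler_pM (nm_ge0 _) (nm_ge0 _) uv uv))//.
    rewrite (@le_trans _ _ (1 * e))// ?ler_wpM2r ?(ltW e0)// ?ge_min ?lexx// mul1r.
    by rewrite ge_min lexx orbT.
  have := nposD n2 (nposZ (ler0n R 2) n3); congr npos.
  have -> : sc U (d / 2) = toC 2 *: sc U (d / 4).
    by rewrite /sc scalerA -toCM; congr (toC _ *: _); field.
  exact: genI_lim_aux.
have := cle_cut_dom (pB_npos pv) (pB_npos pu) (ler0n R 2) (ltW d4) (ltW (divr_gt0 d0 (ltr0n _ 2))) n1.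
by congr (cle (cut _ _) _); field.
Qed.

End IdealGenerated.

(** * Matrix entries and ideals of the stabilization *)

Section Corner.
Context (R : realType) (A : cstarAlgType R).
Local Notation toC := (real_complex R).
Local Notation D := (stabT A).
Implicit Types (S T : infmx A) (n : nat).

Lemma mx_mul_entry S T i j c : stab A S -> stab A T ->
  (exists N, forall n, (N <= n)%N -> pprod n S T i j = c) -> mx_mul S T i j = c.
Proof.
move=> sS sT [N NP]; apply: limn_rnorm => e e0; exists N => n Nn.
by rewrite -[\sum_(k < n) _]/(pprod n S T i j) NP// subrr rnorm0 ltW.
Qed.

(** Left multiplication by the matrix unit at (i', i). Written as an operation on rows because A may
    have no unit, so that the matrix unit is not an element of the stabilization. *)
Definition mxrow i' i T : infmx A := fun a b => if a == i' then T i b else 0.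

Lemma mxb_mxrow i' i T c : mxb T c -> mxb (mxrow i' i T) c.
Proof.
move=> Tc; apply: app_mxb => [|n v]; first by case: Tc.
pose x := \sum_(k < n) cmul (T i k) (v k).
have x1 : rnorm x <= c * vec_norm n v.
  apply: le_trans (mx_app_le i.+1 n v Tc).
  exact: (@vec_norm_term _ _ _ (fun k => \sum_(j < n) cmul (T k j) (v j)) i (ltnSn i)).
apply: le_trans x1; rewrite -(@ler_pXn2r _ 2) ?nnegrE ?vec_norm_ge0 ?rnorm_ge0//.
rewrite vec_norm2 /ip.
have E k : mx_app n (mxrow i' i T) v k = if k == i' then x else 0.
  rewrite /mx_app /mxrow; case: eqP => // _; apply: big1 => j _; exact: cmul0l.
under eq_bigr do rewrite E.
have [ni|ni] := leqP n i'.
  rewrite big1 ?rnorm0 ?sqr_ge0// => k _; rewrite ifN ?cmul0r//.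
  by rewrite neq_ltn (leq_trans (ltn_ord k) ni).
rewrite (bigD1 (Ordinal ni))//= eqxx big1 ?addr0 ?rnorm_cstar_cmul// => k ki.
by rewrite ifN ?cmul0r//; apply: contra ki => /eqP ki; apply/eqP/val_inj.
Qed.

Lemma mxrowB i' i S T : mxrow i' i (S - T) = mxrow i' i S - mxrow i' i T.
Proof. by apply: mx_ext => a b; rewrite mxBE /mxrow; case: ifP; rewrite ?subr0. Qed.

Lemma stab_mxrow i' i T : stab A T -> stab A (mxrow i' i T).
Proof.
move=> sT; apply: stab_lim => e e0; have [N /(_ N (leqnn _)) h] := stab_near sT e0.
exists (mxrow i' i (mx_trunc N T)); last by rewrite -mxrowB; exact: mxb_mxrow.
apply: (@stab_fins _ _ (maxn N i'.+1)) => a b ab; rewrite /mxrow; case: eqP => // ai.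
rewrite trunc_fins//; case/orP: ab => [|h1]; first by rewrite ai geq_max ltnn andbF.
by rewrite (leq_trans (leq_maxl _ _) h1) orbT.
Qed.

Definition rw i' i (x : D) : D := smk (stab_mxrow i' i (mxs_stab x)).

Lemma rw_ip i' i (x : D) : [/\ mxs (cmul (cstar (rw i' i x)) (rw i' i x)) =
    (fun a b => cmul (cstar (mxs x i a)) (mxs x i b)) ,
  mxs (cmul (cstar x) (rw i i x)) = (fun a b => cmul (cstar (mxs x i a)) (mxs x i b)) &
  mxs (cmul (cstar (rw i i x)) x) = (fun a b => cmul (cstar (mxs x i a)) (mxs x i b))].
Proof.
have big (F : nat -> A) k n : (k < n)%N -> (forall j, j != k -> F j = 0) ->
    \sum_(j < n) F j = F k.
  move=> kn h; rewrite (bigD1 (Ordinal kn))//= big1 ?addr0// => j jk.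
  by apply: h; apply: contra jk => /eqP jk; apply/eqP/val_inj.
have st (y z : D) a b (c : A) : (exists N, forall n, (N <= n)%N -> pprod n (mx_adj (mxs y)) (mxs z) a b = c) ->
    mxs (cmul (cstar y) z) a b = c.
  by rewrite mxsM mxs_star; apply: mx_mul_entry; [exact: stab_adj (mxs_stab y)|exact: mxs_stab].
split; apply: mx_ext => a b; apply: st.
- exists i'.+1 => n ni; rewrite /pprod (big (fun k => cmul (mx_adj (mxs (rw i' i x)) a k) (mxs (rw i' i x) k b)) i' n ni).
    by rewrite /mx_adj mxsK /mxrow eqxx.
  by move=> j ji; rewrite mxsK /mxrow (negbTE ji) cmul0r.
- exists i.+1 => n ni; rewrite /pprod (big (fun k => cmul (mx_adj (mxs x) a k) (mxs (rw i i x) k b)) i n ni).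
    by rewrite /mx_adj mxsK /mxrow eqxx.
  by move=> j ji; rewrite mxsK /mxrow (negbTE ji) cmul0r.
- exists i.+1 => n ni; rewrite /pprod (big (fun k => cmul (mx_adj (mxs (rw i i x)) a k) (mxs x k b)) i n ni).
    by rewrite /mx_adj mxsK /mxrow eqxx.
  by move=> j ji; rewrite /mx_adj mxsK /mxrow (negbTE ji) cstar0 cmul0l.
Qed.

(** The difference is the square of x with its i-th row removed: both cross terms equal the square
    of that row, and moving the row does not change its square. *)
Lemma rw_le i' i (x : D) :
  npos (st (inj x) * inj x - st (inj (rw i' i x)) * inj (rw i' i x)).
Proof.
have [e1 e2 e3] := rw_ip i' i x; have [e1' _ _] := rw_ip i i x.
have := npos_kv (inj (x - rw i i x)); congr npos.
rewrite injB stB mulrBl !mulrBr -!inj_st -!injM.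
have -> : cmul (cstar (rw i i x)) x = cmul (cstar (rw i i x)) (rw i i x).
  by apply: mxs_inj; rewrite e3 e1'.
have -> : cmul (cstar x) (rw i i x) = cmul (cstar (rw i' i x)) (rw i' i x).
  by apply: mxs_inj; rewrite e2 e1.
by rewrite subrr subr0.
Qed.

Definition cormx (a : A) : infmx A := fun i j => if (i == 0%N) && (j == 0%N) then a else 0.

Lemma fins_cor a : fins 1 (cormx a).
Proof. by move=> i j /orP[] h; rewrite /cormx; case: i j h => [|i] [|j]. Qed.

Definition cor a : D := smk (stab_fins (fins_cor a)).

Lemma cor_shom : shom cor.
Proof.
split=> [a b|k a|a b|a]; apply: mxs_inj; apply: mx_ext => i j.
- by rewrite mxsD mxDE !mxsK /cormx; case: ifP; rewrite ?addr0.
- by rewrite mxsZ mxZE !mxsK /cormx; case: ifP; rewrite ?scaler0.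
- rewrite mxsM !mxsK (mx_mul_fins (fins_cor a) (fins_cor b)) /pprod big_ord1 /cormx /=.
  by rewrite eqxx andbT; case: eqP => //= _; [case: ifP; rewrite ?cmul0r|rewrite cmul0l].
- by rewrite mxs_star /mx_adj !mxsK /cormx andbC; case: ifP; rewrite ?cstar0.
Qed.

Lemma cor_entry (x : D) i j : cor (mxs x i j) = cstar (rw 0 j (cstar (rw 0 i x))).
Proof.
apply: mxs_inj; apply: mx_ext => a b; rewrite -[RHS]/(cstar (mxrow 0 j (mx_adj (mxrow 0 i (mxs x))) b a)).
rewrite -[LHS]/(cormx (mxs x i j) a b) /mxrow /mx_adj /cormx.
by case: a b => [|a] [|b]; rewrite /= ?cstarK ?cstar0.
Qed.

Definition unit_mx i j a : D := rw i 0 (cstar (rw j 0 (cstar (cor a)))).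

Lemma unit_mxE i j a k l : mxs (unit_mx i j a) k l = if (k == i) && (l == j) then a else 0.
Proof.
rewrite -[LHS]/(mxrow i 0 (mx_adj (mxrow j 0 (mx_adj (cormx a)))) k l) /mxrow /mx_adj /cormx.
by case: eqP => //= _; case: eqP => //= _; rewrite ?cstarK ?cstar0.
Qed.

Lemma trunc_sum n (x : D) :
  mxs (\sum_(i < n) \sum_(j < n) unit_mx i j (mxs x i j)) = mx_trunc n (mxs x).
Proof.
have mS (I : Type) (r : seq I) (F : I -> D) k l :
    mxs (\sum_(i <- r) F i) k l = \sum_(i <- r) mxs (F i) k l.
  elim: r => [|i r IH]; first by rewrite !big_nil.
  by rewrite !big_cons mxsD mxDE IH.
apply: mx_ext => k l; rewrite mS; under eq_bigr do rewrite mS.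
under eq_bigr do under eq_bigr do rewrite unit_mxE.
rewrite /mx_trunc; case: ifPn => [/andP[kn ln]|].
  rewrite (bigD1 (Ordinal kn))//= (bigD1 (Ordinal ln))//= !eqxx/= big1 ?addr0 => [|j jl].
    rewrite big1 ?addr0// => i ik; apply: big1 => j _; rewrite ifN// negb_and.
    by apply/orP; left; apply: contra ik => /eqP ik; apply/eqP/val_inj.
  by rewrite ifN//; apply: contra jl => /eqP jl; apply/eqP/val_inj.
rewrite negb_and => h; apply: big1 => i _; apply: big1 => j _; rewrite ifN//.
by apply/negP => /andP[/eqP ki /eqP lj]; move: h; rewrite ki lj !ltn_ord.
Qed.

End Corner.

Lemma mulrn_absorb (R : realType) (D : cstarAlgType R) (s : stable_str D) (x y : cu s) n :
  x + y ⊑ y -> x *+ n + y ⊑ y.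
Proof.
move=> h; elim: n => [|n IH]; first by rewrite add0r; exact: cule_refl.
by rewrite mulrSr -addrA; apply: cule_trans IH; exact: culeD (cule_refl _) h.
Qed.

(** * Cancellation from the hypothesis on quotients *)

Section CancellationFromQuotients.
Context (R : realType) (A : cstarAlgType R).
Local Notation toC := (real_complex R).
Local Notation D := (stabT A).
Local Notation s := (stab_stable A).

Section Ideal.
Context (z : cu s).
Local Notation J := (@genI R D s z).

(** The hypothesis concerns quotients of A, whereas [genI z] lives in the stabilization. [J_entry]
    and [J_entries] identify the elements of the stabilization that belong to [genI z] as the
    matrices with entries in this ideal of A. *)
Definition idI : set A := [set a | J (inj (cor a))].

Lemma J_rw i' i (x : D) : J (inj x) -> J (inj (rw i' i x)).
Proof.
apply: (@genI_dom _ _ _ _ (inj x) (inj (rw i' i x)) (inB_inj _) (inB_inj _) 1 ler01) => c c0.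
have := nposD (rw_le i' i x) (nposZ (ltW c0) (npos1 _)); congr npos.
by rewrite addrAC scale1r.
Qed.

Lemma J_star (x : D) : J (inj x) -> J (inj (cstar x)).
Proof. by rewrite inj_st; apply: genI_star; exact: inB_inj. Qed.

Lemma J0 : J (0 : unitz D).
Proof.
move=> d d0; exists 0%N; rewrite st0 mul0r mulr0n -(cl0 s); apply/cule_cl; [|exact: pB0|].
  exact: pB_cut (ltW d0) (@pB0 _ _).
by apply: cut_cle (ltW d0); exact: npos0.
Qed.

Lemma J_entry (x : D) i j : J (inj x) -> idI (mxs x i j).
Proof. by move=> Jx; rewrite /idI /= cor_entry; apply: J_star; apply/J_rw/J_star/J_rw. Qed.

Lemma J_entries (x : D) : (forall i j, idI (mxs x i j)) -> J (inj x).
Proof.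
move=> Ix; apply: genI_lim; first exact: inB_inj.
move=> e e0; have [N /(_ N (leqnn _)) h] := stab_near (mxs_stab x) e0.
pose y : D := \sum_(i < N) \sum_(j < N) unit_mx i j (mxs x i j).
exists (inj y); split; first exact: inB_inj.
  have JD (a b : D) : J (inj a) -> J (inj b) -> J (inj (a + b)).
    by move=> Ja Jb; rewrite injD; apply: genID => //; exact: inB_inj.
  apply: (big_ind (fun y => J (inj y))) => //; first exact: J0.
  move=> i _; apply: (big_ind (fun y => J (inj y))) => //; first exact: J0.
  by move=> j _; apply/J_rw/J_star/J_rw/J_star/Ix.
by rewrite -injB nm_inj; apply: mxs_le; rewrite mxsB trunc_sum.
Qed.

Let hc := cor_shom A.

Lemma idI0 : idI 0.
Proof. by rewrite /idI /= (sh0 hc); exact: J0. Qed.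
Lemma idID a b : idI a -> idI b -> idI (a + b).
Proof. by move=> Ia Ib; rewrite /idI /= (shD hc) injD; apply: genID => //; exact: inB_inj. Qed.
Lemma idIMl a b : idI b -> idI (cmul a b).
Proof. by move=> Ib; rewrite /idI /= (shM hc) injM; apply: genI_left => //; exact: inB_inj. Qed.
Lemma idIMr a b : idI a -> idI (cmul a b).
Proof. by move=> Ib; rewrite /idI /= (shM hc) injM; apply: genI_right => //; exact: inB_inj. Qed.
Lemma idIst a : idI a -> idI (cstar a).
Proof. by move=> Ia; rewrite /idI /= (sh_st hc) inj_st; apply: genI_star => //; exact: inB_inj. Qed.
Lemma idIZ (k : R[i]) a : idI a -> idI (k *: a).
Proof.
move=> Ia; rewrite /idI /= (shZ hc) injZ -[inj (cor a)]mul1r scalerAl.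
by apply: genI_left => //; exact: inB_inj.
Qed.
Lemma idIcl a : (forall e : R, 0 < e -> exists2 b, idI b & rnorm (a - b) <= e) -> idI a.
Proof.
move=> h; apply: genI_lim; first exact: inB_inj.
move=> e /h[b Ib ab]; exists (inj (cor b)); split=> //.
by rewrite -injB nm_inj -(shB hc) (le_trans (sh_norm hc _)).
Qed.

End Ideal.

Hypothesis noquot : ~ exists (I : set A) (Q : cstarAlgType R) (pi : A -> Q) (x : set (infmx Q)),
      [/\ is_quotient I pi, Cu Q x, x <> cu_zero Q, cu_compact x & properly_infinite x].

Lemma cancellation : cuCAN s.
Proof.
move=> u w w' d M uw ww wM.
pose I := idI d.
pose Q := quoT (@idI0 d) (@idID d) (@idIZ d) (@idIMr d) (@idIMl d) (@idIst d) (@idIcl d).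
pose p : A -> Q := @qproj _ _ _ _ _ _ _ _ _ _.
have hp : shom p by exact: qproj_shom.
have hsl := stmap_sl hp; have hst := stmap_shom hp.
pose f := @cumap R D (stabT Q) s (stab_stable Q) (stmap hp).
have fD x y : f (x + y) = f x + f y by exact: cumapD hst hsl x y.
have fle x y : x ⊑ y -> f x ⊑ f y by exact: (@cumap_le _ _ _ _ _ _ hst x y).
have fll x y : cull x y -> cull (f x) (f y) by exact: (@cumap_ll _ _ _ _ _ _ hst x y).
have fn x n : f (x *+ n) = f x *+ n by exact: cumap_mulrn hst hsl x n.
have f0 : f d = 0.
  rewrite /f /cumap -cl0; congr cl.
  have [h [ph hh sh]] := pB_sqrt (pB_cuv d); have bh := pB_inB ph.
  rewrite -hh (ushM (uz_ushom hst)); suff -> : uz (stmap hp) h = 0 by rewrite mul0r.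
  have Jh : genI d (inj h.1).
    move=> c c0; exists 1%N; rewrite mulr1n -(inBP bh) sh hh -{2}[d]cuvK.
    exact: cl_cut (pB_cuv _) (ltW c0).
  rewrite (inBP bh) uz_inj; congr inj; apply: mxs_inj; apply: mx_ext => i j.
  by apply/(qpi0 (@idI0 d) (@idID d) (@idIZ d)); exact: J_entry.
have fw : f w = 0.
  apply: contrapT => nz; apply: noquot.
  have h1 : f u + f w ⊑ f w' by rewrite -fD -[f w']add0r -f0 -fD; exact: fle.
  have h2 := fll _ _ ww; have wle := culeDr (f u) (f w).
  (* What is absorbed once is absorbed M times, and M copies of the image of u dominate the image of
     w. *)
  have inf : f w + f w ⊑ f w.
    apply: cule_trans (culeD (fle _ _ wM) (cule_refl _)) _; rewrite fn; apply: mulrn_absorb.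
    exact: cule_trans h1 (cullW h2).
  have [X [X1 X2 X3 X4]] := cu_compact_infinite (cull_lel (cule_trans wle h1) h2) inf nz.
  by exists I, Q, p, X; split=> //; exact: qproj_quotient.
(* Vanishing in the quotient gives [genI d W], which bounds the cut-downs of W^2 only, with L
   depending on the cut. Since w' lies below a cut-down of W, it is bounded after comparing (t -
   c)_+ with (t^2 - c^2)_+. *)
have [L hL] : exists L, w' ⊑ d *+ L.
  have [c c0 hc] := ww; pose W := cuv w; have pW := pB_cuv w; have nW := pB_npos pW.
  have Wz : uz (stmap hp) W = 0.
    have pU := uz_pB hst pW; have pz := @pB0 _ (stabT Q).
    apply: cle_00; apply/(cule_cl (stab_stable Q) pU pz).
    by rewrite cl0 -fw; exact: cule_refl.
  have JW : genI d W.
    have EW : W = inj W.1 := inBP (pB_inB pW).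
    rewrite EW; apply: J_entries => i j.
    apply/(qpi0 (@idI0 d) (@idID d) (@idIZ d)).
    by have := congr1 (fun z : unitz (stabT Q) => mxs z.1 i j) Wz.
  have c2 : 0 < c ^+ 2 by rewrite exprn_gt0.
  have [L hL] := JW _ c2; exists L; apply: cule_trans hc (cule_trans _ hL).
  apply/cule_cl; [exact: pB_cut (ltW c0) pW|exact: pB_cut (ltW c2) (pB_kv (pB_inB pW))|].
  rewrite (npos_sa nW); have ai := @appr_id R; have ac := @appr_cutf R c.
  have a2 := apprM ai ai; have ac2 := @appr_cutf R (c ^+ 2).
  have -> : cut (c ^+ 2) (W * W) = fc W (fun t => cutf (c ^+ 2) (t * t)).
    rewrite /cut -fc_comp//; last by move=> t t0; exact: mulr_ge0.
    by rewrite fcM// fc_id.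
  apply: (cle_fc_le (K := c^-1)) => //.
  - by apply: appr_comp => // t t0; exact: mulr_ge0.
  - by rewrite invr_ge0 ltW.
  - by move=> t t0 _; exact: cutf_ge0.
  - move=> t t0 _; have [tc|ct] := leP t c.
      by rewrite cutf_lo// mulr_ge0 ?invr_ge0 ?(ltW c0)// cutf_ge0.
    rewrite !cutf_hi ?(ltW ct)//; last by rewrite -expr2 ler_pXn2r ?nnegrE ?(ltW c0) ?(ltW ct).
    rewrite ler_pdivlMl// (_ : t * t - _ = (t - c) * (t + c)); last by ring.
    by rewrite mulrC ler_wpM2l ?subr_ge0 ?(ltW ct)// lerDr.
exists L => -[|n]; first by rewrite mulr0n; exact: cule0.
have wd : u + w ⊑ d + w by apply: cule_trans uw _; exact: culeD (cule_refl _) (cullW ww).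
(* Here w is carried along unchanged; only in the last addition is it traded for w', which lies
   below L copies of d. *)
have it m : u *+ m + w ⊑ d *+ m + w.
  elim: m => [|m IH]; first by rewrite !mulr0n; exact: cule_refl.
  rewrite !mulrS -addrA; apply: cule_trans (culeD (cule_refl u) IH) _.
  rewrite addrCA -[X in _ ⊑ X]addrA [X in _ ⊑ X]addrCA; exact: culeD (cule_refl _) wd.
apply: cule_trans (culeDl _ w) _; rewrite mulrS -addrA.
apply: cule_trans (culeD (cule_refl u) (it n)) _; rewrite addrCA.
apply: cule_trans (culeD (cule_refl _) uw) _; rewrite mulrnDr mulrSr -addrA.
exact: culeD (cule_refl _) (culeD (cule_refl _) hL).
Qed.

End CancellationFromQuotients.

(** * Uniformly continuous sections *)

Lemma sl_norm (R : realType) (D : cstarAlgType R) (s : stable_str D) j x : rnorm (sl s j x) = rnorm x.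
Proof.
apply/eqP; rewrite -(@eqrXn2 _ 2) ?rnorm_ge0//; apply/eqP.
by rewrite -!rnorm_cstar_cmul slI eqxx.
Qed.

Lemma sl_B (R : realType) (D : cstarAlgType R) (s : stable_str D) j x y :
  sl s j (x - y) = sl s j x - sl s j y.
Proof. by rewrite slD -scaleN1r slZ scaleN1r. Qed.

(* Sections that are uniformly continuous with respect to finitely many coordinates [f], which
   amounts to replacing X by its image in a cube. *)
Section UniformFields.
Context (R : realType) (X : topologicalType) (cptX : compact [set: X]).
Context (m : nat) (f : 'I_m -> X -> R) (cf : forall i, continuous (f i)).
Local Notation toC := (real_complex R).

Definition close (d : R) (t t' : X) := forall i, `|f i t - f i t'| <= d.

Lemma close_sym d t t' : close d t t' -> close d t' t.
Proof. by move=> h i; rewrite distrC. Qed.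
Lemma close_le d d' t t' : d <= d' -> close d t t' -> close d' t t'.
Proof. by move=> dd h i; exact: le_trans (h i) dd. Qed.
Lemma close_trans d d' t t' t'' : close d t t' -> close d' t' t'' -> close (d + d') t t''.
Proof. by move=> h h' i; rewrite -(subrKA (f i t')) (le_trans (ler_normD _ _))// lerD. Qed.

Lemma close_near d t : 0 < d -> \forall t' \near t, close d t' t.
Proof.
move=> d0; suff : \forall t' \near t, forall i, i \in enum 'I_m -> `|f i t' - f i t| <= d.
  by apply: filterS => t' h i; apply: h; rewrite mem_enum.
elim: (enum _) => [|i l IH]; first by apply: nearW.
have /cvgrPdist_le/(_ _ d0) h := @cf i t.
near=> t' => k; rewrite inE => /orP[/eqP ->|kl].
  by rewrite distrC; near: t'.
by move: k kl; near: t'.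
Unshelve. all: by end_near. Qed.

(** Compactness as with a Lebesgue number: a scale that works near each point can be shrunk to one
    that works everywhere, since smaller scales stay valid. *)
Lemma cpt_unif (P : R -> X -> Prop) :
  (forall d d' t, 0 < d' -> d' <= d -> P d t -> P d' t) ->
  (forall t, exists2 d : R, 0 < d & forall t', close d t' t -> P d t') ->
  exists2 d : R, 0 < d & forall t, P d t.
Proof.
move=> mono loc.
have : \forall d \near 0^'+, [set: X] `<=` P d.
  apply: (compact_near_coveringP _).1 cptX _ _ _ _ _ => t _.
  have [d d0 h] := loc t.
  exists ([set t' | close d t' t], [set e : R | 0 < e <= d]); first split.
  - exact: close_near.
  - by near=> e; apply/andP; split; near: e; [exact: nbhs_right_gt|exact: nbhs_right_le].
  - by move=> [t' e] /= [h1 /andP[e0 ed]]; apply: mono (h _ h1).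
move=> h; have /filter_ex[d [d0 hd]] : \forall d \near 0^'+, 0 < d /\ [set: X] `<=` P d.
  by near=> d; split; near: d => //; exact: nbhs_right_gt.
by exists d => // t; exact: hd.
Unshelve. all: by end_near. Qed.

Section Alg.
Context (D : cstarAlgType R).
Implicit Types (F G : X -> D).

Definition funif F := forall e : R, 0 < e -> exists2 d : R, 0 < d &
  forall t t', close d t t' -> rnorm (F t - F t') <= e.

Lemma funif_bound F : funif F -> exists2 c : R, 0 <= c & forall t, rnorm (F t) <= c.
Proof.
move=> uF; have [d d0 h] := uF 1 ltr01.
(* The bound is encoded as [c^-1], because [cpt_unif] produces small numbers. *)
have [c c0 hc] : exists2 c : R, 0 < c & forall t, rnorm (F t) <= c^-1.
  apply: cpt_unif => [c c' t c'0 cc|t].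
    by move=> /le_trans; apply; rewrite lef_pV2// posrE ?(lt_le_trans c'0).
  pose b := rnorm (F t) + 1; have b0 : 0 < b by rewrite ltr_wpDl// rnorm_ge0.
  have m0 : 0 < Num.min d b^-1 by rewrite lt_min d0 invr_gt0.
  exists (Num.min d b^-1) => // t' ct.
  have le1 : rnorm (F t') <= b.
    rewrite -[F t'](subrK (F t)) addrC (le_trans (ler_rnormD _ _))// lerD2l.
    by apply: h; apply: close_le ct; rewrite ge_min lexx.
  apply: le_trans le1 _; rewrite -[X in X <= _]invrK lef_pV2 ?posrE ?invr_gt0//.
  by rewrite ge_min lexx orbT.
by exists c^-1; [rewrite invr_ge0 ltW|].
Qed.

Record fe_car := Fe { fev : X -> D ; feP : funif fev }.

Lemma fe_ext x y : (forall t, fev x t = fev y t) -> x = y.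
Proof.
case: x y => [a pa] [b pb] /= ab; have E : a = b by exact/funext.
by subst b; congr Fe; exact: Prop_irrelevance.
Qed.

HB.instance Definition _ := gen_eqMixin fe_car.
HB.instance Definition _ := gen_choiceMixin fe_car.
Implicit Types x y z : fe_car.

Fact funif_cst a : funif (fun=> a).
Proof. by move=> e e0; exists 1 => // t t' _; rewrite subrr rnorm0 ltW. Qed.

Fact funif2 (op : D -> D -> D) F G (K : R) : 0 <= K -> funif F -> funif G ->
  (forall t t', rnorm (op (F t) (G t) - op (F t') (G t')) <=
     K * (rnorm (F t - F t') + rnorm (G t - G t'))) -> funif (fun t => op (F t) (G t)).
Proof.
move=> K0 uF uG h e e0; have K1 : 0 < K + 1 by rewrite ltr_wpDl.
have e2 := divr_gt0 (divr_gt0 e0 K1) (ltr0n _ 2).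
have [d1 d10 h1] := uF _ e2; have [d2 d20 h2] := uG _ e2.
exists (Num.min d1 d2) => [|t t' c]; first by rewrite lt_min d10.
have k1 := h1 t t' (close_le (_ : Num.min d1 d2 <= d1) c).
have k2 := h2 t t' (close_le (_ : Num.min d1 d2 <= d2) c).
apply: le_trans (h t t') _.
have : rnorm (F t - F t') + rnorm (G t - G t') <= e / (K + 1).
  by rewrite [leRHS](splitr _) lerD// ?k1 ?k2// ge_min lexx ?orbT.
by move=> /(ler_wpM2l K0)/le_trans; apply; rewrite small_mul// ltW.
Qed.

Fact funif1 (op : D -> D) F (K : R) : 0 <= K -> funif F ->
  (forall t t', rnorm (op (F t) - op (F t')) <= K * rnorm (F t - F t')) -> funif (fun t => op (F t)).
Proof.
move=> K0 uF h; apply: (@funif2 (fun a _ => op a) F (fun=> 0) K) => // [|t t'].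
  exact: funif_cst.
by rewrite subrr rnorm0 addr0.
Qed.

Fact funifD F G : funif F -> funif G -> funif (fun t => F t + G t).
Proof.
move=> uF uG; apply: (@funif2 +%R F G 1) => // t t'.
by rewrite mul1r opprD addrACA ler_rnormD.
Qed.

Fact funifZ (k : R[i]) F : funif F -> funif (fun t => k *: F t).
Proof.
move=> uF; apply: (@funif1 (fun a => k *: a) F (complex.Re `|k|)) => // [|t t'].
  exact: normCRe_ge0.
by rewrite -scalerBr rnormZ.
Qed.

Fact funifN F : funif F -> funif (fun t => - F t).
Proof.
by move=> uF; apply: (@funif1 (fun a => - a) F 1) => // t t'; rewrite mul1r -opprD rnormN.
Qed.

Fact funif_star F : funif F -> funif (fun t => cstar (F t)).
Proof.
by move=> uF; apply: (@funif1 (@cstar R D) F 1) => // t t'; rewrite mul1r -cstarB rnorm_cstar.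
Qed.

Fact funifM F G : funif F -> funif G -> funif (fun t => cmul (F t) (G t)).
Proof.
move=> uF uG; have [c c0 hc] := funif_bound uF; have [d d0 hd] := funif_bound uG.
apply: (@funif2 (@cmul R D) F G (c + d)) => // [|t t']; first exact: addr_ge0.
rewrite -(subrKA (cmul (F t) (G t'))) -cmulBr -cmulBl (le_trans (ler_rnormD _ _))//.
rewrite mulrDr [leRHS]addrC lerD// (le_trans (rnorm_cmul _ _))//.
  by rewrite ler_wpM2r ?rnorm_ge0// (le_trans (hc t))// lerDl.
by rewrite mulrC ler_wpM2r ?rnorm_ge0// (le_trans (hd t'))// lerDr.
Qed.

Definition fe_add x y := Fe (funifD (feP x) (feP y)).
Definition fe_opp x := Fe (funifN (feP x)).
Definition fe_zero := Fe (funif_cst 0).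
Definition fe_scale (k : R[i]) x := Fe (funifZ k (feP x)).
Definition fe_mul x y := Fe (funifM (feP x) (feP y)).
Definition fe_star x := Fe (funif_star (feP x)).

Fact fe_addA : associative fe_add.
Proof. by move=> x y z; apply: fe_ext => t; exact: addrA. Qed.
Fact fe_addC : commutative fe_add.
Proof. by move=> x y; apply: fe_ext => t; exact: addrC. Qed.
Fact fe_add0 : left_id fe_zero fe_add.
Proof. by move=> x; apply: fe_ext => t; exact: add0r. Qed.
Fact fe_addN : left_inverse fe_zero fe_opp fe_add.
Proof. by move=> x; apply: fe_ext => t; exact: addNr. Qed.
HB.instance Definition _ :=
  GRing.isZmodule.Build fe_car fe_addA fe_addC fe_add0 fe_addN.

Fact fe_scaleA (k l : R[i]) x : fe_scale k (fe_scale l x) = fe_scale (k * l) x.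
Proof. by apply: fe_ext => t; exact: scalerA. Qed.
Fact fe_scale1 : left_id 1 fe_scale.
Proof. by move=> x; apply: fe_ext => t; exact: scale1r. Qed.
Fact fe_scaleDr : right_distributive fe_scale +%R.
Proof. by move=> k x y; apply: fe_ext => t; exact: scalerDr. Qed.
Fact fe_scaleDl x : {morph fe_scale^~ x : k l / k + l}.
Proof. by move=> k l; apply: fe_ext => t; exact: scalerDl. Qed.
HB.instance Definition _ := GRing.Zmodule_isLmodule.Build R[i] fe_car
  fe_scaleA fe_scale1 fe_scaleDr fe_scaleDl.

Definition fe_norm x : R := sup [set rnorm (fev x t) | t in [set: X]].

Lemma fe_norm_ub x : has_ubound [set rnorm (fev x t) | t in [set: X]].
Proof. by have [c _ hc] := funif_bound (feP x); exists c => _ [t _ <-]. Qed.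

Lemma fev_le x t : rnorm (fev x t) <= fe_norm x.
Proof. by apply: ub_le_sup; [exact: fe_norm_ub|exists t]. Qed.

Lemma fe_norm_le x (c : R) : 0 <= c -> (forall t, rnorm (fev x t) <= c) -> fe_norm x <= c.
Proof.
move=> c0 fc; have [[y Ey]|/nonemptyPn E0] :=
  pselect ([set rnorm (fev x t) | t in [set: X]] !=set0).
  by apply: ge_sup; [exists y|move=> _ [t _ <-]].
by rewrite /fe_norm E0 sup0.
Qed.

Lemma fe_norm_ge0 x : 0 <= fe_norm x.
Proof.
have [[_ [t _ _]]|/nonemptyPn E0] :=
  pselect ([set rnorm (fev x t) | t in [set: X]] !=set0).
  exact: le_trans (rnorm_ge0 _) (fev_le x t).
by rewrite /fe_norm E0 sup0.
Qed.

Fact fe_normD x y : fe_norm (x + y) <= fe_norm x + fe_norm y.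
Proof.
apply: fe_norm_le => [|t]; first by rewrite addr_ge0 ?fe_norm_ge0.
by rewrite (le_trans (ler_rnormD _ _))// lerD ?fev_le.
Qed.

Fact fe_normZ (k : R[i]) x : fe_norm (k *: x) = complex.Re `|k| * fe_norm x.
Proof.
have le (l : R[i]) z : fe_norm (l *: z) <= complex.Re `|l| * fe_norm z.
  apply: fe_norm_le => [|t]; first by rewrite mulr_ge0 ?normCRe_ge0 ?fe_norm_ge0.
  by rewrite [leLHS]rnormZ ler_wpM2l ?normCRe_ge0// fev_le.
apply/eqP; rewrite eq_le le andTb; have [->|k0] := eqVneq k 0.
  by rewrite normr0 mul0r fe_norm_ge0.
have kp : 0 < complex.Re `|k| by rewrite -ltcR normCReK normr_gt0.
rewrite -ler_pdivlMl//; have := le k^-1 (k *: x).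
rewrite scalerA mulVf// scale1r normfV => /le_trans; apply.
rewrite le_eqVlt; apply/orP; left; apply/eqP; congr (_ * _); apply: complexI.
by rewrite toCV normCReK -normfV normCReK.
Qed.

Fact fe_norm0 x : fe_norm x = 0 -> x = 0.
Proof.
move=> x0; apply: fe_ext => t; apply: rnorm0_eq0; apply/eqP.
by rewrite eq_le rnorm_ge0 andbT -x0 fev_le.
Qed.

Fact fe_complete (u : nat -> fe_car) : (forall n, fe_norm (u n.+1 - u n) <= 2^-1 ^+ n) ->
    exists l, forall e : R, 0 < e ->
      exists N, forall n, (N <= n)%N -> fe_norm (u n - l) <= e.
Proof.
move=> hu; have p0 n : 0 < (2^-1 ^+ n : R) by rewrite exprn_gt0// invr_gt0.
have tel n k : fe_norm (u (n + k)%N - u n) <= 2 * 2^-1 ^+ n - 2 * 2^-1 ^+ (n + k).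
  elim: k => [|k IH]; first by rewrite addn0 !subrr fe_norm_le// => t; rewrite rnorm0.
  rewrite addnS -(subrKA (u (n + k)%N)) (le_trans (fe_normD _ _))//.
  by rewrite (le_trans (lerD (hu _) IH))// exprS; lra.
have cau e : 0 < e -> exists N, forall n k, (N <= n)%N -> (N <= k)%N -> fe_norm (u n - u k) <= e.
  move=> e0; have [N NP] := half_pow_lt (divr_gt0 e0 (ltr0n _ 4)).
  have tel2 n : (N <= n)%N -> fe_norm (u n - u N) <= e / 2.
    move=> Nn; rewrite -(subnKC Nn) (le_trans (tel _ _))//.
    by have := ltW (p0 (N + (n - N))%N); move: NP; lra.
  exists N => n k Nn Nk; rewrite -(subrKA (u N)) (le_trans (fe_normD _ _))// (splitr e) lerD ?tel2//.
  rewrite -opprB; apply: le_trans (tel2 _ Nk); apply: fe_norm_le => [|t]; first exact: fe_norm_ge0.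
  by rewrite rnormN fev_le.
have /choice[l lP] t : exists l, forall e, 0 < e -> exists N, forall n, (N <= n)%N ->
    rnorm (fev (u n) t - l) <= e.
  apply: rnorm_complete => e /cau[N NP]; exists N => n k Nn Nk.
  exact: le_trans (fev_le (u n - u k) t) (NP _ _ Nn Nk).
have unif e : 0 < e -> exists N, forall n, (N <= n)%N -> forall t, rnorm (fev (u n) t - l t) <= e.
  move=> e0; have [N NP] := cau _ e0; exists N => n Nn t; apply/ler_addgt0Pr => d d0.
  have [M MP] := lP t _ d0; pose k := maxn N M.
  rewrite (le_trans (ler_rdistD (fev (u k) t) _ _))// lerD//; last by apply: MP; rewrite leq_maxr.
  by apply: le_trans (fev_le (u n - u k) t) (NP _ _ Nn _); rewrite leq_maxl.
have ul : funif l.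
  move=> e e0; have e3 : 0 < e / 3 by rewrite divr_gt0.
  have [N /(_ N (leqnn _)) NP] := unif _ e3; have [d d0 h] := feP (u N) e3.
  exists d => // t t' c; rewrite (le_trans (ler_rdistD (fev (u N) t) _ _))//.
  rewrite (_ : e = e / 3 + (e / 3 + e / 3)); last by field.
  rewrite lerD//; first by rewrite rdistC.
  by rewrite (le_trans (ler_rdistD (fev (u N) t') _ _))// lerD// h.
exists (Fe ul) => e e0; have [N NP] := unif _ e0; exists N => n Nn.
by apply: fe_norm_le => [|t]; [exact: ltW|exact: NP].
Qed.

Fact fe_mulA : associative fe_mul.
Proof. by move=> x y z; apply: fe_ext => t; exact: cmulA. Qed.
Fact fe_mulDl : left_distributive fe_mul +%R.
Proof. by move=> x y z; apply: fe_ext => t; exact: cmulDl. Qed.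
Fact fe_mulDr : right_distributive fe_mul +%R.
Proof. by move=> x y z; apply: fe_ext => t; exact: cmulDr. Qed.
Fact fe_mulZl (k : R[i]) x y : fe_mul (k *: x) y = k *: fe_mul x y.
Proof. by apply: fe_ext => t; exact: cmulZl. Qed.
Fact fe_mulZr (k : R[i]) x y : fe_mul x (k *: y) = k *: fe_mul x y.
Proof. by apply: fe_ext => t; exact: cmulZr. Qed.
Fact fe_starK : involutive fe_star.
Proof. by move=> x; apply: fe_ext => t; exact: cstarK. Qed.
Fact fe_starD : {morph fe_star : x y / x + y}.
Proof. by move=> x y; apply: fe_ext => t; exact: cstarD. Qed.
Fact fe_starZ (k : R[i]) x : fe_star (k *: x) = conjc k *: fe_star x.
Proof. by apply: fe_ext => t; exact: cstarZ. Qed.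
Fact fe_starM x y : fe_star (fe_mul x y) = fe_mul (fe_star y) (fe_star x).
Proof. by apply: fe_ext => t; exact: cstarM. Qed.
Fact fe_normM x y : fe_norm (fe_mul x y) <= fe_norm x * fe_norm y.
Proof.
apply: fe_norm_le => [|t]; first by rewrite mulr_ge0 ?fe_norm_ge0.
by rewrite (le_trans (rnorm_cmul _ _))// ler_pM ?rnorm_ge0 ?fev_le.
Qed.
Fact fe_normC x : fe_norm x ^+ 2 <= fe_norm (fe_mul (fe_star x) x).
Proof.
have N0 := fe_norm_ge0 (fe_mul (fe_star x) x).
rewrite -[leRHS]sqr_sqrtr// ler_pXn2r ?nnegrE ?sqrtr_ge0 ?fe_norm_ge0//.
apply: fe_norm_le => [|t]; first exact: sqrtr_ge0.
rewrite -(@ler_pXn2r _ 2) ?nnegrE ?sqrtr_ge0 ?rnorm_ge0// sqr_sqrtr// -rnorm_cstar_cmul.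
exact: (fev_le (fe_mul (fe_star x) x) t).
Qed.

Definition fe_data : cstar_data R := CStarData
  fe_normD fe_normZ fe_norm0 fe_complete fe_mulA fe_mulDl fe_mulDr fe_mulZl fe_mulZr
  fe_starK fe_starD fe_starZ fe_starM fe_normM fe_normC.

Definition FE : cstarAlgType R := cs_of fe_data.

Definition fet (t : X) (x : FE) : D := fev x t.

Lemma fet_shom t : shom (fet t). Proof. by split. Qed.

Lemma fet_ext (x y : FE) : (forall t, fet t x = fet t y) -> x = y.
Proof. exact: fe_ext. Qed.

Lemma fet_norm_le (x : FE) (c : R) : 0 <= c -> (forall t, rnorm (fet t x) <= c) -> rnorm x <= c.
Proof. exact: fe_norm_le. Qed.

Definition evt t : unitz FE -> unitz D := uz (fet t).

Definition uu (F : X -> unitz D) := forall e : R, 0 < e -> exists2 d : R, 0 < d &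
  forall t t', close d t t' -> nm (F t - F t') <= e.

Lemma evt_uu u : uu (evt^~ u).
Proof.
move=> e /(feP u.1)[d d0 h]; exists d => // t t' /h.
by rewrite (_ : evt t u - evt t' u = inj (fet t u.1 - fet t' u.1)) ?nm_inj// /evt /uz /inj; congr pair; rewrite /= subrr.
Qed.

Lemma evt_ushom t : ushom (evt t). Proof. exact: uz_ushom (fet_shom t). Qed.

Lemma uu_ex (F : X -> unitz D) : uu F -> (forall t, inB (F t)) -> exists2 u, inB u & forall t, evt t u = F t.
Proof.
move=> uF bF; have uF' : funif (fun t => (F t).1).
  move=> e /uF[d d0 h]; exists d => // t t' /h.
  by rewrite (inBP (bF t)) (inBP (bF t')) -injB nm_inj.
by exists (inj (Fe uF' : FE)) => // t; rewrite [RHS](inBP (bF t)).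
Qed.

Lemma evt_nm_le u (c : R) : 0 <= c -> inB u -> (forall t, nm (evt t u) <= c) -> nm u <= c.
Proof.
move=> c0 bu h; rewrite (inBP bu) nm_inj; apply: fet_norm_le => // t.
by have := h t; rewrite {1}(inBP bu) -[evt t _]/(inj (fet t u.1)) nm_inj.
Qed.

(** Evaluations are contractive, so the radius [nm u] serves at all points, and the action that
    defines the norm of the unitization can be tested pointwise. *)
Lemma evt_npos u : inB u -> (forall t, npos (evt t u)) -> npos u.
Proof.
move=> bu h; split.
  rewrite /sa (inBP bu) -inj_st; congr inj; apply: fet_ext => t.
  by have := npos_sa (h t); rewrite /sa (inBP bu) => /(congr1 fst).
exists (nm u); first exact: nm_ge0.
apply: unorm_le; first exact: nm_ge0.
  rewrite -[(_ - _).2]/(toC (nm u) * 1 - u.2) bu subr0 mulr1 re_norm_toC//; exact: nm_ge0.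
move=> x; apply: fet_norm_le => [|t]; first by rewrite mulr_ge0 ?nm_ge0 ?rnorm_ge0.
have -> : fet t (uact (sc _ (nm u) - u) x) = uact (evt t (sc _ (nm u) - u)) (fet t x) by [].
apply: le_trans (uact_le _ _) _; apply: ler_pM; [exact: nm_ge0|exact: rnorm_ge0| |exact: fev_le].
rewrite (ushB (evt_ushom t)) (ush_sc (evt_ushom t)); apply: npos_normP (h t) _.
exact: ush_nm (evt_ushom t) _.
Qed.

Lemma evt_pB u : inB u -> (forall t, npos (evt t u)) -> pB u.
Proof. by move=> bu h; split=> //; exact: evt_npos. Qed.

Lemma pB_evt t u : pB u -> pB (evt t u).
Proof. exact: uz_pB (fet_shom t) _. Qed.

Variable s : stable_str D.

Fact funif_sl j F : funif F -> funif (fun t => sl s j (F t)).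
Proof.
move=> uF; apply: (@funif1 (sl s j) F 1) => // t t'.
by rewrite mul1r -sl_B sl_norm.
Qed.

Definition fe_sl j (x : FE) : FE := Fe (funif_sl j (feP x)).

Definition fe_stable : stable_str FE.
Proof.
refine (@StableStr R FE fe_sl _ _ _ _).
- by move=> j x y; apply: fet_ext => t; exact: slD.
- by move=> j k x; apply: fet_ext => t; exact: slZ.
- by move=> j x y; apply: fet_ext => t; exact: slM.
- move=> i j x y; apply: fet_ext => t; rewrite -[LHS]/(cmul (cstar (sl s i (fet t x))) (sl s j (fet t y))).
  by rewrite slI; case: eqP.
Defined.

Definition cuev t : cu fe_stable -> cu s := cumap s (fet t).

Lemma cuevE t u : pB u -> cuev t (cl fe_stable u) = cl s (evt t u).
Proof. exact: cumap_cl (fet_shom t) _. Qed.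

Lemma cuevD t (x y : cu fe_stable) : cuev t (x + y) = cuev t x + cuev t y.
Proof. by apply: (cumapD (fet_shom t)). Qed.

Lemma cuev_le t (x y : cu fe_stable) : x ⊑ y -> cuev t x ⊑ cuev t y.
Proof. exact: (@cumap_le _ _ _ _ _ _ (fet_shom t)). Qed.

Lemma cuev_mulrn t (x : cu fe_stable) n : cuev t (x *+ n) = cuev t x *+ n.
Proof. by apply: (cumap_mulrn (fet_shom t)). Qed.

End Alg.

End UniformFields.

(** * Comparison of sections with room *)

Section Tents.
Context (R : realType).
Implicit Types (z a b : R).

Definition tent z : R := Num.max 0 (1 - `|z|).

Lemma tent_ge0 z : 0 <= tent z. Proof. by rewrite le_max lexx. Qed.
Lemma tent_le1 z : tent z <= 1.
Proof. by rewrite ge_max ler01 lerBlDr lerDl normr_ge0. Qed.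
Lemma tent_gt0 z : (0 < tent z) = (`|z| < 1).
Proof. by rewrite lt_max ltxx /= subr_gt0. Qed.
Lemma tent0 z : 1 <= `|z| -> tent z = 0.
Proof. by move=> z1; apply/max_idPl; rewrite subr_le0. Qed.

Lemma max0_dist a b : `|Num.max 0 a - Num.max 0 b| <= `|a - b|.
Proof.
wlog ab : a b / a <= b => [w|].
  by have /orP[/w//|/w] := le_total a b; rewrite distrC [leRHS]distrC.
rewrite !(ler0_norm) ?subr_le0//; last by rewrite ge_max !le_max lexx ab orbT.
rewrite !opprB; have [a0|a0] := leP a 0.
  rewrite subr0; have [b0|b0] := leP b 0; first by rewrite subr_ge0.
  by rewrite lerBrDr gerDl.
by rewrite (max_idPr (ltW (lt_le_trans a0 ab))).
Qed.

Lemma tent_dist a b : `|tent a - tent b| <= `|a - b|.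
Proof.
apply: le_trans (max0_dist _ _) _.
rewrite (_ : 1 - `|a| - (1 - `|b|) = `|b| - `|a|); last by ring.
by rewrite distrC; exact: ler_dist_dist.
Qed.

(** The second half, about points beyond the grid, is what the induction needs: on the new unit
    interval only the last two tents are nonzero. *)
Lemma tent_sum N z : 0 <= z -> (z <= N%:R -> \sum_(k < N.+1) tent (z - k%:R) = 1) /\
  (N%:R <= z -> \sum_(k < N.+1) tent (z - k%:R) = tent (z - N%:R)).
Proof.
move=> z0; elim: N => [|N [IH1 IH2]].
  rewrite big_ord_recr big_ord0 /= add0r; split=> [z1|//].
  by rewrite (_ : z = 0) ?subrr /tent ?normr0 ?subr0 ?(max_idPr ler01)//; apply/eqP; rewrite eq_le z0 andbT.
rewrite big_ord_recr /=; split=> [zN|zN].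
  have [zN'|zN'] := leP z N%:R.
    rewrite IH1// tent0 ?addr0// ler0_norm ?opprB; last by rewrite subr_le0.
    by rewrite lerBrDr -natr1 [leLHS]addrC lerD2r.
  have E1 : `|z - N%:R| = z - N%:R by rewrite ger0_norm// subr_ge0 ltW.
  have E2 : `|z - N.+1%:R| = N.+1%:R - z by rewrite ler0_norm ?opprB// subr_le0.
  rewrite IH2 ?(ltW zN')// /tent E1 E2; move: zN zN'; rewrite -natr1 => zN zN'.
  by rewrite !(max_idPr _); lra.
rewrite IH2; last by rewrite (le_trans _ zN)// ler_nat.
rewrite tent0 ?add0r// ger0_norm; last by rewrite subr_ge0 (le_trans _ zN)// ler_nat.
by rewrite lerBrDr addrC natr1.
Qed.

Lemma prod_dist m (a b : 'I_m -> R) : (forall i, 0 <= a i <= 1) -> (forall i, 0 <= b i <= 1) ->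
  `|\prod_i a i - \prod_i b i| <= \sum_i `|a i - b i|.
Proof.
elim: m a b => [|m IH] a b ha hb; first by rewrite !big_ord0 subrr normr0.
rewrite !big_ord_recr /=; set P := \prod_(i < m) _; set Q := \prod_(i < m) _.
have hQ : 0 <= Q <= 1.
  apply/andP; split; first by apply: prodr_ge0 => i _; case/andP: (hb (widen_ord (leqnSn m) i)).
  by apply: prodr_ile1 => i _; exact: hb.
rewrite (_ : P * a ord_max - Q * b ord_max = (P - Q) * a ord_max + Q * (a ord_max - b ord_max)); last by ring.
have /andP[a0 a1] := ha ord_max; have /andP[Q0 Q1] := hQ.
rewrite (le_trans (ler_normD _ _))// !normrM (ger0_norm a0) (ger0_norm Q0) lerD//.
  apply: le_trans (ler_piMr _ a1) _ => //.
  by apply: (IH (fun i => a (widen_ord _ i)) (fun i => b (widen_ord _ i))).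
by rewrite ler_piMl.
Qed.

End Tents.

Section Grid.
Context (R : realType) (X : Type) (m : nat) (f : 'I_m -> X -> R).
Hypothesis f01 : forall i t, 0 <= f i t <= 1.

Definition sclose (d : R) (t t' : X) := forall i, `|f i t - f i t'| <= d.
Definition suu (g : X -> R) := forall e : R, 0 < e -> exists2 d : R, 0 < d &
  forall t t', sclose d t t' -> `|g t - g t'| <= e.

Context (N : nat).
Hypothesis N0 : (0 < N)%N.
Local Notation gT := {ffun 'I_m -> 'I_N.+1}.
Implicit Types w : gT.

Definition gphi w t : R := \prod_i tent (N%:R * f i t - (w i)%:R).
Definition gadj w w' := [forall i, (w i <= (w' i).+1)%N && (w' i <= (w i).+1)%N].
Definition gpar w : {ffun 'I_m -> bool} := [ffun i => odd (w i)].
(** Colours are the parity vectors: adjacent cells of the same colour coincide, so 2^m colours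
    suffice whatever the mesh. *)
Definition gcol w : nat := enum_rank (gpar w).

Lemma gcol_lt w : (gcol w < #|{ffun 'I_m -> bool}|)%N. Proof. exact: ltn_ord. Qed.

Lemma gphi_ge0 w t : 0 <= gphi w t.
Proof. by apply: prodr_ge0 => i _; exact: tent_ge0. Qed.

Lemma gphi_le1 w t : gphi w t <= 1.
Proof. by apply: prodr_ile1 => i _; rewrite tent_ge0 tent_le1. Qed.

Lemma gphi_sum t : \sum_w gphi w t = 1.
Proof.
rewrite -(bigA_distr_bigA (fun i (k : 'I_N.+1) => tent (N%:R * f i t - (k : nat)%:R))) big1// => i _.
have /andP[h0 h1] := f01 i t.
by apply: (tent_sum N _).1; [rewrite mulr_ge0|rewrite ler_piMr].
Qed.

Lemma suu_gphi w : suu (gphi w).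
Proof.
move=> e e0; pose K : R := m%:R * N%:R + 1; have K0 : 0 < K by rewrite ltr_wpDl// mulr_ge0.
exists (e / K) => [|t t' c]; first exact: divr_gt0.
apply: le_trans (prod_dist _ _) _; try by move=> i; rewrite tent_ge0 tent_le1.
apply: (@le_trans _ _ (\sum_(i < m) N%:R * (e / K))).
  apply: ler_sum => i _; apply: le_trans (tent_dist _ _) _.
  rewrite (_ : _ - _ = N%:R * (f i t - f i t')); last by ring.
  by rewrite normrM ger0_norm// ler_wpM2l.
rewrite sumr_const card_ord -[leLHS]mulr_natl mulrA /K; apply: small_mul; rewrite ?mulr_ge0//.
exact: ltW.
Qed.

Lemma gphi_gt0 w t : 0 < gphi w t -> forall i, `|N%:R * f i t - (w i)%:R| < 1.
Proof.
move=> h i; rewrite -tent_gt0 lt_neqAle tent_ge0 andbT; apply/eqP => E.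
by move: h; rewrite /gphi (bigD1 i)//= -E mul0r ltxx.
Qed.

Lemma near_nat (a b : nat) (z : R) : `|z - a%:R| < 1 -> `|z - b%:R| < 1 -> (a <= b.+1)%N.
Proof.
move=> h1 h2; rewrite leqNgt; apply/negP => ab.
have : `|a%:R - b%:R : R| < 2.
  have -> : a%:R - b%:R = (z - b%:R) - (z - a%:R) by ring.
  by rewrite (le_lt_trans (ler_normB _ _))// (_ : 2 = 1 + 1) ?ltrD.
rewrite ger0_norm ?subr_ge0 ?ler_nat; last by rewrite (leq_trans _ (ltnW ab)).
by rewrite ltrBlDr -natrD ltr_nat add2n ltnNge ab.
Qed.

Lemma gphi_adj w w' t : 0 < gphi w t -> 0 < gphi w' t -> gadj w w'.
Proof.
move=> /gphi_gt0 h /gphi_gt0 h'; apply/forallP => i; apply/andP.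
by split; apply: near_nat (h _) (h' _) || apply: near_nat (h' _) (h _).
Qed.

Lemma gadj_sym w w' : gadj w w' = gadj w' w.
Proof. by apply: eq_forallb => i; rewrite andbC. Qed.

Lemma gadj_col w w' : gadj w w' -> gcol w = gcol w' -> w = w'.
Proof.
move=> /forallP h /ord_inj/enum_rank_inj/ffunP p; apply/ffunP => i.
have /andP[h1 h2] := h i; have := p i; rewrite !ffunE => o; apply/val_inj => /=.
have [//|ne] := eqVneq (w i : nat) (w' i).
move: ne; rewrite neq_ltn => /orP[] lt; [have E : (w' i : nat) = (w i).+1|have E : (w i : nat) = (w' i).+1];
  try by apply/eqP; rewrite eqn_leq lt ?h1 ?h2.
  by move: o; rewrite E /=; case: (odd _).
by move: o; rewrite E /=; case: (odd _).
Qed.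

Lemma gadj_close w w' t t' : gadj w w' -> 0 < gphi w t -> 0 < gphi w' t' -> sclose (3 / N%:R) t t'.
Proof.
move=> /forallP a /gphi_gt0 h /gphi_gt0 h' i; have Np : 0 < N%:R :> R by rewrite ltr0n.
rewrite ler_pdivlMr// -{1}(ger0_norm (ltW Np)) -normrM mulrC mulrBr.
have -> : N%:R * f i t - N%:R * f i t' = (N%:R * f i t - (w i)%:R) + ((w i)%:R - (w' i)%:R)
    - (N%:R * f i t' - (w' i)%:R) by ring.
rewrite (le_trans (ler_normB _ _))// (_ : 3 = 1 + 1 + 1 :> R); last by ring.
rewrite lerD ?(ltW (h' i))// (le_trans (ler_normD _ _))// lerD ?(ltW (h i))//.
have /andP[a1 a2] := a i; rewrite ler_norml lerBrDr lerBlDr addrC.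
by rewrite lerBlDr [1 + _]addrC !natr1 !ler_nat a1 a2.
Qed.

Lemma gadj_card w : (#|finset (gadj w)| <= #|{ffun 'I_m -> 'I_3}|)%N.
Proof.
pose g w' : {ffun 'I_m -> 'I_3} := [ffun i => inord ((w' i).+1 - w i)].
rewrite -(card_in_imset (f := g)) ?max_card// => w1 w2; rewrite !inE => /forallP h1 /forallP h2 /ffunP E.
apply/ffunP => i; apply/val_inj => /=; have := congr1 val (E i); rewrite !ffunE /=.
have /andP[a1 a2] := h1 i; have /andP[b1 b2] := h2 i.
rewrite !inordK; last 2 first.
- by rewrite ltnS leq_subLR addnC addSn ltnS.
- by rewrite ltnS leq_subLR addnC addSn ltnS.
by move=> /(congr1 (addn (w i))); rewrite !subnKC// => -[].
Qed.

(** Cells active at the same point are pairwise adjacent, hence of different colours. *)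
Lemma gactive_card t : (#|finset (fun w => (0 < gphi w t)%R)| <= #|{ffun 'I_m -> bool}|)%N.
Proof.
rewrite -(card_in_imset (f := gpar)) ?max_card// => w1 w2; rewrite !inE => h1 h2 E.
by apply: gadj_col (gphi_adj h1 h2) _; rewrite /gcol E.
Qed.

End Grid.

(** * A root almost orthogonal to given ones *)

Section Step.
Context (R : realType) (D : cstarAlgType R) (s : stable_str D).
Local Notation toC := (real_complex R).
Local Notation U := (unitz D).
Hypotheses (AU : cuAU s) (CAN : cuCAN s).

Lemma nm_le1B (V : ucstarAlgType R) (x y : V) : npos (y * st y - x * st x) ->
  forall z, nm (z * x) ^+ 2 <= nm (z * (y * st y) * st z).
Proof.
move=> h z; have -> : nm (z * x) ^+ 2 = nm (z * (x * st x) * st z).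
  by rewrite -(nm_st (z * x)) -nmC stK stM !mulrA.
by apply: nm_conj_le => //; rewrite -{1}[x]stK; exact: npos_kv.
Qed.

(* The part of y' orthogonal to the ranges of the r_j still dominates x0, by cancellation. *)
Lemma greedy_step (I : finType) (J : {pred I}) (r : I -> U) (y' h x0 : U) (M : nat) (g c kap : R) :
  pB y' -> pB x0 -> sa h -> h * y' = y' -> 0 < g -> 0 < c -> 0 < kap -> (#|J| <= M)%N -> (0 < M)%N ->
  (forall j, j \in J -> inB (r j) /\ h * r j = r j) ->
  (forall j, j \in J -> cl s (cut g (st (r j) * r j)) ⊑ cl s (cut c x0)) ->
  cl s x0 *+ M.+2 ⊑ cl s y' ->
  exists u : U, [/\ inB u, h * u = u, nm (st u * u - x0) <= kap &
    forall j, j \in J -> nm (st u * r j) <= nm u * Num.sqrt (4 * (M%:R * g))].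
Proof.
move=> py px sh hy g0 c0 kap0 JM M0 hr rx xy.
pose Z := \sum_(j in J) r j * st (r j).
have pj j : j \in J -> pB (r j * st (r j)) by move=> /hr[bj _]; exact: pB_vk.
have pZ : pB Z by apply: big_ind => //; [exact: pB0|exact: pBD].
have nZ := pB_npos pZ; pose G := M%:R * g; have G0 : 0 < G by rewrite mulr_gt0// ltr0n.
have G2 : G < 2 * G by rewrite ltr_pMl// ltr1n.
have G4 : 2 * G < 4 * G by rewrite ltr_pM2r// ltr_nat.
(* Below G = M g the sum Z of at most M terms is invisible once each term is cut by g, so e costs no
   more than the M cut-downs. The new root is built under 1 - e, for which 1 - e1 is a unit, and (1
   - e1) Z (1 - e1) <= 4 G bounds its overlap with each r_j. *)
pose e := fc Z (ramp G (2 * G)); pose e1 := fc Z (ramp (2 * G) (4 * G)).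
have ar := appr_ramp G2; have ar1 := appr_ramp G4; have ac1 := @appr_cst R 1.
have r00 a b : (0 < a -> a < b -> ramp a b 0 = 0 :> R) by move=> a0 ab; rewrite ramp_lo// ltW.
have be : inB e by apply: inB_fc => //; [exact: pB_inB|exact: r00].
have se : sa e by exact: fc_sa.
have se1 : sa e1 by exact: fc_sa.
have he : h * e = e.
  have hZ : (1 - h) * Z = 0.
    rewrite mulr_sumr big1// => j /hr[_ hj]; rewrite mulrA mulrBl mul1r hj subrr mul0r//.
  have : (1 - h) * e = 0 by apply: fc_orth0 => //; exact: r00.
  by rewrite mulrBl mul1r => /subr0_eq.
have ee : (1 - e1) * (1 - e) = 1 - e.
  have -> : 1 - e = fc Z (fun t => 1 - ramp G (2 * G) t) by rewrite fcB// fc_cst// sc1.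
  have -> : 1 - e1 = fc Z (fun t => 1 - ramp (2 * G) (4 * G) t) by rewrite fcB// fc_cst// sc1.
  rewrite -fcM; [|by []|exact: apprB|exact: apprB].
  apply: fc_ext => //; [by apply: apprM; exact: apprB|exact: apprB|move=> t t0 _].
  have [t2|t2] := leP t (2 * G); first by rewrite [ramp (2 * G) _ _]ramp_lo// subr0 mul1r.
  by rewrite [ramp G _ _]ramp_hi ?(ltW t2)// subrr mulr0.
have [k [pk kk sk]] := pB_sqrt py; have bk := pB_inB pk.
have hk : h * k = k.
  have : nm ((1 - h) * k) ^+ 2 = 0.
    rewrite -nm_st -nmC stK stM mulrA -[_ * k * st k]mulrA sk kk mulrBl mul1r hy subrr mul0r.
    by rewrite nm0.
  by move=> /eqP; rewrite sqrf_eq0 => /eqP/nm0_eq0; rewrite mulrBl mul1r => /subr0_eq.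
pose d := st ((1 - e) * k) * ((1 - e) * k); pose d' := ((1 - e) * k) * st ((1 - e) * k).
have bek : inB ((1 - e) * k) by exact: inB_mull.
have pd : pB d := pB_kv bek; have pd' : pB d' := pB_vk bek.
have eZ : cle (e * y' * st e) (cut G Z).
  have nyk := npos_leN (pB_npos py) (lexx (nm y')).
  have : npos (toC (nm y') *: (e * e) - e * y' * st e).
    have := npos_conj e nyk; congr npos; rewrite mulrBr mulrBl scEr -scalerAl se//.
  have ne : npos (e * e) by exact: npos_sq.
  move=> /(cle_le (npos_conj e (pB_npos py))) h1; apply: cle_trans h1 _.
  apply: cle_trans (cleZ (e * e) (nm_ge0 y')) _; rewrite -fcM//.
  apply: (cle_fc_le (K := G^-1)) => //; [exact: apprM|exact: appr_cutf|by rewrite invr_ge0 ltW| |].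
    by move=> t t0 _; rewrite mulr_ge0 ?ramp_ge0.
  move=> t t0 _; have [tG|Gt] := leP t G.
    by rewrite ramp_lo// mul0r mulr_ge0 ?invr_ge0 ?(ltW G0)// cutf_ge0.
  rewrite (le_trans (ler_piMr (ramp_ge0 _ _ _) (ramp_le1 _ _ _)))// cutf_hi ?(ltW Gt)//.
  apply: le_trans (ramp_le G2 (ltW Gt)) _; rewrite (_ : 2 * G - G = G); last by ring.
  by rewrite mulrC.
have ZM : cl s (cut G Z) ⊑ cl s (cut c x0) *+ M.
  pose Zc := \sum_(j in J) cut g (r j * st (r j)).
  have pc j : j \in J -> pB (cut g (r j * st (r j))) by move=> /pj; apply: pB_cut; exact: ltW.
  have pZc : pB Zc by apply: big_ind => //; [exact: pB0|exact: pBD].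
  apply: (@cule_trans _ _ _ (cl s Zc)).
    apply/cule_cl; [exact: pB_cut (ltW G0) pZ|exact: pZc|].
    apply: cle_cut_sub => //; [exact: pB_npos|exact: ltW|].
    have -> : Zc - Z + sc U G = \sum_(j in J) (cut g (r j * st (r j)) - (r j * st (r j) - sc U g))
        + sc U ((M - #|J|)%:R * g).
      have -> : \sum_(j in J) (cut g (r j * st (r j)) - (r j * st (r j) - sc U g)) =
          Zc - Z + sc U g *+ #|J| by rewrite !sumrB sumr_const opprB addrA addrAC.
      rewrite -[RHS]addrA; congr (_ + _).
      rewrite /G -{1}(subnKC JM) natrD mulrDl /sc toCD scalerDl; congr (_ + _).
      by rewrite toCM -scalerA rmorph_nat scaler_nat.
    apply: nposD; first by apply: npos_sum => j /pj/pB_npos; exact: cut_ge.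
    by apply: nposZ (npos1 _); rewrite mulr_ge0// ltW.
  apply: cule_trans (cl_sumle s _ pc) _.
  apply: (@cule_trans _ _ _ (\sum_(j in J) cl s (cut c x0))).
    apply: cule_sum => j jJ; apply: cule_trans (rx _ jJ); have [bj _] := hr _ jJ.
    apply/cule_cl; [exact: pc|exact: pB_cut (ltW g0) (pB_kv bj)|].
    by have := cut_stC (st (r j)) g0; rewrite stK.
  by rewrite sumr_const; exact: cule_wmulrn.
have ybd : cl s y' ⊑ cl s d' + cl s (cut c x0) *+ M.
  rewrite addrC; have py1 : pB (e * y' * st e).
    by split; [apply: npos_conj; exact: pB_npos|exact: inB_mulr (inB_mull _ (pB_inB py))].
  apply: (@cule_trans _ _ _ (cl s (e * y' * st e + d'))).
    apply/cule_cl; [by []|exact: pBD|].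
    have := npos_quad e (1 - e) (pB_npos py) (oner_neq0 R).
    rewrite (_ : e + (1 - e) = 1); last by rewrite addrC subrK.
    rewrite mul1r st1 mulr1 !expr1n invr1.
    have -> : (1 - e) * y' * st (1 - e) = d' by rewrite /d' stM sk !mulrA -[_ * k * k]mulrA kk.
    rewrite -scalerDr => /(cle_le (pB_npos py)) h1; apply: cle_trans h1 _.
    by apply: cleZ; rewrite addr_ge0.
  apply: cule_trans (cl_addle s py1 pd') (culeD _ (cule_refl _)).
  apply: cule_trans ZM; apply/cule_cl => //; exact: pB_cut (ltW G0) pZ.
(* Two of the M + 2 copies are spare. Cancelling M copies against their cut-downs leaves 2 (L + 1)
   copies of x0 below 2 L + 1 copies of d', and almost unperforation applies. *)
have : cl s x0 *+ 2 + cl s x0 *+ M ⊑ cl s d' + cl s (cut c x0) *+ M.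
  by apply: cule_trans ybd; rewrite -mulrnDr add2n.
move=> h3; have [|L hL] := CAN h3 (cull_mulrn M (cull_cut s px c0)) (M := M).
  by apply: cule_mulrn; rewrite -{1}[cl s x0]mulr1n; exact: cule_wmulrn.
have xd : cle x0 d.
  have : cl s x0 ⊑ cl s d'.
    apply: (AU_lt AU (a := 2 * L.+1) (b := L.+1 + L)); last by rewrite mulrnA; exact: hL.
    by rewrite mul2n -addnn ltn_add2l.
  move=> /cule_cl h1; apply: cle_trans (h1 px pd') _.
  by have := cle_stC (st ((1 - e) * k)); rewrite stK.
have [v vP] := cle_inB pd xd kap0.
pose u := (1 - e) * k * st (inj v).
have ue : (1 - e1) * u = u by rewrite /u !mulrA ee.
exists u; split.
- by rewrite /u -mulrA; apply: inB_mull; exact: inB_mulr.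
- have E : h * ((1 - e) * k) = (1 - e) * k by rewrite !mulrBl !mul1r mulrBr hk mulrA he.
  by rewrite /u mulrA E.
- by rewrite /u [st (_ * st _)]stM stK !mulrA; rewrite /d !mulrA in vP.
move=> j jJ; rewrite -{1}ue stM stB st1 se1 -mulrA (le_trans (nmM _ _))// nm_st ler_wpM2l ?nm_ge0//.
rewrite -(@ler_pXn2r _ 2) ?nnegrE ?nm_ge0 ?sqrtr_ge0// sqr_sqrtr; last by rewrite mulr_ge0// ltW.
have [q [pq qq sq]] := pB_sqrt pZ.
have n1 : npos (q * st q - r j * st (r j)).
  rewrite sq qq /Z (bigD1 j)//= addrAC subrr add0r; apply: npos_sum => i /andP[iJ _].
  exact: pB_npos (pj _ iJ).
apply: le_trans (nm_le1B n1 _) _; rewrite sq qq stB st1 se1.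
have -> : (1 - e1) * Z * (1 - e1) = fc Z (fun t => (1 - ramp (2 * G) (4 * G) t) * t * (1 - ramp (2 * G) (4 * G) t)).
  have ab := apprB ac1 ar1; have ai := @appr_id R; have abi := apprM ab ai.
  by rewrite fcM// fcM// fcB// fc_id// fc_cst// sc1.
apply: fc_norm => //; first exact: apprM (apprM (apprB ac1 ar1) (@appr_id R)) (apprB ac1 ar1).
move=> t t0 _; have [t4|t4] := leP (4 * G) t.
  by rewrite ramp_hi// subrr !mul0r normr0 mulr_ge0// ltW.
have h0 : 0 <= 1 - ramp (2 * G) (4 * G) t by rewrite subr_ge0 ramp_le1.
have h1 : 1 - ramp (2 * G) (4 * G) t <= 1 by rewrite lerBlDr lerDl ramp_ge0.
rewrite ger0_norm ?mulr_ge0// (le_trans _ (ltW t4))//.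
by rewrite (le_trans (ler_wpM2l _ h1)) ?mulr_ge0// mulr1 ler_piMl.
Qed.

End Step.

(** * Almost orthogonal families of roots, colour by colour *)

Section GreedyFamily.
Context (R : realType) (D : cstarAlgType R) (s : stable_str D).
Local Notation toC := (real_complex R).
Local Notation U := (unitz D).
Hypotheses (AU : cuAU s) (CAN : cuCAN s).

Definition lev (delta : R) (q : nat) : R := delta / q.+1%:R.
(** Nested units: for p < q the function [hlev q] is 1 on the support of [hlev p]. Roots of colour q
    are kept under [hlev q], so that each later colour still has a unit for all previous ones. *)
Definition hlev (delta : R) (q : nat) : R -> R := ramp (lev delta q.+1) (lev delta q).

Lemma lev_gt0 delta q : 0 < delta -> 0 < lev delta q.
Proof. by move=> d0; rewrite divr_gt0. Qed.

Lemma lev_le delta p q : 0 < delta -> (p <= q)%N -> lev delta q <= lev delta p.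
Proof. by move=> d0 pq; rewrite ler_wpM2l ?(ltW d0)// lef_pV2 ?posrE// ler_nat. Qed.

Lemma lev_lt delta q : 0 < delta -> lev delta q.+1 < lev delta q.
Proof. by move=> d0; rewrite ltr_pM2l// ltf_pV2 ?posrE// ltr_nat. Qed.

Lemma appr_hlev delta q : 0 < delta -> appr (hlev delta q).
Proof. by move=> d0; apply/appr_ramp/lev_lt. Qed.

Lemma hlevM delta p q (u : U) : 0 < delta -> npos u -> (p < q)%N ->
  fc u (hlev delta q) * fc u (hlev delta p) = fc u (hlev delta p).
Proof.
move=> d0 nu pq; have [ap aq] := (appr_hlev p d0, appr_hlev q d0).
rewrite -fcM//; apply: fc_ext => //; first exact: apprM.
move=> t t0 _; have [tp|pt] := leP t (lev delta p.+1).
  by rewrite [hlev _ p t]ramp_lo ?lev_lt// mulr0.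
by rewrite [hlev _ q t]ramp_hi ?lev_lt ?mul1r// (le_trans _ (ltW pt))// lev_le.
Qed.

Lemma hlev_cut delta q (u : U) : 0 < delta -> npos u ->
  fc u (hlev delta q) * cut delta u = cut delta u.
Proof.
move=> d0 nu; have aq := appr_hlev q d0; have ac := @appr_cutf R delta.
rewrite -fcM//; apply: fc_ext => //; first exact: apprM.
move=> t t0 _; have [td|dt] := leP t delta; first by rewrite cutf_lo// mulr0.
rewrite [hlev _ q t]ramp_hi ?lev_lt ?mul1r// (le_trans _ (ltW dt))//.
by rewrite ler_pdivrMr// ler_peMr ?(ltW d0)// ler1n.
Qed.

Lemma nm_hlev delta q (u : U) : 0 < delta -> npos u -> nm (fc u (hlev delta q)) <= 1.
Proof.
move=> d0 nu; apply: fc_norm => //; first exact: appr_hlev.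
by move=> t _ _; rewrite ger0_norm ?ramp_le1 ?ramp_ge0.
Qed.

Context (T : finType) (ne : pred T) (col : T -> nat) (adj : rel T) (x y : T -> U).
Context (M C : nat) (delta B kap kap' g mu : R).
Local Notation h q := (hlev delta q).
Implicit Types w : T.
Hypothesis px : forall w, ne w -> pB (x w).
Hypothesis py : forall w, ne w -> pB (y w).
Hypothesis xy : forall w, ne w -> cl s (x w) *+ M.+2 ⊑ cl s (cut delta (y w)).
Hypothesis xB : forall w, ne w -> nm (x w) + 1 <= B.
Hypothesis xx : forall w w', ne w -> ne w' -> adj w w' -> nm (x w' - x w) <= g / 6.
Hypothesis yy : forall w w' q, ne w -> ne w' -> adj w w' -> (q <= C)%N ->
  nm (fc (y w) (h q) - fc (y w') (h q)) <= mu.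
Hypothesis adjM : forall w, (#|finset (adj w)| <= M)%N.
Hypothesis adjC : forall w w', adj w w' = adj w' w.
Hypothesis adj_col : forall w w', adj w w' -> col w = col w' -> w = w'.
Hypotheses (M0 : (0 < M)%N) (d0 : 0 < delta) (B1 : 1 <= B) (kap0 : 0 < kap) (kap1 : kap <= 1).
Hypotheses (g0 : 0 < g) (kapg : kap <= g / 6) (mu0 : 0 <= mu).
Hypotheses (mug : 2 * (mu * B ^+ 2) <= g / 6) (muk : mu * B ^+ 2 <= kap' / 2).
Hypothesis gk : B * Num.sqrt (4 * (M%:R * g)) <= kap' / 2.

Definition greedy_inv (q : nat) (r : T -> U) := forall w, ne w -> (col w < q)%N ->
  [/\ inB (r w), nm (st (r w) * r w - x w) <= kap,
    (forall p, (col w <= p)%N -> fc (y w) (h p) * r w = r w) &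
    forall w', ne w' -> (col w' < q)%N -> adj w w' -> w != w' -> nm (st (r w) * r w') <= kap'].

Lemma nm_root w u : ne w -> nm (st u * u - x w) <= kap -> nm u <= B.
Proof.
move=> nw h; have B0 : 0 <= B := le_trans ler01 B1.
rewrite -(@ler_pXn2r _ 2) ?nnegrE ?nm_ge0// -nmC.
apply: (@le_trans _ _ (nm (x w) + 1)).
  by rewrite -[st u * u](subrK (x w)) addrC (le_trans (nmD _ _))// lerD2l (le_trans h).
by apply: le_trans (xB nw) _; rewrite expr2 ler_peMr.
Qed.

Lemma greedy_extend q r w : (q <= C)%N -> greedy_inv q r -> ne w -> col w = q ->
  exists u, [/\ inB u, nm (st u * u - x w) <= kap,
    (forall p, (q <= p)%N -> fc (y w) (h p) * u = u) &
    forall w', ne w' -> (col w' < q)%N -> adj w w' -> nm (st u * r w') <= kap'].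
Proof.
move=> qC inv nw cw; have B0 : 0 <= B := le_trans ler01 B1.
have pyw := py nw; have nyw := pB_npos pyw.
pose J : pred T := [pred w' | [&& adj w w', (col w' < q)%N & ne w']].
(* A neighbouring root is supported under its own [y w']. Multiplication by [h q.-1] of [y w] moves
   it under [y w], where [h q] is a unit for it, at a distance of at most mu B. *)
pose r' w' := fc (y w) (h q.-1) * r w'.
have near w' : w' \in J -> [/\ adj w w', (col w' < q)%N, ne w' & nm (r' w' - r w') <= mu * B].
  rewrite inE => /and3P[a cq n]; split=> //; have [b1 b2 b3 _] := inv w' n cq.
  have cq' : (col w' <= q.-1)%N by rewrite -ltnS prednK//; exact: leq_ltn_trans cq.
  rewrite /r' -{2}(b3 _ cq') -mulrBl (le_trans (nmM _ _))// ler_pM ?nm_ge0//.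
    by apply: yy => //; rewrite (leq_trans (leq_pred _)).
  exact: nm_root b2.
have nr' w' : w' \in J -> nm (r' w') <= B.
  move=> /near[_ cq n _]; have [_ b2 _ _] := inv w' n cq.
  rewrite (le_trans (nmM _ _))// (le_trans (ler_wpM2r (nm_ge0 _) (nm_hlev _ d0 nyw)))// mul1r.
  exact: nm_root b2.
have [|||||||w'|w'||u [bu hu uu ur]] := @greedy_step _ _ s AU CAN T J r' (cut delta (y w))
  (fc (y w) (h q)) (x w) M g (g / 2) kap (pB_cut (ltW d0) pyw) (px nw).
- exact: fc_sa (appr_hlev _ d0).
- exact: hlev_cut.
- by [].
- exact: divr_gt0.
- by [].
- apply: leq_trans (adjM w); apply: subset_leq_card; apply/fintype.subsetP => w'.
  by rewrite !inE => /and3P[].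
- by [].
- move=> w'J; have [_ cq n _] := near _ w'J; have [b1 _ _ _] := inv w' n cq.
  split; first by apply: inB_mull.
  rewrite /r' mulrA hlevM// -[X in (_ < X)%N](prednK (leq_ltn_trans (leq0n _) cq))//.
- move=> w'J; have [a cq n rr] := near _ w'J; have [b1 b2 _ _] := inv w' n cq.
  have pr : pB (st (r' w') * r' w') by apply: pB_kv; exact: inB_mull.
  have g2 : 0 <= g / 2 by rewrite ltW// divr_gt0.
  apply: cl_cut_near pr (pB_cut g2 (px nw)) _.
  rewrite (le_trans (ndistD (x w) _ _))// [leRHS](splitr g).
  rewrite lerD//; last by rewrite ndistC cut_near//; exact: pB_npos (px nw).
  rewrite (le_trans (ndistD (st (r w') * r w') _ _))// (_ : g / 2 = g / 6 + (g / 6 + g / 6)); last by field.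
  rewrite lerD//.
    have -> : st (r' w') * r' w' - st (r w') * r w' =
        st (r' w') * (r' w' - r w') + st (r' w' - r w') * r w'.
      by rewrite mulrBr stB mulrBl addrA subrK.
    apply: le_trans mug; rewrite (le_trans (nmD _ _))// (_ : 2 * _ = B * (mu * B) + mu * B * B); last by ring.
    rewrite lerD// (le_trans (nmM _ _))// nm_st ler_pM ?nm_ge0 ?nr'//.
    exact: nm_root b2.
  rewrite (le_trans (ndistD (x w') _ _))// lerD//; last exact: xx.
  exact: le_trans b2 kapg.
- exact: xy.
exists u; split=> // [p|w' n cq a].
  rewrite leq_eqVlt => /orP[/eqP <-//|qp].
  by rewrite -hu mulrA hlevM.
have w'J : w' \in J by rewrite inE a cq n.
have [_ _ _ rr] := near _ w'J.
have -> : st u * r w' = st u * r' w' - st u * (r' w' - r w') by rewrite mulrBr subKr.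
rewrite (le_trans (nmB _ _))// [leRHS](splitr kap').
have uB : nm u <= B := nm_root nw uu.
rewrite lerD//.
  by apply: le_trans (ur _ w'J) _; apply: le_trans gk; rewrite ler_wpM2r ?sqrtr_ge0.
rewrite (le_trans (nmM _ _))// nm_st (le_trans _ muk)// expr2 mulrCA.
by rewrite ler_pM ?nm_ge0.
Qed.

Lemma greedy_family : exists r, greedy_inv C r.
Proof.
suff all q : (q <= C)%N -> exists r, greedy_inv q r by exact: all.
elim: q => [|q IH] qC; first by exists (fun=> 0).
have [r inv] := IH (ltnW qC).
have /choice[u uP] w : exists u, ne w -> col w = q -> [/\ inB u, nm (st u * u - x w) <= kap,
    (forall p, (q <= p)%N -> fc (y w) (h p) * u = u) &
    forall w', ne w' -> (col w' < q)%N -> adj w w' -> nm (st u * r w') <= kap'].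
  have [nw|nw] := boolP (ne w); last by exists 0.
  have [cw|cw] := eqVneq (col w) q; last by exists 0 => _ /eqP; rewrite (negbTE cw).
  by have [u uP] := greedy_extend (ltnW qC) inv nw cw; exists u.
have cases w : (col w < q.+1)%N -> (col w < q)%N \/ col w = q.
  by rewrite ltnS leq_eqVlt => /orP[/eqP|]; [right|left].
exists (fun w => if col w == q then u w else r w) => w nw /cases[cw|cw].
  have ncw : (col w == q) = false by apply/negbTE; rewrite neq_ltn cw.
  have [b1 b2 b3 b4] := inv w nw cw; rewrite ncw; split=> // w' nw' /cases[cw'|cw'] a ww'.
    by rewrite ifN ?b4// neq_ltn cw'.
  rewrite cw' eqxx -nm_st stM stK; have [_ _ _ h4] := uP w' nw' cw'.
  by apply: h4 => //; rewrite adjC.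
have [b1 b2 b3 b4] := uP w nw cw; rewrite cw eqxx; split=> // w' nw' /cases[cw'|cw'] a ww'.
  by rewrite ifN ?b4// neq_ltn cw'.
by case/eqP: ww'; apply: adj_col => //; rewrite cw cw'.
Qed.

End GreedyFamily.

Lemma ush_sum (R : realType) (U V : ucstarAlgType R) (phi : U -> V) (h : ushom phi)
    (I : Type) (r : seq I) (P : pred I) (F : I -> U) :
  phi (\sum_(i <- r | P i) F i) = \sum_(i <- r | P i) phi (F i).
Proof. by apply: big_morph; [exact: ushD h|exact: ush0 h]. Qed.

Lemma small_upto (R : realType) (P : nat -> R -> Prop) :
  (forall q d d', 0 < d' -> d' <= d -> P q d -> P q d') -> (forall q, exists2 d, 0 < d & P q d) ->
  forall n, exists2 d, 0 < d & forall q, (q <= n)%N -> P q d.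
Proof.
move=> mono ex; elim=> [|n [d d0 IH]].
  by have [d d0 h] := ex 0%N; exists d => // q; rewrite leqn0 => /eqP ->.
have [d' d'0 h] := ex n.+1; have m0 : 0 < Num.min d d' by rewrite lt_min d0.
exists (Num.min d d') => // q; rewrite leq_eqVlt => /orP[/eqP ->|qn].
  by apply: mono h => //; rewrite ge_min lexx orbT.
by apply: mono (IH q qn) => //; rewrite ge_min lexx.
Qed.

Lemma cl_cut_near2 (R : realType) (D : cstarAlgType R) (s : stable_str D) (u v : unitz D) (a b : R) :
  pB u -> pB v -> nm (u - v) <= a -> 0 <= b -> cl s (cut (a + b) u) ⊑ cl s (cut b v).
Proof.
move=> pu pv uv b0; apply: cl_cut_near pu (pB_cut b0 pv) _.
by rewrite (le_trans (ndistD v _ _))// lerD// ndistC cut_near//; exact: pB_npos.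
Qed.

Lemma grid_size (R : realType) (d : R) : 0 < d -> exists2 N, (0 < N)%N & 3 / N%:R <= d.
Proof.
move=> d0; exists (Num.bound (3 / d)).+1 => //.
rewrite ler_pdivrMr// mulrC -ler_pdivrMr//.
have q0 : 0 <= 3 / d by rewrite divr_ge0// ltW.
by apply: ltW; apply: lt_le_trans (archi_boundP q0) _; rewrite ler_nat.
Qed.

(** * Gluing roots over a grid *)

Section Fields.
Context (R : realType) (X : topologicalType) (cptX : compact [set: X]).
Context (m : nat) (f : 'I_m -> X -> R) (cf : forall i, continuous (f i)).
Hypothesis f01 : forall i t, 0 <= f i t <= 1.
Context (D : cstarAlgType R) (s : stable_str D).
Hypotheses (AU : cuAU s) (CAN : cuCAN s).
Local Notation toC := (real_complex R).
Local Notation U := (unitz D).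
Local Notation FE := (@FE R X cptX m f cf D).
Local Notation V := (unitz FE).
Local Notation clD := (cl s).
Implicit Types (x y u : V).

Lemma fe_scal (g : X -> R) (a : U) : suu f g -> inB a -> exists2 u : V, inB u &
  forall t, evt t u = toC (g t) *: a.
Proof.
move=> ug ba; have [||u bu uE] := @uu_ex R X cptX m f cf D (fun t => toC (g t) *: a).
- move=> e e0; have a1 : 0 < nm a + 1 by rewrite ltr_wpDl// nm_ge0.
  have [d d0 h] := ug _ (divr_gt0 e0 a1); exists d => // t t' /h gt.
  rewrite -scalerBl -rmorphB nmZr (le_trans (ler_wpM2r (nm_ge0 _) gt))// mulrC small_mul ?nm_ge0//.
  exact: ltW.
- by move=> t; exact: inBZ.
by exists u.
Qed.

Lemma unif_cut n x y (e : R) : pB x -> pB y -> (forall t, clD (evt t x) *+ n ⊑ clD (evt t y)) ->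
  0 < e -> exists2 d, 0 < d & forall t, clD (cut e (evt t x)) *+ n ⊑ clD (cut d (evt t y)).
Proof.
move=> px py xy e0; apply: (cpt_unif cptX cf) => [d d' t d'0 dd h|t].
  exact: cule_trans h (cl_cut_mono _ (pB_evt t py) (ltW d'0) dd).
have e2 := divr_gt0 e0 (ltr0n _ 2); have [pxt pyt] := (pB_evt t px, pB_evt t py).
have /cull_cl[//|d d0 h] := cull_ler (cull_mulrn n (cull_cut s pxt e2)) (xy t).
have d2 := divr_gt0 d0 (ltr0n _ 2).
have [d1 d10 h1] := evt_uu x e2; have [c2 c20 h2] := evt_uu y d2.
have m0 : 0 < Num.min (d / 2) (Num.min d1 c2) by rewrite !lt_min d2 d10.
exists (Num.min (d / 2) (Num.min d1 c2)) => // t' c.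
apply: cule_trans (_ : _ ⊑ clD (cut (e / 2) (evt t x)) *+ n) _.
  apply: cule_mulrn; rewrite {1}(splitr e); apply: cl_cut_near2 (pB_evt t' px) pxt _ (ltW e2).
  by apply/h1/(close_le _ c); rewrite !ge_min lexx ?orbT.
apply: cule_trans h _; rewrite {1}(splitr d).
apply: cule_trans (cl_cut_near2 s pyt (pB_evt t' py) _ (ltW d2)) _.
  by apply/h2/close_sym/(close_le _ c); rewrite !ge_min lexx ?orbT.
by apply: cl_cut_mono (pB_evt t' py) (ltW m0) _; rewrite ge_min lexx.
Qed.

(** 3^m bounds the number of cells adjacent to a given one, itself included; [nbC] is the number 2^m
    of colours. Both are independent of the mesh. *)
Definition nbM := #|{ffun 'I_m -> 'I_3}|.
Definition nbC := #|{ffun 'I_m -> bool}|.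

Lemma nbM_gt0 : (0 < nbM)%N.
Proof. by rewrite /nbM card_ffun expn_gt0 card_ord. Qed.
Lemma nbC_gt0 : (0 < nbC)%N.
Proof. by rewrite /nbC card_ffun expn_gt0 card_bool. Qed.

Lemma sqrt_sqrt (a : R) : 0 <= a -> Num.sqrt a * Num.sqrt a = a.
Proof. by move=> a0; rewrite -expr2 sqr_sqrtr. Qed.

Lemma suu_sqrt (g : X -> R) : (forall t, 0 <= g t) -> suu f g -> suu f (fun t => Num.sqrt (g t)).
Proof.
move=> g0 ug e e0; have [d d0 h] := ug _ (mulr_gt0 e0 e0); exists d => // t t' /h gt.
have dist (a b : R) : 0 <= a -> 0 <= b -> a <= b -> `|a - b| <= e * e -> `|Num.sqrt a - Num.sqrt b| <= e.
  move=> a0 b0 ab; rewrite !ler0_norm ?subr_le0 ?ler_sqrt// !opprB => h1.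
  rewrite lerBlDr -(@ler_pXn2r _ 2) ?nnegrE ?addr_ge0 ?sqrtr_ge0 ?(ltW e0)// sqrrD !sqr_sqrtr//.
  have : 0 <= e * Num.sqrt a by rewrite mulr_ge0 ?sqrtr_ge0 ?(ltW e0).
  by rewrite expr2 mulr2n; move: h1; lra.
have [ab|ba] := leP (g t) (g t'); first exact: dist.
by rewrite distrC dist ?(ltW ba)// distrC.
Qed.

Let evh t := evt_ushom cptX cf D t.

(* On each cell of a grid choose a root of [x] supported under [y], colour by colour, so that the
   roots of neighbouring cells are almost orthogonal; glue them by a partition of unity. *)
Lemma grid_compare x y : pB x -> pB y ->
  (forall t, clD (evt t x) *+ nbM.+2 ⊑ clD (evt t y)) -> cle x y.
Proof.
move=> px py xy0; apply: cle_cutP (pB_npos px) _ => eps eps0.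
have px0 := pB_cut (ltW eps0) px; pose x0 : V := cut eps x.
have nx0 : npos x0 := pB_npos px0; have ny := pB_npos py.
have [delta d0 xy] := unif_cut px py xy0 eps0.
have ecut t : evt t x0 = cut eps (evt t x).
  by rewrite (ush_cut (evh t))//; exact: pB_npos px.
pose C := nbC; pose M := nbM; have M0 := nbM_gt0; have C0 := nbC_gt0.
have CR : 0 < C%:R :> R by rewrite ltr0n.
have MR : 0 < M%:R :> R by rewrite ltr0n.
pose B := nm x0 + 2; have B1 : 1 <= B by rewrite /B; have := nm_ge0 x0; lra.
have B0 : 0 < B := lt_le_trans ltr01 B1.
apply: cle_lim => e e0.
(* The error e is spent in quarters: at most C^2 cross terms of size kap', twice kap (root against
   value in a cell, value in a cell against value at t), and the variation mu of the supports. *)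
pose kap' := e / (4 * C%:R ^+ 2); have kap'0 : 0 < kap' by rewrite divr_gt0// mulr_gt0// exprn_gt0.
(* Makes [B * Num.sqrt (4 * (M%:R * g))], the overlap allowed by [greedy_step], equal to kap' /
   2. *)
pose g := (kap' / (2 * B)) ^+ 2 / (4 * M%:R).
have kB0 : 0 < kap' / (2 * B) by rewrite divr_gt0// mulr_gt0.
have g0 : 0 < g by rewrite divr_gt0 ?exprn_gt0// mulr_gt0.
pose kap := Num.min 1 (Num.min (g / 6) (e / 4)).
have kap0 : 0 < kap by rewrite !lt_min ltr01/=; apply/andP; split; apply: divr_gt0.
pose mu := Num.min (g / (12 * B ^+ 2)) (Num.min (kap' / (2 * B ^+ 2)) (e / (8 * C%:R ^+ 2 * B ^+ 2))).
have B20 : 0 < B ^+ 2 by rewrite exprn_gt0.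
have C20 : 0 < C%:R ^+ 2 :> R by rewrite exprn_gt0.
have mu0 : 0 < mu.
  by rewrite !lt_min; apply/and3P; split; apply: divr_gt0 => //; do ?apply: mulr_gt0.
have [dx dx0 hx] := evt_uu x0 kap0.
have [dy dy0 hy] : exists2 d, 0 < d & forall q, (q <= C)%N -> forall t t', close f d t t' ->
    nm (evt t (fc y (hlev delta q)) - evt t' (fc y (hlev delta q))) <= mu.
  apply: small_upto => [q d d' d'0 dd h t t' c|q]; first exact/h/(close_le dd).
  by have [d d0' h] := evt_uu (fc y (hlev delta q)) mu0; exists d.
pose dd := Num.min dx dy; have dd0 : 0 < dd by rewrite lt_min dx0.
have [N N0 N3] := grid_size dd0.
pose T := {ffun 'I_m -> 'I_N.+1}; pose phi (w : T) t := gphi f w t.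
have phi0 w t : 0 <= phi w t := gphi_ge0 _ _ _.
have phi1 w t : phi w t <= 1 := gphi_le1 _ _ _.
have close3 w w' t t' : gadj w w' -> 0 < phi w t -> 0 < phi w' t' -> close f dd t t'.
  move=> a h h'; apply: close_le N3 _; exact: gadj_close N0 _ _ _ _ a h h'.
pose ne (w : T) := `[< exists t, 0 < phi w t >].
have /choice[xyw xywP] w : exists p : U * U, ne w ->
    exists t, [/\ 0 < phi w t, p.1 = evt t x0 & p.2 = evt t y].
  case: (boolP (ne w)) => [/asboolP[t h]|nw]; last by exists (0, 0).
  by exists (evt t x0, evt t y) => _; exists t.
pose xw w := (xyw w).1; pose yw w := (xyw w).2.
have fcE t q : evt t (fc y (hlev delta q)) = fc (evt t y) (hlev delta q).
  exact: (ush_fc (evh t) ny (appr_hlev q d0)).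
have adjx w w' : ne w -> ne w' -> gadj w w' -> nm (xw w' - xw w) <= kap.
  move=> /xywP[t [h E _]] /xywP[t' [h' E' _]] a; rewrite /xw E E'.
  by apply/hx/close_sym/(close_le _ (close3 _ _ _ _ a h h')); rewrite ge_min lexx.
have adjy w w' q : ne w -> ne w' -> gadj w w' -> (q <= C)%N ->
    nm (fc (yw w) (hlev delta q) - fc (yw w') (hlev delta q)) <= mu.
  move=> /xywP[t [h _ E]] /xywP[t' [h' _ E']] a qC; rewrite /yw E E' -!fcE.
  by apply: hy => //; apply: close_le (close3 _ _ _ _ a h h'); rewrite ge_min lexx orbT.
have [r rP] : exists r, @greedy_inv R D T ne (@gcol m N) (@gadj m N) xw yw delta kap kap' C r.
  apply: (@greedy_family R D s AU CAN T ne (@gcol m N) (@gadj m N) xw yw M C delta B kap kap' g mu).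
  - by move=> w /xywP[t [_ E _]]; rewrite /xw E; exact: pB_evt.
  - by move=> w /xywP[t [_ _ E]]; rewrite /yw E; exact: pB_evt.
  - by move=> w /xywP[t [_ E1 E2]]; rewrite /xw /yw E1 E2 ecut; exact: xy.
  - move=> w /xywP[t [_ E _]]; rewrite /xw E /B (_ : 2 = 1 + 1)// addrA lerD2r.
    by rewrite (le_trans (ush_nm (evh t) _))// lerDl.
  - by move=> w w' nw nw' a; rewrite (le_trans (adjx _ _ nw nw' a))// !ge_min lexx ?orbT.
  - exact: adjy.
  - exact: gadj_card.
  - exact: gadj_sym.
  - exact: gadj_col.
  - exact: M0.
  - exact: d0.
  - exact: B1.
  - exact: kap0.
  - by rewrite ge_min lexx.
  - exact: g0.
  - by rewrite !ge_min lexx ?orbT.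
  - have : mu <= g / (12 * B ^+ 2) by rewrite ge_min lexx.
    rewrite ler_pdivlMr ?mulr_gt0// => h; rewrite ler_pdivlMr// (_ : 2 * _ * 6 = mu * (12 * B ^+ 2))//; ring.
  - have : mu <= kap' / (2 * B ^+ 2) by rewrite !ge_min lexx ?orbT.
    rewrite ler_pdivlMr ?mulr_gt0// => h; rewrite ler_pdivlMr// (_ : mu * _ * 2 = mu * (2 * B ^+ 2))//; ring.
  - rewrite (_ : 4 * (M%:R * g) = (kap' / (2 * B)) ^+ 2); last by rewrite mulrA mulrC divfK// mulf_neq0// gt_eqF.
    rewrite sqrtr_sqr gtr0_norm// le_eqVlt; apply/orP; left; apply/eqP.
    by field; rewrite gt_eqF.
have colC (w : T) : (gcol w < C)%N := gcol_lt w.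
have inv w (nw : ne w) := rP w nw (colC w).
pose r' w := if ne w then r w else 0.
have br' w : inB (r' w) by rewrite /r'; case: (boolP (ne w)) => // /inv[].
have act w t : 0 < phi w t -> ne w by move=> h; apply/asboolP; exists t.
have nmr w : nm (r' w) <= B.
  rewrite /r'; case: (boolP (ne w)) => [nw|_]; last by rewrite nm0 ltW.
  have [_ h _ _] := inv w nw; have [t [_ E _]] := xywP w nw.
  apply: (@nm_root R D T ne xw B kap _ B1 _ w) => //; last by rewrite ge_min lexx.
  move=> w' /xywP[t' [_ E' _]]; rewrite /xw E' /B (_ : 2 = 1 + 1)// addrA lerD2r.
  by rewrite (le_trans (ush_nm (evh t') _))// lerDl.
(* Roots are added with the square roots of the weights, so that the diagonal terms of the square
   carry the partition of unity itself. *)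
pose sph w t := Num.sqrt (phi w t).
have /choice[Rw RwP] w : exists u : V, inB u /\ forall t, evt t u = toC (sph w t) *: r' w.
  have sw : suu f (sph w) by apply: suu_sqrt; [exact: phi0|exact: suu_gphi].
  have [u bu uE] := fe_scal sw (br' w).
  by exists u.
pose Rf : V := \sum_w Rw w; have bR : inB Rf.
  by apply: big_ind => // [a b|w _]; [exact: inBD|have [] := RwP w].
have Rt t : evt t Rf = \sum_w toC (sph w t) *: r' w.
  rewrite (ush_sum (evh t)); apply: eq_bigr => w _; by have [_ ->] := RwP w.
(* Each root lies under the value of y at the reference point of its cell only. Multiplication by G
   changes the glued root little and brings it exactly under y. *)
pose G : V := fc y (hlev delta C); have aG := appr_hlev C d0.
have sG : sa G by exact: fc_sa.
pose a' := st (G * Rf) * (G * Rf); have ba : inB a' by apply/inB_mull/inB_mull.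
exists a'; last first.
  apply: cle_trans (cle_stC _) _; rewrite stM sG.
  have -> : G * Rf * (st Rf * G) = G * (Rf * st Rf) * st G by rewrite sG !mulrA.
  have nRR : npos (Rf * st Rf) by exact: pB_npos (pB_vk bR).
  have n1 := npos_leN nRR (lexx (nm (Rf * st Rf))).
  have n2 : npos (toC (nm (Rf * st Rf)) *: (G * G) - G * (Rf * st Rf) * st G).
    by have := npos_conj G n1; congr npos; rewrite mulrBr mulrBl scEr -scalerAl sG.
  apply: cle_trans (cle_le (npos_conj _ nRR) n2) _.
  apply: cle_trans (cleZ _ (nm_ge0 _)) _; rewrite -fcM// -{2}(fc_id ny).
  apply: (cle_fc_le (K := (lev delta C.+1)^-1)) => //; [exact: apprM|exact: appr_id| | |].
  - by rewrite invr_ge0 ltW// lev_gt0.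
  - by move=> t t0 _; rewrite mulr_ge0 ?ramp_ge0.
  - move=> t t0 _; have [tl|lt] := leP t (lev delta C.+1).
      rewrite [hlev _ _ t]ramp_lo ?lev_lt// mul0r mulr_ge0// invr_ge0 ltW// lev_gt0//.
    rewrite (@le_trans _ _ 1)//.
      by rewrite (le_trans (ler_piMr (ramp_ge0 _ _ _) (ramp_le1 _ _ _)))// ramp_le1.
    by rewrite ler_pdivlMl ?lev_gt0// mulr1 ltW.
apply: evt_nm_le; [exact: ltW|by apply: inBD => //; apply: inBN; exact: pB_inB|move=> t].
rewrite (ushB (evh t)) /a' (ushM (evh t)) (ush_st (evh t)).
rewrite (ushM (evh t)) Rt fcE.
set Gt := fc (evt t y) _; set Rr := \sum_w _; set xt := evt t x0.
pose A := finset (fun w => (0 < phi w t)%R).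
have cA : (#|A| <= C)%N by exact: gactive_card.
have offA w : w \notin A -> phi w t = 0.
  by rewrite inE -leNgt => h; apply/eqP; rewrite eq_le h phi0.
have offs w : w \notin A -> sph w t = 0 by move=> /offA; rewrite /sph => ->; rewrite sqrtr0.
have sph1 w : 0 <= sph w t <= 1 by rewrite sqrtr_ge0 /= -(sqrtr1 R) ler_sqrt.
have sumA (F : T -> U) (c : R) : (forall w, w \notin A -> F w = 0) -> (forall w, w \in A -> nm (F w) <= c) ->
    0 <= c -> nm (\sum_w F w) <= C%:R * c.
  move=> F0 Fc c0; rewrite (le_trans (nm_sum _ _ _))// (bigID (mem A))/= [X in _ + X]big1 => [|w /F0 ->]; last exact: nm0.
  rewrite addr0 (le_trans (ler_sum _ Fc))// sumr_const -[leLHS]mulr_natl ler_wpM2r// ler_nat//.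
have Delta : nm (Gt * Rr - Rr) <= C%:R * (mu * B).
  rewrite /Rr mulr_sumr -sumrB; apply: sumA.
  - by move=> w /offs ->; rewrite !scale0r mulr0 subr0.
  - move=> w; rewrite inE => wA; have nw := act _ _ wA; have [_ _ h _] := inv w nw.
    have := h C (ltnW (colC w)); rewrite -scalerAr -scalerBr /r' nw => E.
    rewrite -[X in _ - X]E -mulrBl nmZr (ger0_norm (proj1 (andP (sph1 w)))).
    rewrite (le_trans (ler_piMl (nm_ge0 _) (proj2 (andP (sph1 w)))))// (le_trans (nmM _ _))//.
    have [t' [h' _ E']] := xywP w nw.
    apply: ler_pM; rewrite ?nm_ge0//; last by have := nmr w; rewrite /r' nw.
    rewrite /Gt /yw E' -!fcE; apply: hy => //; apply: (close_le _ (close3 _ _ _ _ _ wA h')).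
      by rewrite ge_min lexx orbT.
    exact: (gphi_adj wA wA).
  - by rewrite mulr_ge0 ?(ltW mu0) ?(ltW B0).
have RB : nm Rr <= C%:R * B.
  apply: (sumA); [by move=> w /offs ->; rewrite scale0r|move=> w _|exact: ltW].
  rewrite nmZr (ger0_norm (proj1 (andP (sph1 w)))).
  by rewrite (le_trans (ler_piMl (nm_ge0 _) (proj2 (andP (sph1 w))))).
have G1 : nm Gt <= 1 by apply: nm_hlev => //; exact: pB_npos (pB_evt t py).
have part1 : nm (st (Gt * Rr) * (Gt * Rr) - st Rr * Rr) <= e / 4.
  have -> : st (Gt * Rr) * (Gt * Rr) - st Rr * Rr =
      st (Gt * Rr) * (Gt * Rr - Rr) + st (Gt * Rr - Rr) * Rr.
    by rewrite mulrBr stB mulrBl addrA subrK.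
  have GR : nm (Gt * Rr) <= C%:R * B.
    by rewrite (le_trans (nmM _ _))// (le_trans (ler_wpM2r (nm_ge0 _) G1))// mul1r.
  have CB : 0 <= C%:R * B by rewrite mulr_ge0 ?(ltW B0)// ltW.
  apply: (@le_trans _ _ (C%:R * B * (C%:R * (mu * B)) + C%:R * (mu * B) * (C%:R * B))).
    rewrite (le_trans (nmD _ _))// lerD// (le_trans (nmM _ _))// nm_st ler_pM ?nm_ge0//.
  have : mu <= e / (8 * C%:R ^+ 2 * B ^+ 2) by rewrite !ge_min lexx ?orbT.
  rewrite ler_pdivlMr ?mulr_gt0// => h; rewrite ler_pdivlMr//.
  by rewrite (_ : _ * 4 = mu * (8 * C%:R ^+ 2 * B ^+ 2))//; ring.
have part2 : nm (st Rr * Rr - xt) <= e / 4 + e / 4 + e / 4.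
  have -> : st Rr * Rr - xt = \sum_w toC (phi w t) *: (st (r' w) * r' w - xw w)
      + \sum_w toC (phi w t) *: (xw w - xt)
      + \sum_w \sum_(w' | w' != w) toC (sph w t * sph w' t) *: (st (r' w) * r' w').
    have Ex : xt = \sum_w toC (phi w t) *: xt.
      by rewrite -scaler_suml -rmorph_sum/= (gphi_sum f01) scale1r.
    have -> : st Rr * Rr = \sum_w (toC (phi w t) *: (st (r' w) * r' w) +
        \sum_(w' | w' != w) toC (sph w t * sph w' t) *: (st (r' w) * r' w')).
      rewrite /Rr st_sum mulr_suml; apply: eq_bigr => w _; rewrite mulr_sumr (bigD1 w)//=.
      have E w' : st (toC (sph w t) *: r' w) * (toC (sph w' t) *: r' w') =
          toC (sph w t * sph w' t) *: (st (r' w) * r' w').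
        by rewrite stZr -scalerAl -scalerAr scalerA -toCM.
      by rewrite E sqrt_sqrt//; congr (_ + _); apply: eq_bigr => w' _; rewrite E.
    rewrite {1}Ex big_split/= addrAC -sumrB; congr (_ + _).
    rewrite -big_split/=; apply: eq_bigr => w _.
    by rewrite -scalerDr -scalerBr addrA subrK.
  have conv (F : T -> U) (c : R) : (forall w, w \in A -> nm (F w) <= c) -> 0 <= c ->
      nm (\sum_w toC (phi w t) *: F w) <= c.
    move=> Fc c0; rewrite (le_trans (nm_sum _ _ _))//.
    apply: (@le_trans _ _ (\sum_w phi w t * c)); last by rewrite -mulr_suml (gphi_sum f01) mul1r.
    apply: ler_sum => w _; rewrite nmZr ger0_norm//; have [wA|/offA ->] := boolP (w \in A).
      by rewrite ler_wpM2l// Fc.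
    by rewrite !mul0r.
  have kape : kap <= e / 4 by rewrite !ge_min lexx ?orbT.
  have e4 : 0 <= e / 4 by rewrite divr_ge0// ltW.
  rewrite (le_trans (nmD _ _))// lerD//; first rewrite (le_trans (nmD _ _))// lerD//.
  - apply: conv => // w; rewrite inE => /act nw; rewrite /r' nw.
    by have [_ h _ _] := inv w nw; exact: le_trans h kape.
  - apply: conv => // w; rewrite inE => wA; have [t' [h' E' _]] := xywP w (act _ _ wA).
    rewrite /xw E' (le_trans _ kape)//; apply/hx/(close_le _ (close3 _ _ _ _ _ h' wA)).
      by rewrite ge_min lexx.
    exact: (gphi_adj wA wA).
  - apply: (@le_trans _ _ (C%:R * (C%:R * kap'))); last first.
      by rewrite /kap' le_eqVlt; apply/orP; left; apply/eqP; field; rewrite gt_eqF.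
    apply: (sumA) => [w /offs E|w wA|]; last by rewrite mulr_ge0 ?(ltW kap'0).
      by apply: big1 => w' _; rewrite E mul0r scale0r.
    rewrite big_mkcond/=; apply: (sumA) => [w' /offs E|w' wA'|]; last exact: ltW.
      by case: ifP => // _; rewrite E mulr0 scale0r.
    case: ifPn => [ww|_]; last by rewrite nm0 ltW.
    move: wA wA'; rewrite !inE => wA wA'; have [nw nw'] := (act _ _ wA, act _ _ wA').
    have /andP[s0 s1] := sph1 w; have /andP[s0' s1'] := sph1 w'.
    rewrite nmZr ger0_norm ?mulr_ge0// (le_trans (ler_piMl (nm_ge0 _) _))//.
      by rewrite -[1]mulr1 ler_pM.
    rewrite /r' nw nw'; have [_ _ _ h] := inv w nw; apply: h => //.
      exact: gphi_adj wA wA'.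
    by rewrite eq_sym.
rewrite (le_trans (ndistD (st Rr * Rr) _ _))// (_ : e = e / 4 + (e / 4 + e / 4 + e / 4)); last by field.
exact: lerD.
Qed.

End Fields.

(** * Divisibility of sections *)

Lemma cle_cutZ (R : realType) (U : ucstarAlgType R) (y : U) (k d z : R) : npos y -> 0 < k -> k <= z ->
  0 <= d -> cle (cut d y) (cut (k * d) (real_complex R z *: y)).
Proof.
move=> ny k0 kz d0; have z0 : 0 < z := lt_le_trans k0 kz.
have az : appr (fun t => z * t) by apply: (apprZ z (@appr_id R)).
have ac c := @lip_appr R _ (lip_cutf c).
rewrite -{2}(fc_id ny) -fcZ//; last exact: appr_id.
rewrite /cut fc_comp//; last by move=> t t0; rewrite mulr_ge0// ltW.
apply: (cle_fc_le (K := z^-1)) => //.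
- by apply: appr_comp => // t t0; rewrite mulr_ge0// ltW.
- by rewrite invr_ge0 ltW.
- by move=> t _ _; exact: cutf_ge0.
- move=> t t0 _; rewrite ler_pdivlMl// /cutf; have [td|dt] := leP t d.
    by rewrite max_r ?subr_le0// mulr0 le_max lexx orbT.
  rewrite max_l; last by rewrite subr_ge0 ltW.
  rewrite le_max; apply/orP; left; rewrite mulrBr lerD2l lerN2.
  by rewrite ler_wpM2r.
Qed.

Section CountBelow.
Context (R : realType).
(** The ceiling of z when 0 <= z <= M, written as a sum so that it counts the layers l of the
    staircase lying below a weight. *)
Definition cnt (M : nat) (z : R) : nat := \sum_(l < M) (l%:R < z)%R.

Lemma cnt_le M z : (cnt M z <= M)%N.
Proof.
have E : (\sum_(l < M) 1)%N = M by rewrite sum1_card card_ord.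
by rewrite -[leqRHS]E; apply: leq_sum => i _; case: (_ < _).
Qed.

Lemma cnt_ub M z : 0 <= z -> (cnt M z)%:R <= z + 1.
Proof.
move=> z0; elim: M => [|M IH]; first by rewrite /cnt big_ord0 addr_ge0.
rewrite /cnt big_ord_recr/=; have [Mz|_] := ltP; last by rewrite addn0.
by rewrite addn1 -natr1 lerD2r (le_trans _ (ltW Mz))// ler_nat cnt_le.
Qed.

Lemma cnt_lb M z : z <= M%:R -> z <= (cnt M z)%:R.
Proof.
elim: M => [|M IH] zM; first by rewrite /cnt big_ord0.
rewrite /cnt big_ord_recr/=; have [Mz|/IH] := ltP; last by rewrite addn0.
apply: le_trans zM _; rewrite ler_nat addn1 ltnS.
have E : (\sum_(l < M) 1)%N = M by rewrite sum1_card card_ord.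
by rewrite -[leqLHS]E; apply: leq_sum => i _; rewrite (lt_trans _ Mz)// ltr_nat.
Qed.

End CountBelow.

Section DirectSums.
Context (R : realType) (D : cstarAlgType R) (s : stable_str D) (I : Type).
Implicit Types (r : seq I) (F : I -> unitz D).

Definition dss r F : unitz D := foldr (fun i a => ds s (F i) a) 0 r.

Lemma pB_dss r F : (forall i, pB (F i)) -> pB (dss r F).
Proof. by move=> pF; elim: r => [|i r IH]; [exact: pB0|exact: pB_ds]. Qed.

Lemma cl_dss r F : (forall i, pB (F i)) -> cl s (dss r F) = \sum_(i <- r) cl s (F i).
Proof.
move=> pF; elim: r => [|i r IH]; first by rewrite big_nil cl0.
by rewrite big_cons -IH -cl_dsD//; exact: pB_dss.
Qed.

Lemma cut_dss r F (c : R) : (forall i, pB (F i)) -> 0 < c ->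
  cl s (cut c (dss r F)) = \sum_(i <- r) cl s (cut c (F i)).
Proof.
move=> pF c0; elim: r => [|i r IH].
  rewrite big_nil -(cl0 s); apply: cule_anti; last by rewrite cl0; exact: cule0.
  by apply: cl_cut (pB0 _) (ltW c0).
by rewrite big_cons -IH -cl_cut_ds//; exact: pB_dss.
Qed.

End DirectSums.

Lemma uz_dss (R : realType) (A B : cstarAlgType R) (s : stable_str A) (s' : stable_str B)
    (phi : A -> B) (h : shom phi) (I : Type) (r : seq I) (F : I -> unitz A) :
  (forall j a, phi (sl s j a) = sl s' j (phi a)) ->
  uz phi (dss s r F) = dss s' r (fun i => uz phi (F i)).
Proof.
move=> hs; elim: r => [|i r IH]; first exact: ush0 (uz_ushom h).
by rewrite /= (uz_ds h hs) IH.
Qed.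

Lemma cule_sumn (R : realType) (D : cstarAlgType R) (s : stable_str D) (I : Type) (r : seq I)
    (F : I -> cu s) (n : I -> nat) (z : cu s) :
  (forall i, F i ⊑ z *+ n i) -> \sum_(i <- r) F i ⊑ z *+ (\sum_(i <- r) n i)%N.
Proof.
move=> h; elim: r => [|i r IH]; first by rewrite !big_nil mulr0n; exact: cule_refl.
by rewrite !big_cons mulrnDr; exact: culeD.
Qed.

Lemma cule_nsum (R : realType) (D : cstarAlgType R) (s : stable_str D) (I : Type) (r : seq I)
    (F : I -> cu s) (n : I -> nat) (z : cu s) :
  (forall i, z *+ n i ⊑ F i) -> z *+ (\sum_(i <- r) n i)%N ⊑ \sum_(i <- r) F i.
Proof.
move=> h; elim: r => [|i r IH]; first by rewrite !big_nil mulr0n; exact: cule_refl.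
by rewrite !big_cons mulrnDr; exact: culeD.
Qed.

Section Staircase.
Context (R : realType) (X : topologicalType) (cptX : compact [set: X]).
Context (m : nat) (f : 'I_m -> X -> R) (cf : forall i, continuous (f i)).
Hypothesis f01 : forall i t, 0 <= f i t <= 1.
Context (D : cstarAlgType R) (s : stable_str D).
Hypothesis AD : cuAD s.
Local Notation toC := (real_complex R).
Local Notation U := (unitz D).
Local Notation FE := (@FE R X cptX m f cf D).
Local Notation V := (unitz FE).
Local Notation clD := (cl s).
Local Notation C := (nbC m).
Implicit Types (x y : V).

(** A divisor found at t by almost divisibility still works nearby: the gaps between the cuts e / 8,
    e / 4, e / 2 and e absorb the variation of x. The same d is both the radius of the neighbourhood
    and the cut of y, so that one use of compactness suffices. *)
Lemma unif_divide x (e : R) (q : nat) : pB x -> 0 < e -> exists2 d, 0 < d & forall t, exists y : U,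
  pB y /\ forall t', close f d t' t -> clD y *+ q ⊑ clD (cut (e / 8) (evt t' x)) /\
    clD (cut e (evt t' x)) ⊑ clD (cut d y) *+ q.+1.
Proof.
move=> px e0; have [e2 e4 e8] : [/\ 0 < e / 2, 0 < e / 4 & 0 < e / 8] by split; rewrite divr_gt0.
apply: (cpt_unif cptX cf) => [d d' t d'0 dd [y [py h]]|t].
  exists y; split=> // t' c; have [h1 h2] := h t' (close_le dd c); split=> //.
  by apply: cule_trans h2 _; apply: cule_mulrn; exact: cl_cut_mono py (ltW d'0) dd.
have pxt := pB_evt t px.
have ll : cull (clD (cut (e / 2) (evt t x))) (clD (cut (e / 4) (evt t x))).
  have -> : e / 2 = e / 4 + e / 4 by field.
  rewrite -cut_cut ?(ltW e4)//; last exact: pB_npos pxt.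
  exact: cull_cut (pB_cut (ltW e4) pxt) e4.
have [Y + +] := AD q ll; have [y py ->] := cl_ex Y => h1 h2.
have [d0 d00 h3] : exists2 d0, 0 < d0 & clD (cut (e / 2 + e / 4) (evt t x)) ⊑ clD (cut d0 y) *+ q.+1.
  have E := @cl_dss R D s nat (iota 0 q.+1) (fun=> y) (fun=> py).
  have Ed d (d0 : 0 < d) := @cut_dss R D s nat (iota 0 q.+1) (fun=> y) d (fun=> py) d0.
  have Ec (z : cu s) : \sum_(i <- iota 0 q.+1) z = z *+ q.+1.
    by rewrite big_const_seq count_predT size_iota iter_addr_0.
  rewrite Ec in E; have pY := @pB_dss R D s nat (iota 0 q.+1) (fun=> y) (fun=> py).
  have h2' : clD (cut (e / 2) (evt t x)) ⊑ clD (dss s (iota 0 q.+1) (fun=> y)) by rewrite E.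
  have [d d0 h] := cl_cut_le (pB_cut (ltW e2) pxt) pY h2' e4.
  exists d => //; rewrite Ed// Ec in h; move: h; rewrite cut_cut ?(ltW e2) ?(ltW e4)//.
  exact: pB_npos pxt.
have [d1 d10 hd1] := evt_uu x e8; have d12 := divr_gt0 d10 (ltr0n _ 2).
have m0 : 0 < Num.min d0 (d1 / 2) by rewrite lt_min d00.
exists (Num.min d0 (d1 / 2)) => // t' c'; exists y; split=> // t'' c''.
have c : close f d1 t'' t.
  by rewrite (splitr d1); apply: close_trans (close_le _ c'') (close_le _ c'); rewrite ge_min lexx orbT.
have px'' := pB_evt t'' px; split.
  apply: cule_trans h1 _; have -> : e / 4 = e / 8 + e / 8 by field.
  exact: cl_cut_near2 pxt px'' (hd1 _ _ (close_sym c)) (ltW e8).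
apply: cule_trans (_ : _ ⊑ clD (cut (e / 2 + e / 4) (evt t x))) _.
  rewrite {1}(_ : e = e / 4 + (e / 2 + e / 4)); last by field.
  apply: cl_cut_near2 px'' pxt _ _; last by rewrite addr_ge0 ?(ltW e2) ?(ltW e4).
  by apply: le_trans (hd1 _ _ c) _; rewrite ler_pM2l// lef_pV2 ?posrE// ler_nat.
apply: cule_trans h3 _; apply: cule_mulrn; apply: cl_cut_mono py (ltW m0) _.
by rewrite ge_min lexx.
Qed.

Lemma suu_comp_lip (g : X -> R) (h : R -> R) : suu f g -> (forall a b, `|h a - h b| <= `|a - b|) ->
  suu f (fun t => h (g t)).
Proof.
by move=> ug lh e e0; have [d d0 hd] := ug e e0; exists d => // t t' /hd; exact: le_trans (lh _ _).
Qed.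

(* [y] is the direct sum, over the cells [w] of a grid and the [l < M], of the constants [yw w]
   damped by [max 0 (phi w - l / M)]: at each point at most [M + C] summands are nonzero and at
   least [M] of them are not small. *)
Lemma field_divide x (e : R) (q M : nat) : pB x -> 0 < e -> (0 < M)%N -> exists y : V, exists d : R,
  [/\ pB y, 0 < d, forall t, clD (evt t y) *+ q ⊑ clD (cut (e / 8) (evt t x)) *+ (M + C) &
   forall t, clD (cut e (evt t x)) *+ M ⊑ clD (cut d (evt t y)) *+ q.+1].
Proof.
move=> px e0 M0; have [dd dd0 /choice[Y YP]] := unif_divide q px e0.
have [N N0 N3] := grid_size dd0.
pose T := {ffun 'I_m -> 'I_N.+1}; pose phi (w : T) t := gphi f w t.
have phi0 w t : 0 <= phi w t := gphi_ge0 _ _ _.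
have phi1 w t : phi w t <= 1 := gphi_le1 _ _ _.
have C0 : (0 < C)%N := nbC_gt0 m; have CR : 0 < C%:R :> R by rewrite ltr0n.
have MR : 0 < M%:R :> R by rewrite ltr0n.
pose ne (w : T) := exists t, 0 < phi w t.
have /choice[yw ywP] (w : T) : exists y : U, pB y /\ forall t, 0 < phi w t ->
    clD y *+ q ⊑ clD (cut (e / 8) (evt t x)) /\ clD (cut e (evt t x)) ⊑ clD (cut dd y) *+ q.+1.
  have [[t0 h0]|nw] := pselect (ne w); last first.
    by exists 0; split=> [|t h]; [exact: pB0|case: nw; exists t].
  have [py h] := YP t0; exists (Y t0); split=> // t ht; apply: h.
  by apply: close_le N3 _; exact: (gadj_close N0 (gphi_adj h0 h0) ht h0).
have pyw w : pB (yw w) := proj1 (ywP w).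
pose th (i : T * 'I_M) t : R := Num.max 0 (phi i.1 t - i.2%:R / M%:R).
have th0 i t : 0 <= th i t by rewrite le_max lexx.
have uth i : suu f (th i).
  apply: (suu_comp_lip (h := fun a => Num.max 0 (a - i.2%:R / M%:R))); first exact: suu_gphi.
  by move=> a b; rewrite (le_trans (max0_dist _ _))// opprB addrA subrK.
have /choice[F FP] (i : T * 'I_M) : exists u : V, pB u /\ forall t, evt t u = toC (th i t) *: yw i.1.
  have [u bu uE] := @fe_scal R X cptX m f cf D (th i) (yw i.1) (uth i) (pB_inB (pyw i.1)).
  exists u; split=> //; apply: evt_pB => // t; rewrite uE; exact: pB_npos (pBZ (th0 i t) (pyw _)).
have pF i := proj1 (FP i); have FE' i t := proj2 (FP i) t.
pose r := index_enum (T * 'I_M)%type; pose y := dss (fe_stable cptX cf s) r F.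
(* Summands with coefficient at least kap survive the cut kap dd. Lowering the weights by kap on at
   most C active cells loses M C kap = 1 / 2 from a total of M, hence no full unit of the integer
   count. *)
pose kap : R := (2 * C%:R * M%:R)^-1.
have k0 : 0 < kap by rewrite invr_gt0 !mulr_gt0.
have evy t : evt t y = dss s r (fun i => evt t (F i)) 
  by apply: uz_dss => //; exact: (@fet_shom R X cptX m f cf D t).
have pFt t i : pB (evt t (F i)) := pB_evt t (pF i).
pose A t := finset (fun w : T => (0 < phi w t)%R).
have cA t : (#|A t| <= C)%N by exact: gactive_card.
have offA t w : w \notin A t -> phi w t = 0.
  by rewrite inE -leNgt => h; apply/eqP; rewrite eq_le h phi0.
have sumA t : \sum_(w in A t) phi w t = 1.
  by rewrite -(gphi_sum f01 N t) [RHS](bigID (mem (A t)))/= [X in _ + X]big1 ?addr0// => w /offA.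
have cnt0 z : z <= 0 -> cnt M z = 0%N :> nat.
  by move=> z0; apply: big1 => l _; rewrite ltNge (le_trans z0).
exists y, (kap * dd); split; [exact: pB_dss|exact: mulr_gt0|move=> t|move=> t].
- rewrite evy cl_dss// -sumrMnl.
  (* The weights sum to M after scaling, and rounding up costs at most 1 for each of at most C
     active cells. *)
  have fin : (\sum_(w : T) cnt M (M%:R * phi w t) <= M + C)%N.
    rewrite -(ler_nat R) natr_sum (bigID (mem (A t)))/= [X in _ + X]big1 ?addr0; last first.
      by move=> w /offA ->; rewrite mulr0 cnt0.
    apply: (@le_trans _ _ (\sum_(w in A t) (M%:R * phi w t + 1))).
      by apply: ler_sum => w _; apply: cnt_ub; rewrite mulr_ge0.
    by rewrite big_split/= -mulr_sumr sumA mulr1 sumr_const natrD lerD2l ler_nat.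
  apply: cule_trans (cule_wmulrn _ fin).
  have -> : (\sum_(w : T) cnt M (M%:R * phi w t))%N =
      (\sum_(i <- r) (i.2%:R < M%:R * phi i.1 t)%R)%N by rewrite pair_bigA.
  apply: cule_sumn => -[w l]/=; rewrite FE'/= /th/=; have [lt|ge] := ltP.
    have w0 : 0 < phi w t by rewrite -(pmulr_rgt0 _ MR) (le_lt_trans _ lt).
    rewrite mulr1n; apply: cule_trans (proj1 (proj2 (ywP w) t w0)).
    apply: cule_mulrn; apply/cule_cl; [exact: pBZ (th0 (w, l) t) (pyw w)|exact: pyw|].
    exact: cleZ (th0 (w, l) t).
  rewrite max_l; last by rewrite subr_le0 ler_pdivlMr// mulrC.
  by rewrite scale0r cl0 mul0rn mulr0n; exact: cule_refl.
- rewrite evy cut_dss//; last exact: mulr_gt0.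
  rewrite -sumrMnl.
  have fin : (M <= \sum_(w : T) cnt M (M%:R * (phi w t - kap)))%N.
    rewrite -ltnS -(ltr_nat R) -natr1 natr_sum (bigID (mem (A t)))/= [X in _ + X + _]big1 ?addr0; last first.
      by move=> w /offA ->; rewrite sub0r cnt0// mulrN oppr_le0 mulr_ge0 ?ltW.
    apply: (@lt_le_trans _ _ (\sum_(w in A t) M%:R * (phi w t - kap) + 1)); last first.
      rewrite lerD2r; apply: ler_sum => w _; apply: cnt_lb; rewrite ler_piMr ?(ltW MR)//.
      by rewrite lerBlDr (le_trans (phi1 _ _))// lerDl ltW.
    rewrite -mulr_sumr sumrB sumA sumr_const -[kap *+ _]mulr_natl mulrBr mulr1.
    rewrite -addrA ltrDl addrC subr_gt0 (@le_lt_trans _ _ (M%:R * (C%:R * kap)))//.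
      by rewrite ler_wpM2l ?(ltW MR)// ler_wpM2r ?(ltW k0)// ler_nat.
    rewrite (_ : _ * _ = 2^-1) ?invf_lt1 ?ltr1n// /kap; field.
    by rewrite !gt_eqF.
  apply: cule_trans (cule_wmulrn _ fin) _.
  have -> : (\sum_(w : T) cnt M (M%:R * (phi w t - kap)))%N =
      (\sum_(i <- r) (i.2%:R < M%:R * (phi i.1 t - kap))%R)%N by rewrite pair_bigA.
  apply: cule_nsum => -[w l]/=; rewrite FE'/=; have [lt|ge] := ltP; last by rewrite mulr0n; exact: cule0.
  have kt : kap <= th (w, l) t.
    rewrite le_max; apply/orP; right; rewrite lerBrDr -lerBrDl ler_pdivrMr// mulrC.
    exact: ltW.
  have w0 : 0 < phi w t.
    by apply: lt_trans k0 _; rewrite -subr_gt0 -(pmulr_rgt0 _ MR) (le_lt_trans _ lt).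
  rewrite mulr1n; apply: cule_trans (proj2 (proj2 (ywP w) t w0)) _.
  apply: cule_mulrn; apply/cule_cl; [exact: pB_cut (ltW dd0) (pyw w)| |].
    by apply: pB_cut; [exact: ltW (mulr_gt0 k0 dd0)|exact: pBZ (th0 (w, l) t) (pyw w)].
  exact: cle_cutZ (pB_npos (pyw w)) k0 kt (ltW dd0).
Qed.

End Staircase.

(** * Comparison of sections without room *)

Lemma inB_cle (R : realType) (D : cstarAlgType R) (a b : unitz D) : inB b -> cle a b -> inB a.
Proof.
move=> bb ab; apply: inB_lim => e e0; have [v vP] := ab _ e0.
by exists (v * b * st v) => //; apply: inB_mulr; exact: inB_mull.
Qed.

Section CuntzComplement.
Context (R : realType) (D : cstarAlgType R) (s : stable_str D).
Local Notation toC := (real_complex R).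
Implicit Types (w x y : unitz D).

(** The multiple is the class of a direct sum of copies, and a cut-down of a direct sum is the
    direct sum of the cut-downs. *)
Lemma cull_mulrn_inv (z b : cu s) j : cull z (b *+ j) -> exists2 b', cull b' b & z ⊑ b' *+ j.
Proof.
have [u pu ->] := cl_ex b; have Ec (a : cu s) : \sum_(i <- iota 0 j) a = a *+ j.
  by rewrite big_const_seq count_predT size_iota iter_addr_0.
rewrite -Ec -(@cl_dss R D s nat (iota 0 j) (fun=> u) (fun=> pu)) => /cull_cl[|d d0].
  exact: pB_dss.
by rewrite cut_dss// Ec; exists (cl s (cut d u)); first exact: cull_cut.
Qed.

(** The gap between n + 1 and n divides the bound by almost unperforation, and interpolation leaves
    a b' << b, as cancellation requires. *)
Lemma cull_absorb (w b : cu s) a n j : cuAU s -> (j <= n)%N -> cull (w *+ (a * n.+1)) (b *+ j) ->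
  exists2 b', cull b' b & w *+ a ⊑ b'.
Proof.
move=> AU jn /cull_interp[z + /cull_mulrn_inv[b' bb zb]]; rewrite mulrnA => wz.
exists b' => //; apply: (AU_lt AU (a := n.+1) (b := n)) => //.
by apply: cule_trans (cullW wz) _; apply: cule_trans zb _; exact: cule_wmulrn.
Qed.

Lemma cu_complement w y (delta e e' : R) : pB w -> pB y -> cle w y -> 0 < delta -> 0 < e' -> e' < e ->
  exists d, [/\ pB d, cl s (cut delta w) + cl s d ⊑ cl s y, cl s y ⊑ cl s w + cl s d,
    cl s (cut e y) ⊑ cl s w + cl s (cut e' d) & forall g, 0 <= g -> cl s (cut g d) ⊑ cl s (cut g y)].
Proof.
move=> pw py wy delta0 e'0 ee; have e0 : 0 < e := lt_trans e'0 ee; have nw := pB_npos pw; have ny := pB_npos py.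
(* With 1 + eta = e / e', cutting d by e' lowers (1 + eta) d by at most e, which is the cut of y on
   the left. *)
pose eta := e / e' - 1; have eta1 : 1 + eta = e / e' by rewrite /eta addrC subrK.
have eta0 : 0 < eta by rewrite subr_gt0 ltr_pdivlMr// mul1r.
have [p [d [E [[np nd pd wp pdy] [nE Ew nEd dy]]]]] := complement nw ny wy delta0 eta0.
have bd : inB d by apply: (inB_cle (pB_inB py)); have := dy 0 (lexx _); rewrite !cut0.
have bp : inB p.
  apply: (inB_cle (pB_inB py)); apply: cle_trans pdy; apply: cle_le => //.
  by rewrite addrC addKr.
have bE : inB E := inB_cle (pB_inB pw) Ew.
have [pp pd' pE] : [/\ pB p, pB d & pB E] by [].
have eta1' : 0 <= 1 + eta by rewrite addr_ge0// ltW.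
have El (a : unitz D) : pB a -> cl s (E + toC (1 + eta) *: a) ⊑ cl s w + cl s a.
  move=> pa; apply: cule_trans (cl_addle _ _ _) _; [exact: pE|exact: pBZ|].
  apply: culeD; first exact/cule_cl.
  by apply/cule_cl; [exact: pBZ|exact: pa|exact: cleZ].
have pcd : pB (cut e' d) := pB_cut (ltW e'0) pd'.
have sumB a : pB a -> pB (E + toC (1 + eta) *: a) by move=> pa; apply: pBD => //; exact: pBZ.
exists d; split=> //.
- apply: cule_trans (_ : cl s (p + d) ⊑ _); last by apply/cule_cl => //; exact: pBD.
  rewrite cl_orth//; apply: culeD (cule_refl _); apply/cule_cl => //; exact: pB_cut (ltW delta0) pw.
- apply: cule_trans (El _ pd'); apply/cule_cl; [exact: py|exact: sumB|exact: cle_le].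
- apply: cule_trans (El _ pcd); apply/cule_cl; [exact: pB_cut (ltW e0) py|exact: sumB|].
  apply: cle_cut_sub => //; [exact: pB_npos (sumB _ pcd)|exact: ltW|].
  have -> : E + toC (1 + eta) *: cut e' d - y + sc (unitz D) e =
      (E + toC (1 + eta) *: d - y) + toC (1 + eta) *: (cut e' d - (d - sc (unitz D) e')).
    have -> : sc (unitz D) e = toC (1 + eta) *: sc (unitz D) e'.
      by rewrite eta1 /sc scalerA -toCM divfK ?gt_eqF.
    rewrite !scalerBr addrAC [E + _ + _]addrAC -addrA opprB -!addrA; congr (_ + _).
    by rewrite [RHS]addrC [_ *: d + _]addrC !addrA subrK.
  apply: nposD => //; apply: nposZ => //; exact: cut_ge.
- by move=> g g0; apply/cule_cl; [exact: pB_cut|exact: pB_cut|exact: dy].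
Qed.

End CuntzComplement.

Section Compare.
Context (R : realType) (X : topologicalType) (cptX : compact [set: X]).
Context (m : nat) (f : 'I_m -> X -> R) (cf : forall i, continuous (f i)).
Hypothesis f01 : forall i t, 0 <= f i t <= 1.
Context (D : cstarAlgType R) (s : stable_str D).
Hypotheses (AU : cuAU s) (AD : cuAD s) (CAN : cuCAN s).
Local Notation toC := (real_complex R).
Local Notation FE := (@FE R X cptX m f cf D).
Local Notation V := (unitz FE).
Local Notation sF := (fe_stable cptX cf s).
Local Notation "[ x ! t ]" := (cl s (evt t x)) (at level 0, x at level 99, t at level 99).
Implicit Types (x y w W b : V).

Let C := nbC m.
Let C' := (nbM m).+2.
(* [L] must not depend on the number [n] of layers in [split_field]. *)
Let L := (C' * C.+1).+2.

Lemma ev_cut x t (c : R) : pB x -> evt t (cut c x) = cut c (evt t x).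
Proof. by move=> px; rewrite (ush_cut (evt_ushom cptX cf D t))//; exact: pB_npos. Qed.

Lemma ev_le x y t : pB x -> pB y -> cl sF x ⊑ cl sF y -> [x ! t] ⊑ [y ! t].
Proof. by move=> px py /(cuev_le t); rewrite !cuevE. Qed.

(** W is the direct sum of n successive cut-downs of w, each obtained from the previous one by a cut
    g. Cutting W by g moves every layer to the next, so only the first layer, which is w, is lost;
    this is the term w in the bound of W by its own cut. The cut is divided in three because the
    comparison below uses three different cut-downs of W. *)
Lemma split_field x (e : R) n : pB x -> 0 < e -> (0 < n)%N -> exists w W, exists2 th : R, 0 < th &
  [/\ pB w, pB W, cl sF W ⊑ cl sF w + cl sF (cut th (cut th (cut th W))),
    forall t, [W ! t] *+ C' ⊑ [x ! t] &
    (forall t, [cut e x ! t] ⊑ [cut th (cut th (cut th W)) ! t] *+ L) /\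
    forall t, cull ([w ! t] *+ n) ([x ! t])].
Proof.
(* W is at most n + 1 copies of w, and q copies of w lie below C + 1 copies of x; one unit beyond C'
   (n + 1) (C + 1) lets almost unperforation give C' W <= x pointwise. *)
case: n => // n px e0 _; pose q := (C' * n.+1 * C.+1).+1.
have [w [d [pw d0 h1 h2]]] := field_divide f01 AD q px e0 (ltn0Sn 0).
have e8 : 0 < e / 8 by rewrite divr_gt0.
(* The n + 1 cuts of size g add up to d, so even the last shifted layer dominates [cut d w]. *)
pose g : R := d / n.+1%:R; have g0 : 0 < g by rewrite divr_gt0.
pose c i := cut (i%:R * g) w; pose W := dss sF (index_enum 'I_n.+1) (fun i => c i).
have cg0 i : 0 <= i%:R * g by rewrite mulr_ge0// ltW.
have pc i : pB (c i) := pB_cut (cg0 i) pw.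
have pW : pB W by apply: pB_dss => i; exact: pc.
have cutc i : cut g (c i) = c i.+1.
  by rewrite /c cut_cut ?(ltW g0)//; [rewrite -natr1 mulrDl mul1r|exact: pB_npos].
have th0 : 0 < g / 3 by rewrite divr_gt0.
have E3 : cut (g / 3) (cut (g / 3) (cut (g / 3) W)) = cut g W.
  have nW := pB_npos pW; have th1 := ltW th0.
  rewrite !cut_cut ?addr_ge0//; last exact: npos_cut.
  by congr cut; field.
have evW t : evt t W = dss s (index_enum 'I_n.+1) (fun i => evt t (c i)).
  by apply: uz_dss => //; exact: (@fet_shom R X cptX m f cf D t).
have pct t i : pB (evt t (c i)) := pB_evt t (pc i).
have hx t : [w ! t] *+ q ⊑ cl s (cut (e / 8) (evt t x)) *+ C.+1 := h1 t.
have xc t : cl s (cut (e / 8) (evt t x)) ⊑ [x ! t] := cl_cut s (pB_evt t px) (ltW e8).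
have Wn t : [W ! t] ⊑ [w ! t] *+ n.+1.
  rewrite evW cl_dss => [|i]; last exact: pct.
  have E : (\sum_(i < n.+1) 1)%N = n.+1 by rewrite sum1_card card_ord.
  rewrite -[X in _ *+ X]E; apply: cule_sumn => i; rewrite mulr1n /c ev_cut//.
  exact: cl_cut (pB_evt t pw) (cg0 i).
exists w, W, (g / 3) => //; rewrite E3; split=> //; [|move=> t|split=> t].
- rewrite cut_dss// cl_dss// big_ord_recl [X in _ ⊑ _ + X]big_ord_recr/=.
  apply: culeD.
    by apply: cl_cut pw _; exact: cg0 0%N.
  by under [X in _ ⊑ X + _]eq_bigr do rewrite cutc; exact: culeDl.
- apply: (AU_lt AU (a := q) (b := C' * n.+1 * C.+1)) => //.
  apply: cule_trans (cule_mulrn _ (cule_mulrn _ (Wn t))) _.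
  rewrite -!mulrnA (_ : n.+1 * (C' * q) = q * (C' * n.+1))%N; last by ring.
  rewrite (_ : C' * n.+1 * C.+1 = C.+1 * (C' * n.+1))%N; last by ring.
  rewrite !mulrnA; apply: cule_mulrn; apply: cule_mulrn.
  by apply: cule_trans (hx t) _; apply: cule_mulrn.
- have := h2 t; rewrite mulr1n -ev_cut// => h; apply: cule_trans h _.
  apply: cule_trans (_ : cl s (cut d (evt t w)) *+ (n.+1 * L) ⊑ _).
    apply: cule_wmulrn; rewrite /q /L.
    rewrite (_ : n.+1 * (C' * C.+1).+2 = (C' * n.+1 * C.+1).+2 + n * 2)%N; last by ring.
    exact: leq_addr.
  rewrite mulrnA; apply: cule_mulrn; rewrite ev_cut// evW cut_dss//.
  have E : (\sum_(i < n.+1) 1)%N = n.+1 by rewrite sum1_card card_ord.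
  rewrite -[X in _ *+ X]E; apply: cule_nsum => i; have E2 : cut g (evt t (c i)) = evt t (c i.+1) by rewrite -ev_cut// cutc.
  rewrite mulr1n E2 /c ev_cut//.
  apply: cl_cut_mono (pB_evt t pw) (cg0 i.+1) _.
  by rewrite /g mulrA ler_pdivrMr// mulrC ler_wpM2l ?(ltW d0)// ler_nat.
- apply: (cull_lel (y := cl s (cut (e / 8) (evt t x)))); last exact: cull_cut (pB_evt t px) e8.
  apply: (AU_lt AU (a := q) (b := n.+1 * C.+1)).
    by rewrite /q ltnS leq_mul2r leq_pmull ?orbT.
  rewrite -mulrnA mulnC mulrnA [(n.+1 * _)%N]mulnC [X in _ ⊑ X]mulrnA; exact: cule_mulrn.
Qed.

Section Loop.
Context (k : nat) (b : V) (e : R).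
Hypothesis e0 : 0 < e.
(** Chosen so that N (k + 1) = k2 + 1. After N steps, N copies of the rest c of x lie below L copies
    of V2, so N (C' c + V2) <= (C' L + N) V2; taking k + 1 times this gives k2 + 1 copies of C' c +
    V2 below k2 copies of b. [almost_cancel] with k2 in place of k asks for K = k2 + 3 copies of
    w. *)
Let N := (C' * L * k).+1.
Let k2 := ((C' * L + N) * k)%N.
Let K := k2.+3.

(* The comparison of [x] with [y] is reduced to that of the complements of a common piece; the
   pieces removed from [x] accumulate in [V2], the ones removed from [y] in [V3] and [w]. *)
Lemma compare_loop i j x y (V2 V3 w : X -> cu s) : (i + j)%N = N -> pB x -> pB y ->
  (forall t, ([x ! t] + V2 t) *+ k.+1 ⊑ [b ! t] *+ k) ->
  (forall t, [b ! t] ⊑ V3 t + w t + [y ! t]) ->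
  (forall t, cull (w t *+ (K * N.+1)) ([b ! t] *+ j)) ->
  (forall t, [cut e x ! t] *+ j ⊑ V2 t *+ L) ->
  (forall t, cull (V3 t) (V2 t)) ->
  forall d, e < d -> cle (cut d x) y.
Proof.
elim: i j x y V2 V3 w => [|i IH] j x y V2 V3 w ij px py S1 S2 S3 S4 S5 d ed.
  apply: cle_trans (cut_mono (pB_npos px) (ltW e0) (ltW ed)) _.
  have pe : pB (cut e x) := pB_cut (ltW e0) px.
  apply: (grid_compare f01 AU CAN pe py) => t; set c := cl s _.
  have S4' : c *+ N ⊑ V2 t *+ L by have := S4 t; rewrite -ij.
  have [|b' bb wb] := cull_absorb AU _ (S3 t); first by rewrite -ij.
  apply: (almost_cancel AU CAN (k := k2) _ (S2 t) wb bb (S5 t)).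
  rewrite (_ : k2.+1 = N * k.+1)%N; last by rewrite /k2 /N; ring.
  rewrite mulrnA; apply: cule_trans (_ : V2 t *+ (C' * L + N) *+ k.+1 ⊑ _).
    apply: cule_mulrn; rewrite mulrnDl mulrnDr; apply: culeD (cule_refl _).
    by rewrite -/C' -mulrnA mulnC mulrnA [(C' * _)%N]mulnC [X in _ ⊑ X]mulrnA; exact: cule_mulrn.
  rewrite -mulrnA mulnC mulrnA /k2 [((_ + _) * k)%N]mulnC [X in _ ⊑ X]mulrnA; apply: cule_mulrn.
  apply: cule_trans (S1 t); apply: cule_mulrn; rewrite addrC; exact: culeDl.
have N1 : (0 < K * N.+1)%N by [].
(* K (N + 1) copies of the new layer w' lie below x, hence below b: each step adds one copy of b to
   the bound on w, and at most N steps are made. *)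
have [w' [W [th th0 [pw pW hW Wx [xW wx]]]]] := split_field px e0 N1.
have th1 := ltW th0; pose W1 := cut th W; have pW1 : pB W1 := pB_cut th1 pW.
have pW2 : pB (cut th W1) := pB_cut th1 pW1; have pW3 : pB (cut th (cut th W1)) := pB_cut th1 pW2.
have xb t : [x ! t] ⊑ [b ! t].
  apply: (AU (k := k)); apply: cule_trans (S1 t); apply: cule_mulrn; exact: culeDl.
have Wlex : cle W x by apply: (grid_compare f01 AU CAN pW px).
(* C' copies of W lie below x(t), so the bounds for x and y give C' W(t) <= y(t) by cancellation,
   which is the room that the comparison over a grid requires. *)
have Wley : cle W y.
  apply: (grid_compare f01 AU CAN pW py) => t.
  have [|b' bb wb] := cull_absorb AU _ (S3 t); first by rewrite -ij leq_addl.
  apply: (almost_cancel AU CAN (k := k) _ (S2 t) _ bb (S5 t)).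
    apply: cule_trans (S1 t); apply: cule_mulrn; exact: culeD (Wx t) (cule_refl _).
  apply: cule_trans wb; apply: cule_wmulrn.
  by rewrite /K !ltnS /k2 leq_pmull// /N addnS.
pose d' := (e + d) / 2; have [ed' dd' d'0] : [/\ e < d', d' < d & 0 < d'].
  by rewrite /d'; move: ed e0 => ? ?; split; lra.
have W1x : cle W1 x := cle_trans (cut_cle (pB_npos pW) th1) Wlex.
have [c [pc c1 _ c3 c4]] := @cu_complement R FE sF W1 x th d d' pW1 px W1x th0 d'0 dd'.
have [y' [py' y1 y2 _ _]] := @cu_complement R FE sF W y th d d' pW py Wley th0 d'0 dd'.
have pd'c : pB (cut d' c) := pB_cut (ltW d'0) pc.
have pdx : pB (cut d x) := pB_cut (ltW (lt_trans d'0 dd')) px.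
(* The complement c leaves room in x for the second cut-down of W, while the loss from y is covered
   by w' and the third cut-down. The strict order of these two cut-downs preserves V3 << V2. *)
have key : cle (cut d' c) y'.
  apply: (IH j.+1 c y' (fun t => V2 t + [cut th W1 ! t]) (fun t => V3 t + [cut th (cut th W1) ! t])
    (fun t => w t + [w' ! t])) => //; [by rewrite addnS| | | | |].
  - move=> t; apply: cule_trans (S1 t); apply: cule_mulrn; rewrite addrCA [X in _ ⊑ X]addrC.
    apply: culeD (cule_refl _) _; have := cuev_le t c1.
    by rewrite cuevD !cuevE// addrC.
  - move=> t; apply: cule_trans (S2 t) _.
    apply: cule_trans (culeD (cule_refl _) (_ : [y ! t] ⊑ [w' ! t] + [cut th (cut th W1) ! t] + [y' ! t])) _.
      have h := cuev_le t y2; rewrite cuevD !cuevE// in h; apply: cule_trans h _.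
      apply: culeD (cule_refl _); have h' := cuev_le t hW; rewrite cuevD !cuevE// in h'.
    rewrite !addrA; apply: culeD (cule_refl _); rewrite -!addrA.
    by rewrite [X in _ ⊑ _ + X]addrC -!addrA; exact: cule_refl.
  - move=> t; rewrite mulrnDl [X in cull _ X]mulrSr; apply: cullD (S3 t) _; exact: cull_ler (wx t) (xb t).
  - move=> t; rewrite mulrSr mulrnDl; apply: culeD.
      apply: cule_trans (S4 t); apply: cule_mulrn; apply: ev_le (c4 _ (ltW e0)); exact: pB_cut (ltW e0) _.
    apply: cule_trans (_ : _ ⊑ [cut e x ! t]) _.
      by apply: ev_le (c4 _ (ltW e0)); exact: pB_cut (ltW e0) _.
    apply: cule_trans (xW t) _; apply: cule_mulrn; apply: ev_le => //; exact: cl_cut.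
  - move=> t; apply: cullD (S5 t) _; rewrite [in X in cull X _]ev_cut//.
    exact: cull_cut (pB_evt t pW2) th0.
apply/(cule_cl sF pdx py); apply: cule_trans c3 _; apply: cule_trans y1.
by apply: culeD (cule_refl _) _; exact/cule_cl.
Qed.

End Loop.

Theorem field_compare k x b : pB x -> pB b ->
  (forall t, [x ! t] *+ k.+1 ⊑ [b ! t] *+ k) -> cle x b.
Proof.
move=> px pb h; apply: cle_cutP (pB_npos px) _ => d d0; have e0 : 0 < d / 2 by rewrite divr_gt0.
apply: (@compare_loop k b (d / 2) e0 _ 0%N x b (fun=> 0) (fun=> 0) (fun=> 0) (addn0 _)) => // [t|t|t|t|t|].
- by rewrite addr0.
- by rewrite !add0r; exact: cule_refl.
- by rewrite mul0rn; exact: cull0.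
- by rewrite mulr0n; exact: cule0.
- exact: cull0.
- by rewrite ltr_pdivrMr// ltr_pMr// ltr1n.
Qed.

End Compare.

(** * Continuous functions as limits of sections *)

Section FieldDivision.
Context (R : realType) (X : topologicalType) (cptX : compact [set: X]).
Context (m : nat) (f : 'I_m -> X -> R) (cf : forall i, continuous (f i)).
Hypothesis f01 : forall i t, 0 <= f i t <= 1.
Context (D : cstarAlgType R) (s : stable_str D).
Hypotheses (AU : cuAU s) (AD : cuAD s) (CAN : cuCAN s).
Local Notation V := (unitz (@FE R X cptX m f cf D)).
Local Notation sF := (fe_stable cptX cf s).
Implicit Types (x y : V).

Lemma copies n x : pB x -> exists2 z : V, pB z & cl sF z = cl sF x *+ n.
Proof.
move=> px; exists (dss sF (index_enum 'I_n) (fun=> x)); first exact: pB_dss.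
by rewrite cl_dss// sumr_const card_ord.
Qed.

Lemma field_almost_divide x (e : R) n : pB x -> 0 < e -> exists y : V, [/\ pB y,
  cl sF y *+ n ⊑ cl sF x & cl sF (cut e x) ⊑ cl sF y *+ n.+1].
Proof.
(* With this M one has q + 1 = (n + 1)(M - 1). The two pointwise bounds of [field_divide] become
   comparisons of M + C + 1 copies with M + C and of M copies with M - 1. *)
move=> px e0; pose C := nbC m; pose M := (n * C + n * 2).+2; pose q := (n * (M + C).+1)%N.
have [y [d [py d0 h1 h2]]] := field_divide f01 AD q px e0 (ltn0Sn _ : (0 < M)%N).
have [pe e8] : pB (cut e x) /\ 0 < e / 8 by split; [exact: pB_cut (ltW e0) px|rewrite divr_gt0].
exists y; split=> //.
  have [z pz Ez] := copies n py; rewrite -Ez; apply/cule_cl => //.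
  apply: (field_compare f01 AU AD CAN (k := (M + C)%N) pz px) => t.
  rewrite -!cuevE// Ez cuev_mulrn !cuevE// -mulrnA.
  apply: cule_trans (h1 t) _; apply: cule_mulrn; exact: cl_cut (pB_evt t px) (ltW e8).
have [z pz Ez] := copies n.+1 py; rewrite -Ez; apply/cule_cl => //.
apply: (field_compare f01 AU AD CAN (k := M.-1) pe pz) => t.
rewrite -!cuevE// Ez cuev_mulrn !cuevE// ev_cut// -mulrnA.
apply: cule_trans (h2 t) _.
apply: cule_trans (cule_mulrn _ (cl_cut s (pB_evt t py) (ltW d0))) _; apply: cule_wmulrn.
by rewrite /q /M /= leq_eqVlt; apply/orP; left; apply/eqP; ring.
Qed.

End FieldDivision.

(** The coordinates are tents around the centres of a finite cover by balls of half the radius. A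
    point in such a half ball has tent value above 1 / 2, so a point within 1 / 4 of it in all
    coordinates has positive tent value and lies in the full ball. *)
Lemma finite_coordinates (R : realType) (X : metricType R) (cptX : compact [set: X]) (Q : X -> set X) :
  (forall t, nbhs t (Q t)) -> exists m, exists f : 'I_m -> X -> R,
  [/\ forall i, continuous (f i), forall i t, 0 <= f i t <= 1 &
    forall t t', close f (1 / 4) t t' -> exists t0, Q t0 t /\ Q t0 t'].
Proof.
move=> nQ; have /choice[r rP] t : exists r : R, 0 < r /\ ball t r `<=` Q t.
  by have /nbhs_ballP[r r0 h] := nQ t; exists r.
have r0 t : 0 < r t by have [] := rP t.
have [l lP] : exists l : seq X, forall t, exists2 t0, t0 \in l & ball t0 (r t0 / 2) t.
  (* Finite lists of centres, directed by inclusion: compactness in the form of near coverings,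
     applied along this filter, yields a finite cover. *)
  pose F : set_system (seq X) := [set S | exists l0 : seq X, forall l : seq X, {subset l0 <= l} -> S l].
  have FF : Filter F.
    split=> [|S S' [l h] [l' h']|S S' SS [l h]]; first by exists [::].
      exists (l ++ l') => k kl; split; [apply: h|apply: h'] => t tl;
        by apply: kl; rewrite mem_cat tl ?orbT.
    by exists l => k /h /SS.
  have /compact_near_coveringP/(_ _ F (fun l t => exists2 t0, t0 \in l & ball t0 (r t0 / 2) t) FF) := cptX.
  case=> [t _|l h]; last by exists l => t; exact: h.
  exists (ball t (r t / 2), [set l : seq X | t \in l]) => /=.
    by split; [apply: nbhsx_ballx; exact: divr_gt0|exists [:: t] => l; apply; rewrite inE].
  by move=> [t' l] /= [h tl]; exists t.
pose p i := tnth (in_tuple l) i; exists (size l).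
exists (fun i t => tent (mdist (p i) t / r (p i))); split.
- move=> i t; apply/cvgrPdist_lt => e e0; set c := r (p i); have c0 : 0 < c by exact: r0.
  near=> t'; apply: le_lt_trans (tent_dist _ _) _; rewrite -mulrBl normrM (@gtr0_norm _ c^-1) ?invr_gt0//.
  rewrite ltr_pdivrMr//; apply: (@le_lt_trans _ _ (mdist t t')).
    rewrite ler_norml lerBrDr lerBlDr addrC lerBlDr; apply/andP; split; last first.
      by rewrite [X in _ <= X]addrC [mdist t t']metric_sym; exact: metric_triangle.
    exact: metric_triangle.
  near: t'; have : nbhs t (ball t (e * c)) by apply: nbhsx_ballx; exact: mulr_gt0.
  by rewrite ballEmdist.
- by move=> i t; rewrite tent_ge0 tent_le1.
- move=> t t' cl; have [t0 t0D h] := lP t; have t0i : (index t0 l < size l)%N by rewrite index_mem.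
  pose i := Ordinal t0i; have Ep : p i = t0.
    by rewrite /p (tnth_nth t0) /= nth_index.
  have /= := cl i; rewrite Ep; have := h; rewrite ballEmdist /= => d1.
  have d2 : mdist t0 t / r t0 < 1 / 2 by rewrite ltr_pdivrMr// mulrC mulrA mulr1.
  have d3 : 1 / 2 < tent (mdist t0 t / r t0).
    rewrite lt_max ger0_norm ?divr_ge0 ?mdist_ge0 ?(ltW (r0 _))//; apply/orP; right.
    by move: d2; lra.
  rewrite ler_norml => /andP[_ d4]; have : 0 < tent (mdist t0 t' / r t0) by move: d3 d4; lra.
  rewrite tent_gt0 ger0_norm ?divr_ge0 ?mdist_ge0 ?(ltW (r0 _))// ltr_pdivrMr// mul1r => d5.
  exists t0; have [_ sub] := rP t0; split; apply: sub; rewrite ballEmdist//=.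
  move: d2; rewrite ltr_pdivrMr// => d2; apply: lt_le_trans d2 _.
  by rewrite ler_piMl ?(ltW (r0 _))//; lra.
Unshelve. all: by end_near. Qed.

(** * Sections and the stabilization of C(X, A) *)

Section Bridge.
Context (R : realType) (X : topologicalType) (cptX : compact [set: X]) (A : cstarAlgType R).
Local Notation E := (contfun cptX A).
Local Notation SE := (stabT E).
Local Notation D := (stabT A).
Local Notation sE := (stab_stable E).
Local Notation sD := (stab_stable A).
Local Notation toC := (real_complex R).

Definition cfev (t : X) (F : E) : A := cfeval F t.

Lemma cfev_shom t : shom (cfev t). Proof. by split. Qed.

Lemma cf_rnorm_le (F : E) (c : R) : 0 <= c -> (forall t, rnorm (cfev t F) <= c) -> rnorm F <= c.
Proof. exact: cf_norm_ler. Qed.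

Lemma ev_mxb (T : infmx E) (c : R) : 0 <= c -> (forall t, mxb (mxmap (cfev t) T) c) -> mxb T c.
Proof.
move=> c0 h; split=> // n u v; apply: cf_rnorm_le => [|t]; first by rewrite !mulr_ge0 ?vec_norm_ge0.
have vn (w : nat -> E) : vec_norm n (fun i => cfev t (w i)) <= vec_norm n w.
  rewrite /vec_norm ler_sqrt ?rnorm_ge0//; apply: le_trans (sh_norm (cfev_shom t) _).
  by rewrite (sh_sum (cfev_shom t)).
have -> : cfev t (form n T u v) = form n (mxmap (cfev t) T) (fun i => cfev t (u i)) (fun i => cfev t (v i)).
  rewrite !formE (sh_sum (cfev_shom t)); apply: eq_bigr => i _.
  by rewrite (sh_sum (cfev_shom t)).
apply: le_trans (proj2 (h t) _ _ _) _; rewrite ler_wpM2l// ler_pM ?vec_norm_ge0//.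
Qed.

Definition est t : SE -> D := stmap (cfev_shom t).

Lemma est_shom t : shom (est t). Proof. exact: stmap_shom. Qed.

Lemma est_ext (a b : SE) : (forall t, est t a = est t b) -> a = b.
Proof.
move=> h; apply: mxs_inj; apply: mx_ext => i j; apply: cfP => t.
exact: (congr1 (fun z => mxs z i j) (h t)).
Qed.

Lemma est_norm (a : SE) (c : R) : 0 <= c -> (forall t, rnorm (est t a) <= c) -> rnorm a <= c.
Proof.
move=> c0 h; apply: mxs_le; apply: ev_mxb => // t; apply: mxb_le (h t) _; exact: mxs_mxb.
Qed.

(** A finite corner approximates a in norm, hence at all points simultaneously, and it has finitely
    many continuous entries. *)
Lemma est_near (a : SE) t0 (e : R) : 0 < e -> \forall t \near t0, rnorm (est t a - est t0 a) <= e.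
Proof.
move=> e0; have e3 : 0 < e / 3 by rewrite divr_gt0.
have [N /(_ N (leqnn _)) aN] := stab_near (mxs_stab a) e3.
pose g := e / 3 / (N%:R * N%:R + 1); have N0 : 0 < N%:R * N%:R + 1 :> R by rewrite ltr_wpDl// mulr_ge0.
have g0 : 0 < g by rewrite divr_gt0.
have hN : \forall t \near t0, forall i j : 'I_N, rnorm (cfev t (mxs a i j) - cfev t0 (mxs a i j)) <= g.
  apply: filter_forall => i; apply: filter_forall => j.
  have : \forall t \near t0, `|cfeval (mxs a i j) t0 - cfeval (mxs a i j) t| < toC g.
    by apply: (cvgr_dist_lt _ _ (@ev_continuous _ cptX _ _ (mxs a i j) t0)); rewrite ltcR.
  by apply: filterS => t' h; rewrite -lecR rnormE distrC; exact: ltW.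
apply: filterS hN => t h; apply: mxs_le.
have -> : mxs (est t a - est t0 a) = mxmap (cfev t) (mxs a - mx_trunc N (mxs a)) +
   (mx_trunc N (mxmap (cfev t) (mxs a) - mxmap (cfev t0) (mxs a)) -
    mxmap (cfev t0) (mxs a - mx_trunc N (mxs a))).
  rewrite !(mxmapB (cfev_shom _)) mx_truncB !(mxmap_trunc (cfev_shom _)) opprB.
  by rewrite mxsB !mxs_stmap !subrKA.
have -> : e = e / 3 + (e / 3 + e / 3) by field.
apply: mxbD; first exact: mxb_map (cfev_shom t) _ _ aN.
apply: mxbB; last exact: mxb_map (cfev_shom t0) _ _ aN.
apply: mxb_le (mxb_trunc_sum _ _); apply: (@le_trans _ _ (\sum_(i < N) \sum_(j < N) g)).
  by do 2 apply: ler_sum => ? _; exact: h.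
rewrite !sumr_const card_ord -mulrnA -[leLHS]mulr_natl natrM /g mulrA ler_pdivrMr//.
by rewrite mulrC ler_wpM2l ?(ltW e3)// lerDl.
Qed.

Section Fields.
Context (m : nat) (f : 'I_m -> X -> R) (cf : forall i, continuous (f i)).
Hypothesis f01 : forall i t, 0 <= f i t <= 1.
Local Notation FE := (@FE R X cptX m f cf D).
Local Notation sF := (fe_stable cptX cf sD).

Lemma entry_continuous (x : FE) i j : continuous (fun t => mxs (fet t x) i j).
Proof.
move=> t; apply/cvgrPdist_le => e e0.
have eE : toC (complex.Re e) = e by rewrite RRe_real// gtr0_real.
have e0' : 0 < complex.Re e by rewrite -ltcR eE.
have [d d0 h] := feP x e0'; apply: filterS (close_near cf t d0) => t' c.
rewrite -eE -rnormE lecR; apply: le_trans (h _ _ (close_sym c)).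
exact: (mxb_entry i j (mxs_mxb (fet t x - fet t' x))).
Qed.

Definition fmx (x : FE) : infmx E := fun i j => mkcf cptX (@entry_continuous x i j).

Lemma fmx_ev (x : FE) t : mxmap (cfev t) (fmx x) = mxs (fet t x).
Proof. by []. Qed.

Lemma fmx_stab (x : FE) : stab E (fmx x).
Proof.
apply/stabP => e e0; have e3 : 0 < e / 3 by rewrite divr_gt0.
(* A truncation rank common to all points, encoded by [d^-1 <= n] since [cpt_unif] produces small
   numbers. *)
have [d d0 h] : exists2 d : R, 0 < d & forall t n, d^-1 <= n%:R ->
    mxb (mxs (fet t x) - mx_trunc n (mxs (fet t x))) e.
  apply: (cpt_unif cptX cf) => [d d' t d'0 dd h n nd|t].
    by apply: h; apply: le_trans nd; rewrite lef_pV2 ?posrE// (lt_le_trans d'0).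
  have [N NP] := stab_near (mxs_stab (fet t x)) e3; have [d d0 hd] := feP x e3.
  have m0 : 0 < Num.min d (N%:R + 1)^-1 by rewrite lt_min d0 invr_gt0 ltr_wpDl.
  exists (Num.min d (N%:R + 1)^-1) => // t' c n nd.
  have Nn : (N <= n)%N.
    rewrite -(ler_nat R) (le_trans _ nd)// (@le_trans _ _ (N%:R + 1)) ?lerDl//.
    by rewrite -[leLHS]invrK lef_pV2 ?posrE ?invr_gt0 ?ltr_wpDl// ge_min lexx orbT.
  have c' : close f d t' t by apply: close_le c; rewrite ge_min lexx.
  have dM : mxb (mxs (fet t' x) - mxs (fet t x)) (e / 3).
    by apply: mxb_le (hd _ _ c') _; exact: (mxs_mxb (fet t' x - fet t x)).
  have -> : e = e / 3 + (e / 3 + e / 3) by field.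
  apply: (mxb_split dM); apply: mxb_split (NP n Nn) _.
  by rewrite -mx_truncB; apply: mxb_trunc; exact: mxb_distC dM.
exists (Num.bound d^-1) => n nd; apply: ev_mxb => [|t]; first exact: ltW.
rewrite (mxmapB (cfev_shom t)) (mxmap_trunc (cfev_shom t)) fmx_ev; apply: h.
have d1 : 0 <= d^-1 by rewrite invr_ge0 ltW.
apply: le_trans (ltW (archi_boundP d1)) _; by rewrite ler_nat.
Qed.

Definition fsec (x : FE) : SE := smk (fmx_stab x).

Lemma est_fsec (x : FE) t : est t (fsec x) = fet t x.
Proof. exact: mxs_inj. Qed.

Lemma fsec_shom : shom fsec.
Proof.
split=> [a b|k a|a b|a]; apply: est_ext => t.
- by rewrite (shD (est_shom t)) !est_fsec.
- by rewrite (shZ (est_shom t)) !est_fsec.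
- by rewrite (shM (est_shom t)) !est_fsec.
- by rewrite (sh_st (est_shom t)) !est_fsec.
Qed.

Lemma fsec_sl j x : fsec (sl sF j x) = sl sE j (fsec x).
Proof. by apply: est_ext => t; rewrite [RHS]stmap_sl -/(est t _) !est_fsec. Qed.

(** Averaging values of a at points of a fine grid by a partition of unity keeps positivity, and the
    result varies only through the weights, which depend on the coordinates alone. *)
Lemma field_approx (a : unitz SE) (e d : R) : pB a -> 0 < e -> 0 < d ->
  (forall t t', close f d t t' -> rnorm (est t a.1 - est t' a.1) <= e) ->
  exists2 x : unitz FE, pB x & (forall t, nm (evt t x - uz (est t) a) <= e) /\ nm (uz fsec x - a) <= e.
Proof.
move=> pa e0 d0 h; have [N N0 N3] := grid_size d0.
pose T := {ffun 'I_m -> 'I_N.+1}; pose phi (w : T) t := gphi f w t.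
have phi0 w t : 0 <= phi w t := gphi_ge0 _ _ _.
pose ne (w : T) := exists t, 0 < phi w t.
have /choice[aw awP] (w : T) : exists b : unitz D, pB b /\ forall t, 0 < phi w t -> nm (b - uz (est t) a) <= e.
  have [[t0 h0]|nw] := pselect (ne w); last by exists 0; split=> [|t ht]; [exact: pB0|case: nw; exists t].
  exists (uz (est t0) a); split=> [|t ht]; first exact: uz_pB (est_shom t0) _ pa.
  have -> : uz (est t0) a - uz (est t) a = inj (est t0 a.1 - est t a.1).
    by rewrite /uz /inj; congr pair; rewrite /= subrr.
  rewrite nm_inj; apply: h; apply: close_le N3 _; exact: (gadj_close N0 (gphi_adj h0 h0) h0 ht).
have paw w := proj1 (awP w).
have /choice[F FP] (w : T) : exists u : unitz FE, pB u /\ forall t, evt t u = toC (phi w t) *: aw w.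
  have uw : suu f (phi w) by exact: suu_gphi.
  have [u bu uE] := @fe_scal R X cptX m f cf D (phi w) (aw w) uw (pB_inB (paw w)).
  exists u; split=> //; apply: evt_pB => // t; rewrite uE; exact: pB_npos (pBZ (phi0 w t) (paw w)).
pose x : unitz FE := \sum_w F w.
have px : pB x by apply: big_ind => [|u v pu pv|w _]; [exact: pB0|exact: pBD|have [] := FP w].
have xa t : nm (evt t x - uz (est t) a) <= e.
  rewrite (ush_sum (evt_ushom cptX cf D t)).
  have -> : uz (est t) a = \sum_w toC (phi w t) *: uz (est t) a.
    by rewrite -scaler_suml -rmorph_sum/= (gphi_sum f01) scale1r.
  rewrite -sumrB (le_trans (nm_sum _ _ _))//.
  apply: (@le_trans _ _ (\sum_w phi w t * e)); last by rewrite -mulr_suml (gphi_sum f01) mul1r.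
  apply: ler_sum => w _; rewrite (proj2 (FP w)) -scalerBr nmZr ger0_norm//.
  have := phi0 w t; rewrite le_eqVlt => /orP[/eqP <-|w0]; first by rewrite !mul0r.
  by rewrite ler_wpM2l//; exact: (proj2 (awP w)).
exists x => //; split=> //; have bx := pB_inB px; have ba := pB_inB pa.
have -> : uz fsec x - a = inj (fsec x.1 - a.1) by rewrite {1}(inBP bx) {1}(inBP ba) injB.
rewrite nm_inj; apply: est_norm => [|t]; first exact: ltW.
rewrite (shB (est_shom t)) est_fsec -nm_inj; have := xa t.
by rewrite {1}(inBP bx) {1}(inBP ba) injB.
Qed.

End Fields.

End Bridge.

Lemma cl_cut_mulrn (R : realType) (D : cstarAlgType R) (s : stable_str D) (u v : unitz D) n p (c : R) :
  pB u -> pB v -> cl s u *+ n ⊑ cl s v *+ p -> 0 < c ->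
  exists2 d : R, 0 < d & cl s (cut c u) *+ n ⊑ cl s (cut d v) *+ p.
Proof.
move=> pu pv uv c0; have := cull_ler (cull_mulrn n (cull_cut s pu c0)) uv.
move=> /cull_mulrn_inv[b' /(cull_cl _ pv)[d d0 bd] h]; exists d => //.
by apply: cule_trans h _; exact: cule_mulrn.
Qed.

(** * Pureness of the algebra of continuous functions *)

Section PureSections.
Context (R : realType) (X : metricType R) (cptX : compact [set: X]) (A : cstarAlgType R).
Local Notation E := (contfun cptX A).
Local Notation sE := (stab_stable E).
Local Notation sD := (stab_stable A).
Hypotheses (AU : cuAU sD) (AD : cuAD sD) (CAN : cuCAN sD).

Let hes t := est_shom cptX A t.

Lemma approx_coordinates (a b : stabT E) (e : R) : 0 < e -> exists m, exists f : 'I_m -> X -> R,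
  [/\ forall i, continuous (f i), forall i t, 0 <= f i t <= 1,
    forall t t', close f (1 / 4) t t' -> rnorm (est t a - est t' a) <= e &
    forall t t', close f (1 / 4) t t' -> rnorm (est t b - est t' b) <= e].
Proof.
move=> e0; have e2 : 0 < e / 2 by rewrite divr_gt0.
pose Q t0 := [set t | rnorm (est t a - est t0 a) <= e / 2 /\ rnorm (est t b - est t0 b) <= e / 2].
have [t|m [f [cf f01 h]]] := finite_coordinates cptX (Q := Q).
  by apply: filterS2 (est_near a t e2) (est_near b t e2) => t' ? ?; split.
have tri (D : cstarAlgType R) (x y z : D) : rnorm (x - z) <= e / 2 -> rnorm (y - z) <= e / 2 -> rnorm (x - y) <= e.
  move=> xz yz; rewrite (splitr e) -(subrKA z) (le_trans (ler_rnormD _ _))// lerD//.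
  by rewrite -[leLHS]rnormN opprB.
exists m, f; split=> // t t' /h[t0 [[h1 h2] [h3 h4]]].
  exact: (tri _ _ _ _ h1 h3).
exact: (tri _ _ _ _ h2 h4).
Qed.

Lemma est_sl t j (a : stabT E) : est t (sl sE j a) = sl sD j (est t a).
Proof. exact: stmap_sl. Qed.

Lemma pB_est t (a : unitz (stabT E)) : pB a -> pB (uz (est t) a).
Proof. exact: (uz_pB (hes t)). Qed.

Lemma cuest_cut (a : unitz (stabT E)) (c : R) t : pB a -> 0 <= c ->
  cumap sD (est t) (cl sE (cut c a)) = cl sD (cut c (uz (est t) a)).
Proof.
move=> pa c0; rewrite (cumap_cl _ _ (hes t)); last exact: pB_cut.
by rewrite (ush_cut (uz_ushom (hes t)))//; exact: pB_npos.
Qed.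

Lemma contfun_AU : cuAU sE.
Proof.
move=> x y k; have [a pa ->] := cl_ex x; have [b pb ->] := cl_ex y => ab.
apply: (cule_cutP pa) => e e0; have e4 : 0 < e / 4 by rewrite divr_gt0.
have [d d0 h] := cl_cut_mulrn pa pb ab e4; have d4 : 0 < d / 4 by rewrite divr_gt0.
(* The sections x1 and y1 are compared after cuts e / 2 and d / 2. The distance g is small enough
   for the passage from the cuts e / 4 of a and d of b to these, and for the way back to a cut by e
   and to b itself. *)
pose g := Num.min (e / 4) (d / 4); have g0 : 0 < g by rewrite lt_min e4.
have ge : g <= e / 4 by rewrite ge_min lexx.
have gd : g <= d / 4 by rewrite ge_min lexx orbT.
have [m [f [cf f01 ha hb]]] := approx_coordinates a.1 b.1 g0.
have q0 : 0 < 1 / 4 :> R by rewrite divr_gt0.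
have [x1 px1 [x1t x1a]] := field_approx cf f01 pa g0 q0 ha.
have [y1 py1 [y1t y1b]] := field_approx cf f01 pb g0 q0 hb.
have [e2 d2] : 0 < e / 2 /\ 0 < d / 2 by split; rewrite divr_gt0.
have px : pB (cut (e / 2) x1) := pB_cut (ltW e2) px1.
have py : pB (cut (d / 2) y1) := pB_cut (ltW d2) py1.
have hs := fsec_shom cptX A cf; have us := uz_ushom hs.
have pF u (pu : pB u) := uz_pB hs pu.
have xy : cle (cut (e / 2) x1) (cut (d / 2) y1).
  apply: (field_compare f01 AU AD CAN (k := k) px py) => t; rewrite !ev_cut//.
  have [pat pbt] := (pB_est t pa, pB_est t pb).
  apply: cule_trans (_ : _ ⊑ cl sD (cut (e / 4) (uz (est t) a)) *+ k.+1) _.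
    apply: cule_mulrn; have -> : e / 2 = e / 4 + e / 4 by field.
    apply: cl_cut_near2 (pB_evt t px1) pat _ (ltW e4); exact: le_trans (x1t t) ge.
  apply: cule_trans (_ : _ ⊑ cl sD (cut d (uz (est t) b)) *+ k) _.
    have := cumap_le sD (hes t) h.
    by rewrite !(cumap_mulrn (hes t) (est_sl t))// !cuest_cut// ltW.
  apply: cule_mulrn; rewrite [X in cut X](splitr d).
  apply: cl_cut_near2 pbt (pB_evt t py1) _ (ltW d2); rewrite ndistC (le_trans (y1t t))//.
  by rewrite (le_trans gd)// ler_pM2l// lef_pV2 ?posrE// ler_nat.
have {}xy := ush_cle us xy.
rewrite (ush_cut us _ (pB_npos px1)) (ush_cut us _ (pB_npos py1)) in xy.
rewrite (splitr e); apply: cule_trans (cl_cut_near2 sE pa (pF _ px1) _ (ltW e2)) _.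
  by rewrite ndistC (le_trans x1a)// (le_trans ge)// ler_pM2l// lef_pV2 ?posrE// ler_nat.
apply: cule_trans (_ : _ ⊑ cl sE (cut (d / 2) (uz (fsec (cf := cf)) y1))) _.
  by apply/cule_cl => //; apply: pB_cut (pF _ _) => //; exact: ltW.
apply: cl_cut_near (pF _ py1) pb _.
by rewrite (le_trans y1b)// (le_trans gd)// ler_pM2l// lef_pV2 ?posrE// ler_nat.
Qed.

Lemma contfun_AD : cuAD sE.
Proof.
move=> x' x n; have [a pa ->] := cl_ex x => /(cull_cl _ pa)[e e0 xa].
have e3 : 0 < e / 3 by rewrite divr_gt0.
have [m [f [cf f01 ha _]]] := approx_coordinates a.1 a.1 e3.
have q0 : 0 < 1 / 4 :> R by rewrite divr_gt0.
have [x1 px1 [x1t x1a]] := field_approx cf f01 pa e3 q0 ha.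
have hs := fsec_shom cptX A cf; have us := uz_ushom hs.
have pF u (pu : pB u) := uz_pB hs pu.
have px : pB (cut (e / 3) x1) := pB_cut (ltW e3) px1.
have [y [py h1 h2]] := field_almost_divide f01 AU AD CAN n px e3.
exists (cl sE (uz (fsec (cf := cf)) y)).
  have := cumap_le sE hs h1; rewrite (cumap_mulrn hs (@fsec_sl _ _ _ _ _ _ _)) !(cumap_cl _ _ hs)// => h.
  apply: cule_trans h _; rewrite (ush_cut us _ (pB_npos px1)).
  exact: cl_cut_near (pF _ px1) pa x1a.
apply: cule_trans xa _; have := cumap_le sE hs h2.
rewrite (cumap_mulrn hs (@fsec_sl _ _ _ _ _ _ _)) !(cumap_cl _ _ hs)//; last exact: pB_cut (ltW e3) px.
rewrite !(ush_cut us)//; [|exact: pB_npos..].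
rewrite cut_cut ?(ltW e3)//; last exact: pB_npos (pF _ px1).
apply: cule_trans; rewrite {1}(_ : e = e / 3 + (e / 3 + e / 3)); last by field.
apply: cl_cut_near2 pa (pF _ px1) _ _; first by rewrite ndistC.
by rewrite addr_ge0// ltW.
Qed.

End PureSections.

Theorem theorem5p11 (R : realType) (X : metricType R)
    (cptX : compact [set: X]) (A : cstarAlgType R) (pureA : pure A)
    (noquot : ~ exists (I : set A) (Q : cstarAlgType R) (pi : A -> Q)
        (x : set (infmx Q)),
      [/\ is_quotient I pi, Cu Q x, x <> cu_zero Q, cu_compact x &
          properly_infinite x]) :
  pure (contfun cptX A).
Proof.
have [AU AD] := (pureP A).1 pureA; have CAN := cancellation noquot.
by apply/pureP; split; [exact: contfun_AU|exact: contfun_AD].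
Qed.
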